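(* Consider the Cauchy problem for the 2-D pressureless gas system $$\varrho_t+(\varrho u)_x+(\varrho v)_y=0,\quad (\varrho u)_t+(\varrho u^2)_x+(\varrho uv)_y=0,\quad (\varrho v)_t+(\varrho uv)_x+(\varrho v^2)_y=0$$ with the piecewise $C^1$ initial data $(\varrho_0,u_0,v_0)$ having a compressive jump across the curve $\mathcal G$, as described in the context. A generalized solution (in the sense of the Radon-measure definition in the context) of the single-shock form described in the context, with shock surface $\mathcal S$ parametrized by $(x^s(t,l),y^s(t,l))$, $x^s_t=\widetilde u$, $y^s_t=\widetilde v$, $(x^s,y^s)(0,l)=(A(l),B(l))$, and shock densities $\widetilde P_t,\widetilde I_t,\widetilde J_t$, exists if and only if the following formulas hold: $$\widetilde u=\widetilde I_t/\widetilde P_t,\qquad \widetilde v=\widetilde J_t/\widetilde P_t,$$ $$\widetilde P_t=\int_0^t\left[\varrho_0^+\left((a_+)_\tau (b_+)_l-(b_+)_\tau (a_+)_l\right)-\varrho_0^-\left((a_-)_\tau (b_-)_l-(b_-)_\tau (a_-)_l\right)\right]d\tau,$$ $$\widetilde I_t=\int_0^t\left[\varrho_0^+u_0^+\left((a_+)_\tau (b_+)_l-(b_+)_\tau (a_+)_l\right)-\varrho_0^-u_0^-\left((a_-)_\tau (b_-)_l-(b_-)_\tau (a_-)_l\right)\right]d\tau,$$ $$\widetilde J_t=\int_0^t\left[\varrho_0^+v_0^+\left((a_+)_\tau (b_+)_l-(b_+)_\tau (a_+)_l\right)-\varrho_0^-v_0^-\left((a_-)_\tau (b_-)_l-(b_-)_\tau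 (a_-)_l\right)\right]d\tau,$$ where $a_\pm=a_\pm(\tau,l)$, $b_\pm=b_\pm(\tau,l)$ are the initial positions of the characteristics meeting the shock at $(\tau,x^s(\tau,l),y^s(\tau,l))$ from the two sides, and $\varrho_0^j=\varrho_0(a_j,b_j)$, $u_0^j=u_0(a_j,b_j)$, $v_0^j=v_0(a_j,b_j)$ for $j=+,-$.
   Context: Subscripts $\tau,l,x,y$ (and $t$ on $x^s,y^s$ and on the fields $\varrho,\varrho u,\varrho v$ in the system) denote partial derivatives; the subscript $t$ in $P_t,I_t,J_t,\widetilde P_t,\widetilde I_t,\widetilde J_t$ is a time index. Initial data. $\mathcal G=\{(A(l),B(l))\}$ is a $C^1$ curve in the plane $(a,b)$ with $A_l\ge0$, $B_l\ge0$, $A_l^2+B_l^2\ne0$, also given by $G(a,b)=0$ with $G\in C^1(\mathbb R^2)$. Put $\mathcal G^-=\{G<0\}$, $\mathcal G^+=\{G>0\}$; $\mathcal G^-$ lies to the left and $\mathcal G^+$ to the right of $\mathcal G$ when it is traversed with $l$ increasing. The data are $(\varrho_0,u_0,v_0)=(\varrho_-,u_-,v_-)$ in $\mathcal G^-$ and $(\varrho_+,u_+,v_+)$ in $\mathcal G^+$, with $\varrho_0>0$ piecewise $C^1$, and: (I) $u_\pm,v_\pm\in C^1(\overline{\mathcal G^\pm})$; (II) $A_lv_--B_lu_-<0$ and $A_lv_+-B_lu_+>0$ on $\mathcal G$. All considerations are local in time: for each $l$, $0<t<T(l)$, where $T(l)>0$ is such that near the point $(A(l),B(l))$ the maps $(a,b)\mapsto(a+tu_j(a,b),\,b+tv_j(a,b))$,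 $j=+,-$, are nondegenerate for $0<t<T(l)$ and the characteristic lines issued from the same side of $\mathcal G$ do not cross. Generalized solution. Families of Radon measures $(P_t,I_t,J_t)$ on $\mathbb R^2$, weakly continuous in $t$, with $P_t\ge0$ and $I_t,J_t$ absolutely continuous with respect to $P_t$ for a.e. $t>0$; set $u=dI_t/dP_t$, $v=dJ_t/dP_t$ (Radon–Nikodym derivatives). $(P_t,I_t,J_t)$ is a generalized solution iff (1) for all $f,g,h\in C_0^1(\mathbb R^2)$ and $0<t_1<t_2<\infty$, $$\iint f\,dP_{t_2}-\iint f\,dP_{t_1}=\int_{t_1}^{t_2}\Big\{\iint f_x\,dI_\tau+\iint f_y\,dJ_\tau\Big\}d\tau,$$ $$\iint g\,dI_{t_2}-\iint g\,dI_{t_1}=\int_{t_1}^{t_2}\Big\{\iint g_x u\,dI_\tau+\iint g_y v\,dI_\tau\Big\}d\tau,$$ $$\iint h\,dJ_{t_2}-\iint h\,dJ_{t_1}=\int_{t_1}^{t_2}\Big\{\iint h_x u\,dJ_\tau+\iint h_y v\,dJ_\tau\Big\}d\tau;$$ (2) weakly as $t\to+0$: $P_t\to\varrho_0\,da\,db$, $I_t\to\varrho_0u_0\,da\,db$, $J_t\to\varrho_0v_0\,da\,db$. Single-shock form. There is a surface $\mathcal S=\{S(t,x,y)=0\}$, $S\in C^1$, with $\mathcal S\cap\{t=0\}=\mathcal G$, and $C^1$ functions $\varrho_j(t,x,y),u_j(t,x,y),v_j(t,x,y)$, $j=+,-$, satisfying the system classically and agreeing with the data at $t=0$ (so $\varrho_j,u_j,v_j$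 are given by the characteristics formulas $u_j(t,x,y)=u_j(a,b)$, $v_j(t,x,y)=v_j(a,b)$, $\varrho_j(t,x,y)=\varrho_j(a,b)\,\partial(a,b)/\partial(x,y)$, $x=a+tu_j(a,b)$, $y=b+tv_j(a,b)$), such that $P_t$, $I_t$, $J_t$ have densities $\varrho_j$, $\varrho_ju_j$, $\varrho_jv_j$ with respect to $dx\,dy$ on the $j$ side of $\mathcal S$ (minus side $S<0$, plus side $S>0$) and, in addition, singular parts carried by the curve $\mathcal S_t=\mathcal S\cap\{t\}\times\mathbb R^2$, equal to $\widetilde P_t\,dl$, $\widetilde I_t\,dl$, $\widetilde J_t\,dl$ in the parameter $l$, with $\widetilde P_t,\widetilde I_t,\widetilde J_t\in C^1(\mathcal S)$. The velocity on $\mathcal S$ is $(\widetilde u,\widetilde v)$; $\mathcal S$ is parametrized by its integral curves issued from $\mathcal G$: $(x^s(t,l),y^s(t,l))$ with $x^s_t=\widetilde u$, $y^s_t=\widetilde v$. The $C^1$ functions $a_j(t,l),b_j(t,l)$ are defined by $$x^s(t,l)=a_j+tu_j(a_j,b_j),\quad y^s(t,l)=b_j+tv_j(a_j,b_j),\quad (a_j,b_j)\in\overline{\mathcal G^j},\ j=+,-.$$ *)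

(* Defs.v *)
From HB Require Import structures.
From mathcomp Require Import all_boot all_order all_algebra.
From mathcomp Require Import all_classical all_reals all_analysis.

Set Implicit Arguments.
Unset Strict Implicit.
Unset Printing Implicit Defensive.

Import Order.TTheory GRing.Theory Num.Theory.
Import numFieldNormedType.Exports.

Local Open Scope classical_set_scope.
Local Open Scope ring_scope.

(* R * R with the Borel sigma-algebra on each factor, on which
   lebesgue_measure \x lebesgue_measure is defined. *)
Notation mplane R := (measurableTypeR R * measurableTypeR R)%type.

Section calculus.
Context {R : realType}.

(* f is C^1 on E up to the boundary: C^1 on some open set containing E (so a
   function given on E is represented by one of its C^1 extensions). *)
Definition C1 (W : normedModType R) (E : set W) (f : W -> R) : Prop :=
  exists2 U : set W, open U /\ E `<=` U &
    forall p, U p -> differentiable f p /\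
      forall w : W, {for p, continuous ('D_w f)}.

Definition d1 (f : R * R -> R) (p : R * R) : R := 'D_((1, 0) : R * R) f p.
Definition d2 (f : R * R -> R) (p : R * R) : R := 'D_((0, 1) : R * R) f p.

(* A point of space-time is (t, (x, y)). *)
Definition dt (f : R * (R * R) -> R) (q : R * (R * R)) : R :=
  'D_((1, (0, 0)) : R * (R * R)) f q.
Definition dx (f : R * (R * R) -> R) (q : R * (R * R)) : R :=
  'D_((0, (1, 0)) : R * (R * R)) f q.
Definition dy (f : R * (R * R) -> R) (q : R * (R * R)) : R :=
  'D_((0, (0, 1)) : R * (R * R)) f q.

Definition supp (f : R * R -> R) : set (R * R) := closure [set p | f p != 0].

Definition Cc (f : R * R -> R) : Prop := continuous f /\ compact (supp f).

Definition Cc1 (f : R * R -> R) : Prop := C1 setT f /\ compact (supp f).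

Definition slice (Om : set (R * (R * R))) (t : R) : set (R * R) :=
  [set p | Om (t, p)].

End calculus.

Section radon_measures.
Context {R : realType}.
Implicit Types (U : set (R * R)) (P : {measure set (mplane R) -> \bar R}).

Definition radon_on U P : Prop :=
  forall K : set (R * R), compact K -> K `<=` U -> (P K < +oo)%E.

(* A signed Radon measure on the plane need not be finite, hence need not be a
   charge; it is represented by its Jordan decomposition (spos, sneg). *)
Record signed_measure := SignedMeasure {
  spos : {measure set (mplane R) -> \bar R} ;
  sneg : {measure set (mplane R) -> \bar R} }.
Implicit Type mu : signed_measure.

Definition signed_radon_on U mu : Prop :=
  [/\ radon_on U (spos mu), radon_on U (sneg mu) &
      exists H : set (mplane R), [/\ measurable H,
        spos mu (U `\` H) = 0%E & sneg mu (U `&` H) = 0%E]].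

Definition smeas mu (E : set (R * R)) : \bar R := (spos mu E - sneg mu E)%E.

Definition sint mu (h : R * R -> R) : R :=
  \int[spos mu]_p h p - \int[sneg mu]_p h p.

Definition abs_continuous_on U mu P : Prop :=
  forall E : set (mplane R), measurable E -> E `<=` U -> P E = 0%E ->
    spos mu E = 0%E /\ sneg mu E = 0%E.

(* w is (a version of) d mu / d P on U. *)
Definition RN_derivative_on U mu P (w : R * R -> R) : Prop :=
  forall K : set (R * R), compact K -> K `<=` U ->
    P.-integrable K (EFin \o w) /\
    forall E : set (mplane R), measurable E -> E `<=` K ->
      smeas mu E = (\int[P]_(p in E) (w p)%:E)%E.

Definition locally_integrable_on U mu (w : R * R -> R) : Prop :=
  forall K : set (R * R), compact K -> K `<=` U ->
    (spos mu).-integrable K (EFin \o w) /\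
    (sneg mu).-integrable K (EFin \o w).

End radon_measures.

Section generalized_solutions.
Context {R : realType}.

(* The notion is localized to a relatively open subset Om of
   [0, +oo[ x R^2: only the restriction of P t, I t, J t to slice Om t matters,
   and test functions are those f for which [t1, t2] x supp f lies in Om.  For
   Om = [0, +oo[ x R^2 this is the global notion.  The functions u t and v t are
   the Radon-Nikodym derivatives dI/dP and dJ/dP. *)
Record generalized_solution (Om : set (R * (R * R)))
    (rho0 u0 v0 : R * R -> R)
    (P : R -> {measure set (mplane R) -> \bar R})
    (I J : R -> @signed_measure R) (u v : R -> R * R -> R) : Prop := {
  gs_radon : forall t, 0 < t ->
    [/\ radon_on (slice Om t) (P t), signed_radon_on (slice Om t) (I t) &
        signed_radon_on (slice Om t) (J t)] ;
  gs_weakly_continuous : forall f t0, Cc f -> 0 < t0 ->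
    supp f `<=` slice Om t0 ->
    [/\ (fun t => \int[P t]_p f p) @ t0 --> \int[P t0]_p f p,
        (fun t => sint (I t) f) @ t0 --> sint (I t0) f &
        (fun t => sint (J t) f) @ t0 --> sint (J t0) f] ;
  gs_abs_continuous : {ae @lebesgue_measure R, forall t, 0 < t ->
    abs_continuous_on (slice Om t) (I t) (P t) /\
    abs_continuous_on (slice Om t) (J t) (P t)} ;
  gs_velocity : {ae @lebesgue_measure R, forall t, 0 < t ->
    RN_derivative_on (slice Om t) (I t) (P t) (u t) /\
    RN_derivative_on (slice Om t) (J t) (P t) (v t)} ;
  (* the integrals of g_x u, g_y v, h_x u, h_y v below make sense *)
  gs_integrable : {ae @lebesgue_measure R, forall t, 0 < t ->
    [/\ locally_integrable_on (slice Om t) (I t) (u t),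
        locally_integrable_on (slice Om t) (I t) (v t),
        locally_integrable_on (slice Om t) (J t) (u t) &
        locally_integrable_on (slice Om t) (J t) (v t)]} ;
  gs_mass : forall f t1 t2, Cc1 f -> 0 < t1 -> t1 < t2 ->
    (forall t, t1 <= t <= t2 -> supp f `<=` slice Om t) ->
    let F t := sint (I t) (d1 f) + sint (J t) (d2 f) in
    (@lebesgue_measure R).-integrable `[t1, t2] (EFin \o F) /\
    \int[P t2]_p f p - \int[P t1]_p f p =
      \int[@lebesgue_measure R]_(t in `[t1, t2]) F t ;
  gs_momentum_x : forall g t1 t2, Cc1 g -> 0 < t1 -> t1 < t2 ->
    (forall t, t1 <= t <= t2 -> supp g `<=` slice Om t) ->
    let F t := sint (I t) (fun p => d1 g p * u t p) +
               sint (I t) (fun p => d2 g p * v t p) in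
    (@lebesgue_measure R).-integrable `[t1, t2] (EFin \o F) /\
    sint (I t2) g - sint (I t1) g =
      \int[@lebesgue_measure R]_(t in `[t1, t2]) F t ;
  gs_momentum_y : forall h t1 t2, Cc1 h -> 0 < t1 -> t1 < t2 ->
    (forall t, t1 <= t <= t2 -> supp h `<=` slice Om t) ->
    let F t := sint (J t) (fun p => d1 h p * u t p) +
               sint (J t) (fun p => d2 h p * v t p) in
    (@lebesgue_measure R).-integrable `[t1, t2] (EFin \o F) /\
    sint (J t2) h - sint (J t1) h =
      \int[@lebesgue_measure R]_(t in `[t1, t2]) F t ;
  gs_initial : forall f, Cc f -> supp f `<=` slice Om 0 ->
    let leb2 := (@lebesgue_measure R \x @lebesgue_measure R)%E in
    [/\ (fun t => \int[P t]_p f p) @ 0^'+ -->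
          \int[leb2]_p (f p * rho0 p),
        (fun t => sint (I t) f) @ 0^'+ -->
          \int[leb2]_p (f p * (rho0 p * u0 p)) &
        (fun t => sint (J t) f) @ 0^'+ -->
          \int[leb2]_p (f p * (rho0 p * v0 p))] }.

End generalized_solutions.

Section cauchy_problem.
Context {R : realType}.

(* The index j : bool is the sign of a side: true is +, false is -. *)
Definition side (j : bool) (z : R) : Prop := if j then 0 < z else z < 0.
Definition cside (j : bool) (z : R) : Prop := if j then 0 <= z else z <= 0.

Definition region (G : R * R -> R) (j : bool) : set (R * R) :=
  [set p | side j (G p)].

(* The value on the curve G = 0, which is a null set, is irrelevant. *)
Definition piecewise (G : R * R -> R) (w : bool -> R * R -> R) (p : R * R) : R :=
  if G p < 0 then w false p else w true p.

Record compressive_data (A B : R -> R) (G : R * R -> R)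
    (rho u v : bool -> R * R -> R) : Prop := {
  cd_A : C1 setT A ;
  cd_B : C1 setT B ;
  cd_A_ge0 : forall l, 0 <= derive1 A l ;
  cd_B_ge0 : forall l, 0 <= derive1 B l ;
  cd_regular : forall l, derive1 A l ^+ 2 + derive1 B l ^+ 2 != 0 ;
  cd_G : C1 setT G ;
  cd_curve : forall p, G p = 0 <-> exists l, p = (A l, B l) ;
  (* (- B_l, A_l) is the left normal of the curve, (B_l, - A_l) the right one *)
  cd_left : forall l, \forall s \near 0^'+,
    side false (G (A l - s * derive1 B l, B l + s * derive1 A l)) ;
  cd_right : forall l, \forall s \near 0^'+,
    side true (G (A l + s * derive1 B l, B l - s * derive1 A l)) ;
  cd_rho : forall j, C1 (closure (region G j)) (rho j) ;
  cd_u : forall j, C1 (closure (region G j)) (u j) ;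
  cd_v : forall j, C1 (closure (region G j)) (v j) ;
  cd_rho_gt0 : forall j p, closure (region G j) p -> 0 < rho j p ;
  cd_compressive_minus : forall l,
    derive1 A l * v false (A l, B l) - derive1 B l * u false (A l, B l) < 0 ;
  cd_compressive_plus : forall l,
    derive1 A l * v true (A l, B l) - derive1 B l * u true (A l, B l) > 0 }.

Definition flow (u v : R * R -> R) (t : R) (p : R * R) : R * R :=
  (p.1 + t * u p, p.2 + t * v p).

(* d(x, y) / d(a, b) for (x, y) = flow u v t (a, b) *)
Definition flow_jac (u v : R * R -> R) (t : R) (p : R * R) : R :=
  let x q := (flow u v t q).1 in
  let y q := (flow u v t q).2 in
  d1 x p * d2 y p - d2 x p * d1 y p.

(* V l is the neighbourhood of (A l, B l) meant by "near (A l, B l)". *)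
Record local_time (A B : R -> R) (G : R * R -> R) (u v : bool -> R * R -> R)
    (T : R -> R) (V : R -> set (R * R)) : Prop := {
  lt_T_gt0 : forall l, 0 < T l ;
  (* {(t, l) | 0 <= t < T l} is relatively open *)
  lt_T_lsc : forall l t, t < T l -> \forall l' \near l, t < T l' ;
  lt_V : forall l, nbhs (A l, B l) (V l) ;
  lt_nondegenerate : forall l j t p, 0 < t < T l ->
    V l p -> closure (region G j) p -> flow_jac (u j) (v j) t p != 0 ;
  lt_no_crossing : forall l j t p p', 0 < t < T l ->
    V l p -> closure (region G j) p -> V l p' -> closure (region G j) p' ->
    flow (u j) (v j) t p = flow (u j) (v j) t p' -> p = p' }.

(* The domain of the shock parameters (t, l). *)
Definition pdom (T : R -> R) : set (R * R) := [set z | 0 <= z.1 < T z.2].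

(* Om is the relatively open part of [0, +oo[ x R^2 where the single-shock
   configuration is considered; being local in time, it contains the points
   (t, x^s(t, l), y^s(t, l)) for 0 <= t < T l and no other point of S = 0.
   The functions ut, vt of (t, l) give the velocity on the shock, and
   (a j, b j) are the feet of the characteristics meeting it from side j. *)
Record shock_surface (A B : R -> R) (G : R * R -> R) (u v : bool -> R * R -> R)
    (T : R -> R) (V : R -> set (R * R)) (Om : set (R * (R * R)))
    (S : R * (R * R) -> R) (xs ys ut vt : R * R -> R)
    (a b : bool -> R * R -> R) : Prop := {
  ss_domain : exists2 W : set (R * (R * R)), open W &
    Om = W `&` [set q | 0 <= q.1] ;
  ss_S : C1 Om S ;
  (* S = 0 is a C^1 surface: dS does not vanish on it *)
  ss_regular : forall q, Om q -> S q = 0 ->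
    exists w : R * (R * R), 'D_w S q != 0 ;
  ss_initial_surface : forall p, Om (0, p) ->
    (S (0, p) = 0 <-> G p = 0) /\
    (forall j, side j (S (0, p)) <-> side j (G p)) ;
  ss_param : forall t p, (Om (t, p) /\ S (t, p) = 0) <->
    exists2 l, 0 <= t < T l & p = (xs (t, l), ys (t, l)) ;
  ss_inj : forall t l l', 0 <= t < T l -> 0 <= t < T l' ->
    (xs (t, l), ys (t, l)) = (xs (t, l'), ys (t, l')) -> l = l' ;
  ss_xs : C1 (pdom T) xs ;
  ss_ys : C1 (pdom T) ys ;
  (* (t, l) are C^1 coordinates on the surface *)
  ss_immersion : forall z, pdom T z -> (d2 xs z, d2 ys z) != (0, 0) ;
  ss_integral_curves : forall z, pdom T z -> d1 xs z = ut z /\ d1 ys z = vt z ;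
  ss_issued : forall l, xs (0, l) = A l /\ ys (0, l) = B l ;
  ss_a : forall j, C1 (pdom T) (a j) ;
  ss_b : forall j, C1 (pdom T) (b j) ;
  ss_feet : forall j t l, 0 <= t < T l ->
    [/\ closure (region G j) (a j (t, l), b j (t, l)),
        V l (a j (t, l), b j (t, l)) &
        (xs (t, l), ys (t, l)) =
          flow (u j) (v j) t (a j (t, l), b j (t, l))] }.

(* The fields rhoS j, uS j, vS j (functions of (t, (x, y))) on the j side of
   the shock. *)
Record side_solutions (G : R * R -> R) (rho u v : bool -> R * R -> R)
    (T : R -> R) (V : R -> set (R * R)) (Om : set (R * (R * R)))
    (S : R * (R * R) -> R) (rhoS uS vS : bool -> R * (R * R) -> R) : Prop := {
  so_C1 : forall j, let E := [set q | Om q /\ cside j (S q)] in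
    [/\ C1 E (rhoS j), C1 E (uS j) & C1 E (vS j)] ;
  so_system : forall j q, Om q -> 0 < q.1 -> side j (S q) ->
    let r := rhoS j in let U := uS j in let W := vS j in
    [/\ dt r q + dx (r \* U) q + dy (r \* W) q = 0,
        dt (r \* U) q + dx (r \* U \* U) q + dy (r \* U \* W) q = 0 &
        dt (r \* W) q + dx (r \* U \* W) q + dy (r \* W \* W) q = 0] ;
  so_initial : forall j p, Om (0, p) -> cside j (S (0, p)) ->
    [/\ rhoS j (0, p) = rho j p, uS j (0, p) = u j p & vS j (0, p) = v j p] ;
  so_characteristics : forall j t q, Om (t, q) -> cside j (S (t, q)) ->
    exists l p, [/\ t < T l, V l p, closure (region G j) p &
                    q = flow (u j) (v j) t p] ;
  so_formulas : forall j t q l p, Om (t, q) -> cside j (S (t, q)) ->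
    t < T l -> V l p -> closure (region G j) p -> q = flow (u j) (v j) t p ->
    [/\ uS j (t, q) = u j p, vS j (t, q) = v j p &
        rhoS j (t, q) = rho j p / flow_jac (u j) (v j) t p] }.

(* mu t has density F j on the side j of the shock and the singular part
   m(t, l) dl on the shock curve at time t.  The sets E have compact closure in
   slice Om t, since mu t may be signed. *)
Definition shock_decomposition (T : R -> R) (Om : set (R * (R * R)))
    (S : R * (R * R) -> R) (xs ys : R * R -> R)
    (F : bool -> R * (R * R) -> R) (m : R * R -> R)
    (mu : R -> set (R * R) -> \bar R) : Prop :=
  let leb2 := (@lebesgue_measure R \x @lebesgue_measure R)%E in
  forall t K (E : set (mplane R)), 0 < t ->
    compact K -> K `<=` slice Om t -> measurable E -> E `<=` K ->
    mu t E =
      (\int[leb2]_(p in E `&` [set p | side false (S (t, p))]) F false (t, p) +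
       \int[leb2]_(p in E `&` [set p | side true (S (t, p))]) F true (t, p) +
       \int[@lebesgue_measure R]_(l in
           [set l | t < T l /\ E (xs (t, l), ys (t, l))]) m (t, l))%:E.

Record single_shock_form (T : R -> R) (Om : set (R * (R * R)))
    (S : R * (R * R) -> R) (xs ys ut vt : R * R -> R)
    (rhoS uS vS : bool -> R * (R * R) -> R) (Pt It Jt : R * R -> R)
    (P : R -> {measure set (mplane R) -> \bar R})
    (I J : R -> @signed_measure R) (u v : R -> R * R -> R) : Prop := {
  sf_P : shock_decomposition T Om S xs ys rhoS Pt (fun t => P t) ;
  sf_I : shock_decomposition T Om S xs ys (fun j => rhoS j \* uS j) It
    (fun t => smeas (I t)) ;
  sf_J : shock_decomposition T Om S xs ys (fun j => rhoS j \* vS j) Jt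
    (fun t => smeas (J t)) ;
  (* the shock carries mass, so that dI/dP and dJ/dP are determined on it *)
  sf_mass : forall t l, 0 < t < T l -> 0 < Pt (t, l) ;
  (* the velocity (dI/dP, dJ/dP) of the solution on the shock is (ut, vt) *)
  sf_velocity : forall t l, 0 < t < T l ->
    u t (xs (t, l), ys (t, l)) = ut (t, l) /\
    v t (xs (t, l), ys (t, l)) = vt (t, l) }.

Definition absorbed (w : bool -> R * R -> R) (a b : bool -> R * R -> R)
    (t l : R) : R :=
  let flux j z := w j (a j z, b j z) *
    (d1 (a j) z * d2 (b j) z - d1 (b j) z * d2 (a j) z) in
  \int[@lebesgue_measure R]_(tau in `[0, t])
    (flux true (tau, l) - flux false (tau, l)).

(* Pt != 0 says that the quotients are genuine (x / 0 = 0 in the library). *)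
Definition shock_formulas (rho u v : bool -> R * R -> R) (T : R -> R)
    (ut vt : R * R -> R) (a b : bool -> R * R -> R) (Pt It Jt : R * R -> R) :
    Prop :=
  forall t l, 0 < t < T l -> Pt (t, l) != 0 /\
    [/\ ut (t, l) = It (t, l) / Pt (t, l),
        vt (t, l) = Jt (t, l) / Pt (t, l),
        Pt (t, l) = absorbed rho a b t l,
        It (t, l) = absorbed (fun j => rho j \* u j) a b t l &
        Jt (t, l) = absorbed (fun j => rho j \* v j) a b t l].

End cauchy_problem.

(* Main.v *)
From HB Require Import structures.
Require Import Defs.
From mathcomp Require Import all_boot all_order all_algebra.
From mathcomp Require Import all_classical all_reals all_analysis.
From mathcomp Require Import measurable_realfun.
From mathcomp Require Import ring lra.
Import Order.TTheory GRing.Theory Num.Theory.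
Import numFieldNormedType.Exports.
Local Open Scope classical_set_scope.
Local Open Scope ring_scope.
Set Implicit Arguments.
Unset Strict Implicit.
Unset Printing Implicit Defensive.

(* For a measure mu_t with densities r_j on the two sides of the shock and a singular part m dl on
   it, and for a test function f, cut off by step (n S), integrate the transport equations
   (r_j)_t + (r_j U_j)_x + (r_j W_j)_y = 0 by parts and let n tend to infinity with the help of the
   coarea formula.  This gives
     [mu_t(f)]_{t1}^{t2} = int_{t1}^{t2} (momentum of mu_t tested against grad f) dt
                         + int_{t1}^{t2} int f(x^s, y^s) (m_t - (F_+ - F_-)) dl dt,
   where F_j = r_j ((x^s_t - U_j) y^s_l - (y^s_t - W_j) x^s_l) is the mass flow through the shock.
   Hence the weak equation is equivalent to m_t = F_+ - F_- and the initial condition to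
   m = 0 at t = 0.  By the formulas along the characteristics F_j is the initial density times
   (a_j)_t (b_j)_l - (b_j)_t (a_j)_l, so these ordinary differential equations are the integral
   formulas; the densities r_j u_j, r_j v_j are treated in the same way, and the Radon-Nikodym
   derivatives are the velocities on the shock iff It = ut Pt and Jt = vt Pt.  Conversely, the
   compressivity of the data gives F_+ - F_- > 0 at t = 0, so Pt is positive for small t and, as it
   never vanishes, for all t: the formulas do define a nonnegative measure. *)

(** * Measurability and integration in the plane *)

(** Everything is known on a part of space-time only: a field r_j is controlled on its closed side,
    and the parameters (t, l) fill the set t < T l. Multiplication by step (n S), which vanishes on
    S <= 0, and extension by 0 where T l <= t give integrands that are continuous everywhere; for
    the curve this rests on the fact that it leaves each compact set inside Om when t reaches T l.
    The surface has no global coordinate. Near each point it is a graph over x or over y, and the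
    exchange of x and y reduces the second case to the first. The velocities of a solution are
    Radon-Nikodym derivatives, given for almost every t and up to null sets, and prescribed
    pointwise on the shock only. Off the shock they are replaced by the classical velocities; the
    relations obtained on the shock for almost every t extend to every t by continuity. A
    decomposition gives the masses of sets. Integrals follow because two bounded functionals that
    agree on indicators agree on bounded Borel functions of compact support. *)

Notation leb R := (@lebesgue_measure R).
Notation leb2 R := (@lebesgue_measure R \x @lebesgue_measure R)%E.

Section plane_measurability.
Context {R : realType}.

(** The sigma-algebra of [mplane] is generated by rectangles; an open set belongs to it as the union
    of the countably many rational boxes that it contains. *)
Lemma open_measurable_plane (U : set (R * R)) :
  open U -> measurable (U : set (mplane R)).
Proof.
move=> oU.
pose box (r : (rat * rat) * (rat * rat)) : set (R * R) :=
  `]ratr r.1.1, ratr r.1.2[%classic `*` `]ratr r.2.1, ratr r.2.2[%classic.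
pose D := [set r | box r `<=` U].
have -> : U = \bigcup_(r in D) box r.
  apply/seteqP; split => [[x y] Uxy|p [r Dr] /Dr//].
  have /nbhs_ballP[e /= e0 eU] : nbhs (x, y) U by exact: open_nbhs_nbhs.
  have rb (z : R) : exists r : rat * rat,
      z - e < ratr r.1 < z /\ z < ratr r.2 < z + e.
    have /rat_in_itvoo[r1] : z - e < z by rewrite ltrBlDr ltrDl.
    have /rat_in_itvoo[r2] : z < z + e by rewrite ltrDl.
    by rewrite !in_itv/= => h2 h1; exists (r1, r2).
  have [rx [/andP[x1 x2] /andP[x3 x4]]] := rb x.
  have [ry [/andP[y1 y2] /andP[y3 y4]]] := rb y.
  exists (rx, ry); last by split; rewrite /= in_itv/= ?x2 ?x3 ?y2 ?y3.
  move=> [a b] [/=]; rewrite !in_itv/= => /andP[a1 a2] /andP[b1 b2].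
  apply: eU; split; rewrite /= /ball/= ltr_norml; apply/andP; split; lra.
rewrite bigcup_mkcond; apply: countable_bigcupT_measurable => // r.
by case: ifPn => // _; apply: measurableX; exact: measurable_itv.
Qed.

Lemma closed_measurable_plane (F : set (R * R)) :
  closed F -> measurable (F : set (mplane R)).
Proof.
move=> cF; rewrite -[F]setCK; apply: measurableC.
by apply: open_measurable_plane; rewrite openC.
Qed.

Lemma compact_measurable_plane (K : set (R * R)) :
  compact K -> measurable (K : set (mplane R)).
Proof.
move=> cK; apply: closed_measurable_plane; apply: compact_closed => //.
Qed.

Lemma within_continuous_measurable_plane (D : set (R * R)) (f : R * R -> R) :
  measurable (D : set (mplane R)) -> {within D, continuous f} ->
  measurable_fun (D : set (mplane R)) (f : mplane R -> R).
Proof.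
move=> mD /continuousP cf.
apply: (measurability _ (RGenOpens.measurableE R)).
move=> _ [_ [a [b ->] <-]]; have oab : open (`]a, b[%classic : set R) by exact: interval_open.
have /open_subspaceP[V oV VE] := cf _ oab.
rewrite setIC -VE; apply: measurableI => //; exact: open_measurable_plane.
Qed.

Lemma continuous_measurable_plane (f : R * R -> R) :
  continuous f -> measurable_fun setT (f : mplane R -> R).
Proof.
move=> cf; apply: within_continuous_measurable_plane; first exact: measurableT.
exact: continuous_subspaceT.
Qed.

Lemma open_continuous_measurable_plane (D : set (R * R)) (f : R * R -> R) :
  open D -> {in D, continuous f} ->
  measurable_fun (D : set (mplane R)) (f : mplane R -> R).
Proof.
move=> oD cf; apply: within_continuous_measurable_plane.
  exact: open_measurable_plane.
by move: cf; rewrite -(continuous_open_subspace f oD).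
Qed.

End plane_measurability.

(** * Bounded Borel functions with bounded support, and Fubini's theorem for them *)

Section bounded_support.
Context {R : realType}.

(* bcs: bounded, (Borel) measurable, with bounded support *)
Definition bcs1 (g : R -> R) := measurable_fun setT g /\
  exists2 M : R, 0 <= M & forall x, `|g x| <= M /\ (M < `|x| -> g x = 0).

Definition bcs2 (g : R * R -> R) := measurable_fun setT (g : mplane R -> R) /\
  exists2 M : R, 0 <= M & forall p, `|g p| <= M /\
    (M < `|p.1| \/ M < `|p.2| -> g p = 0).

Lemma leb2_box (a b c d : R) : a <= b -> c <= d ->
  leb2 R (`[a, b]%classic `*` `[c, d]%classic) = ((b - a) * (d - c))%:E.
Proof.
move=> ab cd; rewrite product_measure1E//= !lebesgue_measure_itv/= !lte_fin.
have h (x y : R) : x <= y -> (if (x < y)%R then y%:E + (- x)%:E else 0)%E = (y - x)%:E.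
  by rewrite le_eqVlt => /orP[/eqP->|->]; rewrite ?ltxx ?subrr// -EFinD.
by rewrite !h// EFinM.
Qed.

Lemma bcs1_integrable (g : R -> R) : bcs1 g -> (leb R).-integrable setT (EFin \o g).
Proof.
move=> [mg [M M0 gM]].
have -> : EFin \o g = (EFin \o g) \_ `[- M, M].
  apply/funext => x; rewrite patchE; case: ifPn => // /negP h.
  rewrite /= (gM x).2// ltNge; apply/negP => xM; apply: h.
  by rewrite inE/= in_itv/= -ler_norml.
apply/(integrable_mkcond _ _).1 => //.
apply: measurable_bounded_integrable => //.
- have h : (leb R `[(- M)%R, M]%classic < +oo)%E.
    by rewrite lebesgue_measure_itv/=; case: ifP => // _; rewrite -EFinD ltry.
  exact: h.
- exact: measurable_funTS.
- exists M; split; first exact: num_real.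
  by move=> z Mz x _; exact: le_trans (gM x).1 (ltW Mz).
Qed.

Lemma bcs2_integrable (g : R * R -> R) : bcs2 g -> (leb2 R).-integrable setT (EFin \o g).
Proof.
move=> [mg [M M0 gM]]; pose K : set (mplane R) := `[- M, M]%classic `*` `[- M, M]%classic.
have mK : measurable K by apply: measurableX; exact: measurable_itv.
have -> : EFin \o g = (EFin \o g) \_ K.
  apply/funext => p; rewrite patchE; case: ifPn => // /negP h.
  rewrite /= (gM p).2//; apply: contrapT => /not_orP[/negP + /negP].
  rewrite -!leNgt !ler_norml => h1 h2; apply: h.
  by rewrite inE; split; rewrite /= in_itv.
apply/(integrable_mkcond _ _).1 => //.
apply: measurable_bounded_integrable => //.
- have h : (leb2 R (`[(- M)%R, M]%classic `*` `[(- M)%R, M]%classic) < +oo)%E.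
    by rewrite leb2_box ?ltry//; lra.
  exact: h.
- exact: measurable_funTS.
- exists M; split; first exact: num_real.
  by move=> z Mz x _; exact: le_trans (gM x).1 (ltW Mz).
Qed.

Lemma bcs2_section (g : R * R -> R) x : bcs2 g -> bcs1 (fun y => g (x, y)).
Proof.
move=> [mg [M M0 gM]]; split; first exact: measurableT_comp mg (measurable_pair1 x).
by exists M => // y; split; [exact: (gM _).1|move=> h; apply: (gM _).2; right].
Qed.

Lemma int2_fubini (g : R * R -> R) : bcs2 g ->
  \int[leb2 R]_p g p = \int[leb R]_x \int[leb R]_y g (x, y).
Proof.
move=> bg; rewrite /Rintegral.
rewrite -integral12_prod_meas1; last exact: bcs2_integrable.
congr fine; apply: eq_integral => x _; rewrite /fubini_F fineK//.
by apply: integrable_fin_num => //; have /bcs1_integrable := bcs2_section x bg.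
Qed.

Lemma bcs2_swap (g : R * R -> R) : bcs2 g -> bcs2 (fun p => g (p.2, p.1)).
Proof.
move=> [mg [M M0 gM]]; split; first exact: measurableT_comp mg (@measurable_swap _ _ _ _).
by exists M => // p; split; [exact: (gM _).1|move=> h; apply: (gM _).2; rewrite /= or_comm].
Qed.

Lemma int2_swap (g : R * R -> R) : bcs2 g ->
  \int[leb2 R]_p g (p.2, p.1) = \int[leb2 R]_p g p.
Proof.
move=> bg; rewrite int2_fubini; last exact: bcs2_swap.
rewrite /Rintegral; congr fine.
rewrite -integral21_prod_meas1; last exact: bcs2_integrable.
apply: eq_integral => x _; rewrite /fubini_G fineK//.
by apply: integrable_fin_num => //; have /bcs1_integrable := bcs2_section x (bcs2_swap bg).
Qed.

End bounded_support.

(** * Dominated convergence for real-valued integrals *)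

Section dominated.
Context {R : realType} d (T : measurableType d) (mu : {measure set T -> \bar R}).

(** The bound by M on a set of finite measure is asked for large n only, so the sequence is shifted
    by the rank N from which it holds; the dominating function is [|M|] times the indicator of D. *)
Lemma dominated_Rintegral (D : set T) (g_ : nat -> T -> R) (g : T -> R) (M : R) :
  measurable D -> (mu D < +oo)%E ->
  (\forall n \near \oo, measurable_fun setT (g_ n) /\
     forall x, `|g_ n x| <= M /\ (~ D x -> g_ n x = 0)) ->
  measurable_fun setT g ->
  {ae mu, forall x, g_ n x @[n --> \oo] --> g x} ->
  \int[mu]_x g_ n x @[n --> \oo] --> \int[mu]_x g x.
Proof.
move=> mD Doo [N _ gN] mg cg.
have M0 : 0 <= `|M| by [].
pose h := fun x => (`|M| * \1_D x)%:E.
have ih : mu.-integrable setT h.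
  have -> : h = (EFin \o cst `|M|) \_ D.
    apply/funext => x; rewrite /h patchE indicE; case: ifP => _ /=.
      by rewrite mulr1.
    by rewrite mulr0.
  apply/(integrable_mkcond _ mD).1; apply: measurable_bounded_integrable => //.
  exact: bounded_cst.
have hb n x : (`|(g_ (n + N)%N x)%:E| <= h x)%E.
  have [h1 h2] := (gN _ (leq_addl n N)).2 x.
  rewrite /h lee_fin indicE; have [Dx|Dx] := pselect (D x).
    by rewrite mem_set// mulr1 (le_trans h1)// ler_norm.
  by rewrite h2// normr0 memNset// mulr0.
pose mgN n := (measurable_EFinP _ _).2 (gN _ (leq_addl n N)).1.
have cgN : {ae mu, forall x, setT x -> (g_ (n + N)%N x)%:E @[n --> \oo] --> (g x)%:E}.
  apply: filterS cg => x cx _; apply: cvg_EFin; first exact: nearW.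
  by move: cx; rewrite -(cvg_shiftn N).
have [ig _ cI] := @dominated_convergence _ _ _ mu setT measurableT
  (fun n x => (g_ (n + N)%N x)%:E) (EFin \o g) h mgN
  ((measurable_EFinP _ _).2 mg) cgN ih (aeW _ (fun x n _ => hb n x)).
rewrite -(cvg_shiftn N); apply: fine_cvg.
by rewrite fineK//; apply: integrable_fin_num.
Qed.

End dominated.

(** * C^1 functions, cut-offs and partitions of unity *)

Section partition_of_unity.
Context {R : realType} {V : normedModType R}.

(* Subtracting cut-offs one at a time: [1 - \prod_i (1 - theta_i)] is a sum of
   functions with small support and equals 1 where some [theta_i] is 1. *)
Lemma local_to_global (C : set V) (Q : (V -> R) -> Prop) : compact C ->
  (forall f g, (forall q, C q -> f q = g q) -> Q f -> Q g) ->
  Q (cst 0) ->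
  (forall f g : V -> R, continuous f -> continuous g -> Q f -> Q g -> Q (fun q => f q + g q)) ->
  (forall q, C q -> exists2 r : R, 0 < r & forall f : V -> R, continuous f ->
     (forall q', f q' != 0 -> ball q r q') -> Q f) ->
  Q (cst 1).
Proof.
move=> cC Qeq Q0 QD Qloc.
(* A tent equal to 1 on the ball of radius r / 2 and to 0 outside the ball of radius r, whence the
   cover of C by half balls below. *)
pose bump (q : V) (r : R) (q' : V) : R :=
  Num.min 1 (Num.max 0 (2 - 2 * `|q - q'| / r)).
have cbump q r : continuous (bump q r).
  move=> q'; apply: (@continuous_min _ _ (cst 1) (fun q' => Num.max 0 _)).
    exact: cst_continuous.
  apply: (@continuous_max _ _ (cst 0) (fun q' => 2 - 2 * `|q - q'| / r)).
    exact: cst_continuous.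
  apply: cvgB; first exact: cvg_cst.
  apply: cvgMl; apply: cvgMr.
  by apply: cvg_norm; apply: cvgB => //; exact: cvg_cst.
have [r rP] : exists r : V -> R, forall q, C q -> 0 < r q /\
    forall f : V -> R, continuous f -> (forall q', f q' != 0 -> ball q (r q) q') -> Q f.
  have : forall q, exists r : R, C q -> 0 < r /\
      forall f : V -> R, continuous f -> (forall q', f q' != 0 -> ball q r q') -> Q f.
    move=> q; have [Cq|nCq] := pselect (C q); last by exists 0.
    by have [r r0 rQ] := Qloc _ Cq; exists r.
  by move=> /choice[r rP]; exists r.
have [D DC Dcov] : exists2 D : seq V, {subset D <= C} &
    forall q, C q -> exists2 q', q' \in D & ball q' (r q' / 2) q.
  move: cC; rewrite compact_cover => /(_ V C (fun q => ball q (r q / 2))).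
  move=> -[]; first by move=> q _; exact: ball_open.
    move=> q Cq; exists q => //; apply: ballxx.
    by rewrite divr_gt0//; exact: (rP q Cq).1.
  move=> D DC Dcov; exists (finmap.enum_fset D).
    by move=> x xD; apply: DC.
  by move=> q /Dcov[q' /= q'D qq']; exists q'.
pose prd (s : seq V) (q : V) := \prod_(q' <- s) (1 - bump q' (r q') q).
have cprd s : continuous (prd s).
  elim: s => [|a s ihs] q.
    rewrite /prd; under eq_fun do rewrite big_nil; exact: cst_continuous.
  rewrite /prd; under eq_fun do rewrite big_cons.
  apply: cvgM; last exact: ihs.
  apply: cvgB; first exact: cvg_cst.
  exact: cbump.
have main s : {subset s <= C} -> Q (fun q => 1 - prd s q).
  elim: s => [_|a s ihs sC].
    by apply: Qeq Q0 => q _ ; rewrite /prd big_nil subrr.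
  have Ca : C a by apply/set_mem/sC; rewrite inE eqxx.
  apply: (Qeq (fun q => (1 - prd s q) + bump a (r a) q * prd s q)).
    by move=> q _; rewrite /prd big_cons; ring.
  apply: QD.
  - by move=> q; apply: cvgB; [exact: cvg_cst|exact: cprd].
  - by move=> q; apply: cvgM; [exact: cbump|exact: cprd].
  - by apply: ihs => x xs; apply: sC; rewrite inE xs orbT.
  - have [ra0 +] := rP a Ca; apply.
      by move=> q; apply: cvgM; [exact: cbump|exact: cprd].
    move=> q'; rewrite mulf_eq0 => /norP[+ _]; apply: contraNP => nb.
    rewrite /bump; have : r a <= `|a - q'|.
      by rewrite leNgt; apply/negP => h; apply: nb; rewrite -ball_normE.
    move=> h; have h1 : 1 <= `|a - q'| / r a by rewrite ler_pdivlMr// mul1r.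
    have -> : Num.max 0 (2 - 2 * `|a - q'| / r a) = 0.
      by apply/max_idPl; rewrite -mulrA; lra.
    by apply/eqP/min_idPr.
apply: Qeq (main D DC) => q Cq.
have [a aD aq] := Dcov q Cq.
rewrite /prd (big_rem a)//= /bump.
have [ra0 _] := rP a (set_mem (DC a aD)).
have -> : Num.min 1 (Num.max 0 (2 - 2 * `|a - q| / r a)) = 1.
  apply/min_idPl; rewrite le_max; apply/orP; right.
  move: aq; rewrite -ball_normE /= => aq.
  have : `|a - q| / r a < 1 / 2 by rewrite ltr_pdivrMr//; lra.
  by rewrite -mulrA; lra.
by rewrite subrr mul0r subr0.
Qed.

End partition_of_unity.

Section product_continuity.

Lemma continuous_at_fst (U V : topologicalType) (p : U * V) :
  {for p, continuous (fst : U * V -> U)}.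
Proof. exact: cvg_fst. Qed.

Lemma continuous_at_snd (U V : topologicalType) (p : U * V) :
  {for p, continuous (snd : U * V -> V)}.
Proof. exact: cvg_snd. Qed.

Lemma continuous_at_pair (W U V : topologicalType) (f : W -> U) (g : W -> V) (p : W) :
  {for p, continuous f} -> {for p, continuous g} ->
  {for p, continuous (fun w => (f w, g w))}.
Proof. by move=> cf cg; exact: cvg_pair. Qed.

Lemma continuous_at_near_eq (U V : topologicalType) (f g : U -> V) (p : U) :
  (\forall q \near p, f q = g q) -> {for p, continuous f} -> {for p, continuous g}.
Proof.
move=> fg cf; have e : f p = g p := nbhs_singleton fg.
rewrite /prop_for /continuous_at -e; apply: cvg_trans cf.
exact: near_eq_cvg.
Qed.

Lemma differentiable_fst (R : realType) (U V : normedModType R) (p : U * V) :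
  differentiable (fst : U * V -> U) p.
Proof.
apply: (@linear_differentiable R (U * V)%type U fst p) => q.
exact: continuous_at_fst.
Qed.

Lemma differentiable_snd (R : realType) (U V : normedModType R) (p : U * V) :
  differentiable (snd : U * V -> V) p.
Proof.
apply: (@linear_differentiable R (U * V)%type V snd p) => q.
exact: continuous_at_snd.
Qed.

End product_continuity.

(** * Pointwise C^1 calculus and partial derivatives *)

Section c1.
Context {R : realType}.

(** The pointwise form of [C1 E]: it holds at each point of E, boundary points included, and passes
    to opposites, products and compositions without any choice of an open set. *)
Definition c1at (V : normedModType R) (f : V -> R) (q : V) :=
  \forall q' \near q, differentiable f q' /\ forall w, {for q', continuous ('D_w f)}.

Lemma C1_c1at (V : normedModType R) (E : set V) (f : V -> R) q :
  C1 E f -> E q -> c1at f q.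
Proof.
move=> [U [oU EU] h] Eq; have : nbhs q U by apply: open_nbhs_nbhs; split=> //; exact: EU.
by apply: filterS => q' /h.
Qed.

Lemma c1at_diff (V : normedModType R) (f : V -> R) q : c1at f q -> differentiable f q.
Proof. by move=> /nbhs_singleton[]. Qed.

Lemma c1at_continuous (V : normedModType R) (f : V -> R) q :
  c1at f q -> {for q, continuous f}.
Proof. by move=> /c1at_diff /differentiable_continuous. Qed.

Lemma c1at_derive (V : normedModType R) (f : V -> R) q w :
  c1at f q -> {for q, continuous ('D_w f)}.
Proof. by move=> /nbhs_singleton[_]. Qed.

Lemma c1at_opp (V : normedModType R) (f : V -> R) q :
  c1at f q -> c1at (fun q => - f q) q.
Proof.
move=> /nbhs_interior; apply: filterS => q' hq'.
have [df cf] := nbhs_singleton hq'; split; first exact: differentiableN.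
move=> w; apply: (@continuous_at_near_eq _ _ (fun z => - 'D_w f z)); last first.
  exact: cvgN (cf w).
by apply: filterS hq' => z [dz _]; rewrite deriveN//; exact: diff_derivable.
Qed.

Lemma c1at_d1 (f : R * R -> R) q : c1at f q -> {for q, continuous (d1 f)}.
Proof. exact: c1at_derive. Qed.

Lemma c1at_d2 (f : R * R -> R) q : c1at f q -> {for q, continuous (d2 f)}.
Proof. exact: c1at_derive. Qed.

Lemma c1at_dt (f : R * (R * R) -> R) q : c1at f q -> {for q, continuous (dt f)}.
Proof. exact: c1at_derive. Qed.

Lemma c1at_dx (f : R * (R * R) -> R) q : c1at f q -> {for q, continuous (dx f)}.
Proof. exact: c1at_derive. Qed.

Lemma c1at_dy (f : R * (R * R) -> R) q : c1at f q -> {for q, continuous (dy f)}.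
Proof. exact: c1at_derive. Qed.

Lemma is_derive_comp2 (f : R * R -> R) (x y : R -> R) (s x' y' : R) :
  differentiable f (x s, y s) -> is_derive s 1 x x' -> is_derive s 1 y y' ->
  is_derive s 1 (fun s => f (x s, y s)) (x' * d1 f (x s, y s) + y' * d2 f (x s, y s)).
Proof.
move=> df [dx Dx] [dy Dy].
have gx := (derivable1_diffP x s).1 dx.
have gy := (derivable1_diffP y s).1 dy.
have gxy : differentiable (fun s => (x s, y s)) s by exact: differentiable_pair.
have gf : differentiable (fun s => f (x s, y s)) s.
  exact: (differentiable_comp gxy df).
apply: DeriveDef; first exact/derivable1_diffP.
rewrite deriveE// (diff_comp gxy df)/= diff_pair//= -!deriveE// Dx Dy.
have -> : (x', y') = x' *: ((1, 0) : R * R) + y' *: ((0, 1) : R * R).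
  by congr pair; rewrite /= /GRing.scale/= !(mulr0, mulr1) ?addr0 ?add0r.
by rewrite deriveE// linearD !linearZ /d1 /d2 !deriveE.
Qed.

Lemma is_derive_comp3 (f : R * (R * R) -> R) (z x y : R -> R) (s z' x' y' : R) :
  differentiable f (z s, (x s, y s)) ->
  is_derive s 1 z z' -> is_derive s 1 x x' -> is_derive s 1 y y' ->
  is_derive s 1 (fun s => f (z s, (x s, y s)))
   (z' * dt f (z s, (x s, y s)) + x' * dx f (z s, (x s, y s)) + y' * dy f (z s, (x s, y s))).
Proof.
move=> df [dz Dz] [dx Dx] [dy Dy].
have gz := (derivable1_diffP z s).1 dz.
have gx := (derivable1_diffP x s).1 dx.
have gy := (derivable1_diffP y s).1 dy.
have gxy : differentiable (fun s => (x s, y s)) s by exact: differentiable_pair.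
have gzxy : differentiable (fun s => (z s, (x s, y s))) s by exact: differentiable_pair.
have gf : differentiable (fun s => f (z s, (x s, y s))) s.
  exact: (differentiable_comp gzxy df).
apply: DeriveDef; first exact/derivable1_diffP.
rewrite deriveE// (diff_comp gzxy df)/= diff_pair//= diff_pair//= -!deriveE// Dz Dx Dy.
have -> : (z', (x', y')) = z' *: ((1, (0, 0)) : R * (R * R))
   + x' *: ((0, (1, 0)) : R * (R * R)) + y' *: ((0, (0, 1)) : R * (R * R)).
  by congr pair; [|congr pair]; rewrite /= /GRing.scale/= !(mulr0, mulr1) ?addr0 ?add0r.
by rewrite deriveE// !linearD !linearZ /dt /Defs.dx /Defs.dy !deriveE.
Qed.

Let lin2l (A B : R) : 1 * A + 0 * B = A. Proof. by ring. Qed.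
Let lin2r (A B : R) : 0 * A + 1 * B = B. Proof. by ring. Qed.
Let lin31 (A B C : R) : 1 * A + 0 * B + 0 * C = A. Proof. by ring. Qed.
Let lin32 (A B C : R) : 0 * A + 1 * B + 0 * C = B. Proof. by ring. Qed.
Let lin33 (A B C : R) : 0 * A + 0 * B + 1 * C = C. Proof. by ring. Qed.

Lemma is_derive_d1 (f : R * R -> R) x y : differentiable f (x, y) ->
  is_derive x 1 (fun s => f (s, y)) (d1 f (x, y)).
Proof.
move=> df; exact: is_derive_eq (is_derive_comp2 df (is_derive_id x 1) (is_derive_cst y x 1)) (lin2l _ _).
Qed.

Lemma is_derive_d2 (f : R * R -> R) x y : differentiable f (x, y) ->
  is_derive y 1 (fun s => f (x, s)) (d2 f (x, y)).
Proof.
move=> df; exact: is_derive_eq (is_derive_comp2 df (is_derive_cst x y 1) (is_derive_id y 1)) (lin2r _ _).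
Qed.

Lemma is_derive_dt (f : R * (R * R) -> R) t p : differentiable f (t, p) ->
  is_derive t 1 (fun s => f (s, p)) (dt f (t, p)).
Proof.
case: p => x y df; exact: is_derive_eq (is_derive_comp3 df (is_derive_id t 1) (is_derive_cst x t 1) (is_derive_cst y t 1)) (lin31 _ _ _).
Qed.

Lemma is_derive_dx (f : R * (R * R) -> R) t x y : differentiable f (t, (x, y)) ->
  is_derive x 1 (fun s => f (t, (s, y))) (dx f (t, (x, y))).
Proof.
move=> df; exact: is_derive_eq (is_derive_comp3 df (is_derive_cst t x 1) (is_derive_id x 1) (is_derive_cst y x 1)) (lin32 _ _ _).
Qed.

Lemma is_derive_dy (f : R * (R * R) -> R) t x y : differentiable f (t, (x, y)) ->
  is_derive y 1 (fun s => f (t, (x, s))) (dy f (t, (x, y))).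
Proof.
move=> df; exact: is_derive_eq (is_derive_comp3 df (is_derive_cst t y 1) (is_derive_cst x y 1) (is_derive_id y 1)) (lin33 _ _ _).
Qed.

End c1.

(** * A C^1 step function *)

Section smooth_step.
Context {R : realType}.

(** The simplest C^1 function that is positive for s > 0 and zero elsewhere; the step function and
    the test functions are built from it. *)
Definition psq (s : R) := Num.max 0 s ^+ 2.

Lemma is_derive_psq (s : R) : is_derive s 1 psq (2 * Num.max 0 s).
Proof.
have [s0|s0|->] := ltgtP s 0.
- rewrite mulr0; apply: (@near_eq_is_derive R R R (cst 0)).
    near=> z; rewrite /psq (max_idPl _) ?expr0n//=.
    by apply: ltW; near: z; exact: lt_nbhsl.
- apply: (@near_eq_is_derive R R R (id * id)).
    near=> z; rewrite /psq (max_idPr _)//.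
    by apply: ltW; near: z; exact: lt_nbhsr.
  have := is_deriveM (is_derive_id s 1) (is_derive_id s 1).
  by rewrite -mulr2n /GRing.scale/= mulr1 mulr_natl.
- rewrite mulr0.
  (* At the junction the difference quotient is [Num.max 0 h], which tends to 0. *)
  have c0 : h^-1 *: (psq (h *: 1 + 0) - psq 0) @[h --> 0^'] --> (0 : R).
    apply: (@cvg_trans _ ((fun h : R => Num.max 0 h : R) @ (0:R)^')).
      apply: near_eq_cvg; near=> h; rewrite addr0 /GRing.scale/= mulr1.
      have h0 : h != 0 by near: h; exact: nbhs_dnbhs_neq.
      rewrite /psq maxxx expr0n subr0 /Num.max; case: ifPn => hh.
        by rewrite expr2 mulKf.
      by rewrite expr0n mulr0.
    apply: cvg_within_filter.
    have : (fun h : R => Num.max 0 h : R) @ (0:R) --> (Num.max 0 0 : R).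
      apply: (@continuous_max _ _ (cst 0) id); first exact: cst_continuous.
      exact: cvg_id.
    by rewrite maxxx.
  apply: DeriveDef; first by apply/cvg_ex; exists 0.
  exact/cvg_lim.
Unshelve. all: by end_near. Qed.

(* [step] is a C^1 transition from 0 (for s <= 0) to 1 (for s >= 1), so that step (n S) tends to
   the indicator function of S > 0; [dstep] is its derivative. *)
Definition step (s : R) := 1 - psq (1 - psq s).
Definition dstep (s : R) := (2 * Num.max 0 (1 - psq s)) * (2 * Num.max 0 s).

Lemma is_derive_step (s : R) : is_derive s 1 step (dstep s).
Proof.
have h1 : is_derive s 1 (fun s => 1 - psq s) (- (2 * Num.max 0 s)).
  have := is_deriveB (is_derive_cst (1:R) s 1) (is_derive_psq s).
  by rewrite sub0r.
have h2 := @is_derive1_comp R psq (fun s => 1 - psq s) s _ _ (is_derive_psq (1 - psq s)) h1.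
have := is_deriveB (is_derive_cst (1:R) s 1) h2.
by rewrite sub0r mulrN opprK.
Qed.

Lemma psq_ge0 s : 0 <= psq s. Proof. exact: sqr_ge0. Qed.

Lemma step_le0 s : s <= 0 -> step s = 0.
Proof.
move=> s0; rewrite /step {2}/psq (max_idPl s0) expr0n/= subr0 /psq (max_idPr _)//.
by rewrite expr1n subrr.
Qed.

Lemma step_ge1 s : 1 <= s -> step s = 1.
Proof.
move=> s1; rewrite /step /psq (max_idPl _) ?expr0n/= ?subr0//.
by rewrite (max_idPr _) ?subr_le0 ?exprn_ege1//; lra.
Qed.

Lemma dstep_ge0 s : 0 <= dstep s.
Proof. by rewrite /dstep !mulr_ge0// le_max lexx. Qed.

Lemma dstep_le0 s : s <= 0 -> dstep s = 0.
Proof. by move=> s0; rewrite /dstep (max_idPl s0) !mulr0. Qed.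

Lemma dstep_ge1 s : 1 <= s -> dstep s = 0.
Proof.
move=> s1; rewrite /dstep /psq [X in 2 * X](max_idPl _) ?mulr0 ?mul0r//.
by rewrite (max_idPr _) ?subr_le0 ?exprn_ege1//; lra.
Qed.

Lemma step_ge0 s : 0 <= step s.
Proof.
rewrite /step /psq subr_ge0 expr_le1// ?le_max ?lexx// ge_max ler01/=.
by rewrite gerBl sqr_ge0.
Qed.

Lemma step_le1 s : step s <= 1.
Proof. by rewrite /step gerBl psq_ge0. Qed.

Lemma continuous_psq : continuous psq.
Proof.
move=> s; apply: differentiable_continuous; apply/derivable1_diffP.
by have [] := is_derive_psq s.
Qed.

Lemma continuous_step : continuous step.
Proof.
move=> s; apply: differentiable_continuous; apply/derivable1_diffP.
by have [] := is_derive_step s.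
Qed.

Lemma continuous_dstep : continuous dstep.
Proof.
have cm (f : R -> R) : continuous f -> continuous (fun s => 2 * Num.max 0 (f s)).
  move=> cf s; apply: cvgMr.
  apply: (@continuous_max _ _ (cst 0) f); first exact: cst_continuous.
  exact: cf.
move=> s; apply: cvgM; last by apply: (cm id) => z; exact: cvg_id.
apply: (cm (fun s => 1 - psq s)) => z.
by apply: cvgB; [exact: cvg_cst|exact: continuous_psq].
Qed.

End smooth_step.

(** * Charts of the shock surface *)

Section near_boxes.
Context {R : realType}.

Lemma near2P (P : R * R -> Prop) a b : (\forall z \near (a, b), P z) <->
  exists2 r, 0 < r & forall x y, `|x - a| <= r -> `|y - b| <= r -> P (x, y).
Proof.
split=> [/nbhs_ballP[r /= r0 rP]|[r r0 rP]].
  exists (r / 2); first by rewrite divr_gt0.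
  move=> x y hx hy; apply: rP; split; rewrite /ball/= distrC;
    by [apply: le_lt_trans hx _; lra|apply: le_lt_trans hy _; lra].
apply/nbhs_ballP; exists r => //= -[x y] [/= hx hy]; apply: rP;
  by rewrite distrC ltW.
Qed.

Lemma near3P (P : R * (R * R) -> Prop) a b c : (\forall z \near (a, (b, c)), P z) <->
  exists2 r, 0 < r & forall x y z, `|x - a| <= r -> `|y - b| <= r ->
    `|z - c| <= r -> P (x, (y, z)).
Proof.
split=> [/nbhs_ballP[r /= r0 rP]|[r r0 rP]].
  exists (r / 2); first by rewrite divr_gt0.
  move=> x y z hx hy hz; apply: rP; split; [|split]; rewrite /ball/= distrC;
    by [apply: le_lt_trans hx _; lra|apply: le_lt_trans hy _; lra|apply: le_lt_trans hz _; lra].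
apply/nbhs_ballP; exists r => //= -[x [y z]] [/= hx [/= hy hz]]; apply: rP;
  by rewrite distrC ltW.
Qed.

(** Here (a, b) is the gradient of S in the plane and (c, d) the tangent of the curve: where S_y <>
    0 the curve is not vertical, so x is a coordinate on it. *)
Lemma tangent_neq0 (a b c d : R) :
  a * c + b * d = 0 -> b != 0 -> c != 0 \/ d != 0 -> c != 0.
Proof.
move=> h b0 cd; apply/eqP => c0; move: h; rewrite c0 mulr0 add0r => /eqP.
rewrite mulf_eq0 (negPf b0)/= => /eqP d0.
by case: cd; rewrite ?c0 ?d0 eqxx.
Qed.

Lemma itv_norm (x a e : R) : a - e <= x <= a + e -> `|x - a| <= e.
Proof. by rewrite ler_norml; lra. Qed.

Lemma sg_between (sg x0 x xl xr d : R) : sg = 1 \/ sg = -1 ->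
  d < sg * (xr - x0) -> sg * (xl - x0) < - d -> `|x - x0| <= d ->
  sg * xl < sg * x < sg * xr.
Proof. by rewrite ler_norml => -[->|->]; lra. Qed.

Lemma half_ltr (x : R) : 0 < x -> x / 2 < x. Proof. by lra. Qed.

Lemma mvt_ge (f f' : R -> R) (a b c : R) : a <= b ->
  (forall x, a <= x <= b -> is_derive x 1 f (f' x)) ->
  (forall x, a <= x <= b -> c <= f' x) -> c * (b - a) <= f b - f a.
Proof.
rewrite le_eqVlt => /predU1P[->|ab] df fc; first by rewrite !subrr mulr0.
have [||x xab ->] := @MVT R f f' a b ab.
- by move=> x; rewrite in_itv/= => /andP[/ltW ax /ltW xb]; apply: df; rewrite ax.
- apply: derivable_within_continuous => x; rewrite in_itv/= => /df[] //.
- by rewrite ler_pM2r ?subr_gt0// fc//; move: xab; rewrite in_itv/= => /andP[/ltW-> /ltW->].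
Qed.

(** Vanishing on the right suffices to identify a two-sided derivative. This is needed at t = 0,
    where the relations on the shock hold for t >= 0 only. *)
Lemma is_derive_right0 (f : R -> R) (x d : R) :
  is_derive x 1 f d -> f x = 0 -> (\forall h \near 0^'+, f (x + h) = 0) -> d = 0.
Proof.
move=> [df <-] fx0 f0.
have h1 : h^-1 *: (f (h *: 1 + x) - f x) @[h --> 0^'+] --> 'D_1 f x.
  apply: cvg_trans df.
  apply: cvg_app => A; rewrite /dnbhs /at_right /within /nbhs/=.
  by apply: filterS => h hA h0; apply: hA; rewrite gt_eqF.
have h2 : h^-1 *: (f (h *: 1 + x) - f x) @[h --> 0^'+] --> (0 : R).
  apply: cvg_near_cst; apply: filterS f0 => h.
  by rewrite /GRing.scale/= mulr1 fx0 subr0 addrC => ->; rewrite mulr0.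
exact: (cvg_unique _ h1 h2).
Qed.

End near_boxes.

Opaque d1 d2 dt dx dy.

Section surfaces.
Context {R : realType}.

(* The consequences of [shock_surface] that are stable under the exchange of x with y and of S
   with - S; the coarea formula is then only needed where S_y <> 0 and on the side S > 0. *)
Record surf (T : R -> R) (Om : set (R * (R * R))) (S : R * (R * R) -> R)
    (X Y : R * R -> R) : Prop := Surf {
  su_Om : exists2 W : set (R * (R * R)), open W & Om = W `&` [set q | 0 <= q.1] ;
  su_S : forall q, Om q -> c1at S q ;
  su_T : forall l t, t < T l -> \forall l' \near l, t < T l' ;
  su_X : forall z, pdom T z -> c1at X z ;
  su_Y : forall z, pdom T z -> c1at Y z ;
  su_on : forall t l, 0 <= t < T l ->
    Om (t, (X (t, l), Y (t, l))) /\ S (t, (X (t, l), Y (t, l))) = 0 ;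
  su_par : forall t p, Om (t, p) -> S (t, p) = 0 ->
    exists2 l, 0 <= t < T l & p = (X (t, l), Y (t, l)) ;
  su_inj : forall t l l', 0 <= t < T l -> 0 <= t < T l' ->
    (X (t, l), Y (t, l)) = (X (t, l'), Y (t, l')) -> l = l' ;
  su_imm : forall z, pdom T z -> d2 X z != 0 \/ d2 Y z != 0 ;
  su_tan : forall t l, 0 <= t < T l -> let q := (t, (X (t, l), Y (t, l))) in
    dx S q * d2 X (t, l) + dy S q * d2 Y (t, l) = 0 ;
  su_reg : forall q, Om q -> S q = 0 -> dx S q != 0 \/ dy S q != 0 ;
  su_time : forall t l, 0 <= t < T l -> let q := (t, (X (t, l), Y (t, l))) in
    dt S q + dx S q * d1 X (t, l) + dy S q * d1 Y (t, l) = 0 }.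

Lemma pdom_near (T : R -> R) t l : (forall l t, t < T l -> \forall l' \near l, t < T l') ->
  t < T l -> \forall z \near (t, l), z.1 < T z.2.
Proof.
(* Semicontinuity keeps T above the midpoint m near l, which leaves the time free to move up to
   m. *)
move=> hT tT; pose m := (t + T l) / 2.
have tm : t < m by rewrite /m; lra.
have /hT/nbhs_ballP[r /= r0 rP] : m < T l by rewrite /m; lra.
apply/near2P; exists (Num.min (r / 2) (m - t)).
  by rewrite lt_min divr_gt0//= subr_gt0.
move=> x y /=; rewrite !le_min => /andP[_ hx] /andP[hy _].
have h1 : m < T y by apply: rP; rewrite /ball/= distrC; apply: le_lt_trans hy _; lra.
apply: le_lt_trans h1; move: hx; rewrite ler_norml; lra.
Qed.

End surfaces.

(** * The surface as a graph over (t, x) where S_y <> 0 *)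

Section chart.
Context {R : realType}.
Variables (T : R -> R) (Om : set (R * (R * R))) (S : R * (R * R) -> R) (X Y : R * R -> R).
Hypothesis su : surf T Om S X Y.

(* In the box |t - t0|, |x - x0| <= d, |y - y0| <= e the function S is strictly monotone in y and
   changes sign, so S = 0 is a graph over (t, x); [sg] and [sg'] are the signs of S_y and X_l. *)
Record chart (t0 l0 x0 y0 : R) (N : set (R * (R * R))) (eta d e c sg sg' : R) : Prop := {
  ch_sg : sg = 1 \/ sg = -1 ; ch_sg' : sg' = 1 \/ sg' = -1 ;
  ch_eta : 0 < eta ; ch_d : 0 < d ; ch_e : 0 < e ; ch_c : 0 < c ;
  ch_box : forall t x y, 0 <= t -> `|t - t0| <= d -> `|x - x0| <= d -> `|y - y0| <= e ->
    [/\ Om (t, (x, y)), N (t, (x, y)) & c <= sg * dy S (t, (x, y))] ;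
  ch_top : forall t x, 0 <= t -> `|t - t0| <= d -> `|x - x0| <= d ->
    c <= sg * S (t, (x, y0 + e)) ;
  ch_bot : forall t x, 0 <= t -> `|t - t0| <= d -> `|x - x0| <= d ->
    sg * S (t, (x, y0 - e)) <= - c ;
  ch_arc : forall t l, 0 <= t -> `|t - t0| <= d -> `|l - l0| <= eta ->
    [/\ t < T l, `|Y (t, l) - y0| < e & c <= sg' * d2 X (t, l)] ;
  ch_right : forall t, 0 <= t -> `|t - t0| <= d -> d < sg' * (X (t, l0 + eta) - x0) ;
  ch_left : forall t, 0 <= t -> `|t - t0| <= d -> sg' * (X (t, l0 - eta) - x0) < - d ;
  ch_inv : forall t l, 0 <= t -> `|t - t0| <= d -> t < T l ->
    `|X (t, l) - x0| <= d -> `|Y (t, l) - y0| <= e -> `|l - l0| < eta }.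

(** On a vertical segment S_y keeps its sign and stays away from 0, so S is strictly monotone
    there. *)
Lemma box_inj t x y1 y2 (y0 e c sg : R) : 0 < c ->
  (forall y, `|y - y0| <= e -> Om (t, (x, y)) /\ c <= sg * dy S (t, (x, y))) ->
  `|y1 - y0| <= e -> `|y2 - y0| <= e ->
  S (t, (x, y1)) = S (t, (x, y2)) -> y1 = y2.
Proof.
move=> c0 box; wlog y12 : y1 y2 / y1 <= y2.
  move=> h h1 h2 e12; have [/h->//|/ltW /h] := leP y1 y2.
  by move=> /(_ h2 h1 (esym e12)).
rewrite !ler_norml => h1 h2 e12.
have hin y : y1 <= y <= y2 -> `|y - y0| <= e by rewrite ler_norml; lra.
have := @mvt_ge _ (fun y => sg * S (t, (x, y))) (fun y => sg * dy S (t, (x, y))) y1 y2 c y12.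
have hd y : y1 <= y <= y2 -> is_derive y 1 (fun y => sg * S (t, (x, y))) (sg * dy S (t, (x, y))).
  move=> /hin/box[/(su_S su)/c1at_diff hO _].
  exact: is_deriveZ (is_derive_dy hO).
have hc y : y1 <= y <= y2 -> c <= sg * dy S (t, (x, y)) by move=> /hin/box[].
move=> /(_ hd hc); rewrite e12 subrr => hh.
apply/eqP; rewrite eq_le y12/= -subr_le0.
by move: hh; rewrite pmulr_rle0.
Qed.

(** An implicit function argument: e comes from the continuity of S_y, then d from the signs of S at
    the top and the bottom of the box, and eta from the tangent, which is not vertical. The delicate
    field is [ch_inv], since the parametrization is only assumed injective: a shock point in the box
    must not come from a remote parameter. *)
Lemma chart_exists t0 l0 (N : set (R * (R * R))) (eta0 : R) :
  let x0 := X (t0, l0) in let y0 := Y (t0, l0) in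
  0 <= t0 < T l0 -> dy S (t0, (x0, y0)) != 0 -> nbhs (t0, (x0, y0)) N -> 0 < eta0 ->
  exists eta d e c sg sg', chart t0 l0 x0 y0 N eta d e c sg sg' /\ eta <= eta0.
Proof.
move=> x0 y0 tl0 Sy0 nN eta00; have /andP[t00 tT0] := tl0.
have [Omq Sq] := su_on su tl0.
have [W oW OmW] := su_Om su.
have Wq : nbhs (t0, (x0, y0)) W by apply: open_nbhs_nbhs; split => //; move: Omq; rewrite OmW => -[].
pose sg := Num.sg (dy S (t0, (x0, y0))); pose c1 := `|dy S (t0, (x0, y0))| / 2.
have c10 : 0 < c1 by rewrite divr_gt0// normr_gt0.
have sgE : sg = 1 \/ sg = -1 by rewrite /sg; case: sgrP Sy0; auto.
have hc1 : \forall q \near (t0, (x0, y0)), c1 < sg * dy S q.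
  have cS : {for (t0, (x0, y0)), continuous (fun q => sg * dy S q)}.
    by apply: cvgMr; apply: (c1at_dy (su_S su Omq)).
  apply: (cvgr_gt _ cS); rewrite -normrEsg /c1.
  by apply: half_ltr; rewrite normr_gt0.
have [r1 r10 hr1] := (near3P _ _ _ _).1 (filterI Wq (filterI nN hc1)).
pose e := r1.
have box t x y : 0 <= t -> `|t - t0| <= r1 -> `|x - x0| <= r1 -> `|y - y0| <= e ->
    [/\ Om (t, (x, y)), N (t, (x, y)) & c1 <= sg * dy S (t, (x, y))].
  move=> ht h1 h2 h3; have [h4 [h5 /ltW h6]] := hr1 _ _ _ h1 h2 h3.
  by split => //; rewrite OmW.
have e0 : 0 < e by [].
have top0 : c1 * e <= sg * S (t0, (x0, y0 + e)).
  have := @mvt_ge _ (fun y => sg * S (t0, (x0, y))) (fun y => sg * dy S (t0, (x0, y))) y0 (y0 + e) c1.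
  rewrite Sq mulr0 subr0 (addrC y0) addrK (addrC e); apply.
  - by rewrite lerDl ltW.
  - move=> y hy; have [//|||/(su_S su)/c1at_diff hO _ _] := box t0 x0 y t00; rewrite ?subrr ?normr0 ?(ltW r10)//.
      by apply: itv_norm; move: hy e0; clear; lra.
    exact: is_deriveZ (is_derive_dy hO).
  - move=> y hy; have [//|||//] := box t0 x0 y t00; rewrite ?subrr ?normr0 ?(ltW r10)//.
    by apply: itv_norm; move: hy e0; clear; lra.
have bot0 : sg * S (t0, (x0, y0 - e)) <= - (c1 * e).
  have := @mvt_ge _ (fun y => sg * S (t0, (x0, y))) (fun y => sg * dy S (t0, (x0, y))) (y0 - e) y0 c1.
  have -> : y0 - (y0 - e) = e by ring.
  rewrite Sq mulr0 sub0r lerNr; apply.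
  - by rewrite gerBl ltW.
  - move=> y hy; have [//|||/(su_S su)/c1at_diff hO _ _] := box t0 x0 y t00; rewrite ?subrr ?normr0 ?(ltW r10)//.
      by apply: itv_norm; move: hy e0; clear; lra.
    exact: is_deriveZ (is_derive_dy hO).
  - move=> y hy; have [//|||//] := box t0 x0 y t00; rewrite ?subrr ?normr0 ?(ltW r10)//.
    by apply: itv_norm; move: hy e0; clear; lra.
have c1e : 0 < c1 * e by rewrite mulr_gt0.
have contS y : `|y - y0| <= e -> {for (t0, (x0, y)), continuous (fun q => sg * S q)}.
  move=> hy; have [||hO _ _] := box t0 x0 y t00 _ _ hy; rewrite ?subrr ?normr0 ?(ltW r10)//.
  by apply: cvgMr; apply: (c1at_continuous (su_S su hO)).
have [r2 r20 hr2] : exists2 r2, 0 < r2 & forall t x, `|t - t0| <= r2 -> `|x - x0| <= r2 ->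
    c1 * e / 2 <= sg * S (t, (x, y0 + e)).
  have : \forall q \near (t0, (x0, y0 + e)), c1 * e / 2 < sg * S q.
    apply: (cvgr_gt _ (contS _ _)); first by rewrite addrC addKr gtr0_norm.
    by apply: lt_le_trans top0; exact: half_ltr.
  move=> /near3P[r r0 rP]; exists r => // t x ht hx; apply: ltW; apply: rP => //.
  by rewrite subrr normr0 ltW.
have [r2' r2'0 hr2'] : exists2 r2, 0 < r2 & forall t x, `|t - t0| <= r2 -> `|x - x0| <= r2 ->
    sg * S (t, (x, y0 - e)) <= - (c1 * e / 2).
  have : \forall q \near (t0, (x0, y0 - e)), sg * S q < - (c1 * e / 2).
    apply: (cvgr_lt _ (contS _ _)); first by rewrite addrC addKr normrN gtr0_norm.
    by apply: le_lt_trans bot0 _; rewrite ltrN2; exact: half_ltr.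
  move=> /near3P[r r0 rP]; exists r => // t x ht hx; apply: ltW; apply: rP => //.
  by rewrite subrr normr0 ltW.
have Xl0 : d2 X (t0, l0) != 0.
  exact: (tangent_neq0 (su_tan su tl0) Sy0 (su_imm su (tl0 : pdom T (t0, l0)))).
pose sg' := Num.sg (d2 X (t0, l0)); pose c2 := `|d2 X (t0, l0)| / 2.
have c20 : 0 < c2 by rewrite divr_gt0// normr_gt0.
have sg'E : sg' = 1 \/ sg' = -1 by rewrite /sg'; case: sgrP Xl0; auto.
have hc2 : \forall z \near (t0, l0), c2 < sg' * d2 X z.
  have cX : {for (t0, l0), continuous (fun q => sg' * d2 X q)}.
    by apply: cvgMr; apply: (c1at_d2 (su_X su _)).
  apply: (cvgr_gt _ cX); rewrite -normrEsg /c2.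
  by apply: half_ltr; rewrite normr_gt0.
have hY : \forall z \near (t0, l0), `|Y z - y0| < e.
  have cY : {for (t0, l0), continuous (fun z => `|Y z - y0|)}.
    apply: cvg_norm; apply: cvgB; last exact: cvg_cst.
    exact: c1at_continuous (su_Y su _).
  by apply: (cvgr_lt _ cY); rewrite subrr normr0.
have [r3 r30 hr3] := (near2P _ _ _).1 (filterI (pdom_near (su_T su) tT0) (filterI hY hc2)).
pose eta := Num.min r3 eta0.
have eta_gt0 : 0 < eta by rewrite lt_min r30.
have etar3 : eta <= r3 by rewrite ge_min lexx.
have arc t l : 0 <= t -> `|t - t0| <= r3 -> `|l - l0| <= eta ->
    [/\ t < T l, `|Y (t, l) - y0| < e & c2 <= sg' * d2 X (t, l)].
  move=> t1 t2 l1; have [h1 [h2 /ltW h3]] := hr3 _ _ t2 (le_trans l1 etar3).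
  by [].
have arcX t l : 0 <= t -> `|t - t0| <= r3 -> `|l - l0| <= eta ->
    is_derive l 1 (fun l => sg' * X (t, l)) (sg' * d2 X (t, l)).
  move=> t1 t2 l1; have [h1 _ _] := arc _ _ t1 t2 l1.
  apply: is_deriveZ; apply: is_derive_d2; apply: c1at_diff; apply: (su_X su).
  by rewrite /pdom /= t1.
have t0r3 : `|t0 - t0| <= r3 by rewrite subrr normr0 ltW.
have right0 : c2 * eta <= sg' * (X (t0, l0 + eta) - x0).
  have := @mvt_ge _ (fun l => sg' * X (t0, l)) (fun l => sg' * d2 X (t0, l)) l0 (l0 + eta) c2.
  rewrite -mulrBr (addrC l0) addrK (addrC eta); apply.
  - by rewrite lerDl ltW.
  - by move=> l hl; apply: arcX => //; apply: itv_norm; move: hl eta_gt0; clear; lra.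
  - by move=> l hl; have [] := arc t0 l t00 t0r3 => //; apply: itv_norm; move: hl eta_gt0; clear; lra.
have left0 : sg' * (X (t0, l0 - eta) - x0) <= - (c2 * eta).
  have := @mvt_ge _ (fun l => sg' * X (t0, l)) (fun l => sg' * d2 X (t0, l)) (l0 - eta) l0 c2.
  have -> : l0 - (l0 - eta) = eta by ring.
  rewrite -mulrBr lerNr -mulrN opprB; apply.
  - by rewrite gerBl ltW.
  - by move=> l hl; apply: arcX => //; apply: itv_norm; move: hl eta_gt0; clear; lra.
  - by move=> l hl; have [] := arc t0 l t00 t0r3 => //; apply: itv_norm; move: hl eta_gt0; clear; lra.
have c2e : 0 < c2 * eta by rewrite mulr_gt0.
have contX l : `|l - l0| <= eta -> {for (t0, l), continuous (fun z => sg' * (X z - x0))}.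
  move=> hl; have [h1 _ _] := arc t0 l t00 t0r3 hl.
  apply: cvgMr; apply: cvgB; last exact: cvg_cst.
  by apply: (c1at_continuous (su_X su _)); rewrite /pdom/= t00.
have [r4 r40 hr4] : exists2 r, 0 < r & forall t, `|t - t0| <= r ->
    c2 * eta / 2 < sg' * (X (t, l0 + eta) - x0).
  have : \forall q \near (t0, l0 + eta), c2 * eta / 2 < sg' * (X q - x0).
    apply: (cvgr_gt _ (contX _ _)); first by rewrite addrC addKr gtr0_norm.
    by apply: lt_le_trans right0; exact: half_ltr.
  move=> /near2P[r r0 rP]; exists r => // t ht; apply: rP => //.
  by rewrite subrr normr0 ltW.
have [r5 r50 hr5] : exists2 r, 0 < r & forall t, `|t - t0| <= r ->
    sg' * (X (t, l0 - eta) - x0) < - (c2 * eta / 2).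
  have : \forall q \near (t0, l0 - eta), sg' * (X q - x0) < - (c2 * eta / 2).
    apply: (cvgr_lt _ (contX _ _)); first by rewrite addrC addKr normrN gtr0_norm.
    by apply: le_lt_trans left0 _; rewrite ltrN2; exact: half_ltr.
  move=> /near2P[r r0 rP]; exists r => // t ht; apply: rP => //.
  by rewrite subrr normr0 ltW.
(* The last entry makes the arc leave the strip |x - x0| <= d at both ends, because its ends are at
   a horizontal distance of more than [c2 * eta / 2] from x0 for t near t0. *)
pose d := Num.min r1 (Num.min r2 (Num.min r2' (Num.min r3 (Num.min r4 (Num.min r5 (c2 * eta / 4)))))).
have d0 : 0 < d by rewrite !lt_min r10 r20 r2'0 r30 r40 r50 divr_gt0.
have dlt : d < c2 * eta / 2.
  have dc : d <= c2 * eta / 4 by rewrite !ge_min lexx !orbT.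
  by apply: le_lt_trans dc _; move: c2e; clear; lra.
pose c := Num.min (Num.min c1 (c1 * e / 2)) c2.
have c0 : 0 < c by rewrite !lt_min c10 c20 divr_gt0.
exists eta, d, e, c, sg, sg'; split; last by rewrite ge_min lexx orbT.
have dr1 : d <= r1 by rewrite !ge_min lexx ?orbT.
have dr2 : d <= r2 by rewrite !ge_min lexx ?orbT.
have dr2' : d <= r2' by rewrite !ge_min lexx ?orbT.
have dr3 : d <= r3 by rewrite !ge_min lexx ?orbT.
have dr4 : d <= r4 by rewrite !ge_min lexx ?orbT.
have dr5 : d <= r5 by rewrite !ge_min lexx ?orbT.
have chr t : 0 <= t -> `|t - t0| <= d -> d < sg' * (X (t, l0 + eta) - x0).
  by move=> _ ht; exact: lt_trans dlt (hr4 _ (le_trans ht dr4)).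
have chl t : 0 <= t -> `|t - t0| <= d -> sg' * (X (t, l0 - eta) - x0) < - d.
  by move=> _ ht; apply: lt_trans (hr5 _ (le_trans ht dr5)) _; rewrite ltrN2.
have cc1 : c <= c1 by rewrite !ge_min lexx.
have cc1e : c <= c1 * e / 2 by rewrite !ge_min lexx orbT.
have cc2 : c <= c2 by rewrite !ge_min lexx !orbT.
split => //.
- move=> t x y ht h1 h2 h3.
  have [h4 h5 h6] := box t x y ht (le_trans h1 dr1) (le_trans h2 dr1) h3.
  by split => //; apply: le_trans h6.
- by move=> t x ht h1 h2; apply: le_trans (hr2 _ _ (le_trans h1 dr2) (le_trans h2 dr2)).
- move=> t x ht h1 h2; apply: le_trans (hr2' _ _ (le_trans h1 dr2') (le_trans h2 dr2')) _.
  by rewrite lerN2.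
- move=> t l ht h1 h2; have [h3 h4 h5] := arc t l ht (le_trans h1 dr3) h2.
  by split => //; apply: le_trans h5.
(* The arc crosses the whole strip, so it has a point with the abscissa of the given shock point;
   monotonicity of S in y gives the same ordinate, and injectivity of the parametrization the same
   label. *)
- move=> t l ht h1 h2 h3 h4.
  have hl0 : `|l0 - eta - l0| <= eta by rewrite addrC addKr normrN gtr0_norm.
  have hr0 : `|l0 + eta - l0| <= eta by rewrite addrC addKr gtr0_norm.
  have /andP[hL hR] := sg_between sg'E (chr _ ht h1) (chl _ ht h1) h3.
  have [l1 hl1 Xl1] : exists2 l1, l1 \in `[l0 - eta, l0 + eta] & sg' * X (t, l1) = sg' * X (t, l).
    apply: (@IVT _ (fun l => sg' * X (t, l))).
    - by rewrite lerBlDr -addrA lerDl addr_ge0 ?ltW.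
    - apply: derivable_within_continuous => l'; rewrite in_itv/= => /itv_norm hl'.
      by have [] := arcX t l' ht (le_trans h1 dr3) hl'.
    - by rewrite ge_min le_max (ltW hL) (ltW hR) orbT.
  have {}Xl1 : X (t, l1) = X (t, l).
    by case: sg'E Xl1 => ->; rewrite ?mul1r ?mulN1r// => /oppr_inj.
  have hl1' : `|l1 - l0| <= eta by move: hl1; rewrite in_itv/=; exact: itv_norm.
  have [Tl1 Yl1 _] := arc t l1 ht (le_trans h1 dr3) hl1'.
  have tl1 : 0 <= t < T l1 by rewrite ht.
  have tl : 0 <= t < T l by rewrite ht.
  have Yl : Y (t, l1) = Y (t, l).
    apply: (@box_inj t (X (t, l)) _ _ y0 e c sg c0) => //.
    - move=> y hy; have [h5 _ h6] := box t (X (t, l)) y ht (le_trans h1 dr1) (le_trans h3 dr1) hy.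
      by split => //; apply: le_trans h6.
    - exact: ltW.
    - by rewrite (su_on su tl).2 -Xl1 (su_on su tl1).2.
  have <- : l1 = l by apply: (su_inj su tl1 tl); rewrite Xl1 Yl.
  move: hl1'; rewrite le_eqVlt => /predU1P[|//].
  case: ger0P => _ hE.
    have l1E : l1 = l0 + eta by rewrite -hE addrC subrK.
    by move: hR; rewrite -Xl1 l1E ltxx.
  have l1E : l1 = l0 - eta by rewrite -hE opprK addrC subrK.
  by move: hL; rewrite -Xl1 l1E ltxx.
Qed.

End chart.

(** * Symmetries of the surface, and continuity of its labels *)

Section swap.
Context {R : realType}.

Definition sw (p : R * R) : R * R := (p.2, p.1).
Definition sw3 (q : R * (R * R)) : R * (R * R) := (q.1, sw q.2).

Lemma continuous_sw : continuous sw.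
Proof.
by move=> p; apply: continuous_at_pair; [exact: continuous_at_snd|exact: continuous_at_fst].
Qed.

Lemma continuous_sw3 : continuous sw3.
Proof.
move=> q; apply: continuous_at_pair; first exact: continuous_at_fst.
by apply: continuous_comp; [exact: continuous_at_snd|exact: continuous_sw].
Qed.

Lemma derive_sw3 (f : R * (R * R) -> R) w q :
  'D_w (f \o sw3) q = 'D_(sw3 w) f (sw3 q).
Proof. by []. Qed.

Lemma differentiable_sw3 q : differentiable sw3 q.
Proof.
have h2 := @differentiable_snd R R (R * R)%type q.
apply: differentiable_pair; first exact: differentiable_fst.
apply: differentiable_pair.
  by apply: (differentiable_comp h2); exact: differentiable_snd.
by apply: (differentiable_comp h2); exact: differentiable_fst.
Qed.

Lemma c1at_sw3 (f : R * (R * R) -> R) q : c1at f (sw3 q) -> c1at (f \o sw3) q.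
Proof.
move=> hf; pose P q' := differentiable f q' /\ forall w, {for q', continuous ('D_w f)}.
have : nbhs q (sw3 @^-1` P) by exact: continuous_sw3 hf.
apply: filterS => q' [df cf]; split.
  by apply: differentiable_comp => //; exact: differentiable_sw3.
move=> w; have -> : 'D_w (f \o sw3) = 'D_(sw3 w) f \o sw3 by apply/funext => z; exact: derive_sw3.
by apply: continuous_comp; [exact: continuous_sw3|exact: cf].
Qed.

Lemma surf_sw T Om S (X Y : R * R -> R) :
  surf T Om S X Y -> surf T (sw3 @^-1` Om) (S \o sw3) Y X.
Proof.
Transparent dt dx dy.
move=> su; have [W oW OmW] := su_Om su.
have hdx q : dx (S \o sw3) q = dy S (sw3 q) by exact: derive_sw3.
have hdy q : dy (S \o sw3) q = dx S (sw3 q) by exact: derive_sw3.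
have hdt q : dt (S \o sw3) q = dt S (sw3 q) by exact: derive_sw3.
Opaque dt dx dy.
constructor.
- exists (sw3 @^-1` W); last by rewrite OmW.
  by apply: open_comp => // q _; exact: continuous_sw3.
- by move=> q /(su_S su)/c1at_sw3.
- exact: (su_T su).
- exact: (su_Y su).
- exact: (su_X su).
- exact: (su_on su).
- move=> t [x y] h1 h2; have [l hl [e1 e2]] := su_par su h1 h2.
  by exists l => //; rewrite e1 e2.
- by move=> t l l' h1 h2 [e1 e2]; apply: (su_inj su h1 h2); rewrite e1 e2.
- by move=> z /(su_imm su)[]; [right|left].
- by move=> t l h /=; rewrite hdx hdy addrC; exact: (su_tan su h).
- by move=> q h1 h2; rewrite hdx hdy; have [] := su_reg su h1 h2; [right|left].
- by move=> t l h /=; rewrite hdx hdy hdt addrAC; exact: (su_time su h).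
Qed.

Lemma derive_opp (V : normedModType R) (f : V -> R) w q :
  differentiable f q -> 'D_w (fun q => - f q) q = - 'D_w f q.
Proof. by move=> df; rewrite deriveN//; exact: diff_derivable. Qed.

Lemma surf_opp T Om S (X Y : R * R -> R) :
  surf T Om S X Y -> surf T Om (fun q => - S q) X Y.
Proof.
Transparent dt dx dy.
move=> su.
have hdx q : Om q -> dx (fun q => - S q) q = - dx S q.
  by move=> /(su_S su)/c1at_diff; exact: derive_opp.
have hdy q : Om q -> dy (fun q => - S q) q = - dy S q.
  by move=> /(su_S su)/c1at_diff; exact: derive_opp.
have hdt q : Om q -> dt (fun q => - S q) q = - dt S q.
  by move=> /(su_S su)/c1at_diff; exact: derive_opp.
Opaque dt dx dy.
constructor.
- exact: (su_Om su).
- by move=> q /(su_S su)/c1at_opp.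
- exact: (su_T su).
- exact: (su_X su).
- exact: (su_Y su).
- by move=> t l h; have [h1 h2] := su_on su h; split=> //; rewrite h2 oppr0.
- by move=> t p h1 /eqP; rewrite oppr_eq0 => /eqP; exact: (su_par su).
- exact: (su_inj su).
- exact: (su_imm su).
- move=> t l h /=; have [h1 _] := su_on su h.
  rewrite hdx// hdy//; have := su_tan su h => /=.
  by move: (dx S _) (dy S _) (d2 X _) (d2 Y _) => a b c d e; rewrite !mulNr -opprD e oppr0.
- move=> q h1 /eqP; rewrite oppr_eq0 => /eqP h2; rewrite hdx// hdy//.
  by have := su_reg su h1 h2; move: (dx S _) (dy S _) => a b; rewrite !oppr_eq0.
- move=> t l h /=; have [h1 _] := su_on su h.
  rewrite hdx// hdy// hdt//; have := su_time su h => /=.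
  by move: (dt S _) (dx S _) (dy S _) (d1 X _) (d1 Y _) => f a b c d e; rewrite !mulNr -!opprD e oppr0.
Qed.

(** The inverse of the parametrization is continuous, uniformly for t near t0: this is [ch_inv] in a
    chart over x or over y, whichever exists. *)
Lemma surf_inverse T Om S (X Y : R * R -> R) t0 l0 eta : surf T Om S X Y ->
  0 <= t0 < T l0 -> 0 < eta -> exists2 d, 0 < d &
  forall t l, 0 <= t < T l -> `|t - t0| <= d -> `|X (t, l) - X (t0, l0)| <= d ->
    `|Y (t, l) - Y (t0, l0)| <= d -> `|l - l0| < eta.
Proof.
move=> su tl0 eta0; have [h1 h2] := su_on su tl0.
have [Sx|Sy] := su_reg su h1 h2.
  have [|eta' [d [e [c [sg [sg' [[_ _ _ d0 e0 _ _ _ _ _ _ _ inv] le]]]]]]] :=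
    @chart_exists _ _ _ _ _ _ (surf_sw su) t0 l0 setT eta tl0 _ filterT eta0.
    Transparent dx dy.
    by rewrite /dy derive_sw3.
    Opaque dx dy.
  exists (Num.min d e); first by rewrite lt_min d0.
  move=> t l /andP[t1 t2]; rewrite !le_min => /andP[h3 _] /andP[_ h4] /andP[h5 _].
  by apply: lt_le_trans le; apply: inv h4.
have [eta' [d [e [c [sg [sg' [[_ _ _ d0 e0 _ _ _ _ _ _ _ inv] le]]]]]]] :=
    @chart_exists _ _ _ _ _ _ su t0 l0 setT eta tl0 Sy filterT eta0.
exists (Num.min d e); first by rewrite lt_min d0.
move=> t l /andP[t1 t2]; rewrite !le_min => /andP[h3 _] /andP[h5 _] /andP[_ h4].
by apply: lt_le_trans le; apply: inv h4.
Qed.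

End swap.

(** * The coarea formula *)

Section segment_integrals.
Context {R : realType}.

Lemma within_segment (f : R -> R) (a b : R) :
  (forall y, a <= y <= b -> {for y, continuous f}) -> {within `[a, b], continuous f}.
Proof.
by move=> cf; apply: continuous_in_subspaceT => y; rewrite inE/= in_itv/= => /cf.
Qed.

Lemma segment_integrable (f : R -> R) (a b : R) :
  (forall y, a <= y <= b -> {for y, continuous f}) ->
  (leb R).-integrable `[a, b] (EFin \o f).
Proof.
move=> cf; apply: continuous_compact_integrable; first exact: segment_compact.
exact: within_segment.
Qed.

Lemma Rintegral_FTC2 (f F : R -> R) (a b : R) : a <= b ->
  (forall y, a <= y <= b -> is_derive y 1 F (f y)) ->
  (forall y, a <= y <= b -> {for y, continuous f}) ->
  \int[leb R]_(y in `[a, b]) f y = F b - F a.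
Proof.
rewrite le_eqVlt => /predU1P[->|ab] dF cf; first by rewrite set_itv1 Rintegral_set1 subrr.
have cF y : a <= y <= b -> {for y, continuous F}.
  by move=> /dF[h _]; apply: differentiable_continuous; exact/derivable1_diffP.
rewrite /Rintegral (@continuous_FTC2 _ f F a b)//.
- exact: within_segment.
- split.
  + move=> y; rewrite in_itv/= => /andP[/ltW h1 /ltW h2].
    by have [] := dF y; rewrite ?h1.
  + by apply: cvg_at_right_filter; apply: cF; rewrite lexx ltW.
  + by apply: cvg_at_left_filter; apply: cF; rewrite lexx ltW.
- move=> y; rewrite in_itv/= => /andP[/ltW h1 /ltW h2].
  by rewrite derive1E; have [] := dF y; rewrite ?h1.
Qed.

Lemma Rintegral_cst_segment (k a b : R) : a <= b ->
  \int[leb R]_(y in `[a, b]) k = k * (b - a).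
Proof.
move=> ab; rewrite mulrBr.
apply: (@Rintegral_FTC2 (cst k) (fun y => k * y)) => // y _; last exact: cvg_cst.
by have := is_deriveZ k (is_derive_id y 1); rewrite /GRing.scale/= mulr1.
Qed.

Lemma Rintegral_segment (f : R -> R) (a b : R) :
  (forall y, ~ (a <= y <= b) -> f y = 0) ->
  \int[leb R]_y f y = \int[leb R]_(y in `[a, b]) f y.
Proof.
move=> f0; rewrite [RHS]Rintegral_mkcond; apply: eq_Rintegral => y _.
rewrite patchE; case: ifPn => // /negP h; apply: f0 => yab; apply: h.
by rewrite inE/= in_itv.
Qed.

End segment_integrals.

Lemma mulf_weight (R : fieldType) (sg A s g : R) : sg * s != 0 ->
  A * g = sg * (A * s) * (g / (sg * s)).
Proof. by rewrite mulf_eq0 negb_or => /andP[h1 h2]; field; rewrite h1 h2. Qed.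

(** * The coarea formula on a segment *)

Section coarea1.
Context {R : realType}.
Variables (s s' : R -> R) (a b y0 sg c : R).
Hypothesis (ay : a < y0) (yb : y0 < b) (c0 : 0 < c) (sgE : sg = 1 \/ sg = -1).
Hypothesis ds : forall y, a <= y <= b -> is_derive y 1 s (s' y).
Hypothesis cs' : forall y, a <= y <= b -> {for y, continuous s'}.
Hypothesis s'c : forall y, a <= y <= b -> c <= sg * s' y.
Hypothesis s0 : s y0 = 0.

(** The derivative of sg * step (n s). It is nonnegative, its integral is at most 1 and equals 1 for
    large n, and it lives where 0 < s < 1 / n: an approximate identity at y0. *)
Let k (n : nat) y := sg * (n%:R * dstep (n%:R * s y) * s' y).

Let ab : a <= b. Proof. exact: ltW (lt_trans ay yb). Qed.

Let cs y : a <= y <= b -> {for y, continuous s}.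
Proof.
by move=> /ds[h _]; apply: differentiable_continuous; exact/derivable1_diffP.
Qed.

Let cdn n y : a <= y <= b -> {for y, continuous (fun y => n%:R * dstep (n%:R * s y))}.
Proof.
move=> yab; apply: cvgMr; apply: (@continuous_comp _ _ _ (fun y => n%:R * s y) dstep).
  by apply: cvgMr; exact: cs.
exact: continuous_dstep.
Qed.

Let ck n y : a <= y <= b -> {for y, continuous (k n)}.
Proof. by move=> yab; apply: cvgMr; apply: cvgM; [exact: cdn|exact: cs']. Qed.

Let k_ge0 n y : a <= y <= b -> 0 <= k n y.
Proof.
move=> yab; rewrite /k mulrCA; apply: mulr_ge0.
  by apply: mulr_ge0 => //; exact: dstep_ge0.
exact: le_trans (ltW c0) (s'c yab).
Qed.

Let int_k n : \int[leb R]_(y in `[a, b]) k n y = sg * (step (n%:R * s b) - step (n%:R * s a)).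
Proof.
have dk y : a <= y <= b -> is_derive y 1 (fun y => sg * step (n%:R * s y)) (k n y); last first.
  exact: etrans (@Rintegral_FTC2 R (k n) _ a b ab dk (@ck n)) (esym (mulrBr _ _ _)).
move=> yab; apply: is_deriveZ.
have h : is_derive y 1 (fun y => n%:R * s y) (n%:R * s' y) by apply: is_deriveZ; exact: ds.
have := @is_derive1_comp R step (fun y => n%:R * s y) y _ _ (is_derive_step _) h.
by rewrite mulrCA mulrA.
Qed.

Let s_incr y1 y2 : a <= y1 -> y1 <= y2 -> y2 <= b ->
  c * (y2 - y1) <= sg * s y2 - sg * s y1.
Proof.
move=> h3 h4 h5; apply: (@mvt_ge _ (fun y => sg * s y) (fun y => sg * s' y)) => //.
  move=> x /andP[h6 h7]; apply: is_deriveZ; apply: ds.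
  by rewrite (le_trans h3 h6) (le_trans h7 h5).
by move=> x /andP[h6 h7]; apply: s'c; rewrite (le_trans h3 h6) (le_trans h7 h5).
Qed.

Let s_far y : a <= y <= b -> c * `|y - y0| <= `|s y|.
Proof.
move=> /andP[h1 h2].
have nsg z : sg * z <= `|z|.
  by case: sgE => ->; rewrite ?mul1r ?mulN1r; [exact: ler_norm|rewrite -normrN; exact: ler_norm].
have nsg' z : - (sg * z) <= `|z| by rewrite -mulrN -(normrN z).
have [yy0|yy0] := leP y y0.
  have := s_incr h1 yy0 (ltW yb); rewrite s0 mulr0 sub0r => h.
  by rewrite distrC ger0_norm ?subr_ge0// (le_trans h).
have := s_incr (ltW ay) (ltW yy0) h2; rewrite s0 mulr0 subr0 => h.
by rewrite ger0_norm ?subr_ge0 ?(ltW yy0)// (le_trans h).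
Qed.

Let int_k_le1 n : \int[leb R]_(y in `[a, b]) k n y <= 1.
Proof.
rewrite int_k.
have := step_ge0 (n%:R * s b); have := step_ge0 (n%:R * s a).
have := step_le1 (n%:R * s b); have := step_le1 (n%:R * s a).
by case: sgE => ->; lra.
Qed.

Let large (x : R) : 0 < x -> \forall n \near \oo, 1 <= n%:R * x.
Proof.
move=> x0; near=> n; rewrite -ler_pdivrMr//; near: n; exact: nbhs_infty_ger.
Unshelve. all: by end_near. Qed.

Let int_k_eq1 : \forall n \near \oo, \int[leb R]_(y in `[a, b]) k n y = 1.
Proof.
have b1 : c * (b - y0) <= sg * s b.
  by have := s_incr (ltW ay) (ltW yb) (lexx b); rewrite s0 mulr0 subr0.
have a1 : c * (y0 - a) <= - (sg * s a).
  by have := s_incr (lexx a) (ltW ay) (ltW yb); rewrite s0 mulr0 sub0r.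
have b2 : 0 < c * (b - y0) by rewrite mulr_gt0// subr_gt0.
have a2 : 0 < c * (y0 - a) by rewrite mulr_gt0// subr_gt0.
near=> n; have hb : 1 <= n%:R * (c * (b - y0)) by near: n; exact: large.
have ha : 1 <= n%:R * (c * (y0 - a)) by near: n; exact: large.
have {}hb : 1 <= n%:R * (sg * s b) by apply: le_trans hb _; exact: ler_wpM2l.
have {}ha : 1 <= n%:R * - (sg * s a) by apply: le_trans ha _; exact: ler_wpM2l.
rewrite int_k; case: sgE hb ha => ->; rewrite ?mul1r ?mulN1r ?opprK => hb ha.
  rewrite (step_ge1 hb) (@step_le0 _ (n%:R * s a)) ?subr0//.
  by rewrite -oppr_ge0 -mulrN (le_trans ler01).
rewrite (step_ge1 ha) (@step_le0 _ (n%:R * s b)) ?sub0r ?opprK//.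
by rewrite -oppr_ge0 -mulrN (le_trans ler01).
Unshelve. all: by end_near. Qed.

Let nint (f : R -> R) : (forall y, a <= y <= b -> {for y, continuous f}) ->
  (leb R).-integrable `[a, b] (EFin \o f).
Proof. exact: segment_integrable. Qed.

Variable g : R -> R.
Hypothesis cg : forall y, a <= y <= b -> {for y, continuous g}.

Let s'neq0 y : a <= y <= b -> sg * s' y != 0.
Proof. by move=> /s'c h; rewrite gt_eqF// (lt_le_trans c0). Qed.

Let h y := g y / (sg * s' y).

Let ch y : a <= y <= b -> {for y, continuous h}.
Proof.
move=> yab; apply: cvgM; first exact: cg.
apply: cvgV; first exact: s'neq0.
by apply: cvgMr; exact: cs'.
Qed.

Let dstepE n : \int[leb R]_(y in `[a, b]) (n%:R * dstep (n%:R * s y) * g y) =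
  \int[leb R]_(y in `[a, b]) (k n y * h y).
Proof.
apply: eq_Rintegral => y; rewrite inE/= in_itv/= => yab.
exact: mulf_weight (s'neq0 yab).
Qed.

(** The weight h is bounded by M / c and the kernel has mass at most 1. The bound does not depend on
    n, so it serves as domination in the remaining variables. *)
Lemma coarea1_bound M n : (forall y, a <= y <= b -> `|g y| <= M) ->
  `|\int[leb R]_(y in `[a, b]) (n%:R * dstep (n%:R * s y) * g y)| <= M / c.
Proof.
move=> gM; rewrite dstepE.
have y0ab : a <= y0 <= b by rewrite !ltW.
have M0 : 0 <= M by exact: le_trans (gM _ y0ab).
have hM y : a <= y <= b -> `|h y| <= M / c.
  move=> yab; rewrite /h normrM normfV ler_pM ?invr_ge0//; first exact: gM.
  rewrite lef_pV2 ?posrE//; last by rewrite normr_gt0 s'neq0.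
  exact: le_trans (s'c yab) (ler_norm _).
have ikh : (leb R).-integrable `[a, b] (EFin \o (fun y => k n y * h y)).
  by apply: nint => y yab; apply: cvgM; [exact: ck|exact: ch].
apply: (le_trans (le_normr_Rintegral _ ikh)) => //.
apply: (@le_trans _ _ (\int[leb R]_(y in `[a, b]) (k n y * (M / c)))).
  apply: le_Rintegral => //.
  - by apply: nint => y yab; apply: cvg_norm; apply: cvgM; [exact: ck|exact: ch].
  - by apply: nint => y yab; apply: cvgMl; exact: ck.
  - move=> y; rewrite /= in_itv/= => yab; rewrite normrM ger0_norm ?k_ge0//.
    by rewrite ler_wpM2l ?k_ge0// hM.
rewrite RintegralZr//; last by apply: nint => y yab; exact: ck.
rewrite -[leRHS]mul1r ler_wpM2r ?int_k_le1// divr_ge0// ltW//.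
Qed.

(** The integrand is [k n * h] with h = g / (sg * s'), and [k n] is an approximate identity at
    y0. *)
Lemma coarea1_cvg :
  (\int[leb R]_(y in `[a, b]) (n%:R * dstep (n%:R * s y) * g y)) @[n --> \oo] -->
  g y0 / (sg * s' y0).
Proof.
have y0ab : a <= y0 <= b by rewrite !ltW.
apply/cvgrPdist_le => e e0.
have /cvgrPdist_le/(_ e e0) := ch y0ab; rewrite -[X in X -> _]/(\near y0, _).
move=> /nbhs_ballP[d /= d0 hd].
near=> n; rewrite dstepE -/(h y0).
have k1 : \int[leb R]_(y in `[a, b]) k n y = 1 by near: n; exact: int_k_eq1.
have nd : 1 <= n%:R * (c * (d / 2)).
  by near: n; apply: large; rewrite mulr_gt0 ?divr_gt0.
have -> : h y0 - \int[leb R]_(y in `[a, b]) (k n y * h y) =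
    \int[leb R]_(y in `[a, b]) (k n y * h y0 - k n y * h y).
  rewrite RintegralB//; first last.
  - by apply: nint => y yab; apply: cvgM; [exact: ck|exact: ch].
  - by apply: nint => y yab; apply: cvgMl; exact: ck.
  by rewrite RintegralZr ?k1 ?mul1r//; apply: nint => y yab; exact: ck.
have ci : forall y, a <= y <= b -> {for y, continuous (fun y => k n y * h y0 - k n y * h y)}.
  move=> y yab; apply: cvgB; first by apply: cvgMl; exact: ck.
  by apply: cvgM; [exact: ck|exact: ch].
apply: (le_trans (le_normr_Rintegral _ (nint ci))) => //.
apply: (@le_trans _ _ (\int[leb R]_(y in `[a, b]) (k n y * e))).
  apply: le_Rintegral => //.
  - by apply: nint => y yab; apply: cvg_norm; exact: ci.
  - by apply: nint => y yab; apply: cvgMl; exact: ck.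
  move=> y; rewrite /= in_itv/= => yab.
  rewrite -mulrBr normrM ger0_norm ?k_ge0//.
  have [->|kn0] := eqVneq (k n y) 0; first by rewrite !mul0r.
  rewrite ler_wpM2l ?k_ge0//; apply: hd; rewrite /ball/= distrC.
  have [n0|n0] := eqVneq n 0%N.
    by move: nd; rewrite n0 mul0r ler10.
  have n0' : 0 < n%:R :> R by rewrite ltr0n lt0n.
  (* Outside this range [dstep] is 0, against k n y <> 0. As |s| grows at least like c |y - y0|, the
     point y is then close to y0. *)
  have sy : 0 < n%:R * s y < 1.
    apply/andP; split; rewrite ltNge; apply/negP => hn; move: kn0; rewrite /k.
      by rewrite dstep_le0// mulr0 mul0r mulr0 eqxx.
    by rewrite dstep_ge1// mulr0 mul0r mulr0 eqxx.
  have : n%:R * (c * `|y - y0|) < 1.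
    apply: le_lt_trans (_ : n%:R * s y < 1); last by case/andP: sy.
    rewrite ler_wpM2l ?ler0n//; apply: le_trans (s_far yab) _.
    by rewrite ger0_norm//; move: sy => /andP[+ _]; rewrite pmulr_rgt0// => /ltW.
  move=> hy; have := lt_le_trans hy nd.
  rewrite ltr_pM2l// ltr_pM2l// => /lt_trans; apply.
  exact: half_ltr.
rewrite RintegralZr ?k1 ?mul1r//; by apply: nint => y yab; exact: ck.
Unshelve. all: by end_near. Qed.

End coarea1.

Section more_integrals.
Context {R : realType}.

Lemma leb_itv_lty (a b : R) : (leb R `[a, b]%classic < +oo)%E.
Proof. by rewrite lebesgue_measure_itv/=; case: ifP => // _; rewrite -EFinD ltry. Qed.

Lemma dominated_Rintegral1 (g_ : nat -> R -> R) (g : R -> R) (M : R) :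
  (\forall n \near \oo, measurable_fun setT (g_ n) /\
     forall x, `|g_ n x| <= M /\ (M < `|x| -> g_ n x = 0)) ->
  measurable_fun setT g ->
  (forall x, g_ n x @[n --> \oo] --> g x) ->
  \int[leb R]_x g_ n x @[n --> \oo] --> \int[leb R]_x g x.
Proof.
move=> gM mg cg; apply: (@dominated_Rintegral R _ (measurableTypeR R) (leb R) `[- M, M]%classic g_ g M) => //.
- exact: leb_itv_lty.
- apply: filterS gM => n [h1 h2]; split => // x; split; first exact: (h2 x).1.
  move=> nx; apply: (h2 x).2; rewrite ltNge; apply/negP => xM; apply: nx.
  by rewrite /= in_itv/= -ler_norml.
- exact: aeW.
Qed.

Lemma continuous_int_section (Z : R * R -> R) : continuous Z -> bcs2 Z ->
  continuous (fun x => \int[leb R]_y Z (x, y)).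
Proof.
move=> cZ bZ x; apply/(@cvg_nbhsP _ R^o) => u ux.
have [mZ [M M0 ZM]] := bZ.
apply: (@dominated_Rintegral1 _ _ M).
- apply: nearW => n; split; first exact: (bcs2_section _ bZ).1.
  by move=> y; split; [exact: (ZM _).1|move=> h; apply: (ZM _).2; right].
- exact: (bcs2_section _ bZ).1.
- move=> y; have h : (fun n => (u n, y)) @ \oo --> ((x, y) : R * R).
    exact: (cvg_pair ux (cvg_cst y)).
  exact: cvg_comp h (cZ _).
Qed.

(** The sign sg treats increasing and decreasing F at once. Since k vanishes outside the image of
    ]a, b[, the integral over the line reduces to one over this image. *)
Lemma Rintegral_substitution (F F' k : R -> R) (a b sg c : R) :
  a < b -> sg = 1 \/ sg = -1 -> 0 < c ->
  (forall l, a <= l <= b -> is_derive l 1 F (F' l)) ->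
  (forall l, a <= l <= b -> {for l, continuous F'}) ->
  (forall l, a <= l <= b -> c <= sg * F' l) ->
  continuous k ->
  (forall x, k x != 0 -> sg * F a < sg * x < sg * F b) ->
  \int[leb R]_x k x = \int[leb R]_(l in `[a, b]) (k (F l) * (sg * F' l)).
Proof.
move=> ab sgE c0 dF cF' F'c ck k0.
have cF l : a <= l <= b -> {for l, continuous F}.
  by move=> /dF[h _]; apply: differentiable_continuous; exact/derivable1_diffP.
have mono x y : a <= x -> x < y -> y <= b -> sg * F x < sg * F y.
  move=> ax xy yb; have : c * (y - x) <= sg * F y - sg * F x.
    apply: (@mvt_ge _ (fun l => sg * F l) (fun l => sg * F' l)); first exact: ltW.
      move=> z /andP[h1 h2]; apply: is_deriveZ; apply: dF.
      by rewrite (le_trans ax h1) (le_trans h2 yb).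
    by move=> z /andP[h1 h2]; apply: F'c; rewrite (le_trans ax h1) (le_trans h2 yb).
  by rewrite -subr_gt0; apply: lt_le_trans; rewrite mulr_gt0// subr_gt0.
have dFE l : a <= l <= b -> derive1 F l = F' l.
  by move=> h; rewrite derive1E; have [] := dF l h.
have aab : a <= a <= b by rewrite lexx ltW.
have bab : a <= b <= b by rewrite lexx ltW.
have cF'o : {in `]a, b[, continuous (derive1 F)}.
  move=> l lab; have h : a <= l <= b by move: lab; rewrite in_itv/= => /andP[/ltW-> /ltW->].
  apply: (continuous_at_near_eq _ (cF' _ h)).
  have : \forall z \near l, z \in `]a, b[ by exact: near_in_itvoo.
  by apply: filterS => z; rewrite in_itv/= => /andP[/ltW h1 /ltW h2]; rewrite dFE// h1.
have cva : cvg (derive1 F x @[x --> a^'+]).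
  apply/cvg_ex; exists (F' a).
  have h : F' x @[x --> a^'+] --> F' a by apply: cvg_at_right_filter; exact: cF'.
  apply: cvg_trans h; apply: near_eq_cvg; near=> x; rewrite dFE//.
  by apply/andP; split; near: x; [exact: nbhs_right_ge|exact: nbhs_right_le].
have cvb : cvg (derive1 F x @[x --> b^'-]).
  apply/cvg_ex; exists (F' b).
  have h : F' x @[x --> b^'-] --> F' b by apply: cvg_at_left_filter; exact: cF'.
  apply: cvg_trans h; apply: near_eq_cvg; near=> x; rewrite dFE//.
  by apply/andP; split; near: x; [exact: nbhs_left_ge|exact: nbhs_left_le].
have LR : derivable_oo_LRcontinuous F a b.
  split.
  - move=> y; rewrite in_itv/= => /andP[/ltW h1 /ltW h2].
    by have [] := dF y; rewrite ?h1.
  - by apply: cvg_at_right_filter; exact: cF.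
  - by apply: cvg_at_left_filter; exact: cF.
have ckw A : {within A, continuous k} by exact: continuous_subspaceT.
case: sgE mono k0 => ->.
  move=> mono k0; rewrite (@Rintegral_segment _ k (F a) (F b)).
    rewrite /Rintegral; congr fine.
    rewrite (integration_by_substitution_increasing (ltW ab) _ cF'o cva cvb LR (ckw _)).
      apply: eq_integral => l; rewrite inE/= in_itv/= => lab.
      by rewrite mul1r -(dFE _ lab).
    move=> x y; rewrite !in_itv/= => /andP[h1 h2] /andP[h3 h4] xy.
    by have := mono x y h1 xy h4; rewrite !mul1r.
  move=> y h; apply: contra_notP h => /eqP/k0.
  by rewrite !mul1r => /andP[/ltW-> /ltW->].
move=> mono k0; rewrite (@Rintegral_segment _ k (F b) (F a)).
  rewrite /Rintegral; congr fine.
  rewrite (integration_by_substitution_decreasing (ltW ab) _ cF'o cva cvb LR (ckw _)).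
    apply: eq_integral => l; rewrite inE/= in_itv/= => lab.
    by rewrite mulN1r -(dFE _ lab).
  move=> x y; rewrite !in_itv/= => /andP[h1 h2] /andP[h3 h4] xy.
  by have := mono y x h3 xy h2; rewrite !mulN1r ltrN2.
move=> y h; apply: contra_notP h => /eqP/k0.
by rewrite !mulN1r !ltrN2 => /andP[/ltW-> /ltW->].
Unshelve. all: by end_near. Qed.

Lemma compact_bound (V : topologicalType) (A : set V) (h : V -> R) : compact A ->
  (forall q, A q -> {for q, continuous h}) ->
  exists2 M : R, 0 <= M & forall q, A q -> `|h q| <= M.
Proof.
move=> cA ch.
have cwh : {within A, continuous h} by apply: continuous_in_subspaceT => q /set_mem/ch.
have [M [_ hM]] := compact_bounded (continuous_compact cwh cA).
exists (`|M| + 1); first by rewrite addr_ge0.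
move=> q Aq; apply: (hM (`|M| + 1)); last by exists q.
by rewrite (le_lt_trans (ler_norm M))// ltrDl.
Qed.

Lemma segment_norm_le (a b x : R) : a <= x <= b -> `|x| <= `|a| + `|b|.
Proof.
move=> /andP[h1 h2]; rewrite ler_norml; apply/andP; split.
  rewrite opprD (le_trans _ h1)// lerBlDr; have := ler_norm (- a); rewrite normrN.
  by have := normr_ge0 b; lra.
by rewrite (le_trans h2)//; have := normr_ge0 a; have := ler_norm b; lra.
Qed.

Lemma continuous_bcs1 (Z : R -> R) (a r : R) : continuous Z ->
  (forall x, Z x != 0 -> `|x - a| <= r) -> bcs1 Z.
Proof.
move=> cZ Zr; split; first exact: continuous_measurable_fun.
have [M M0 hM] := @compact_bound _ `[a - r, a + r]%classic Z (@segment_compact _ _ _) (fun q _ => cZ q).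
have ZM x : Z x != 0 -> `|Z x| <= M /\ `|x| <= `|a| + `|r|.
  move=> /Zr xr; split.
    by apply: hM; move: xr; rewrite /= in_itv/= ler_norml lerBlDl lerBrDl.
  have -> : x = a + (x - a) by rewrite addrC subrK.
  by rewrite (le_trans (ler_normD _ _))// lerD2l (le_trans xr)// ler_norm.
exists (M + (`|a| + `|r|)); first by rewrite !addr_ge0.
move=> x; have [->|/ZM[h1 h2]] := eqVneq (Z x) 0.
  by split => //; rewrite normr0 !addr_ge0.
split; first by rewrite (le_trans h1)// lerDl addr_ge0.
by rewrite ltNge (le_trans h2)// lerDr.
Qed.

Lemma continuous_bcs2 (Z : R * R -> R) (a b r : R) : continuous Z ->
  (forall x y, Z (x, y) != 0 -> `|x - a| <= r /\ `|y - b| <= r) -> bcs2 Z.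
Proof.
move=> cZ Zr; split; first exact: continuous_measurable_plane.
have cK : compact (`[a - r, a + r]%classic `*` `[b - r, b + r]%classic : set (R * R)).
  by apply: compact_setX; exact: segment_compact.
have [M M0 hM] := @compact_bound _ _ Z cK (fun q _ => cZ q).
(* One bound for both coordinates; the second alternative is absurd for c = a and for c = b. *)
have nb (x c : R) : `|x - c| <= r -> `|x| <= `|a| + `|b| + `|r| \/ `|c| > `|a| + `|b|.
  move=> xr; have [h|] := leP `|c| (`|a| + `|b|); [left|by right].
  have -> : x = c + (x - c) by rewrite addrC subrK.
  by rewrite (le_trans (ler_normD _ _))// lerD// (le_trans xr)// ler_norm.
have ZM x y : Z (x, y) != 0 -> [/\ `|Z (x, y)| <= M, `|x| <= `|a| + `|b| + `|r| &
    `|y| <= `|a| + `|b| + `|r|].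
  move=> /Zr[xr yr]; split.
  - by apply: hM; split; [move: xr|move: yr]; rewrite /= in_itv/= ler_norml lerBlDl lerBrDl.
  - by have [//|] := nb _ _ xr; rewrite ltNge lerDl normr_ge0.
  - by have [//|] := nb _ _ yr; rewrite ltNge lerDr normr_ge0.
exists (M + (`|a| + `|b| + `|r|)); first by rewrite !addr_ge0.
move=> [x y]; have [->|/ZM[h1 h2 h3]] := eqVneq (Z (x, y)) 0.
  by split => //; rewrite normr0 !addr_ge0.
split; first by rewrite (le_trans h1)// lerDl !addr_ge0.
by move=> [|] /=; rewrite ltNge ?(le_trans h2)// ?(le_trans h3)// lerDr.
Qed.

End more_integrals.

Opaque d1 d2 dt dx dy.

Section local_coarea.
Context {R : realType}.

(** What a derivative of step (n S) produces, with the derivative of S absorbed into g. *)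
Definition Zf (S g th : R * (R * R) -> R) (n : nat) (t : R) (p : R * R) : R :=
  n%:R * dstep (n%:R * S (t, p)) * (th (t, p) * g (t, p)).

(* The factor by which the limit of n (step' (n S)) dx dy, carried by S = 0, differs from dl. *)
Definition omega (S : R * (R * R) -> R) (X Y : R * R -> R) (t l : R) : R :=
  let q := (t, (X (t, l), Y (t, l))) in
  (d2 X (t, l) ^+ 2 + d2 Y (t, l) ^+ 2) / `|dx S q * d2 Y (t, l) - dy S q * d2 X (t, l)|.

Definition crv (T : R -> R) (S : R * (R * R) -> R) (X Y : R * R -> R)
    (g th : R * (R * R) -> R) (t l : R) : R :=
  let q := (t, (X (t, l), Y (t, l))) in
  if t < T l then th q * g q * omega S X Y t l else 0.

(* [th] is a cut-off used to localize: the formula is additive in it. *)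
Definition coareaQ T S X Y t1 t2 g th :=
  exists C N, (forall n t, (N <= n)%N -> t1 <= t <= t2 ->
      bcs2 (Zf S g th n t) /\ `|\int[leb2 R]_p Zf S g th n t p| <= C) /\
    (forall t, t1 <= t <= t2 -> bcs1 (crv T S X Y g th t) /\
      \int[leb2 R]_p Zf S g th n t p @[n --> \oo] --> \int[leb R]_l crv T S X Y g th t l).

(** In a chart over x the limit measure is dx / |S_y|, that is, |X_l| / |S_y| dl. Tangency rewrites
    this weight in the form of [omega], which is symmetric in x and y and so does not depend on the
    chart. *)
Lemma omegaE (a b c d sg sg' k : R) : a * c + b * d = 0 -> 0 < k ->
  k <= sg * b -> k <= sg' * c -> (sg = 1 \/ sg = -1) -> (sg' = 1 \/ sg' = -1) ->
  (c ^+ 2 + d ^+ 2) / `|a * d - b * c| = sg' * c / (sg * b).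
Proof.
move=> h k0 kb kc sgE sg'E.
have b0 : 0 < sg * b by exact: lt_le_trans kb.
have c0 : 0 < sg' * c by exact: lt_le_trans kc.
have bn0 : b != 0 by apply/eqP => b0'; move: b0; rewrite b0' mulr0 ltxx.
have dE : d = - (a * c) / b.
  by apply: (mulfI bn0); rewrite mulrCA divff// mulr1; apply/eqP; rewrite -addr_eq0 addrC h.
have absb : `|b| = sg * b.
  by case: sgE b0 => ->; rewrite ?mul1r ?mulN1r; [move/gtr0_norm|rewrite oppr_gt0 => /ltr0_norm].
have absc : `|c| = sg' * c.
  by case: sg'E c0 => ->; rewrite ?mul1r ?mulN1r; [move/gtr0_norm|rewrite oppr_gt0 => /ltr0_norm].
have c0' : `|c| != 0 by rewrite absc gt_eqF.
have ab2 : 0 < a ^+ 2 + b ^+ 2.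
  by rewrite ltr_wpDl ?sqr_ge0// lt_def sqr_ge0 andbT sqrf_eq0.
rewrite -absb -absc.
have -> : a * d - b * c = - (c * (a ^+ 2 + b ^+ 2) / b) by rewrite dE; field.
have -> : c ^+ 2 + d ^+ 2 = c ^+ 2 * (a ^+ 2 + b ^+ 2) / b ^+ 2 by rewrite dE; field.
rewrite normrN !normrM normfV (gtr0_norm ab2) -(real_normK (num_real c)) -(real_normK (num_real b)).
have ab2' : a ^+ 2 + `|b| ^+ 2 != 0 by rewrite real_normK ?num_real// gt_eqF.
by field; rewrite c0' ab2' normr_eq0 bn0.
Qed.

End local_coarea.

(** * The coarea formula in a chart *)

Section chart_coarea.
Context {R : realType}.
Variables (T : R -> R) (Om : set (R * (R * R))) (S : R * (R * R) -> R) (X Y : R * R -> R).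
Hypothesis su : surf T Om S X Y.
Variables (t0 l0 x0 y0 eta d e c sg sg' : R) (g : R * (R * R) -> R).
Hypothesis ch : chart T Om S X Y t0 l0 x0 y0 [set q | {for q, continuous g}] eta d e c sg sg'.
Variables (r : R) (th : R * (R * R) -> R).
Hypothesis (r0 : 0 < r) (rd : r < d) (re : r < e) (cth : continuous th).
Hypothesis thr : forall t x y, th (t, (x, y)) != 0 ->
  [/\ `|t - t0| < r, `|x - x0| < r & `|y - y0| < r].

Let a := l0 - eta.
Let b := l0 + eta.

Let F t x y := th (t, (x, y)) * g (t, (x, y)).

Let F0 t x y : F t x y != 0 -> [/\ `|t - t0| < r, `|x - x0| < r & `|y - y0| < r].
Proof. by rewrite /F mulf_eq0 negb_or => /andP[/thr]. Qed.

Let F_bounded : exists2 M, 0 <= M & forall t x y, 0 <= t -> `|F t x y| <= M.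
Proof.
pose B := (`[t0 - r, t0 + r]%classic `&` [set t | 0 <= t]) `*`
  (`[x0 - r, x0 + r]%classic `*` `[y0 - r, y0 + r]%classic).
have cB : compact B.
  apply: compact_setX.
    by apply: compact_closedI; [exact: segment_compact|exact: closed_ge].
  by apply: compact_setX; exact: segment_compact.
have nrm z z0 : z \in `[z0 - r, z0 + r] -> `|z - z0| <= r by rewrite in_itv/=; exact: itv_norm.
have [|M M0 hM] := @compact_bound _ _ B (fun q => th q * g q) cB.
  move=> [t [x y]] [[/nrm h1 h2] [/nrm h3 /nrm h4]].
  apply: cvgM; first exact: cth.
  have [_ h _] := ch_box ch h2 (le_trans h1 (ltW rd)) (le_trans h3 (ltW rd)) (le_trans h4 (ltW re)).
  exact: h.
exists M => // t x y ht; have [->|Fn0] := eqVneq (F t x y) 0; first by rewrite normr0.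
have [h1 h2 h3] := F0 Fn0.
have nrm' z z0 : `|z - z0| < r -> z \in `[z0 - r, z0 + r].
  by move=> /ltW; rewrite in_itv/= ler_norml lerBlDl lerBrDl.
by apply: (hM (t, (x, y))); split; [split => //; exact: nrm'|split; exact: nrm'].
Qed.

Let near_far (z w s : R) : s < `|z - w| -> \forall z' \near z, s < `|z' - w|.
Proof.
move=> h; have cn : {for z, continuous (fun z' => `|z' - w|)}.
  by apply: cvg_norm; apply: cvgB; [exact: cvg_id|exact: cvg_cst].
exact: (cvgr_gt _ cn).
Qed.

Let Z n t (p : R * R) := Zf S g th n t p.

Let ZE n t x y : Z n t (x, y) = n%:R * dstep (n%:R * S (t, (x, y))) * F t x y.
Proof. by []. Qed.

Let Z0 n t x y : Z n t (x, y) != 0 -> [/\ `|t - t0| < r, `|x - x0| < r & `|y - y0| < r].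
Proof. by rewrite ZE mulf_eq0 negb_or => /andP[_ /F0]. Qed.

(** The support of th lies strictly inside the box of the chart, so the integrand is locally 0
    outside this box, where nothing is known about S and g. *)
Let cZ n t : 0 <= t -> `|t - t0| <= d -> continuous (Z n t).
Proof.
move=> t1 t2 [x y].
have [hx|hx] := leP `|x - x0| d; last first.
  apply: (@continuous_at_near_eq _ _ (cst 0)); last exact: cvg_cst.
  have : \forall p \near (x, y), r < `|p.1 - x0|.
    exact: (@continuous_at_fst R R (x, y) [set z | r < `|z - _|] (near_far (lt_trans rd hx))).
  apply: filterS => -[x' y'] /= h; apply/esym/eqP; apply: contraTT h => /Z0[_ + _].
  by rewrite -leNgt => /ltW.
have [hy|hy] := leP `|y - y0| e; last first.
  apply: (@continuous_at_near_eq _ _ (cst 0)); last exact: cvg_cst.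
  have : \forall p \near (x, y), r < `|p.2 - y0|.
    exact: (@continuous_at_snd R R (x, y) [set z | r < `|z - _|] (near_far (lt_trans re hy))).
  apply: filterS => -[x' y'] /= h; apply/esym/eqP; apply: contraTT h => /Z0[_ _].
  by rewrite -leNgt => /ltW.
have [hO hg _] := ch_box ch t1 t2 hx hy.
have cp : {for (x, y), continuous (fun p : R * R => (t, p))}.
  by apply: continuous_at_pair; [exact: cvg_cst|exact: cvg_id].
have cS : {for (x, y), continuous (fun p : R * R => S (t, p))}.
  exact: (@continuous_comp _ _ _ _ S _ cp (c1at_continuous (su_S su hO))).
have cg : {for (x, y), continuous (fun p : R * R => g (t, p))}.
  exact: (@continuous_comp _ _ _ _ g _ cp hg).
have ct : {for (x, y), continuous (fun p : R * R => th (t, p))}.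
  by apply: (@continuous_comp _ _ _ (fun p : R * R => (t, p)) th _ cp); exact: cth.
rewrite /Z /Zf; apply: cvgM; last exact: cvgM.
apply: cvgMr; apply: (@continuous_comp _ _ _ (fun p : R * R => n%:R * S (t, p)) dstep).
  exact: cvgMr.
exact: continuous_dstep.
Qed.

Let bZ n t : 0 <= t -> `|t - t0| <= d -> bcs2 (Z n t).
Proof.
move=> t1 t2; apply: (@continuous_bcs2 _ _ x0 y0 r); first exact: cZ.
by move=> x y /Z0[_ /ltW-> /ltW->].
Qed.

Let kn n t x := \int[leb R]_y Z n t (x, y).

Let knE n t x : kn n t x = \int[leb R]_(y in `[y0 - e, y0 + e]) Z n t (x, y).
Proof.
apply: Rintegral_segment => y h; apply/eqP; apply: contra_notT h => /Z0[_ _ yr].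
by have := lt_trans yr re; rewrite ltr_norml ltrBlDl ltrBrDl => /andP[/ltW-> /ltW->].
Qed.

Let kn0 n t x : kn n t x != 0 -> `|x - x0| < r.
Proof.
apply: contraNT => hx; rewrite /kn (_ : (fun y => _) = cst 0) ?Rintegral_cst ?mul0r//.
by apply/funext => y; apply/eqP; apply: contraNT hx => /Z0[].
Qed.

(** Fubini, then the substitution x = X (t, l): the inner integral [kn] vanishes unless |x - x0| <
    r, and these abscissas are covered by the arc. *)
Let intZ n t : 0 <= t -> `|t - t0| <= d ->
  \int[leb2 R]_p Z n t p = \int[leb R]_(l in `[a, b]) (kn n t (X (t, l)) * (sg' * d2 X (t, l))).
Proof.
move=> t1 t2; rewrite int2_fubini; last exact: bZ.
have arc l : a <= l <= b -> [/\ t < T l, `|Y (t, l) - y0| < e & c <= sg' * d2 X (t, l)].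
  by move=> /itv_norm; exact: (ch_arc ch).
have arcX l : a <= l <= b -> c1at X (t, l).
  by move=> /arc[h _ _]; apply: (su_X su); rewrite /pdom/= t1.
apply: (@Rintegral_substitution _ (fun l => X (t, l)) (fun l => d2 X (t, l)) (kn n t) a b sg' c).
- by rewrite ltrBlDr -addrA ltrDl addr_gt0// (ch_eta ch).
- exact: (ch_sg' ch).
- exact: (ch_c ch).
- by move=> l /arcX/c1at_diff; exact: is_derive_d2.
- move=> l /arcX/c1at_d2 h; apply: (@continuous_comp _ _ _ (fun l => (t, l)) (d2 X)) => //.
  by apply: continuous_at_pair; [exact: cvg_cst|exact: cvg_id].
- by move=> l /arc[].
- by apply: continuous_int_section; [exact: cZ|exact: bZ].
- move=> x /kn0 xr; apply: (sg_between (ch_sg' ch) (ch_right ch t1 t2) (ch_left ch t1 t2)).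
  by rewrite ltW// (lt_trans xr rd).
Qed.

Let kn_bound n t x M : 0 <= t -> `|t - t0| <= d -> (forall y, `|F t x y| <= M) ->
  (exists2 l, a <= l <= b & x = X (t, l)) -> `|kn n t x| <= M / c.
Proof.
move=> t1 t2 FM [l /itv_norm hl xE].
have c0 := ch_c ch.
have M0 : 0 <= M by exact: le_trans (FM 0).
have [kn0'|/kn0 xr] := eqVneq (kn n t x) 0.
  by rewrite kn0' normr0 divr_ge0// ltW.
have xd : `|x - x0| <= d := ltW (lt_trans xr rd).
have [Tl Yl _] := ch_arc ch t1 t2 hl.
have tl : 0 <= t < T l by rewrite t1.
have Sl : S (t, (x, Y (t, l))) = 0 by rewrite xE (su_on su tl).2.
have hbox y : y0 - e <= y <= y0 + e -> [/\ Om (t, (x, y)), {for (t, (x, y)), continuous g}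
   & c <= sg * dy S (t, (x, y))].
  by move=> /itv_norm; exact: (ch_box ch).
have cpy (h : R * (R * R) -> R) y : {for (t, (x, y)), continuous h} ->
    {for y, continuous (fun y => h (t, (x, y)))}.
  move=> hc; apply: (@continuous_comp _ _ _ (fun y => (t, (x, y))) h) => //.
  apply: continuous_at_pair; first exact: cvg_cst.
  by apply: continuous_at_pair; [exact: cvg_cst|exact: cvg_id].
have Ylt := Yl; move: Ylt; rewrite ltr_norml ltrBlDl ltrBrDl => /andP[Ya Yb].
rewrite knE; apply: (@coarea1_bound R (fun y => S (t, (x, y))) (fun y => dy S (t, (x, y)))
  (y0 - e) (y0 + e) (Y (t, l)) sg c Ya _ c0 (ch_sg ch) _ _ _ (fun y => F t x y)).
- exact: Yb.
- by move=> y /hbox[/(su_S su)/c1at_diff hO _ _]; exact: is_derive_dy.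
- by move=> y /hbox[/(su_S su)/c1at_dy hO _ _]; exact: cpy.
- by move=> y /hbox[].
- move=> y /hbox[_ hg _]; apply: cvgM; last exact: cpy.
  by apply: cpy; exact: cth.
- by [].
Qed.

Let kn_cvg t l : 0 <= t -> `|t - t0| <= d -> a <= l <= b ->
  kn n t (X (t, l)) @[n --> \oo] -->
    F t (X (t, l)) (Y (t, l)) / (sg * dy S (t, (X (t, l), Y (t, l)))).
Proof.
move=> t1 t2 /itv_norm hl; set x := X (t, l).
have c0 := ch_c ch.
have [xr|xr] := ltP `|x - x0| r; last first.
  have -> : F t x (Y (t, l)) = 0.
    by apply/eqP; apply: contraTT xr => /F0[_ h _]; rewrite -ltNge.
  rewrite mul0r (_ : (fun n => _) = cst 0); first exact: cvg_cst.
  by apply/funext => n; apply/eqP; apply: contraTT xr => /kn0; rewrite -ltNge.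
have xd : `|x - x0| <= d := ltW (lt_trans xr rd).
have [Tl Yl _] := ch_arc ch t1 t2 hl.
have tl : 0 <= t < T l by rewrite t1.
have Sl : S (t, (x, Y (t, l))) = 0 by rewrite (su_on su tl).2.
have hbox y : y0 - e <= y <= y0 + e -> [/\ Om (t, (x, y)), {for (t, (x, y)), continuous g}
   & c <= sg * dy S (t, (x, y))].
  by move=> /itv_norm; exact: (ch_box ch).
have cpy (h : R * (R * R) -> R) y : {for (t, (x, y)), continuous h} ->
    {for y, continuous (fun y => h (t, (x, y)))}.
  move=> hc; apply: (@continuous_comp _ _ _ (fun y => (t, (x, y))) h) => //.
  apply: continuous_at_pair; first exact: cvg_cst.
  by apply: continuous_at_pair; [exact: cvg_cst|exact: cvg_id].
have Ylt := Yl; move: Ylt; rewrite ltr_norml ltrBlDl ltrBrDl => /andP[Ya Yb].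
have -> : (fun n => kn n t x) = (fun n => \int[leb R]_(y in `[y0 - e, y0 + e])
   (n%:R * dstep (n%:R * S (t, (x, y))) * F t x y)) by apply/funext => n; rewrite knE.
apply: (@coarea1_cvg R (fun y => S (t, (x, y))) (fun y => dy S (t, (x, y)))
  (y0 - e) (y0 + e) (Y (t, l)) sg c Ya _ c0 (ch_sg ch) _ _ _ Sl (fun y => F t x y)).
- exact: Yb.
- by move=> y /hbox[/(su_S su)/c1at_diff hO _ _]; exact: is_derive_dy.
- by move=> y /hbox[/(su_S su)/c1at_dy hO _ _]; exact: cpy.
- by move=> y /hbox[].
- move=> y /hbox[_ hg _]; apply: cvgM; last exact: cpy.
  by apply: cpy; exact: cth.
Qed.

Let crvE t l : 0 <= t -> `|t - t0| <= d -> a <= l <= b ->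
  crv T S X Y g th t l = F t (X (t, l)) (Y (t, l)) / (sg * dy S (t, (X (t, l), Y (t, l))))
    * (sg' * d2 X (t, l)).
Proof.
move=> t1 t2 /itv_norm hl; rewrite /crv.
have [Tl Yl Xc] := ch_arc ch t1 t2 hl; rewrite Tl -/(F _ _ _).
have [->|/F0[_ xr yr]] := eqVneq (F t (X (t, l)) (Y (t, l))) 0; first by rewrite !mul0r.
have tl : 0 <= t < T l by rewrite t1.
have [_ _ Sc] := ch_box ch t1 t2 (ltW (lt_trans xr rd)) (ltW (lt_trans yr re)).
rewrite /omega (omegaE (su_tan su tl) (ch_c ch) Sc Xc (ch_sg ch) (ch_sg' ch)).
by rewrite mulrA mulrAC.
Qed.

Let crv0 t l : 0 <= t -> crv T S X Y g th t l != 0 -> `|t - t0| < r /\ a <= l <= b.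
Proof.
move=> t1; rewrite /crv; case: ifPn => [Tl|_]; last by rewrite eqxx.
rewrite mulf_eq0 negb_or => /andP[/F0[tr xr yr] _]; split => //.
have := ch_inv ch t1 (ltW (lt_trans tr rd)) Tl (ltW (lt_trans xr rd)) (ltW (lt_trans yr re)).
by rewrite ltr_norml ltrBlDl ltrBrDl => /andP[/ltW h1 /ltW h2]; rewrite /a /b h1.
Qed.

Lemma chart_coareaQ t1 t2 : 0 <= t1 -> coareaQ T S X Y t1 t2 g th.
Proof.
move=> t10.
have [M M0 FM] := F_bounded.
have c0 := ch_c ch.
have ab : a <= b by rewrite lerBlDr -addrA lerDl addr_ge0// ltW// (ch_eta ch).
have [D D0 hD] : exists2 D, 0 <= D & forall t l, 0 <= t -> `|t - t0| <= d -> a <= l <= b ->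
    `|d2 X (t, l)| <= D.
  pose B := (`[t0 - d, t0 + d]%classic `&` [set t | 0 <= t]) `*` `[a, b]%classic.
  have cB : compact B.
    apply: compact_setX; last exact: segment_compact.
    by apply: compact_closedI; [exact: segment_compact|exact: closed_ge].
  have [|D D0 hD] := @compact_bound _ _ B (d2 X) cB.
    move=> [t l] [[/= ht ht0] hl]; apply: c1at_d2; apply: (su_X su).
    move: ht hl; rewrite !in_itv/= => /itv_norm ht /itv_norm hl.
    by have [h _ _] := ch_arc ch ht0 ht hl; rewrite /pdom/= ht0.
  exists D => // t l h1 h2 h3; apply: (hD (t, l)); split; last by rewrite /= in_itv.
  by split => //; move: h2; rewrite /= in_itv/= ler_norml lerBlDl lerBrDl.
have Xsg t l : `|sg' * d2 X (t, l)| = `|d2 X (t, l)|.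
  by rewrite normrM; case: (ch_sg' ch) => ->; rewrite ?normrN normr1 mul1r.
(* M / c bounds the inner integrals uniformly in n, and D bounds the Jacobian X_l of the
   substitution. *)
pose B := M / c * D.
have B0 : 0 <= B by rewrite mulr_ge0// divr_ge0// ltW.
pose Gn n t l := if (a <= l <= b) then kn n t (X (t, l)) * (sg' * d2 X (t, l)) else 0.
have GnE n t : Gn n t = (fun l => kn n t (X (t, l)) * (sg' * d2 X (t, l))) \_ `[a, b].
  apply/funext => l; rewrite /Gn patchE; case: ifPn => h.
    by rewrite mem_set//= in_itv.
  by rewrite memNset//= in_itv/=; exact/negP.
have mGn n t : 0 <= t -> `|t - t0| <= d -> measurable_fun setT (Gn n t).
  move=> h1 h2; rewrite GnE; apply/(measurable_restrictT _ _).1 => //.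
  apply: subspace_continuous_measurable_fun => //; apply: within_segment => l hl.
  have cX : c1at X (t, l).
    move: hl => /itv_norm hl; have [h _ _] := ch_arc ch h1 h2 hl.
    by apply: (su_X su); rewrite /pdom/= h1.
  have cp : {for l, continuous (fun l => (t, l))}.
    by apply: continuous_at_pair; [exact: cvg_cst|exact: cvg_id].
  apply: cvgM.
    apply: (@continuous_comp _ _ _ (fun l => X (t, l)) (kn n t)).
      exact: (@continuous_comp _ _ _ (fun l => (t, l)) X _ cp (c1at_continuous cX)).
    by apply: continuous_int_section; [exact: cZ|exact: bZ].
  apply: cvgMr; exact: (@continuous_comp _ _ _ (fun l => (t, l)) (d2 X) _ cp (c1at_d2 cX)).
have GnB n t l : 0 <= t -> `|t - t0| <= d -> `|Gn n t l| <= B.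
  move=> h1 h2; rewrite /Gn; case: ifPn => hl; last by rewrite normr0.
  rewrite normrM Xsg ler_pM//; last exact: hD.
  by apply: kn_bound => //; [move=> y; exact: FM|exists l].
have intGn n t : 0 <= t -> `|t - t0| <= d ->
    \int[leb2 R]_p Zf S g th n t p = \int[leb R]_l Gn n t l.
  by move=> h1 h2; rewrite GnE -Rintegral_mkcond -/(Z n t) intZ.
have Gcvg t l : 0 <= t -> `|t - t0| <= d -> Gn n t l @[n --> \oo] --> crv T S X Y g th t l.
  move=> h1 h2; rewrite /Gn; have [hl|hl] := boolP (a <= l <= b).
    by rewrite crvE//; apply: cvgMl; exact: kn_cvg.
  have -> : crv T S X Y g th t l = 0.
    by apply/eqP; apply: contraNT hl => /(crv0 h1)[].
  exact: cvg_cst.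
have mcrv t : 0 <= t -> `|t - t0| <= d -> measurable_fun setT (crv T S X Y g th t).
  move=> h1 h2; apply: (@measurable_fun_cvg _ _ _ setT (fun n => Gn n t)).
    by move=> n; exact: mGn.
  by move=> l _; exact: Gcvg.
have crvB t l : 0 <= t -> `|t - t0| <= d -> `|crv T S X Y g th t l| <= B.
  move=> h1 h2; have hc : `|Gn n t l| @[n --> \oo] --> `|crv T S X Y g th t l|.
    exact: cvg_norm (Gcvg t l h1 h2).
  rewrite -(cvg_lim _ hc)//; apply: limr_le; first by apply/cvg_ex; eexists; exact: hc.
  by apply: nearW => n; exact: GnB.
have Gn0 n t l : ~ (a <= l <= b) -> Gn n t l = 0 by rewrite /Gn; case: ifP.
have crvbcs t : 0 <= t -> `|t - t0| <= d -> bcs1 (crv T S X Y g th t).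
  move=> h1 h2; split; first exact: mcrv.
  exists (B + (`|a| + `|b|)); first by rewrite !addr_ge0.
  move=> l; split; first by rewrite (le_trans (crvB _ _ h1 h2))// lerDl addr_ge0.
  move=> hl; apply/eqP; apply: contraTT hl => /(crv0 h1)[_ /segment_norm_le h].
  by rewrite -leNgt (le_trans h)// lerDr.
have trivial_Z n t p : ~ (`|t - t0| <= d) -> Zf S g th n t p = 0.
  case: p => x y h; apply/eqP; apply: contra_notT h => /Z0[h _ _].
  exact: ltW (lt_trans h rd).
have trivial_crv t l : 0 <= t -> ~ (`|t - t0| <= d) -> crv T S X Y g th t l = 0.
  move=> h1 h; apply/eqP; apply: contra_notT h => /(crv0 h1)[h _].
  exact: ltW (lt_trans h rd).
have bcs20 : bcs2 (fun=> 0 : R).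
  by apply: (@continuous_bcs2 _ _ 0 0 0) => [p|x y]; [exact: cvg_cst|rewrite eqxx].
have bcs10 : bcs1 (fun=> 0 : R).
  by apply: (@continuous_bcs1 _ _ 0 0) => [p|x]; [exact: cvg_cst|rewrite eqxx].
exists (B * (b - a)), 0%N; split=> [n t _ /andP[/(le_trans t10) h1 _]|t /andP[/(le_trans t10) h1 _]].
  have [h2|h2] := pselect (`|t - t0| <= d); last first.
    rewrite (_ : Zf S g th n t = fun=> 0); last by apply/funext => p; exact: trivial_Z.
    by split; [exact: bcs20|rewrite Rintegral_cst// mul0r normr0 mulr_ge0// subr_ge0].
  split; first exact: bZ.
  have ik : (leb R).-integrable `[a, b] (EFin \o Gn n t).
    apply: measurable_bounded_integrable => //; first exact: leb_itv_lty.
      by apply: measurable_funTS; exact: mGn.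
    exists B; split; first exact: num_real.
    by move=> z Bz l _; exact: le_trans (GnB _ _ _ h1 h2) (ltW Bz).
  rewrite intGn// (@Rintegral_segment _ _ a b); last by move=> l; exact: Gn0.
  apply: (le_trans (le_normr_Rintegral _ ik)) => //.
  apply: (@le_trans _ _ (\int[leb R]_(l in `[a, b]) B)).
    apply: le_Rintegral => //.
    - exact: integrable_norm.
    - by apply: segment_integrable => y _; exact: cvg_cst.
    - by move=> l _; exact: GnB.
  by rewrite Rintegral_cst_segment.
have [h2|h2] := pselect (`|t - t0| <= d); last first.
  have hz n : \int[leb2 R]_p Zf S g th n t p = 0.
    rewrite (_ : Zf S g th n t = fun=> 0) ?Rintegral_cst ?mul0r//.
    by apply/funext => p; exact: trivial_Z.
  rewrite (_ : (fun n => \int[leb2 R]_p Zf S g th n t p) = cst 0); last exact/funext.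
  rewrite (_ : crv T S X Y g th t = fun=> 0); last by apply/funext => p; exact: trivial_crv.
  by split; [exact: bcs10|rewrite Rintegral_cst// mul0r; exact: cvg_cst].
split; first exact: crvbcs.
rewrite (_ : (fun n => _) = (fun n => \int[leb R]_l Gn n t l)); last first.
  by apply/funext => n; exact: intGn.
apply: (@dominated_Rintegral1 _ _ _ (B + (`|a| + `|b|))).
- apply: nearW => n; split; first exact: mGn.
  move=> l; split; first by rewrite (le_trans (GnB _ _ _ h1 h2))// lerDl addr_ge0.
  move=> hl; apply: Gn0 => /segment_norm_le h; move: hl.
  by rewrite ltNge (le_trans h)// lerDr.
- exact: mcrv.
- by move=> l; exact: Gcvg.
Qed.

End chart_coarea.

Section bcs_add.
Context {R : realType}.

Lemma bcs1_add (f g : R -> R) : bcs1 f -> bcs1 g -> bcs1 (fun x => f x + g x).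
Proof.
move=> [mf [M M0 fM]] [mg [N N0 gN]]; split; first exact: measurable_funD.
exists (M + N); first exact: addr_ge0.
move=> x; split; first by rewrite (le_trans (ler_normD _ _))// lerD// ?(fM x).1 ?(gN x).1.
by move=> h; rewrite (fM x).2 ?(gN x).2 ?addr0//; apply: le_lt_trans h; rewrite ?lerDl ?lerDr.
Qed.

Lemma bcs2_add (f g : R * R -> R) : bcs2 f -> bcs2 g -> bcs2 (fun x => f x + g x).
Proof.
move=> [mf [M M0 fM]] [mg [N N0 gN]]; split; first exact: measurable_funD.
exists (M + N); first exact: addr_ge0.
move=> x; split; first by rewrite (le_trans (ler_normD _ _))// lerD// ?(fM x).1 ?(gN x).1.
by move=> [h|h]; rewrite (fM x).2 ?(gN x).2 ?addr0//; [left|left|right|right];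
  apply: le_lt_trans h; rewrite ?lerDl ?lerDr.
Qed.

Lemma int1_add (f g : R -> R) : bcs1 f -> bcs1 g ->
  \int[leb R]_x (f x + g x) = \int[leb R]_x f x + \int[leb R]_x g x.
Proof. by move=> bf bg; rewrite RintegralD//; exact: bcs1_integrable. Qed.

Lemma int2_add (f g : R * R -> R) : bcs2 f -> bcs2 g ->
  \int[leb2 R]_x (f x + g x) = \int[leb2 R]_x f x + \int[leb2 R]_x g x.
Proof. by move=> bf bg; rewrite RintegralD//; exact: bcs2_integrable. Qed.

Lemma bcs2_0 : bcs2 (fun=> 0 : R).
Proof. by apply: (@continuous_bcs2 _ _ 0 0 0) => [p|x y]; [exact: cvg_cst|rewrite eqxx]. Qed.

Lemma bcs1_0 : bcs1 (fun=> 0 : R).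
Proof. by apply: (@continuous_bcs1 _ _ 0 0) => [p|x]; [exact: cvg_cst|rewrite eqxx]. Qed.

Lemma int2_0 : \int[leb2 R]_p (0 : R) = 0.
Proof. by rewrite Rintegral_cst// mul0r. Qed.

Lemma int1_0 : \int[leb R]_p (0 : R) = 0.
Proof. by rewrite Rintegral_cst// mul0r. Qed.

End bcs_add.

(** * The coarea formula on a compact set *)

Section global_coarea.
Context {R : realType}.

Lemma coareaQ_sw T (S : R * (R * R) -> R) X Y t1 t2 g th :
  coareaQ T (S \o sw3) Y X t1 t2 (g \o sw3) (th \o sw3) -> coareaQ T S X Y t1 t2 g th.
Proof.
have hdx q : dx (S \o sw3) q = dy S (sw3 q).
  Transparent dx dy.
  exact: derive_sw3.
have hdy q : dy (S \o sw3) q = dx S (sw3 q).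
  exact: derive_sw3.
Opaque dx dy.
have crvE t l : crv T (S \o sw3) Y X (g \o sw3) (th \o sw3) t l = crv T S X Y g th t l.
  rewrite /crv /omega hdx hdy distrC /=.
  by rewrite [d2 Y _ ^+ 2 + _]addrC.
have ZfE n t : Zf S g th n t =
    fun p => Zf (S \o sw3) (g \o sw3) (th \o sw3) n t (p.2, p.1).
  by apply/funext => -[x y].
move=> [C [N [h1 h2]]]; exists C, N; split.
  move=> n t Nn t12; have [b1 c1] := h1 n t Nn t12.
  by rewrite ZfE int2_swap//; split => //; exact: (bcs2_swap b1).
move=> t t12; have [b1 c1] := h2 t t12.
have crvE' : crv T (S \o sw3) Y X (g \o sw3) (th \o sw3) t = crv T S X Y g th t.
  by apply/funext => l; exact: crvE.
rewrite crvE' in b1 c1; split => //.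
apply: cvg_trans c1; apply: near_eq_cvg; exists N => // n /= Nn.
by have [b2 _] := h1 n t Nn t12; rewrite ZfE int2_swap.
Qed.

(** Where S <> 0 the integrand vanishes as soon as n |S| >= 1; this is why [coareaQ] asks for its
    bound from some N on, and why g need only be continuous near the zeros of S. At a zero a chart
    over x or over y applies. *)
Lemma coareaQ_local T Om (S : R * (R * R) -> R) X Y t1 t2 g q0 :
  surf T Om S X Y -> 0 <= t1 -> 0 <= q0.1 -> Om q0 ->
  (S q0 = 0 -> \forall q \near q0, {for q, continuous g}) ->
  exists2 r : R, 0 < r & forall th : R * (R * R) -> R, continuous th ->
    (forall q, th q != 0 -> ball q0 r q) -> coareaQ T S X Y t1 t2 g th.
Proof.
move=> su t10; case: q0 => t0 [x0 y0] /= t00 Oq hg.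
have [Sq|Sq] := eqVneq (S (t0, (x0, y0))) 0; last first.
  pose c := `|S (t0, (x0, y0))| / 2.
  have c0 : 0 < c by rewrite divr_gt0// normr_gt0.
  have : \forall q \near (t0, (x0, y0)), c < `|S q|.
    have cS : {for (t0, (x0, y0)), continuous (fun q => `|S q|)}.
      by apply: cvg_norm; exact: (c1at_continuous (su_S su Oq)).
    by apply: (cvgr_gt _ cS); apply: half_ltr; rewrite normr_gt0.
  move=> /nbhs_ballP[r /= r0 hr]; exists r => // th cth thr.
  have [N _ hN] : \forall n \near \oo, 1 <= n%:R * c.
    near=> n; rewrite -ler_pdivrMr//; near: n; exact: nbhs_infty_ger.
  have Z0 n t p : (N <= n)%N -> Zf S g th n t p = 0.
    move=> Nn; rewrite /Zf; have [->|/thr/hr cS] := eqVneq (th (t, p)) 0.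
      by rewrite mul0r mulr0.
    have h1 : 1 <= n%:R * `|S (t, p)|.
      by apply: le_trans (hN n Nn) _; apply: ler_wpM2l => //; exact: ltW.
    rewrite (_ : dstep _ = 0) ?mulr0 ?mul0r//.
    move: h1; case: (lerP 0 (S (t, p))) => hS; first by rewrite ger0_norm// => /dstep_ge1.
    by move=> _; apply: dstep_le0; rewrite mulr_ge0_le0// ltW.
  have crv0 t l : 0 <= t -> crv T S X Y g th t l = 0.
    move=> t0'; rewrite /crv; case: ifPn => // Tl.
    have tl : 0 <= t < T l by rewrite t0'.
    have [->|/thr/hr] := eqVneq (th (t, (X (t, l), Y (t, l)))) 0; first by rewrite !mul0r.
    by rewrite /= (su_on su tl).2 normr0 => /(lt_trans c0); rewrite ltxx.
  exists 0, N; split=> [n t Nn _|t /andP[/(le_trans t10) h _]].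
    rewrite (_ : Zf S g th n t = fun=> 0); last by apply/funext => p; exact: Z0.
    by rewrite int2_0 normr0; split; first exact: bcs2_0.
  rewrite (_ : crv T S X Y g th t = fun=> 0); last by apply/funext => l; exact: crv0.
  rewrite int1_0; split; first exact: bcs1_0.
  apply: cvg_near_cst; exists N => // n /= Nn.
  rewrite (_ : Zf S g th n t = fun=> 0) ?int2_0//; by apply/funext => p; exact: Z0.
have [l0 tl0 [x0E y0E]] := su_par su Oq Sq.
have base S' X' Y' Om' g' x' y' (su' : surf T Om' S' X' Y') : x' = X' (t0, l0) -> y' = Y' (t0, l0) ->
    dy S' (t0, (x', y')) != 0 -> (\forall q \near (t0, (x', y')), {for q, continuous g'}) ->
    exists2 r : R, 0 < r & forall th : R * (R * R) -> R, continuous th ->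
    (forall q, th q != 0 -> ball (t0, (x', y')) r q) -> coareaQ T S' X' Y' t1 t2 g' th.
  move=> -> -> Sy hg'.
  have [eta [d [e [c [sg [sg' [ch _]]]]]]] := chart_exists su' tl0 Sy hg' ltr01.
  pose r := Num.min d e / 2.
  have m0 : 0 < Num.min d e by rewrite lt_min (ch_d ch) (ch_e ch).
  have rm : r < Num.min d e by exact: half_ltr.
  exists r; first by rewrite divr_gt0.
  move=> th cth thr; apply: (chart_coareaQ (r := r) su' ch _ _ cth) => //.
  - by apply: lt_le_trans rm _; rewrite ge_min lexx.
  - by apply: lt_le_trans rm _; rewrite ge_min lexx orbT.
  - move=> t x y /thr[/= h1 [/= h2 h3]].
    by split; rewrite distrC.
have [Sx|Sy] := su_reg su Oq Sq; last exact: (base S X Y Om g x0 y0 su x0E y0E Sy (hg Sq)).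
have Sx' : dy (S \o sw3) (t0, (y0, x0)) != 0.
  Transparent dx dy.
  by rewrite /dy derive_sw3.
  Opaque dx dy.
have hg' : \forall q \near (t0, (y0, x0)), {for q, continuous (g \o sw3)}.
  have h : nbhs (t0, (y0, x0)) (sw3 @^-1` [set q | {for q, continuous g}]).
    by apply: (@continuous_sw3 R (t0, (y0, x0))); exact: hg.
  by apply: filterS h => q hq; apply: continuous_comp; [exact: continuous_sw3|exact: hq].
have [r r0 hr] := base _ _ _ _ _ _ _ (surf_sw su) y0E x0E Sx' hg'.
exists r => // th cth thr; apply: coareaQ_sw; apply: hr.
  by move=> q; apply: continuous_comp; [exact: continuous_sw3|exact: cth].
by move=> [t [x y]] /thr[/= h1 [/= h2 h3]].
Unshelve. all: by end_near. Qed.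

(** [coareaQ] is additive in the cut-off and only sees it on [t1, t2] x K, so [local_to_global]
    glues the local statements along this compact set. *)
Lemma coarea T Om (S : R * (R * R) -> R) X Y t1 t2 g (K : set (R * R)) :
  surf T Om S X Y -> 0 <= t1 -> compact K ->
  (forall t p, t1 <= t <= t2 -> K p -> Om (t, p)) ->
  (forall t p, t1 <= t <= t2 -> ~ K p -> g (t, p) = 0) ->
  (forall t p, t1 <= t <= t2 -> K p -> S (t, p) = 0 ->
     \forall q \near (t, p), {for q, continuous g}) ->
  coareaQ T S X Y t1 t2 g (cst 1).
Proof.
move=> su t10 cK KO gK cg.
pose C := `[t1, t2]%classic `*` K.
apply: (@local_to_global _ _ C).
- by apply: compact_setX => //; exact: segment_compact.
- move=> f f' ff' [c [N [h1 h2]]].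
  have e t p : t1 <= t <= t2 -> f (t, p) * g (t, p) = f' (t, p) * g (t, p).
    move=> ht; have [Kp|nKp] := pselect (K p); last by rewrite gK// !mulr0.
    by rewrite ff'//; split => //=; rewrite in_itv.
  have eZ n t : t1 <= t <= t2 -> Zf S g f n t = Zf S g f' n t.
    by move=> ht; apply/funext => p; rewrite /Zf e.
  have ec t : t1 <= t <= t2 -> crv T S X Y g f t = crv T S X Y g f' t.
    by move=> ht; apply/funext => l; rewrite /crv e.
  exists c, N; split=> [n t Nn ht|t ht]; first by rewrite -eZ//; exact: h1.
  rewrite -ec//; have [b1 b2] := h2 t ht; split => //.
  by rewrite (_ : (fun n => _) = fun n => \int[leb2 R]_p Zf S g f n t p)//; apply/funext => n; rewrite eZ.
- have e n t : Zf S g (cst 0) n t = fun=> 0.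
    by apply/funext => p; rewrite /Zf /= mul0r mulr0.
  have e' t : crv T S X Y g (cst 0) t = fun=> 0.
    by apply/funext => l; rewrite /crv /= !mul0r; case: ifP.
  exists 0, 0%N; split=> [n t _ _|t _].
    by rewrite e int2_0 normr0; split; first exact: bcs2_0.
  rewrite e' int1_0; split; first exact: bcs1_0.
  by rewrite (_ : (fun n => _) = cst 0); [exact: cvg_cst|apply/funext => n; rewrite e int2_0].
- move=> f f' _ _ [c [N [h1 h2]]] [c' [N' [h1' h2']]].
  have e n t : Zf S g (fun q => f q + f' q) n t = fun p => Zf S g f n t p + Zf S g f' n t p.
    by apply/funext => p; rewrite /Zf mulrDl mulrDr.
  have e' t : crv T S X Y g (fun q => f q + f' q) t =
      fun l => crv T S X Y g f t l + crv T S X Y g f' t l.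
    by apply/funext => p; rewrite /crv; case: ifP => _; rewrite ?addr0// !mulrDl.
  exists (c + c'), (maxn N N'); split=> [n t|t ht].
    rewrite geq_max => /andP[Nn Nn'] ht; have [b1 b2] := h1 n t Nn ht.
    have [b1' b2'] := h1' n t Nn' ht; rewrite e int2_add//; split; first exact: bcs2_add.
    by rewrite (le_trans (ler_normD _ _))// lerD.
  have [b1 b2] := h2 t ht; have [b1' b2'] := h2' t ht.
  rewrite e' int1_add//; split; first exact: bcs1_add.
  apply: cvg_trans (cvgD b2 b2'); apply: near_eq_cvg; exists (maxn N N') => // n /=.
  rewrite geq_max => /andP[Nn Nn']; rewrite e int2_add//.
    by have [] := h1 n t Nn ht.
  by have [] := h1' n t Nn' ht.
- move=> [t p] [/= ht Kp]; rewrite in_itv/= in ht.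
  apply: (coareaQ_local t2 su t10); first by rewrite /= (le_trans t10)//; case/andP: ht.
    exact: KO.
  exact: cg.
Qed.

End global_coarea.

Opaque d1 d2 dt dx dy.

(** * Balance laws on a side and along the curve *)

Section parameter_integrals.
Context {R : realType}.

(** Sequential continuity is the form in which dominated convergence yields the continuity of
    integrals in a parameter. *)
Lemma continuous_seq (V : normedModType R) (f : V -> R) (p : V) :
  (forall u : nat -> V, u n @[n --> \oo] --> p -> f (u n) @[n --> \oo] --> f p) ->
  {for p, continuous f}.
Proof.
move=> h; apply/cvgrPdist_lt => e e0; apply: contrapT => hn.
have hu (n : nat) : exists v, ball p n.+1%:R^-1 v /\ e <= `|f p - f v|.
  apply: contrapT => hv; apply: hn; apply/nbhs_ballP; exists n.+1%:R^-1 => //=.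
  by move=> v pv; rewrite ltNge; apply/negP => ev; apply: hv; exists v.
have [u hu'] := choice hu.
have up : u n @[n --> \oo] --> p.
  apply/cvg_ballP => r r0; near=> n; have [+ _] := hu' n.
  apply: le_ball; apply: ltW; near: n; exact: near_infty_natSinv_lt (PosNum r0).
have /cvgrPdist_lt/(_ e e0)[N _ hN] := h u up.
by have := hN N (leqnn N); rewrite /= ltNge; have [_ ->] := hu' N.
Unshelve. all: by end_near. Qed.

(** The set D is where h is under control, such as one closed side of the shock; elsewhere h may be
    wild. Local bounds on D are patched along C. *)
Lemma compact_local_bound (V : topologicalType) (C D : set V) (h : V -> R) : compact C ->
  (forall q, C q -> exists M, \forall q' \near q, D q' -> `|h q'| <= M) ->
  exists2 M : R, 0 <= M & forall q, C q -> D q -> `|h q| <= M.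
Proof.
move=> /compact_near_coveringP cC hC.
have : \forall M \near +oo, C `<=` [set q | D q -> `|h q| <= M].
  apply: cC => q /hC[M hM]; exists ([set q' | D q' -> `|h q'| <= M], [set M' | M <= M']).
    by split => //; exact: (nbhs_pinfty_ge (num_real M)).
  by move=> [q' M'] [/= h1 h2] /h1 /le_trans; apply.
move=> [M [_ hM]]; exists (`|M| + 1); first by rewrite addr_ge0.
by apply: hM; rewrite (le_lt_trans (ler_norm M))// ltrDl.
Qed.

Lemma continuous_int_param (V : normedModType R) (Phi : V * R -> R) (M : R) :
  continuous Phi -> (forall v y, Phi (v, y) != 0 -> `|y| <= M) ->
  continuous (fun v => \int[leb R]_y Phi (v, y)).
Proof.
move=> cP PM v0; apply: continuous_seq => u uv0.
have cPv v : continuous (fun y => Phi (v, y)).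
  move=> y; apply: (@continuous_comp _ _ _ (fun y => (v, y)) Phi); last exact: cP.
  by apply: continuous_at_pair; [exact: cvg_cst|exact: cvg_id].
have [B B0 hB] := @compact_bound R _ `[- M, M]%classic (fun y => Phi (v0, y))
  (@segment_compact _ _ _) (fun y _ => cPv v0 y).
(* Compactness of [- M, M] makes the bound uniform in y for all v near v0. *)
have nB : \forall v \near v0, `[- M, M]%classic `<=` [set y | `|Phi (v, y)| <= B + 1].
  have /compact_near_coveringP cM := @segment_compact R (- M) M.
  apply: cM => y yM.
  have cn : {for (v0, y), continuous (fun q => `|Phi q|)} by apply: cvg_norm; exact: cP.
  have : \forall q \near (v0, y), `|Phi q| < B + 1.
    by apply: (cvgr_lt _ cn); rewrite (le_lt_trans (hB _ yM))// ltrDl.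
  move=> [[/= A1 A2] [h1 h2] h12]; exists (A2, A1) => // -[y' v'] [/= h3 h4].
  exact/ltW/(h12 (v', y')).
apply: (@dominated_Rintegral1 _ _ _ (B + 1 + `|M|)).
- have : \forall n \near \oo, `[- M, M]%classic `<=` [set y | `|Phi (u n, y)| <= B + 1] by exact: uv0 _ nB.
  apply: filterS => n /= hn; split.
    exact: continuous_measurable_fun.
  move=> y; split; last first.
    move=> hy; apply/eqP; apply: contraTT hy => /PM yM.
    by rewrite -leNgt (le_trans yM)// (le_trans (ler_norm M))// lerDr addr_ge0.
  have [->|/PM yM] := eqVneq (Phi (u n, y)) 0; first by rewrite normr0 !addr_ge0.
  by rewrite (le_trans (hn y _)) ?lerDl//= in_itv/= -ler_norml.
- exact: continuous_measurable_fun.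
- move=> y; have h : (fun n => (u n, y)) @ \oo --> ((v0, y) : V * R).
    exact: (cvg_pair uv0 (cvg_cst y)).
  exact: cvg_comp h (cP _).
Qed.

Lemma continuous_int2_param (V : normedModType R) (Phi : V * (R * R) -> R) (M : R) :
  continuous Phi -> (forall v x y, Phi (v, (x, y)) != 0 -> `|x| <= M /\ `|y| <= M) ->
  continuous (fun v => \int[leb2 R]_p Phi (v, p)).
Proof.
move=> cP PM.
have cv v : continuous (fun p => Phi (v, p)).
  move=> y; apply: (@continuous_comp _ _ _ (fun y => (v, y)) Phi); last exact: cP.
  by apply: continuous_at_pair; [exact: cvg_cst|exact: cvg_id].
have bv v : bcs2 (fun p => Phi (v, p)).
  by apply: (@continuous_bcs2 _ _ 0 0 M) => // x y /PM; rewrite !subr0.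
have -> : (fun v => \int[leb2 R]_p Phi (v, p)) =
    (fun v => \int[leb R]_x \int[leb R]_y Phi (v, (x, y))).
  by apply/funext => v; rewrite int2_fubini.
pose h (q : V * R) := \int[leb R]_y Phi (q.1, (q.2, y)).
have ch : continuous h.
  apply: (@continuous_int_param (V * R)%type (fun w => Phi (w.1.1, (w.1.2, w.2))) M).
    move=> [[v x] y]; apply: (@continuous_comp _ _ _
      (fun w : V * R * R => (w.1.1, (w.1.2, w.2))) Phi); last exact: cP.
    have c1 : {for (v, x, y), continuous (fun w : V * R * R => w.1)} by exact: continuous_at_fst.
    apply: continuous_at_pair.
      by apply: (continuous_comp c1); exact: continuous_at_fst.
    apply: continuous_at_pair; last exact: continuous_at_snd.
    by apply: (continuous_comp c1); exact: continuous_at_snd.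
  by move=> [v x] y /= /PM[].
apply: (@continuous_int_param V h M) => // v x.
apply: contraNT => hx; rewrite /h (_ : (fun y => _) = fun=> 0) ?int1_0//.
by apply/funext => y; apply/eqP; apply: contraNT hx => /PM[].
Qed.

Lemma int_swap (h : R * R -> R) (t1 t2 M : R) : continuous h ->
  (forall t x, h (t, x) != 0 -> `|x| <= M) ->
  \int[leb R]_x \int[leb R]_(t in `[t1, t2]) h (t, x) =
  \int[leb R]_(t in `[t1, t2]) \int[leb R]_x h (t, x).
Proof.
move=> chh hM.
(* Extension by 0 outside [t1, t2] turns the iterated integrals into integrals over the plane. *)
pose G (p : R * R) := if t1 <= p.2 <= t2 then h (p.2, p.1) else 0.
have [B B0 hB] := @compact_bound R _ (`[t1, t2]%classic `*` `[- M, M]%classic) h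
  (compact_setX (@segment_compact _ _ _) (@segment_compact _ _ _)) (fun q _ => chh q).
have bG : bcs2 G.
  split.
    have mG : measurable_fun setT ((fun p : mplane R => h (p.2, p.1)) \_
        (setT `*` `[t1, t2]%classic)).
      apply/(measurable_restrictT _ _).1; first by apply: measurableX.
      apply: measurable_funTS; apply: continuous_measurable_plane => p.
      by apply: (@continuous_comp _ _ _ sw h); [exact: continuous_sw|exact: chh].
    move: mG; congr (measurable_fun _ _); apply/funext => p; rewrite patchE /G.
    case: ifPn => hp; first by case: ifPn => // /negP[]; move: hp; rewrite inE => -[_]; rewrite /= in_itv.
    by case: ifPn => // hp'; move: hp; rewrite notin_setE => -[]; split => //=; rewrite in_itv.
  exists (B + (`|t1| + `|t2|) + `|M|); first by rewrite !addr_ge0.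
  move=> [x t]; rewrite /G /=; case: ifPn => ht; last first.
    by rewrite normr0; split => //; rewrite !addr_ge0.
  have [->|hx] := eqVneq (h (t, x)) 0; first by rewrite normr0; split => //; rewrite !addr_ge0.
  have xM := hM _ _ hx; split.
    rewrite -addrA; apply: (@le_trans _ _ B); last by rewrite lerDl !addr_ge0.
    apply: (hB (t, x)).
    by split; rewrite /= in_itv//= -ler_norml.
  move=> [|] h1; exfalso; move: h1; apply/negP; rewrite -leNgt.
    by rewrite (le_trans xM)// (le_trans (ler_norm M))// lerDr !addr_ge0.
  by rewrite (le_trans (segment_norm_le ht))// (addrC B) -addrA lerDl addr_ge0.
have e1 x : \int[leb R]_(t in `[t1, t2]) h (t, x) = \int[leb R]_t G (x, t).
  rewrite Rintegral_mkcond; apply: eq_Rintegral => t _; rewrite patchE /G /=.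
  by rewrite mem_setE in_itv.
have e2 t : \int[leb R]_x G (x, t) = if t1 <= t <= t2 then \int[leb R]_x h (t, x) else 0.
  by rewrite /G/=; case: ifPn => // _; exact: int1_0.
transitivity (\int[leb R]_x \int[leb R]_t G (x, t)); first by apply: eq_Rintegral => x _.
rewrite -int2_fubini// -int2_swap// int2_fubini; last exact: bcs2_swap.
rewrite [RHS]Rintegral_mkcond; apply: eq_Rintegral => t _ /=.
by rewrite e2 patchE mem_setE in_itv.
Qed.

Lemma int_swap3 (Phi : R * (R * R) -> R) (t1 t2 M : R) : continuous Phi ->
  (forall t x y, Phi (t, (x, y)) != 0 -> `|x| <= M /\ `|y| <= M) ->
  \int[leb R]_x \int[leb R]_y \int[leb R]_(t in `[t1, t2]) Phi (t, (x, y)) =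
  \int[leb R]_(t in `[t1, t2]) \int[leb2 R]_p Phi (t, p).
Proof.
move=> cP PM.
have c1 x : continuous (fun q : R * R => Phi (q.1, (x, q.2))).
  move=> [t y]; apply: (@continuous_comp _ _ _ (fun q : R * R => (q.1, (x, q.2))) Phi); last exact: cP.
  apply: continuous_at_pair; first exact: continuous_at_fst.
  by apply: continuous_at_pair; [exact: cvg_cst|exact: continuous_at_snd].
transitivity (\int[leb R]_x \int[leb R]_(t in `[t1, t2]) \int[leb R]_y Phi (t, (x, y))).
  apply: eq_Rintegral => x _; apply: (@int_swap (fun q => Phi (q.1, (x, q.2))) t1 t2 M (c1 x)).
  by move=> t y /= /PM[].
pose h (q : R * R) := \int[leb R]_y Phi (q.1, (q.2, y)).
have ch : continuous h.
  apply: (@continuous_int_param (R * R)%type (fun w => Phi (w.1.1, (w.1.2, w.2))) M).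
    move=> [[v x] y]; apply: (@continuous_comp _ _ _
      (fun w : R * R * R => (w.1.1, (w.1.2, w.2))) Phi); last exact: cP.
    have c2 : {for (v, x, y), continuous (fun w : R * R * R => w.1)} by exact: continuous_at_fst.
    apply: continuous_at_pair.
      by apply: (continuous_comp c2); exact: continuous_at_fst.
    apply: continuous_at_pair; last exact: continuous_at_snd.
    by apply: (continuous_comp c2); exact: continuous_at_snd.
  by move=> [v x] y /= /PM[].
rewrite (@int_swap h t1 t2 M)//; last first.
  move=> t x; apply: contraNT => hx; rewrite /h (_ : (fun y => _) = fun=> 0) ?int1_0//.
  by apply/funext => y; apply/eqP; apply: contraNT hx => /PM[].
apply: eq_Rintegral => t _; rewrite int2_fubini//.
apply: (@continuous_bcs2 _ _ 0 0 M) => [p|x y /PM]; last by rewrite !subr0.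
apply: (@continuous_comp _ _ _ (fun y => (t, y)) Phi); last exact: cP.
by apply: continuous_at_pair; [exact: cvg_cst|exact: cvg_id].
Qed.

End parameter_integrals.

(** * Regularity of cut-off products *)

Section cutoff.
Context {R : realType}.

(* Continuity of [F * (k \o s) * C] although [s] and [C] may be garbage away from
   [{F != 0, s >= 0}], which is where the three factors are under control. *)
Lemma cutoff_continuous (V : topologicalType) (F s C : V -> R) (k : R -> R) (q : V) :
  (forall z, z <= 0 -> k z = 0) -> continuous k -> {for q, continuous F} ->
  [\/ \forall q' \near q, F q' = 0, \forall q' \near q, s q' < 0 |
      {for q, continuous s} /\ {for q, continuous C}] ->
  {for q, continuous (fun q => F q * (k (s q) * C q))}.
Proof.
move=> k0 ck cF [F0|s0|[cs cC]].
- apply: (@continuous_at_near_eq _ _ (cst 0)); last exact: cvg_cst.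
  by apply: filterS F0 => q' ->; rewrite mul0r.
- apply: (@continuous_at_near_eq _ _ (cst 0)); last exact: cvg_cst.
  by apply: filterS s0 => q' /ltW/k0 ->; rewrite mul0r mulr0.
- apply: cvgM; first exact: cF.
  apply: cvgM; last exact: cC.
  by apply: (@continuous_comp _ _ _ s k); [exact: cs|exact: ck].
Qed.

Lemma is_derive_near0 (f : R -> R) (u d : R) :
  (\forall z \near u, f z = 0) -> is_derive u 1 f d -> d = 0.
Proof.
move=> f0 [_ <-]; have h : is_derive u 1 f 0.
  apply: (@near_eq_is_derive R R R (cst 0)).
  by apply: filterS f0 => z ->.
by have [] := h.
Qed.

(** The product rule under the same three alternatives. Where s < 0 both [step] and [dstep] vanish,
    so the formula is right whatever s' and C' are; where F vanishes locally, so does F'. *)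
Lemma cutoff_derive (F s C : R -> R) (u F' s' C' : R) (n : nat) :
  is_derive u 1 F F' ->
  [\/ \forall z \near u, F z = 0, \forall z \near u, s z < 0 |
      is_derive u 1 s s' /\ is_derive u 1 C C'] ->
  is_derive u 1 (fun u => F u * (step (n%:R * s u) * C u))
    (F' * (step (n%:R * s u) * C u) +
     F u * (n%:R * dstep (n%:R * s u) * s' * C u + step (n%:R * s u) * C')).
Proof.
move=> dF [F0|s0|[ds dC]].
- rewrite (is_derive_near0 F0 dF) (nbhs_singleton F0) !mul0r addr0.
  apply: (@near_eq_is_derive R R R (cst 0)).
  by apply: filterS F0 => z ->; rewrite mul0r.
- have ns z : s z < 0 -> n%:R * s z <= 0 by move=> /ltW; exact: mulr_ge0_le0.
  have su := ns _ (nbhs_singleton s0).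
  rewrite (step_le0 su) (dstep_le0 su) !(mulr0, mul0r, addr0).
  apply: (@near_eq_is_derive R R R (cst 0)).
  by apply: filterS s0 => z /ns/step_le0 ->; rewrite mul0r mulr0.
- have h : is_derive u 1 (fun u => n%:R * s u) (n%:R * s') by exact: is_deriveZ.
  have h1 := @is_derive1_comp R step (fun y => n%:R * s y) u _ _ (is_derive_step _) h.
  have h2 := is_deriveM dF (is_deriveM h1 dC).
  apply: (@is_derive_eq _ _ _ _ _ _ _ _ h2).
  change (F u * (step (n%:R * s u) * C' + C u * (dstep (n%:R * s u) * (n%:R * s'))) +
    (step (n%:R * s u) * C u) * F' = F' * (step (n%:R * s u) * C u) +
    F u * (n%:R * dstep (n%:R * s u) * s' * C u + step (n%:R * s u) * C')).
  by ring.
Qed.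

End cutoff.

Section divergence.
Context {R : realType}.

Lemma int_derive1_0 (G G' : R * R -> R) (M : R) : continuous G' ->
  (forall x y : R, is_derive x 1 (fun x => G (x, y)) (G' (x, y))) ->
  (forall x y, M < `|x| -> G (x, y) = 0) ->
  (forall x y, G' (x, y) != 0 -> `|x| <= M /\ `|y| <= M) ->
  \int[leb2 R]_p G' p = 0.
Proof.
move=> cG dG G0 G'M.
have bG : bcs2 G' by apply: (@continuous_bcs2 _ _ 0 0 M) => // x y /G'M; rewrite !subr0.
rewrite -int2_swap// int2_fubini; last exact: bcs2_swap.
rewrite -[RHS](@int1_0 R); apply: eq_Rintegral => y _ /=.
(* A bound strictly beyond M, so that G vanishes at both ends of the segment. *)
pose N := `|M| + 1.
have NM : M < `|N|.
  by rewrite ger0_norm ?addr_ge0// (le_lt_trans (ler_norm M))// ltrDl.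
rewrite (@Rintegral_segment _ _ (- N) N); last first.
  move=> x hx; apply/eqP; apply: contra_notT hx => /G'M[xM _].
  have h : `|x| <= N by rewrite (le_trans xM)// (le_trans (ler_norm M))// lerDl.
  by move: h; rewrite ler_norml.
rewrite (@Rintegral_FTC2 _ _ (fun x => G (x, y))).
- by rewrite !G0 ?subrr// normrN.
- by rewrite lerNl (le_trans (_ : - N <= 0)) ?oppr_le0 ?addr_ge0.
- move=> x _; apply: (@continuous_comp _ _ _ (fun x => (x, y)) G'); last exact: cG.
  by apply: continuous_at_pair; [exact: cvg_id|exact: cvg_cst].
Qed.

Lemma int_derive2_0 (G G' : R * R -> R) (M : R) : continuous G' ->
  (forall x y : R, is_derive y 1 (fun y => G (x, y)) (G' (x, y))) ->
  (forall x y, M < `|y| -> G (x, y) = 0) ->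
  (forall x y, G' (x, y) != 0 -> `|x| <= M /\ `|y| <= M) ->
  \int[leb2 R]_p G' p = 0.
Proof.
move=> cG dG G0 G'M.
have bG : bcs2 G' by apply: (@continuous_bcs2 _ _ 0 0 M) => // x y /G'M; rewrite !subr0.
rewrite -int2_swap//; apply: (@int_derive1_0 (G \o sw) (fun p => G' (p.2, p.1)) M).
- by move=> p; apply: (@continuous_comp _ _ _ sw G'); [exact: continuous_sw|exact: cG].
- by move=> x y; exact: dG.
- by move=> x y xM; exact: G0.
- by move=> x y /G'M[].
Qed.

End divergence.

(** The projection onto [t1, t2]. Data controlled for these times only become functions continuous
    on the whole line by composition with it. *)
Definition clampr {R : realType} (t1 t2 t : R) : R := Num.max t1 (Num.min t2 t).

Section clampr.
Context {R : realType}.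
Implicit Types t : R.

Lemma clampr_in t1 t2 t : t1 <= t2 -> t1 <= clampr t1 t2 t <= t2.
Proof. by move=> t12; rewrite /clampr le_max lexx/= ge_max ge_min lexx t12. Qed.

Lemma clampr_id t1 t2 t : t1 <= t <= t2 -> clampr t1 t2 t = t.
Proof. by move=> /andP[h1 h2]; rewrite /clampr (min_idPr h2) (max_idPr h1). Qed.

Lemma continuous_clampr t1 t2 : continuous (clampr t1 t2).
Proof.
move=> t; apply: (@continuous_max _ _ (cst t1) (fun t => Num.min t2 t)); first exact: cvg_cst.
by apply: (@continuous_min _ _ (cst t2) id); [exact: cvg_cst|exact: cvg_id].
Qed.

End clampr.

(** * The transport equation tested against f step (n s) *)

Section key.
Context {R : realType}.
Variables (T : R -> R) (Om : set (R * (R * R))) (s : R * (R * R) -> R) (X Y : R * R -> R).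
Hypothesis su : surf T Om s X Y.
Variables (t1 t2 : R) (f : R * R -> R).
Hypothesis (t10 : 0 < t1) (t12 : t1 < t2) (Cf : Cc1 f).
Hypothesis fOm : forall t p, t1 <= t <= t2 -> supp f p -> Om (t, p).

Let cK : compact (supp f). Proof. exact: Cf.2. Qed.

Let f_out p : ~ supp f p -> \forall p' \near p, f p' = 0.
Proof.
move=> np; have oU : open (~` supp f) by rewrite openC; exact: closed_closure.
have : nbhs p (~` supp f) by apply: open_nbhs_nbhs.
apply: filterS => p' np'; apply/eqP; apply: contra_notT np' => fp'.
exact: subset_closure.
Qed.

Let f0 p : ~ supp f p -> f p = 0.
Proof. by move=> /f_out/nbhs_singleton. Qed.

Let cf p : c1at f p. Proof. exact: (C1_c1at Cf.1). Qed.

(** The alternatives of [cutoff_continuous] and [cutoff_derive]: in the first two the product is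
    locally 0, in the third the fields are C^1. *)
Let tri q : t1 <= q.1 <= t2 ->
  [\/ \forall q' \near q, ~ supp f q'.2,
      (\forall q' \near q, s q' < 0) | [/\ Om q, 0 <= s q & supp f q.2]].
Proof.
case: q => t p /= ht; have [fp|nfp] := pselect (supp f p); last first.
  have nf : nbhs p (~` supp f).
    by apply: open_nbhs_nbhs; split => //; rewrite openC; exact: closed_closure.
  have h : nbhs (t, p) ((snd : R * (R * R) -> R * R) @^-1` (~` supp f)).
    exact: (@continuous_at_snd R (R * R)%type (t, p)).
  by apply: Or31; apply: filterS h.
have Oq := fOm ht fp; have [sq|sq] := leP 0 (s (t, p)); first by apply: Or33.
by apply: Or32; apply: (cvgr_lt _ (c1at_continuous (su_S su Oq))).
Qed.

Let strip_cont (F : R * R -> R) (k : R -> R) (C : R * (R * R) -> R) q :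
  continuous F -> (forall p, ~ supp f p -> F p = 0) ->
  (forall z, z <= 0 -> k z = 0) -> continuous k ->
  (forall q, Om q -> 0 <= s q -> {for q, continuous C}) ->
  t1 <= q.1 <= t2 -> {for q, continuous (fun q => F q.2 * (k (s q) * C q))}.
Proof.
move=> cF F0 k0 ck cC hq; apply: (@cutoff_continuous R _ (fun q => F q.2)) => //.
  by apply: (@continuous_comp _ _ _ snd F); [exact: continuous_at_snd|exact: cF].
have [h|h|[h1 h2 h3]] := tri hq.
- by apply: Or31; apply: filterS h => q' /F0.
- exact: Or32.
- by apply: Or33; split; [exact: c1at_continuous (su_S su h1)|exact: cC].
Qed.

Let M_ex : exists2 M, 0 <= M & forall x y, supp f (x, y) -> `|x| <= M /\ `|y| <= M.
Proof.
have [M1 M10 h1] := compact_bound cK (fun q _ => @continuous_at_fst R R q).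
have [M2 M20 h2] := compact_bound cK (fun q _ => @continuous_at_snd R R q).
exists (M1 + M2) => [|x y fxy]; first exact: addr_ge0.
split; [apply: le_trans (h1 _ fxy) _|apply: le_trans (h2 _ fxy) _];
  by rewrite ?lerDl ?lerDr.
Qed.

Let d1f0 p : ~ supp f p -> d1 f p = 0.
Proof.
case: p => x y np; apply: (is_derive_near0 _ (is_derive_d1 (c1at_diff (cf (x, y))))).
have c : {for x, continuous (fun x => (x, y))}.
  by apply: continuous_at_pair; [exact: cvg_id|exact: cvg_cst].
exact: c (f_out np).
Qed.

Let d2f0 p : ~ supp f p -> d2 f p = 0.
Proof.
case: p => x y np; apply: (is_derive_near0 _ (is_derive_d2 (c1at_diff (cf (x, y))))).
have c : {for y, continuous (fun y => (x, y))}.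
  by apply: continuous_at_pair; [exact: cvg_cst|exact: cvg_id].
exact: c (f_out np).
Qed.

Let Psi n (c : R * (R * R) -> R) q := f q.2 * (step (n%:R * s q) * c q).

(** The term in which the derivative falls on the cut-off; D is a partial derivative of s. *)
Definition jump n (c D : R * (R * R) -> R) q :=
  n%:R * dstep (n%:R * s q) * D q * c q.

Let dtPsi n c q := f q.2 * (jump n c (dt s) q + step (n%:R * s q) * dt c q).
Let dxPsi n c q := d1 f q.2 * (step (n%:R * s q) * c q) +
  f q.2 * (jump n c (dx s) q + step (n%:R * s q) * dx c q).
Let dyPsi n c q := d2 f q.2 * (step (n%:R * s q) * c q) +
  f q.2 * (jump n c (dy s) q + step (n%:R * s q) * dy c q).

Let good c := forall q, Om q -> 0 <= s q -> c1at c q.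

Let tri_path (g : R -> R * (R * R)) u : {for u, continuous g} -> t1 <= (g u).1 <= t2 ->
  [\/ \forall z \near u, ~ supp f (g z).2,
      (\forall z \near u, s (g z) < 0) | [/\ Om (g u), 0 <= s (g u) & supp f (g u).2]].
Proof.
move=> cg /tri[h|h|h]; [apply: Or31|apply: Or32|exact: Or33]; exact: cg _ h.
Qed.

Let Psi_dt n c (t : R) p : good c -> t1 <= t <= t2 ->
  is_derive t 1 (fun t => Psi n c (t, p)) (dtPsi n c (t, p)).
Proof.
move=> gc ht.
have cg : {for t, continuous (fun t => (t, p))}.
  by apply: continuous_at_pair; [exact: cvg_id|exact: cvg_cst].
have h := @cutoff_derive R (cst (f p)) (fun t => s (t, p)) (fun t => c (t, p)) t 0
  (dt s (t, p)) (dt c (t, p)) n (is_derive_cst _ _ _).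
apply: (is_derive_eq (h _)); last by rewrite mul0r add0r.
have [h1|h1|[h1 h2 h3]] := tri_path cg ht.
- by apply: Or31; apply: filterS h1 => z /f0.
- exact: Or32.
- apply: Or33; split; apply: is_derive_dt; apply: c1at_diff; [exact: (su_S su)|exact: gc].
Qed.

Let Psi_dx n c (t x y : R) : good c -> t1 <= t <= t2 ->
  is_derive x 1 (fun x => Psi n c (t, (x, y))) (dxPsi n c (t, (x, y))).
Proof.
move=> gc ht.
have cg : {for x, continuous (fun x => (t, (x, y)))}.
  apply: continuous_at_pair; first exact: cvg_cst.
  by apply: continuous_at_pair; [exact: cvg_id|exact: cvg_cst].
have df := is_derive_d1 (c1at_diff (cf (x, y))).
apply: (@cutoff_derive R (fun x => f (x, y)) (fun x => s (t, (x, y)))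
  (fun x => c (t, (x, y))) x _ (dx s (t, (x, y))) (dx c (t, (x, y))) n df).
have [h1|h1|[h1 h2 h3]] := tri_path cg ht.
- by apply: Or31; apply: filterS h1 => z /f0.
- exact: Or32.
- apply: Or33; split; apply: is_derive_dx; apply: c1at_diff; [exact: (su_S su)|exact: gc].
Qed.

Let Psi_dy n c (t x y : R) : good c -> t1 <= t <= t2 ->
  is_derive y 1 (fun y => Psi n c (t, (x, y))) (dyPsi n c (t, (x, y))).
Proof.
move=> gc ht.
have cg : {for y, continuous (fun y => (t, (x, y)))}.
  apply: continuous_at_pair; first exact: cvg_cst.
  by apply: continuous_at_pair; [exact: cvg_cst|exact: cvg_id].
have df := is_derive_d2 (c1at_diff (cf (x, y))).
apply: (@cutoff_derive R (fun y => f (x, y)) (fun y => s (t, (x, y)))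
  (fun y => c (t, (x, y))) y _ (dy s (t, (x, y))) (dy c (t, (x, y))) n df).
have [h1|h1|[h1 h2 h3]] := tri_path cg ht.
- by apply: Or31; apply: filterS h1 => z /f0.
- exact: Or32.
- apply: Or33; split; apply: is_derive_dy; apply: c1at_diff; [exact: (su_S su)|exact: gc].
Qed.

Let cstep n : continuous (fun z : R => step (n%:R * z)).
Proof.
move=> z; apply: (@continuous_comp _ _ _ (fun z : R => n%:R * z) step); last exact: continuous_step.
by apply: cvgMr; exact: cvg_id.
Qed.

Let cdstep n : continuous (fun z : R => n%:R * dstep (n%:R * z)).
Proof.
move=> z; apply: cvgMr.
apply: (@continuous_comp _ _ _ (fun z : R => n%:R * z) dstep); last exact: continuous_dstep.
by apply: cvgMr; exact: cvg_id.
Qed.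

Let nneg n (z : R) : z <= 0 -> n%:R * z <= 0. Proof. exact: mulr_ge0_le0. Qed.

Let ccf : continuous f. Proof. by move=> p; exact: c1at_continuous. Qed.

Let step_cont n (F : R * R -> R) C q : continuous F -> (forall p, ~ supp f p -> F p = 0) ->
  (forall q, Om q -> 0 <= s q -> {for q, continuous C}) -> t1 <= q.1 <= t2 ->
  {for q, continuous (fun q => F q.2 * (step (n%:R * s q) * C q))}.
Proof.
move=> cF F0 cC ht; apply: (@strip_cont F (fun z => step (n%:R * z)) C q) => //.
by move=> z /(nneg n)/step_le0.
Qed.

Let jump_cont n c D q : good c -> (forall q, Om q -> {for q, continuous D}) -> t1 <= q.1 <= t2 ->
  {for q, continuous (fun q => f q.2 * jump n c D q)}.
Proof.
move=> gc cD ht.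
have := @strip_cont f (fun z => n%:R * dstep (n%:R * z)) (fun q => D q * c q) q.
rewrite (_ : (fun q => f q.2 * (_ * _)) = (fun q => f q.2 * jump n c D q)); last first.
  by apply/funext => q'; rewrite /jump -!mulrA.
apply => //.
- by move=> z /(nneg n)/dstep_le0 ->; rewrite mulr0.
- by move=> q' h1 h2; apply: cvgM; [exact: cD|exact: c1at_continuous (gc _ h1 h2)].
Qed.

Let dtPsi_cont n c q : good c -> t1 <= q.1 <= t2 -> {for q, continuous (dtPsi n c)}.
Proof.
move=> gc ht; rewrite /dtPsi.
rewrite (_ : (fun q => _) = (fun q => f q.2 * jump n c (dt s) q + f q.2 * (step (n%:R * s q) * dt c q))).
  apply: cvgD.
    by apply: jump_cont => // q' h1; exact: c1at_dt (su_S su h1).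
  by apply: step_cont => // q' h1 h2; exact: c1at_dt (gc _ h1 h2).
by apply/funext => q'; rewrite mulrDr.
Qed.

Let dxPsi_cont n c q : good c -> t1 <= q.1 <= t2 -> {for q, continuous (dxPsi n c)}.
Proof.
move=> gc ht; apply: cvgD.
  apply: step_cont => //; first by move=> p; exact: c1at_d1.
  by move=> q' h1 h2; exact: c1at_continuous (gc _ h1 h2).
rewrite (_ : (fun q => _) = (fun q => f q.2 * jump n c (dx s) q + f q.2 * (step (n%:R * s q) * dx c q))).
  rewrite mulrDr; apply: cvgD.
    by apply: jump_cont => // q' h1; exact: c1at_dx (su_S su h1).
  by apply: step_cont => // q' h1 h2; exact: c1at_dx (gc _ h1 h2).
by apply/funext => q'; rewrite mulrDr.
Qed.

Let dyPsi_cont n c q : good c -> t1 <= q.1 <= t2 -> {for q, continuous (dyPsi n c)}.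
Proof.
move=> gc ht; apply: cvgD.
  apply: step_cont => //; first by move=> p; exact: c1at_d2.
  by move=> q' h1 h2; exact: c1at_continuous (gc _ h1 h2).
rewrite (_ : (fun q => _) = (fun q => f q.2 * jump n c (dy s) q + f q.2 * (step (n%:R * s q) * dy c q))).
  rewrite mulrDr; apply: cvgD.
    by apply: jump_cont => // q' h1; exact: c1at_dy (su_S su h1).
  by apply: step_cont => // q' h1 h2; exact: c1at_dy (gc _ h1 h2).
by apply/funext => q'; rewrite mulrDr.
Qed.

Variables (r U W : R * (R * R) -> R).
Hypothesis (gr : forall q, Om q -> 0 <= s q -> c1at r q).
Hypothesis (gU : forall q, Om q -> 0 <= s q -> c1at U q).
Hypothesis (gW : forall q, Om q -> 0 <= s q -> c1at W q).
Hypothesis (grU : forall q, Om q -> 0 <= s q -> c1at (r \* U) q).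
Hypothesis (grW : forall q, Om q -> 0 <= s q -> c1at (r \* W) q).
Hypothesis pde : forall q, Om q -> 0 < q.1 -> 0 < s q ->
  dt r q + dx (r \* U) q + dy (r \* W) q = 0.

(** The factor of r is the derivative of s along the trajectories, so this is the rate at which
    mass, weighted by f, crosses the level surfaces of s. *)
Definition flux_density q := f q.2 * (r q * (dt s q + U q * dx s q + W q * dy s q)).

Let A n q := step (n%:R * s q) * (r q * (d1 f q.2 * U q + d2 f q.2 * W q)).

Let Psi_identity n q : t1 <= q.1 <= t2 -> dtPsi n r q =
  A n q + Zf s flux_density (cst 1) n q.1 q.2 - dxPsi n (r \* U) q - dyPsi n (r \* W) q.
Proof.
move=> ht.
have h : f q.2 * (step (n%:R * s q) * (dt r q + dx (r \* U) q + dy (r \* W) q)) = 0.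
  have [fq|/f0->] := pselect (supp f q.2); last by rewrite mul0r.
  have [sq|sq] := leP (s q) 0; first by rewrite step_le0 ?mul0r ?mulr0// nneg.
  rewrite pde ?mulr0//; last by apply: lt_le_trans t10 _; case/andP: ht.
  by rewrite [q]surjective_pairing; apply: fOm.
rewrite /dtPsi /dxPsi /dyPsi /A /Zf /jump /flux_density -surjective_pairing /=.
move: h; move: (dx (r \* U) q) (dy (r \* W) q) (dt r q) (dt s q) (dx s q) (dy s q) (d1 f q.2) (d2 f q.2).
move: (f q.2) (step _) (dstep _) (r q) (U q) (W q) => F st ds r' U' W' a b c d e g h i hh.
apply/eqP; rewrite -subr_eq0 -hh; apply/eqP; ring.
Qed.

Let clamp := clampr t1 t2.
Let clampP t : t1 <= clamp t <= t2. Proof. exact: clampr_in (ltW t12). Qed.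
Let clamp_id t : t1 <= t <= t2 -> clamp t = t. Proof. exact: clampr_id. Qed.
Let continuous_clamp : continuous clamp. Proof. exact: continuous_clampr. Qed.

Let clamped (Phi : R * (R * R) -> R) (q : R * (R * R)) := Phi (clamp q.1, q.2).

Let clamped_cont Phi : (forall q, t1 <= q.1 <= t2 -> {for q, continuous Phi}) ->
  continuous (clamped Phi).
Proof.
move=> cP q; apply: (@continuous_comp _ _ _ (fun q : R * (R * R) => (clamp q.1, q.2)) Phi).
  apply: continuous_at_pair; last exact: continuous_at_snd.
  apply: (@continuous_comp _ _ _ fst clamp); first exact: continuous_at_fst.
  exact: continuous_clamp.
by apply: cP; exact: clampP.
Qed.

Let slice_cont (Phi : R * (R * R) -> R) t : (forall q, t1 <= q.1 <= t2 -> {for q, continuous Phi}) ->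
  t1 <= t <= t2 -> continuous (fun p => Phi (t, p)).
Proof.
move=> cP ht p; apply: (@continuous_comp _ _ _ (fun p => (t, p)) Phi); last exact: cP.
by apply: continuous_at_pair; [exact: cvg_cst|exact: cvg_id].
Qed.

Let slice_bcs (Phi : R * (R * R) -> R) t : (forall q, t1 <= q.1 <= t2 -> {for q, continuous Phi}) ->
  (forall q, ~ supp f q.2 -> Phi q = 0) ->
  t1 <= t <= t2 -> bcs2 (fun p => Phi (t, p)).
Proof.
move=> cP P0 ht; have [M M0 hM] := M_ex.
apply: (@continuous_bcs2 _ _ 0 0 M); first exact: slice_cont.
move=> x y; rewrite !subr0 => h; apply: hM; apply: contrapT => nf.
by move: h; rewrite P0// eqxx.
Qed.

Let Psi_cont n c q : good c -> t1 <= q.1 <= t2 -> {for q, continuous (Psi n c)}.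
Proof.
by move=> gc ht; apply: step_cont => // q' h1 h2; exact: c1at_continuous (gc _ h1 h2).
Qed.

Let Psi0 n c q : ~ supp f q.2 -> Psi n c q = 0.
Proof. by move=> /f0 h; rewrite /Psi h mul0r. Qed.

Let dxPsi0 n c q : ~ supp f q.2 -> dxPsi n c q = 0.
Proof. by move=> nf; rewrite /dxPsi d1f0// f0// !mul0r addr0. Qed.

Let dyPsi0 n c q : ~ supp f q.2 -> dyPsi n c q = 0.
Proof. by move=> nf; rewrite /dyPsi d2f0// f0// !mul0r addr0. Qed.

Let dtPsi0 n c q : ~ supp f q.2 -> dtPsi n c q = 0.
Proof. by move=> nf; rewrite /dtPsi f0// !mul0r. Qed.

Let ZfE n q : Zf s flux_density (cst 1) n q.1 q.2 =
  f q.2 * (n%:R * dstep (n%:R * s q) * (r q * (dt s q + U q * dx s q + W q * dy s q))).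
Proof. by rewrite /Zf /flux_density -surjective_pairing mul1r mulrCA. Qed.

Let Zf_cont n q : t1 <= q.1 <= t2 ->
  {for q, continuous (fun q => Zf s flux_density (cst 1) n q.1 q.2)}.
Proof.
move=> ht; rewrite (_ : (fun q => _) = (fun q => f q.2 * (n%:R * dstep (n%:R * s q) *
  (r q * (dt s q + U q * dx s q + W q * dy s q))))); last by apply/funext => q'; exact: ZfE.
apply: (@strip_cont f (fun z => n%:R * dstep (n%:R * z))) => //.
  by move=> z /(nneg n)/dstep_le0 ->; rewrite mulr0.
move=> q' h1 h2; apply: cvgM; first exact: c1at_continuous (gr h1 h2).
apply: cvgD; first apply: cvgD.
- exact: c1at_dt (su_S su h1).
- by apply: cvgM; [exact: c1at_continuous (gU h1 h2)|exact: c1at_dx (su_S su h1)].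
- by apply: cvgM; [exact: c1at_continuous (gW h1 h2)|exact: c1at_dy (su_S su h1)].
Qed.

Let AE n q : A n q = d1 f q.2 * (step (n%:R * s q) * (r q * U q)) +
  d2 f q.2 * (step (n%:R * s q) * (r q * W q)).
Proof.
rewrite /A; move: (d1 f q.2) (d2 f q.2) (step _) (r q) (U q) (W q) => a b c d e g; ring.
Qed.

Let A_cont n q : t1 <= q.1 <= t2 -> {for q, continuous (A n)}.
Proof.
move=> ht; rewrite (_ : A n = fun q => d1 f q.2 * (step (n%:R * s q) * (r q * U q)) +
  d2 f q.2 * (step (n%:R * s q) * (r q * W q))); last by apply/funext => q'; exact: AE.
apply: cvgD; apply: step_cont => //.
- by move=> p; exact: c1at_d1.
- by move=> q' h1 h2; apply: cvgM; [exact: c1at_continuous (gr h1 h2)|exact: c1at_continuous (gU h1 h2)].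
- by move=> p; exact: c1at_d2.
- by move=> q' h1 h2; apply: cvgM; [exact: c1at_continuous (gr h1 h2)|exact: c1at_continuous (gW h1 h2)].
Qed.

Let A0 n q : ~ supp f q.2 -> A n q = 0.
Proof. by move=> nf; rewrite AE d1f0// d2f0// !mul0r addr0. Qed.

Let Zf0 n q : ~ supp f q.2 -> Zf s flux_density (cst 1) n q.1 q.2 = 0.
Proof. by move=> nf; rewrite ZfE f0// mul0r. Qed.

Let M_box (Phi : R * (R * R) -> R) M : (forall x y, supp f (x, y) -> `|x| <= M /\ `|y| <= M) ->
  (forall q, ~ supp f q.2 -> Phi q = 0) ->
  forall t x y, Phi (t, (x, y)) != 0 -> `|x| <= M /\ `|y| <= M.
Proof.
move=> hM P0 t x y h; apply: hM; apply: contrapT => nf.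
by move: h; rewrite P0// eqxx.
Qed.

Let int_dxPsi n t : t1 <= t <= t2 -> \int[leb2 R]_p dxPsi n (r \* U) (t, p) = 0.
Proof.
move=> ht; have [M M0 hM] := M_ex.
apply: (@int_derive1_0 _ (fun p => Psi n (r \* U) (t, p)) _ M).
- exact: (@slice_cont (dxPsi n (r \* U)) _ (fun q => @dxPsi_cont n (r \* U) q grU) ht).
- by move=> x y; exact: (@Psi_dx n (r \* U) t x y grU ht).
- move=> x y xM; apply: Psi0 => /hM[h _].
  by move: xM; rewrite ltNge h.
- by move=> x y; exact: (@M_box (dxPsi n (r \* U)) M hM (@dxPsi0 n (r \* U))).
Qed.

Let int_dyPsi n t : t1 <= t <= t2 -> \int[leb2 R]_p dyPsi n (r \* W) (t, p) = 0.
Proof.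
move=> ht; have [M M0 hM] := M_ex.
apply: (@int_derive2_0 _ (fun p => Psi n (r \* W) (t, p)) _ M).
- exact: (@slice_cont (dyPsi n (r \* W)) _ (fun q => @dyPsi_cont n (r \* W) q grW) ht).
- by move=> x y; exact: (@Psi_dy n (r \* W) t x y grW ht).
- move=> x y xM; apply: Psi0 => /hM[_ h].
  by move: xM; rewrite ltNge h.
- by move=> x y; exact: (@M_box (dyPsi n (r \* W)) M hM (@dyPsi0 n (r \* W))).
Qed.

Let cancel4 (a z x y : R) : a + z = a + z - x - y + (x + y).
Proof. by ring. Qed.

Let int_dtPsi n t : t1 <= t <= t2 -> \int[leb2 R]_p dtPsi n r (t, p) =
  \int[leb2 R]_p A n (t, p) + \int[leb2 R]_p Zf s flux_density (cst 1) n t p.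
Proof.
move=> ht.
have bA : bcs2 (fun p => A n (t, p)) by exact: (@slice_bcs (A n) _ (@A_cont n) (@A0 n) ht).
have bZ : bcs2 (Zf s flux_density (cst 1) n t).
  exact: (@slice_bcs (fun q => Zf s flux_density (cst 1) n q.1 q.2) _ (@Zf_cont n) (@Zf0 n) ht).
have bx : bcs2 (fun p => dxPsi n (r \* U) (t, p)).
  exact: (@slice_bcs (dxPsi n (r \* U)) _ (fun q => @dxPsi_cont n (r \* U) q grU) (@dxPsi0 n (r \* U)) ht).
have bt : bcs2 (fun p => dtPsi n r (t, p)).
  exact: (@slice_bcs (dtPsi n r) _ (fun q => @dtPsi_cont n r q gr) (@dtPsi0 n r) ht).
have by' : bcs2 (fun p => dyPsi n (r \* W) (t, p)).
  exact: (@slice_bcs (dyPsi n (r \* W)) _ (fun q => @dyPsi_cont n (r \* W) q grW) (@dyPsi0 n (r \* W)) ht).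
have e1 : \int[leb2 R]_p (A n (t, p) + Zf s flux_density (cst 1) n t p) =
    \int[leb2 R]_p (dtPsi n r (t, p) + (dxPsi n (r \* U) (t, p) + dyPsi n (r \* W) (t, p))).
  apply: eq_Rintegral => p _; rewrite (@Psi_identity n (t, p))//; exact: (@cancel4 (A n (t, p)) (Zf s flux_density (cst 1) n t p)
    (dxPsi n (r \* U) (t, p)) (dyPsi n (r \* W) (t, p))).
rewrite -int2_add// e1 int2_add//; last exact: bcs2_add.
by rewrite int2_add// int_dxPsi// int_dyPsi// !addr0.
Qed.

(** For each (x, y) the function Psi is the integral of its time derivative over [t1, t2]; then the
    integrals in time and in the plane are exchanged. The clamp makes the integrand continuous for
    all times. *)
Let key_n n : \int[leb2 R]_p Psi n r (t2, p) - \int[leb2 R]_p Psi n r (t1, p) =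
  \int[leb R]_(t in `[t1, t2]) (\int[leb2 R]_p A n (t, p) +
     \int[leb2 R]_p Zf s flux_density (cst 1) n t p).
Proof.
have [M M0 hM] := M_ex.
have t1in : t1 <= t1 <= t2 by rewrite lexx ltW.
have t2in : t1 <= t2 <= t2 by rewrite lexx ltW.
have b1 : bcs2 (fun p => Psi n r (t1, p)).
  exact: (@slice_bcs (Psi n r) _ (fun q => @Psi_cont n r q gr) (@Psi0 n r) t1in).
have b2 : bcs2 (fun p => Psi n r (t2, p)).
  exact: (@slice_bcs (Psi n r) _ (fun q => @Psi_cont n r q gr) (@Psi0 n r) t2in).
have cD : continuous (clamped (dtPsi n r)).
  exact: (@clamped_cont (dtPsi n r) (fun q => @dtPsi_cont n r q gr)).
transitivity (\int[leb R]_(t in `[t1, t2]) \int[leb2 R]_p clamped (dtPsi n r) (t, p)); last first.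
  apply: eq_Rintegral => t; rewrite inE/= in_itv/= => ht.
  by rewrite /clamped /= clamp_id// int_dtPsi.
rewrite -(@int_swap3 _ _ t1 t2 M cD); last first.
  move=> t x y; rewrite /clamped /=; exact: (@M_box (dtPsi n r) M hM (@dtPsi0 n r)).
have b12 : bcs2 (fun p => Psi n r (t2, p) - Psi n r (t1, p)).
  have cP p : {for p, continuous (fun p => Psi n r (t2, p) - Psi n r (t1, p))}.
    by apply: cvgB; [exact: (@slice_cont (Psi n r) _ (fun q => @Psi_cont n r q gr) t2in)|
      exact: (@slice_cont (Psi n r) _ (fun q => @Psi_cont n r q gr) t1in)].
  apply: (@continuous_bcs2 _ _ 0 0 M); first exact: cP.
  move=> x y; rewrite !subr0 => h; apply: hM; apply: contrapT => nf.
  by move: h; rewrite !Psi0// subrr eqxx.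
rewrite -RintegralB//; [|exact: bcs2_integrable..].
rewrite (int2_fubini b12); apply: eq_Rintegral => x _; apply: eq_Rintegral => y _.
have h := @Rintegral_FTC2 R (fun t => dtPsi n r (t, (x, y))) (fun t => Psi n r (t, (x, y))) t1 t2
   (ltW t12).
apply: etrans (esym (h _ _)) _; last first.
- apply: eq_Rintegral => t; rewrite inE/= in_itv/= => ht.
  by rewrite /clamped /= clamp_id.
- move=> t ht; apply: (@continuous_comp _ _ _ (fun t => (t, (x, y))) (dtPsi n r)).
    by apply: continuous_at_pair; [exact: cvg_id|exact: cvg_cst].
  exact: (@dtPsi_cont n r (t, (x, y)) gr ht).
- by move=> t ht; exact: (@Psi_dt n r t (x, y) gr ht).
Qed.

Lemma cutoff_balance n :
  \int[leb2 R]_p (f p * (step (n%:R * s (t2, p)) * r (t2, p))) -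
  \int[leb2 R]_p (f p * (step (n%:R * s (t1, p)) * r (t1, p))) =
  \int[leb R]_(t in `[t1, t2])
    (\int[leb2 R]_p (step (n%:R * s (t, p)) *
       (r (t, p) * (d1 f p * U (t, p) + d2 f p * W (t, p)))) +
     \int[leb2 R]_p Zf s flux_density (cst 1) n t p).
Proof. exact: key_n. Qed.

Lemma Zf_int_continuous n :
  continuous (fun t => \int[leb2 R]_p Zf s flux_density (cst 1) n (clampr t1 t2 t) p).
Proof.
have [M M0 hM] := M_ex.
apply: (@continuous_int2_param _ _ (fun q => Zf s flux_density (cst 1) n (clampr t1 t2 q.1) q.2) M).
  exact: (@clamped_cont (fun q => Zf s flux_density (cst 1) n q.1 q.2) (@Zf_cont n)).
move=> t x y; exact: (@M_box (fun q => Zf s flux_density (cst 1) n q.1 q.2) M hM (@Zf0 n)).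
Qed.

End key.

(** * The shock curve is a Lebesgue null set *)

Section null.
Context {R : realType}.
Implicit Types E : set (R * R).

Lemma closed_zeros (V : topologicalType) (A : set V) (h : V -> R) : closed A ->
  (forall q, A q -> {for q, continuous h}) -> closed [set q | A q /\ h q = 0].
Proof.
move=> cA ch q clq; have Aq : A q by apply: cA => B /clq[z [[Az _] Bz]]; exists z.
split => //; apply: contrapT => /eqP hq0.
have : \forall q' \near q, h q' != 0.
  have := ch q Aq; rewrite /continuous_at => /cvgr_norm_gt/(_ 0).
  rewrite normr_gt0 => /(_ hq0); apply: filterS => z; by rewrite normr_gt0.
by move=> /clq[z [[_ ->]]]; rewrite eqxx.
Qed.

Lemma compact_zeros (V : topologicalType) (A : set V) (h : V -> R) : compact A -> closed A ->
  (forall q, A q -> {for q, continuous h}) -> compact [set q | A q /\ h q = 0].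
Proof.
move=> cA clA ch; apply: (subclosed_compact _ cA); first exact: closed_zeros.
by move=> q [].
Qed.

Lemma bcs2_indic E : compact E -> bcs2 (\1_E : R * R -> R).
Proof.
move=> cE; split; first exact: measurable_indic (compact_measurable_plane cE).
have [M [_ hM]] := compact_bounded cE.
exists (`|M| + 1); first by rewrite addr_ge0.
have {}hM p : E p -> `|p| <= `|M| + 1.
  by apply: hM; rewrite (le_lt_trans (ler_norm M))// ltrDl.
move=> p; split.
  by rewrite indicE (le_trans (y := 1))// ?lerDr//; case: (_ \in _); rewrite ?normr1 ?normr0.
move=> h; rewrite indicE memNset// => /hM; rewrite prod_normE ge_max => /andP[h1 h2].
by case: h; rewrite ltNge ?h1 ?h2.
Qed.

Lemma leb2_sections_null E : compact E ->
  (forall x y y', E (x, y) -> E (x, y') -> y = y') -> leb2 R E = 0%E.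
Proof.
move=> cE h; rewrite /product_measure1; apply: integral0_eq => x _ /=.
have [[y Exy]|nE] := pselect (exists y, E (x, y)).
  suff -> : xsection E x = [set y] by rewrite lebesgue_measure_set1.
  apply/seteqP; split => y'; rewrite /xsection/= ?inE; first by move=> /h; exact.
  by move=> ->.
suff -> : xsection E x = set0 by rewrite measure0.
by apply/seteqP; split => y' //; rewrite /xsection/= inE => Exy; case: nE; exists y'.
Qed.

Lemma leb2_compact_lty E : compact E -> (leb2 R E < +oo)%E.
Proof.
move=> cE; have := bcs2_integrable (bcs2_indic cE).
move=> /integrableP[_]; under eq_integral do rewrite /= ger0_norm//.
by rewrite integral_indic// ?setIT//; exact: compact_measurable_plane.
Qed.

Lemma leb2_swap_null E : compact E -> leb2 R [set p | E (p.2, p.1)] = 0%E -> leb2 R E = 0%E.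
Proof.
move=> cE E0; have mE := compact_measurable_plane cE.
have h : \int[leb2 R]_p \1_E p = 0.
  rewrite -(int2_swap (bcs2_indic cE)) /Rintegral.
  rewrite (_ : (fun p => _) = (fun p : R * R => (\1_[set p | E (p.2, p.1)] p : R)%:E)); last first.
    by apply/funext => p; rewrite !indicE; congr (_ %:E); congr (_ %:R); congr nat_of_bool; apply/idP/idP; rewrite !inE.
  have mE' : measurable ([set p | E (p.2, p.1)] : set (mplane R)).
    by rewrite -[X in measurable X]setTI; exact: (@measurable_swap _ _ (measurableTypeR R) (measurableTypeR R) measurableT _ mE).
  by apply: (etrans (congr1 fine (integral_indic _ measurableT mE'))); rewrite setIT; exact: (congr1 fine E0).
move: h; rewrite /Rintegral integral_indic// setIT => h.
by rewrite -[LHS]fineK ?h// ge0_fin_numE// leb2_compact_lty.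
Qed.

(** Inside a chart over x or over y the curve meets each parallel to one axis in at most one point,
    and compactness reduces the claim to charts. *)
Lemma surf_null T Om (S : R * (R * R) -> R) X Y t (K : set (R * R)) : surf T Om S X Y ->
  0 <= t -> compact K -> K `<=` slice Om t ->
  (leb2 R).-negligible [set p | K p /\ S (t, p) = 0].
Proof.
move=> su t0 cK KO; pose C := [set p | K p /\ S (t, p) = 0].
have clK : closed K by exact: compact_closed.
have cS p : K p -> {for p, continuous (fun p => S (t, p))}.
  move=> /KO Op; apply: (@continuous_comp _ _ _ (fun p => (t, p)) S).
    by apply: continuous_at_pair; [exact: cvg_cst|exact: cvg_id].
  exact: c1at_continuous (su_S su Op).
have cC : compact C by exact: compact_zeros.
(* [local_to_global] is used for negligibility: Q h concerns the part of the curve where h does not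
   vanish, and h = 1 gives the whole of it. *)
pose Q (h : R * R -> R) := (leb2 R).-negligible [set p | C p /\ h p != 0].
suff : Q (cst 1) by apply: negligibleS => p Cp; split => //=; exact: oner_neq0.
apply: (@local_to_global _ _ C) => //.
- by move=> f g fg; apply: negligibleS => p [Cp gp]; split; rewrite ?fg.
- rewrite /Q (_ : [set p | _] = set0); first exact: negligible_set0.
  by apply/seteqP; split => p //= -[_]; rewrite eqxx.
- move=> f g _ _ Qf Qg; apply: negligibleS (negligibleU Qf Qg) => p [Cp] fg.
  have [f0|f0] := eqVneq (f p) 0; [right|left] => //; split => //.
  by move: fg; rewrite f0 add0r.
move=> p0 [Kp Sp].
have [l0 tl pE] := su_par su (KO _ Kp) Sp.
have box_null (r d e : R) : 0 < r -> r <= d -> r <= e ->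
    leb2 R (C `&` (`[p0.1 - d, p0.1 + d]%classic `*` `[p0.2 - e, p0.2 + e]%classic)) = 0%E ->
    exists2 r : R, 0 < r & forall f : R * R -> R, continuous f ->
      (forall q, f q != 0 -> ball p0 r q) -> Q f.
  set D := _ `&` _ => r0 rd re E0; exists r => // f _ fr.
  apply: (@negligibleS _ _ _ (leb2 R) D).
    move=> p [Cp /fr[]]; rewrite /ball/= !ltr_norml => h1 h2; split => //.
    by split; rewrite /= in_itv/=; lra.
  apply/negligibleP => //; apply: compact_measurable_plane; apply: (@compact_closedI _ _ _ cC).
  by apply: compact_closed => //; apply: compact_setX; exact: segment_compact.
have cD d e : compact (C `&` (`[p0.1 - d, p0.1 + d]%classic `*` `[p0.2 - e, p0.2 + e]%classic)).
  apply: (@compact_closedI _ _ _ cC).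
  by apply: compact_closed => //; apply: compact_setX; exact: segment_compact.
have itvE (z z0 d : R) : z \in `[z0 - d, z0 + d] -> `|z - z0| <= d.
  by rewrite in_itv/= ler_norml; lra.
have tt0 (d : R) : 0 < d -> `|t - t| <= d by move=> /ltW; rewrite subrr normr0.
have [Om0 S0] := su_on su tl.
have [Sx|Sy] := su_reg su Om0 S0.
- have [|eta [d [e' [c [sg [sg' [ch _]]]]]]] :=
    @chart_exists _ _ _ _ _ _ (surf_sw su) t l0 setT 1 tl _ filterT ltr01.
    Transparent dx dy.
    by rewrite /dy derive_sw3.
    Opaque dx dy.
  have d0 := ch_d ch; have e0 := ch_e ch.
  apply: (@box_null (Num.min d e') e' d); rewrite ?lt_min ?d0 ?e0 ?ge_min ?lexx ?orbT//.
  apply: leb2_swap_null; first exact: cD.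
  apply: leb2_sections_null.
    have := @continuous_compact _ _ sw _ (continuous_subspaceT (@continuous_sw _)) (cD e' d).
    congr compact; apply/seteqP; split => p /=.
      by move=> [q Dq <-]; rewrite /sw/= -surjective_pairing.
    by move=> Dp; exists (p.2, p.1) => //; rewrite /sw/= -surjective_pairing.
  move=> x y y' [/= [_ S1] [/itvE h1 /itvE h2]] [/= [_ S2] [/itvE h3 _]].
  rewrite pE /= in h1 h2 h3; apply: (@box_inj _ _ _ _ _ _ (surf_sw su) t x y y' _ e' c sg (ch_c ch) _ h1 h3).
    by move=> z hz; have [] := ch_box ch t0 (tt0 _ d0) h2 hz.
  by rewrite /= /sw3 /= /sw /= S1 S2.
- have [eta [d [e' [c [sg [sg' [ch _]]]]]]] :=
    @chart_exists _ _ _ _ _ _ su t l0 setT 1 tl Sy filterT ltr01.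
  have d0 := ch_d ch; have e0 := ch_e ch.
  apply: (@box_null (Num.min d e') d e'); rewrite ?lt_min ?d0 ?e0 ?ge_min ?lexx ?orbT//.
  apply: leb2_sections_null; first exact: cD.
  move=> x y y' [/= [_ S1] [/itvE h1 /itvE h2]] [/= [_ S2] [_ /itvE h3]].
  rewrite pE /= in h1 h2 h3; apply: (@box_inj _ _ _ _ _ _ su t x y y' _ e' c sg (ch_c ch) _ h2 h3).
    by move=> z hz; have [] := ch_box ch t0 (tt0 _ d0) h1 hz.
  by rewrite S1 S2.
Qed.

End null.

Definition sidef {R : realType} (s F : R * (R * R) -> R) (t : R) (phi : R * R -> R) (p : R * R) : R :=
  if 0 < s (t, p) then phi p * F (t, p) else 0.

(** * Integrals over one side of the shock *)

Section sides.
Context {R : realType}.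
Variables (T : R -> R) (Om : set (R * (R * R))) (s : R * (R * R) -> R) (X Y : R * R -> R).
Hypothesis su : surf T Om s X Y.
Variables (t1 t2 : R) (K : set (R * R)).
Hypotheses (t10 : 0 <= t1) (t12 : t1 <= t2) (cK : compact K).
Hypothesis KO : forall t p, t1 <= t <= t2 -> K p -> Om (t, p).
Variable F : R * (R * R) -> R.
Hypothesis gF : forall q, Om q -> 0 <= s q -> {for q, continuous F}.

Lemma cs q : Om q -> {for q, continuous s}.
Proof. by move=> /(su_S su)/c1at_continuous. Qed.

Lemma side_bound : exists2 M : R, 0 <= M &
  forall t p, t1 <= t <= t2 -> K p -> 0 <= s (t, p) -> `|F (t, p)| <= M.
Proof.
have cC : compact (`[t1, t2]%classic `*` K) by apply: compact_setX => //; exact: segment_compact.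
have [|M M0 hM] := @compact_local_bound _ _ _ [set q | 0 <= s q] F cC.
  move=> [t p] [/=]; rewrite in_itv/= => ht Kp; have Oq := KO ht Kp.
  have [sq|sq] := leP 0 (s (t, p)).
    exists (`|F (t, p)| + 1); have := gF Oq sq; rewrite /continuous_at.
    by move=> /cvgr_norm_lt/(_ (`|F (t, p)| + 1)); rewrite ltrDl => /(_ ltr01); apply: filterS => z /ltW.
  exists 0; have := cs Oq; rewrite /continuous_at => /cvgr_lt/(_ 0 sq); apply: filterS => z /= h.
  by rewrite leNgt h.
by exists M => // t p ht Kp; apply: (hM (t, p)); split => //=; rewrite in_itv.
Qed.

Lemma slice_section (V : topologicalType) (h : R * (R * R) -> V) t p :
  {for (t, p), continuous h} -> {for p, continuous (fun p => h (t, p))}.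
Proof.
move=> ch; apply: (@continuous_comp _ _ _ (fun p => (t, p)) h); last exact: ch.
by apply: continuous_at_pair; [exact: cvg_cst|exact: cvg_id].
Qed.

Lemma time_section (V : topologicalType) (h : R * (R * R) -> V) t p :
  {for (t, p), continuous h} -> {for t, continuous (fun t => h (t, p))}.
Proof.
move=> ch; apply: (@continuous_comp _ _ _ (fun t => (t, p)) h); last exact: ch.
by apply: continuous_at_pair; [exact: cvg_id|exact: cvg_cst].
Qed.

Lemma side_measurable t : t1 <= t <= t2 ->
  measurable (K `&` [set p | 0 < s (t, p)] : set (mplane R)) /\
  measurable_fun (K `&` [set p | 0 < s (t, p)] : set (mplane R)) (fun p => F (t, p)).
Proof.
move=> ht; have mK := compact_measurable_plane cK.
have mD : measurable (K `&` [set p | 0 < s (t, p)] : set (mplane R)).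
  have : measurable_fun (K : set (mplane R)) (fun p => s (t, p)).
    apply: within_continuous_measurable_plane => //; apply: continuous_in_subspaceT => p /set_mem Kp.
    by apply: slice_section; apply: cs; exact: KO.
  move=> /(_ mK _ (measurable_itv `]0, +oo[)); congr measurable.
  by apply/seteqP; split => p [Kp]; rewrite /= in_itv/= andbT.
split => //; apply: within_continuous_measurable_plane => //.
apply: continuous_in_subspaceT => p /set_mem[Kp sp].
by apply: slice_section; apply: gF; [exact: KO|exact: ltW].
Qed.

Lemma side_bcs2 t (phi : R * R -> R) (B : R) : t1 <= t <= t2 ->
  measurable_fun setT (phi : mplane R -> R) -> (forall p, `|phi p| <= B) ->
  (forall p, ~ K p -> phi p = 0) -> bcs2 (sidef s F t phi).
Proof.
move=> ht mphi phiB phi0; have [mD mF] := side_measurable ht.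
have [M M0 hM] := side_bound.
have B0 : 0 <= B by exact: le_trans (phiB (0, 0)).
split.
  have -> : sidef s F t phi = (fun p => phi p * F (t, p)) \_ (K `&` [set p | 0 < s (t, p)]).
    apply/funext => p; rewrite /sidef patchE; case: ifPn => sp; case: ifPn => //.
      move=> /negP nK; rewrite phi0 ?mul0r// => Kp; apply: nK; rewrite inE.
      by split.
    by rewrite inE => -[_ /= h]; rewrite h in sp.
  apply: (measurable_restrictT _ mD).1; apply: measurable_funM => //.
  exact: measurable_funTS.
have [N [_ hN]] := compact_bounded cK.
have {}hN p : K p -> `|p| <= `|N| + 1.
  by apply: hN; rewrite (le_lt_trans (ler_norm N))// ltrDl.
exists (B * M + (`|N| + 1)); first by rewrite addr_ge0 ?mulr_ge0// addr_ge0.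
have h p : `|sidef s F t phi p| <= B * M.
  rewrite /sidef; case: ifPn => [sp|_]; last by rewrite normr0 mulr_ge0.
  have [Kp|Kp] := pselect (K p); last by rewrite phi0// mul0r normr0 mulr_ge0.
  by rewrite normrM ler_pM//; apply: hM => //; exact: ltW.
move=> p; split; first by rewrite (le_trans (h p))// lerDl addr_ge0.
move=> hp; rewrite /sidef; case: ifP => // _.
rewrite phi0 ?mul0r// => /hN; rewrite prod_normE ge_max => /andP[h1 h2].
have BM0 : 0 <= B * M by exact: mulr_ge0.
by case: hp; rewrite ltNge => /negP; apply; [apply: le_trans h1 _|apply: le_trans h2 _]; rewrite lerDr.
Qed.

(** At a fixed p the integrand may jump when the curve passes through p. For the limit time this
    happens only for p on the curve, a null set, so dominated convergence still applies. *)
Lemma side_continuous (phi : R * R -> R) : continuous phi -> (forall p, ~ K p -> phi p = 0) ->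
  continuous (fun t => \int[leb2 R]_p sidef s F (clampr t1 t2 t) phi p).
Proof.
move=> cphi phi0 t.
have [B B0 hB] := @compact_bound _ _ K phi cK (fun q _ => cphi q).
have {}hB p : `|phi p| <= B.
  by have [/hB//|/phi0->] := pselect (K p); rewrite normr0.
have mphi := continuous_measurable_plane cphi.
have [M M0 hM] := side_bound.
apply: continuous_seq => u ut.
have bs t' := @side_bcs2 _ phi B (clampr_in t' t12) mphi hB phi0.
apply: (@dominated_Rintegral _ _ (mplane R) (leb2 R) K _ _ (B * M)).
- exact: compact_measurable_plane.
- exact: leb2_compact_lty.
- apply: nearW => n; split; first exact: (bs _).1.
  move=> p; rewrite /sidef; split; last by move=> nK; case: ifP => // _; rewrite phi0 ?mul0r.
  case: ifPn => [sp|_]; last by rewrite normr0 mulr_ge0.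
  have [Kp|Kp] := pselect (K p); last by rewrite phi0// mul0r normr0 mulr_ge0.
  by rewrite normrM ler_pM//; apply: hM => //; [exact: clampr_in|exact: ltW].
- exact: (bs _).1.
have t00 : 0 <= clampr t1 t2 t by apply: le_trans t10 _; have /andP[] := clampr_in t t12.
have nul := @surf_null _ _ _ _ _ _ _ _ su t00 cK (fun p => @KO _ p (clampr_in t t12)).
apply: negligibleS nul => p /=; apply: contra_notP => nul.
have [Kp|Kp] := pselect (K p); last first.
  rewrite (_ : (fun n => _) = cst 0); last first.
    by apply/funext => n; rewrite /sidef phi0// mul0r if_same.
  by rewrite /sidef phi0// mul0r if_same; exact: cvg_cst.
have Oq := KO (clampr_in t t12) Kp.
have s0 : s (clampr t1 t2 t, p) != 0 by apply/eqP => h; apply: nul.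
have cut : clampr t1 t2 (u n) @[n --> \oo] --> clampr t1 t2 t.
  exact: cvg_comp ut (@continuous_clampr R t1 t2 t).
have csu : s (clampr t1 t2 (u n), p) @[n --> \oo] --> s (clampr t1 t2 t, p).
  exact: cvg_comp cut (time_section (cs Oq)).
rewrite {2}/sidef; case: ifPn => sp.
  apply: (@cvg_trans _ ((fun n => phi p * F (clampr t1 t2 (u n), p)) @ \oo)).
    have : \forall n \near \oo, phi p * F (clampr t1 t2 (u n), p) = sidef s F (clampr t1 t2 (u n)) phi p.
      have hn : \forall n \near \oo, 0 < s (clampr t1 t2 (u n), p) by exact: cvgr_gt csu _ sp.
      by apply: filterS hn => n h; rewrite /sidef h.
    exact: near_eq_cvg.
  have cF : F (clampr t1 t2 (u n), p) @[n --> \oo] --> F (clampr t1 t2 t, p).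
    exact: cvg_comp cut (time_section (gF Oq (ltW sp))).
  exact: cvgM (cvg_cst _) cF.
have {}sp : s (clampr t1 t2 t, p) < 0 by rewrite lt_neqAle s0/= leNgt.
have hn : \forall n \near \oo, sidef s F (clampr t1 t2 (u n)) phi p = 0.
  have h : \forall n \near \oo, s (clampr t1 t2 (u n), p) < 0 by exact: cvgr_lt csu _ sp.
  by apply: filterS h => n h; rewrite /sidef ltNge (ltW h).
exact: cvg_near_cst hn.
Qed.

End sides.

Definition curvef {R : realType} (T : R -> R) (X Y m : R * R -> R) (t : R) (phi : R * R -> R) (l : R) : R :=
  if t < T l then phi (X (t, l), Y (t, l)) * m (t, l) else 0.

(** * Integrals along the shock curve *)

Section curve.
Context {R : realType}.
Variables (T : R -> R) (Om : set (R * (R * R))) (s : R * (R * R) -> R) (X Y : R * R -> R).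
Hypothesis su : surf T Om s X Y.
Variables (t1 t2 : R) (K : set (R * R)).
Hypotheses (t10 : 0 <= t1) (t12 : t1 <= t2) (cK : compact K).
Hypothesis KO : forall t p, t1 <= t <= t2 -> K p -> Om (t, p).

Let foot_ex : exists lam : R * (R * R) -> R, forall q, Om q -> s q = 0 ->
  0 <= q.1 < T (lam q) /\ q.2 = (X (q.1, lam q), Y (q.1, lam q)).
Proof.
suff /choice[lam hlam] : forall q : R * (R * R), exists l, Om q -> s q = 0 ->
    0 <= q.1 < T l /\ q.2 = (X (q.1, l), Y (q.1, l)) by exists lam.
move=> [t p]; have [[Oq sq]|nq] := pselect (Om (t, p) /\ s (t, p) = 0).
  by have [l h1 h2] := su_par su Oq sq; exists l.
by exists 0 => h1 h2; case: nq.
Qed.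

Let foot_eq (lam : R * (R * R) -> R) : (forall q, Om q -> s q = 0 ->
    0 <= q.1 < T (lam q) /\ q.2 = (X (q.1, lam q), Y (q.1, lam q))) ->
  forall t l, 0 <= t < T l -> lam (t, (X (t, l), Y (t, l))) = l.
Proof.
move=> hlam t l tl; have [h1 h2] := su_on su tl.
have [/= h3 h4] := hlam _ h1 h2.
by apply: (su_inj su h3 tl); rewrite -h4.
Qed.

Let foot_near (lam : R * (R * R) -> R) q eta : (forall q, Om q -> s q = 0 ->
    0 <= q.1 < T (lam q) /\ q.2 = (X (q.1, lam q), Y (q.1, lam q))) ->
  Om q -> s q = 0 -> 0 < eta -> \forall q' \near q, Om q' -> s q' = 0 -> `|lam q' - lam q| < eta.
Proof.
move=> hlam Oq sq eta0; have [tl qE] := hlam q Oq sq.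
have [d d0 hd] := surf_inverse su tl eta0.
apply/nbhs_ballP; exists d => //= q' [/= h1 [h2 h3]] Oq' sq'.
have [tl' qE'] := hlam q' Oq' sq'.
move: h2 h3; rewrite qE qE'/= => h2 h3.
by apply: hd tl' _ _ _; rewrite distrC; apply: ltW.
Qed.

(** The parameters of the shock points in K are not known beforehand to stay in a compact subset of
    [pdom T]. The bound is therefore taken in space-time, on the compact set [t1, t2] x K, through
    the label [lam], which is continuous along the surface. The choice h = [snd] then bounds the
    labels themselves. *)
Lemma curve_bound (h : R * R -> R) : (forall z, pdom T z -> {for z, continuous h}) ->
  exists2 M : R, 0 <= M & forall t l, t1 <= t <= t2 -> t < T l -> K (X (t, l), Y (t, l)) ->
    `|h (t, l)| <= M.
Proof.
move=> ch; have [lam hlam] := foot_ex.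
have cC : compact (`[t1, t2]%classic `*` K) by apply: compact_setX => //; exact: segment_compact.
have [|M M0 hM] := @compact_local_bound _ _ _ [set q | Om q /\ s q = 0] (fun q => h (q.1, lam q)) cC.
  move=> q [/=]; rewrite in_itv/= => ht Kp.
  have Oq : Om q by rewrite [q]surjective_pairing; exact: KO.
  have [sq|sq] := eqVneq (s q) 0; last first.
    exists 0; have := c1at_continuous (su_S su Oq); rewrite /continuous_at => /cvgr_norm_gt/(_ 0).
    rewrite normr_gt0 => /(_ sq); apply: filterS => z; rewrite normr_gt0 => sz [_ sz0].
    by rewrite sz0 eqxx in sz.
  exists (`|h (q.1, lam q)| + 1).
  have [tl qE] := hlam q Oq sq.
  have := ch (q.1, lam q) tl; rewrite /prop_for /continuous_at => /cvgr_norm_lt/(_ (`|h (q.1, lam q)| + 1)).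
  rewrite ltrDl => /(_ ltr01)/nbhs_ballP[eta /= eta0 heta].
  have n1 := foot_near hlam Oq sq eta0.
  have n2 : \forall q' \near q, ball q eta q' by exact: nbhsx_ballx.
  apply: filterS2 n1 n2 => q' h1 [h2 _] [Oq' sq']; apply: ltW; apply: heta; split => //=.
  by rewrite /ball/= distrC; exact: h1.
exists M => // t l ht tl Kp.
have tl0 : 0 <= t < T l by rewrite tl andbT (le_trans t10)//; case/andP: ht.
have := hM (t, (X (t, l), Y (t, l))); rewrite /= (foot_eq hlam tl0); apply.
  by split => //=; rewrite in_itv.
exact: (su_on su tl0).
Qed.

Lemma curve_lbound : exists2 M : R, 0 <= M & forall t l, t1 <= t <= t2 -> t < T l ->
  K (X (t, l), Y (t, l)) -> `|l| <= M.
Proof. by have := @curve_bound snd (fun z _ => @continuous_at_snd _ _ z). Qed.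

(** A surface point over K at time z0.1 has a label l with z0.1 < T l, hence l <> z0.2. Continuity
    of the label and compactness of [t1, t2] x K keep the pairs (time, label) of all surface points
    over K away from z0. *)
Lemma curve_away z0 : t1 <= z0.1 <= t2 -> T z0.2 <= z0.1 ->
  \forall z \near z0, t1 <= z.1 <= t2 -> z.1 < T z.2 -> ~ K (X z, Y z).
Proof.
move=> ht0 tl; have [lam hlam] := foot_ex.
pose P (z : R * R) (q : R * (R * R)) := Om q -> s q = 0 -> q.1 = z.1 -> lam q <> z.2.
have cC : compact (`[t1, t2]%classic `*` K) by apply: compact_setX => //; exact: segment_compact.
have : \forall z \near z0, (`[t1, t2]%classic `*` K) `<=` P z.
  have cN := (@compact_near_coveringP _ (`[t1, t2]%classic `*` K)).1 cC.
  apply: (cN _ (nbhs z0) P _) => q [/=]; rewrite in_itv/= => ht Kp.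
  have Oq : Om q by rewrite [q]surjective_pairing; exact: KO.
  have [sq|sq] := eqVneq (s q) 0; last first.
    have := c1at_continuous (su_S su Oq); rewrite /prop_for /continuous_at => /cvgr_norm_gt/(_ 0).
    rewrite normr_gt0 => /(_ sq) h; exists ([set q | 0 < `|s q|], setT); first by split => //; exact: filterT.
    by move=> [q' z] [/= h1 _] _ sq'; move: h1; rewrite sq' normr0 ltxx.
  have [tlq qE] := hlam q Oq sq.
  have [e|ne] := eqVneq q.1 z0.1.
    have r0 : 0 < `|lam q - z0.2| / 2.
      rewrite divr_gt0// normr_gt0 subr_eq0; apply/eqP => h.
      by move: tlq; rewrite h e ltNge tl andbF.
    exists ([set q' | Om q' -> s q' = 0 -> `|lam q' - lam q| < `|lam q - z0.2| / 2],
            [set z | `|z0.2 - z.2| < `|lam q - z0.2| / 2]).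
      split; first exact: foot_near.
      apply/nbhs_ballP; exists (`|lam q - z0.2| / 2) => //= z [_]; exact.
    move=> [q' z] [/= h1 h2] Oq' sq' _ e2; have := h1 Oq' sq'; rewrite e2 => h3.
    have := ler_distD z.2 (lam q) z0.2; rewrite leNgt => /negP; apply.
    rewrite [ltRHS]splitr ltrD// distrC//.
  have r0 : 0 < `|q.1 - z0.1| / 2 by rewrite divr_gt0// normr_gt0 subr_eq0.
  exists ([set q' | `|q.1 - q'.1| < `|q.1 - z0.1| / 2],
      [set z | `|z0.1 - z.1| < `|q.1 - z0.1| / 2]).
    by split; apply/nbhs_ballP; exists (`|q.1 - z0.1| / 2) => //= z [].
  move=> [q' z] [/= h1 h2] Oq' sq' e _.
  have := ler_distD q'.1 q.1 z0.1; rewrite leNgt => /negP; apply.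
  by rewrite [ltRHS]splitr ltrD// e distrC.
apply: filterS => z hz ht tz Kp.
have tz0 : 0 <= z.1 < T z.2 by rewrite tz andbT (le_trans t10)//; case/andP: ht.
move: Kp tz0 hz; rewrite {1 2}[z]surjective_pairing => Kp tz0 hz; have [h1 h2] := su_on su tz0.
apply: (hz _ _ h1 h2 erefl (foot_eq hlam tz0)); split => //=; rewrite in_itv/=.
Qed.

(** Where t < T l this is a composition of continuous functions. Where T l <= t, [curve_away] shows
    that the extension by 0 is 0 in a whole neighbourhood, so no jump occurs at the boundary of
    [pdom T]. *)
Lemma curve_continuous (phi m : R * R -> R) : (forall z, pdom T z -> {for z, continuous m}) ->
  continuous phi -> (forall p, ~ K p -> phi p = 0) ->
  continuous (fun z : R * R => curvef T X Y m (clampr t1 t2 z.1) phi z.2).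
Proof.
move=> cm cphi phi0 z0; pose c z : R * R := (clampr t1 t2 z.1, z.2).
have cc : {for z0, continuous c}.
  apply: continuous_at_pair; last exact: continuous_at_snd.
  by apply: (@continuous_comp _ _ _ fst (clampr t1 t2)); [exact: continuous_at_fst|exact: continuous_clampr].
have c0 z : t1 <= (c z).1 <= t2 by exact: clampr_in.
have [tl|tl] := ltP (clampr t1 t2 z0.1) (T z0.2).
  have pc : pdom T (c z0) by rewrite /pdom/= tl andbT (le_trans t10)//; case/andP: (c0 z0).
  apply: (@continuous_at_near_eq _ _ (fun z => phi (X (c z), Y (c z)) * m (c z))).
    have : \forall z \near z0, (c z).1 < T (c z).2.
      exact: cc (pdom_near (su_T su) tl).
    by apply: filterS => z /= h; rewrite /curvef h.
  apply: cvgM; last exact: continuous_comp cc (cm _ pc).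
  apply: (@continuous_comp _ _ _ (fun z => (X (c z), Y (c z))) phi); last exact: cphi.
  by apply: continuous_at_pair; [exact: continuous_comp cc (c1at_continuous (su_X su pc))|
    exact: continuous_comp cc (c1at_continuous (su_Y su pc))].
have hz : \forall z \near z0, t1 <= (c z).1 <= t2 -> (c z).1 < T (c z).2 -> ~ K (X (c z), Y (c z)).
  exact: cc (@curve_away (c z0) (c0 z0) tl).
apply: (@continuous_at_near_eq _ _ (cst 0)); last exact: cvg_cst.
apply: filterS hz => z hz; rewrite /curvef; case: ifPn => //= tz.
by rewrite phi0 ?mul0r//; exact: hz.
Qed.

(** Here phi is only Borel, because indicators of Borel sets are to be inserted. Restricting X, Y
    and m to the open set t < T l and extending by 0 makes the integrand a composition of Borel maps
    on the whole line. *)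
Lemma curve_bcs1 t (phi m : R * R -> R) (B : R) : t1 <= t <= t2 ->
  (forall z, pdom T z -> {for z, continuous m}) ->
  measurable_fun setT (phi : mplane R -> R) -> (forall p, `|phi p| <= B) ->
  (forall p, ~ K p -> phi p = 0) -> bcs1 (curvef T X Y m t phi).
Proof.
move=> ht cm mphi phiB phi0.
have t0 : 0 <= t by rewrite (le_trans t10)//; case/andP: ht.
have [L L0 hL] := curve_lbound; have [M M0 hM] := curve_bound cm.
have B0 : 0 <= B by exact: le_trans (phiB (0, 0)).
pose D := [set l | t < T l].
have oD : open D by rewrite openE => l tl; exact: (su_T su tl).
have mD : measurable D by exact: open_measurable.
have mc (h : R * R -> R) : (forall z, pdom T z -> {for z, continuous h}) ->
    measurable_fun setT ((fun l => h (t, l)) \_ D).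
  move=> ch; apply: (measurable_restrictT _ mD).1.
  apply: open_continuous_measurable_fun => // l /set_mem tl.
  apply: (@continuous_comp _ _ _ (fun l => (t, l)) h).
    by apply: continuous_at_pair; [exact: cvg_cst|exact: cvg_id].
  by apply: ch; rewrite /pdom/= t0.
have mX := mc X (fun z hz => c1at_continuous (su_X su hz)).
have mY := mc Y (fun z hz => c1at_continuous (su_Y su hz)).
split.
  have -> : curvef T X Y m t phi = (fun l => phi (((fun l => X (t, l)) \_ D) l, ((fun l => Y (t, l)) \_ D) l)
      * ((fun l => m (t, l)) \_ D) l).
    apply/funext => l; rewrite /curvef !patchE; case: ifPn => tl.
      by rewrite mem_set.
    by rewrite memNset ?mulr0//; exact/negP.
  apply: measurable_funM; last exact: mc.
  exact: (measurableT_comp mphi (measurable_fun_pair mX mY)).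
exists (B * M + L); first by rewrite addr_ge0// mulr_ge0.
move=> l; split; last first.
  move=> hl; rewrite /curvef; case: ifP => // tl; rewrite phi0 ?mul0r// => Kp.
  by move: hl; rewrite ltNge (le_trans (hL _ _ ht tl Kp))// lerDr mulr_ge0.
rewrite (@le_trans _ _ (B * M))// ?lerDl// /curvef; case: ifP => [tl|_]; last by rewrite normr0 mulr_ge0.
have [Kp|Kp] := pselect (K (X (t, l), Y (t, l))); last by rewrite phi0// mul0r normr0 mulr_ge0.
by rewrite normrM ler_pM//; exact: hM.
Qed.

Lemma curve_int_continuous (phi m : R * R -> R) : (forall z, pdom T z -> {for z, continuous m}) ->
  continuous phi -> (forall p, ~ K p -> phi p = 0) ->
  continuous (fun t => \int[leb R]_l curvef T X Y m (clampr t1 t2 t) phi l).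
Proof.
move=> cm cphi phi0; have [L L0 hL] := curve_lbound.
apply: (@continuous_int_param _ _ (fun z => curvef T X Y m (clampr t1 t2 z.1) phi z.2) L).
  exact: curve_continuous.
move=> t l; rewrite /curvef /=; case: ifP => [tl h|]; last by rewrite eqxx.
apply: hL tl _; first exact: clampr_in.
by apply: contrapT => nK; move: h; rewrite phi0// mul0r eqxx.
Qed.

End curve.

Section limits.
Context {R : realType}.

Lemma int2_bound (g : R * R -> R) (K : set (R * R)) (B : R) : bcs2 g -> compact K ->
  (forall p, `|g p| <= B) -> (forall p, ~ K p -> g p = 0) ->
  `|\int[leb2 R]_p g p| <= B * fine (leb2 R K).
Proof.
move=> bg cK gB g0; have mK := compact_measurable_plane cK.
have bK := bcs2_indic cK.
have -> : B * fine (leb2 R K) = \int[leb2 R]_p (B * \1_K p).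
  rewrite RintegralZl//; last exact: bcs2_integrable.
  by rewrite /Rintegral integral_indic// setIT.
apply: (le_trans (le_normr_Rintegral measurableT (bcs2_integrable bg))).
apply: le_Rintegral => //.
- have := integrable_norm (bcs2_integrable bg); exact.
- have := integrableZl measurableT B (bcs2_integrable bK).
  by apply: eq_integrable => // p _; rewrite /= EFinM.
- move=> p _; have [Kp|Kp] := pselect (K p).
    by rewrite indicE mem_set// mulr1.
  by rewrite g0// normr0 indicE memNset// mulr0.
Qed.

Lemma Rintegral_segment_cvg (G_ : nat -> R -> R) (G : R -> R) (t1 t2 C : R) (N : nat) : t1 <= t2 ->
  (forall n, continuous (fun t => G_ n (clampr t1 t2 t))) ->
  (forall n t, (N <= n)%N -> t1 <= t <= t2 -> `|G_ n t| <= C) ->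
  (forall t, t1 <= t <= t2 -> G_ n t @[n --> \oo] --> G t) ->
  (leb R).-integrable `[t1, t2] (EFin \o G) /\
  \int[leb R]_(t in `[t1, t2]) G_ n t @[n --> \oo] --> \int[leb R]_(t in `[t1, t2]) G t.
Proof.
move=> t12 cG GC Gcvg; pose D := `[t1, t2]%classic : set R.
have C0 : 0 <= C.
  have tt : t1 <= t1 <= t2 by rewrite lexx.
  exact: le_trans (GC N t1 (leqnn N) tt).
have mD : measurable D by exact: measurable_itv.
have mG n : measurable_fun setT (G_ n \_ D).
  have -> : G_ n \_ D = (fun t => G_ n (clampr t1 t2 t)) \_ D.
    apply/funext => t; rewrite !patchE; case: ifPn => // h.
    by rewrite clampr_id//; move: h; rewrite /D inE/= in_itv.
  apply: (measurable_restrictT _ mD).1; apply: measurable_funTS.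
  exact: continuous_measurable_fun.
have cD t : (G_ n \_ D) t @[n --> \oo] --> (G \_ D) t.
  rewrite patchE; case: ifPn => [|tD].
    rewrite /D inE/= in_itv/= => ht; rewrite (_ : (fun n => _) = G_ ^~ t); first exact: Gcvg.
    by apply/funext => n; rewrite patchE mem_set//= in_itv.
  rewrite (_ : (fun n => _) = cst 0); first exact: cvg_cst.
  by apply/funext => n; rewrite patchE (negbTE tD).
have mGD : measurable_fun setT (G \_ D).
  by apply: (measurable_fun_cvg mG) => t _; exact: cD.
have GDC t : `|(G \_ D) t| <= C.
  rewrite patchE; case: ifPn => [|_]; last by rewrite normr0.
  rewrite /D inE/= in_itv/= => ht.
  have h : `|G_ n t| @[n --> \oo] --> `|G t| by exact: cvg_norm (Gcvg _ ht).
  by apply: (ler_cvg_to h (cvg_cst C)); exists N => // n /= Nn; exact: GC.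
split.
  apply/(@integrable_mkcond _ _ _ (leb R) D (EFin \o G) mD).
  have -> : (EFin \o G) \_ D = EFin \o (G \_ D).
    by apply/funext => t; rewrite /= !patchE; case: ifP.
  have b : bcs1 (G \_ D).
    split => //; exists (C + (`|t1| + `|t2|)); first by rewrite !addr_ge0.
    move=> t; split; first by rewrite (le_trans (GDC t))// lerDl addr_ge0.
    move=> h; rewrite patchE; case: ifPn => //; rewrite /D inE/= in_itv/= => /andP[h1 h2].
    exfalso; move: h; rewrite ltNge => /negP; apply.
    have n1 := ler_norm t2; have n2 := ler_norm (- t1); rewrite normrN in n2.
    have n3 := normr_ge0 t1; have n4 := normr_ge0 t2.
    by rewrite ler_norml; apply/andP; split; lra.
  exact: bcs1_integrable b.
have e (H : R -> R) : \int[leb R]_(t in `[t1, t2]) H t = \int[leb R]_t (H \_ D) t.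
  by rewrite Rintegral_mkcond.
have hG n t : (N <= n)%N -> `|(G_ n \_ D) t| <= C /\ (~ D t -> (G_ n \_ D) t = 0).
  move=> Nn; rewrite patchE; split; last by move=> h; rewrite memNset.
  by case: ifPn => [|_]; [rewrite /D inE/= in_itv/=; exact: GC|rewrite normr0].
rewrite e; under eq_fun do rewrite e.
apply: (@dominated_Rintegral _ _ (measurableTypeR R) (leb R) D _ _ C) => //.
- exact: leb_itv_lty.
- by exists N => // n /= Nn; split => [|t]; [exact: mG|exact: (@hG n t Nn)].
- by apply: aeW => t; exact: cD.
Qed.

End limits.

Section side_limit.
Context {R : realType}.
Variables (T : R -> R) (Om : set (R * (R * R))) (s : R * (R * R) -> R) (X Y : R * R -> R).
Hypothesis su : surf T Om s X Y.
Variables (t1 t2 : R) (K : set (R * R)).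
Hypotheses (t10 : 0 <= t1) (t12 : t1 <= t2) (cK : compact K).
Hypothesis KO : forall t p, t1 <= t <= t2 -> K p -> Om (t, p).
Variables (F : R * (R * R) -> R) (phi : R * R -> R).
Hypothesis gF : forall q, Om q -> 0 <= s q -> {for q, continuous F}.
Hypotheses (cphi : continuous phi) (phi0 : forall p, ~ K p -> phi p = 0).

Let Fn n q := step (n%:R * s q) * F q.

Let gFn n q : Om q -> 0 <= s q -> {for q, continuous (Fn n)}.
Proof.
move=> Oq sq; apply: cvgM; last exact: gF.
apply: (@continuous_comp _ _ _ s (fun z => step (n%:R * z))).
  exact: c1at_continuous (su_S su Oq).
apply: (@continuous_comp _ _ _ (fun z : R => n%:R * z) step); last exact: continuous_step.
by apply: cvgM; [exact: cvg_cst|exact: cvg_id].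
Qed.

Lemma cutoff_sidef n t p : phi p * (step (n%:R * s (t, p)) * F (t, p)) = sidef s (Fn n) t phi p.
Proof.
rewrite /sidef; case: ltP => // sp; rewrite step_le0 ?mul0r ?mulr0//.
exact: mulr_ge0_le0.
Qed.

Let phi_bound : exists2 B : R, 0 <= B & forall p, `|phi p| <= B.
Proof.
have cphi' q : K q -> {for q, continuous phi} by move=> _; exact: cphi.
have [B B0 hB] := compact_bound cK cphi'.
exists B => // p; by have [/hB//|/phi0->] := pselect (K p); rewrite normr0.
Qed.

Lemma cutoff_int_continuous n : continuous (fun t => \int[leb2 R]_p (phi p *
  (step (n%:R * s (clampr t1 t2 t, p)) * F (clampr t1 t2 t, p)))).
Proof.
have h := side_continuous su t10 t12 cK KO (@gFn n) cphi phi0.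
rewrite (_ : (fun t => _) = (fun t => \int[leb2 R]_p sidef s (Fn n) (clampr t1 t2 t) phi p))//.
by apply/funext => t; apply: eq_Rintegral => p _; rewrite cutoff_sidef.
Qed.

Lemma cutoff_int_cvg : exists2 C : R,
  forall n t, t1 <= t <= t2 ->
    bcs2 (fun p => phi p * (step (n%:R * s (t, p)) * F (t, p))) /\
    `|\int[leb2 R]_p (phi p * (step (n%:R * s (t, p)) * F (t, p)))| <= C &
  forall t, t1 <= t <= t2 ->
    \int[leb2 R]_p (phi p * (step (n%:R * s (t, p)) * F (t, p))) @[n --> \oo] -->
    \int[leb2 R]_p sidef s F t phi p.
Proof.
have [B B0 hB] := phi_bound; have [M M0 hM] := side_bound su cK KO gF.
have mphi := continuous_measurable_plane cphi.
have e n t : (fun p => phi p * (step (n%:R * s (t, p)) * F (t, p))) = sidef s (Fn n) t phi.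
  by apply/funext => p; rewrite cutoff_sidef.
have b n t : t1 <= t <= t2 -> bcs2 (sidef s (Fn n) t phi).
  by move=> ht; exact: (side_bcs2 su cK KO (@gFn n) ht mphi hB phi0).
have bd n t p : t1 <= t <= t2 -> `|sidef s (Fn n) t phi p| <= B * M.
  move=> ht; rewrite /sidef; case: ifPn => [sp|_]; last by rewrite normr0 mulr_ge0.
  have [Kp|Kp] := pselect (K p); last by rewrite phi0// mul0r normr0 mulr_ge0.
  rewrite normrM ler_pM// /Fn normrM -[M]mul1r ler_pM//.
    by rewrite ger0_norm ?step_ge0// step_le1.
  by apply: hM => //; exact: ltW.
have out n t p : ~ K p -> sidef s (Fn n) t phi p = 0.
  by move=> /phi0 h; rewrite /sidef h mul0r if_same.
exists (B * M * fine (leb2 R K)).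
  move=> n t ht; rewrite e; split; first exact: b.
  by apply: int2_bound => //; [exact: b|move=> p; exact: bd|move=> p; exact: out].
move=> t ht; under eq_fun do rewrite e.
apply: (@dominated_Rintegral _ _ (mplane R) (leb2 R) K _ _ (B * M)).
- exact: compact_measurable_plane.
- exact: leb2_compact_lty.
- apply: nearW => n; split; first exact: (b _ _ ht).1.
  by move=> p; split; [exact: bd|exact: out].
- exact: (side_bcs2 su cK KO gF ht mphi hB phi0).1.
apply: aeW => p; rewrite [sidef s F _ _ _]/sidef; case: ifPn => sp; last first.
  exact: cvg_cst.
have hn : \forall n \near \oo, phi p * Fn n (t, p) = phi p * F (t, p).
  have : \forall n \near \oo, (s (t, p))^-1 <= n%:R by exact: nbhs_infty_ger.
  apply: filterS => n hn; rewrite /Fn step_ge1 ?mul1r//.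
  by rewrite -ler_pdivrMr ?div1r.
exact: cvg_near_cst hn.
Qed.

End side_limit.

(* The mass of density r and velocity (U, W) crossing the moving curve (X, Y), per unit of dl. *)
Definition fluxm {R : realType} (r U W : R * (R * R) -> R) (X Y : R * R -> R) (z : R * R) : R :=
  let q := (z.1, (X z, Y z)) in
  r q * ((d1 X z - U q) * d2 Y z - (d1 Y z - W q) * d2 X z).

(** [c1at] is an open condition. For fewer than four functions an argument is repeated. *)
Lemma near_c1at4 {R : realType} (V : normedModType R) (f g h k : V -> R) (P : set V) q :
  c1at f q -> c1at g q -> c1at h q -> c1at k q ->
  (forall q, c1at f q -> c1at g q -> c1at h q -> c1at k q -> P q) -> \forall q' \near q, P q'.
Proof.
move=> /nbhs_interior cf /nbhs_interior cg /nbhs_interior ch /nbhs_interior ck fP.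
by apply: filterS2 (filterI cf cg) (filterI ch ck) => q' [h1 h2] [h3 h4]; exact: (fP q' h1 h2 h3 h4).
Qed.

(** * The balance law on one side *)

Section side_balance.
Context {R : realType}.
Variables (T : R -> R) (Om : set (R * (R * R))) (s : R * (R * R) -> R) (X Y : R * R -> R).
Hypothesis su : surf T Om s X Y.
Variable sg : R.
Hypothesis sgE : sg = 1 \/ sg = -1.
Hypothesis orient : forall t l, 0 <= t < T l -> let q := (t, (X (t, l), Y (t, l))) in
  0 < sg * (dx s q * d2 Y (t, l) - dy s q * d2 X (t, l)).
Variables (r U W : R * (R * R) -> R).
Hypothesis (gr : forall q, Om q -> 0 <= s q -> c1at r q).
Hypothesis (gU : forall q, Om q -> 0 <= s q -> c1at U q).
Hypothesis (gW : forall q, Om q -> 0 <= s q -> c1at W q).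
Hypothesis (grU : forall q, Om q -> 0 <= s q -> c1at (r \* U) q).
Hypothesis (grW : forall q, Om q -> 0 <= s q -> c1at (r \* W) q).
Hypothesis pde : forall q, Om q -> 0 < q.1 -> 0 < s q ->
  dt r q + dx (r \* U) q + dy (r \* W) q = 0.

(** Put N = sx yl - sy xl. Tangency gives (sx, sy) (xl^2 + yl^2) = N (yl, - xl). Eliminating st, the
    derivative of s along the trajectories becomes - N ((xt - U') yl - (yt - W') xl) / (xl^2 +
    yl^2), and the weight [omega] leaves only the sign of N, which is sg. *)
Let flux_algebra (f' r' U' W' st sx sy xt yt xl yl : R) :
  st + sx * xt + sy * yt = 0 -> sx * xl + sy * yl = 0 -> 0 < sg * (sx * yl - sy * xl) ->
  1 * (f' * (r' * (st + U' * sx + W' * sy))) * ((xl ^+ 2 + yl ^+ 2) / `|sx * yl - sy * xl|) =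
  f' * (- sg * (r' * ((xt - U') * yl - (yt - W') * xl))).
Proof.
move=> h1 h2 h3; have nz : sx * yl - sy * xl != 0.
  by apply/eqP => h; move: h3; rewrite h mulr0 ltxx.
have -> : `|sx * yl - sy * xl| = sg * (sx * yl - sy * xl).
  by case: sgE h3 => ->; rewrite ?mul1r ?mulN1r ?oppr_gt0 => h3; rewrite ?(gtr0_norm h3) ?(ltr0_norm h3).
have -> : st = - (sx * xt + sy * yt) by apply/eqP; rewrite -subr_eq0 opprK addrA h1.
have e1 : sx * (xl ^+ 2 + yl ^+ 2) = (sx * yl - sy * xl) * yl.
  have -> : sx * (xl ^+ 2 + yl ^+ 2) = (sx * xl + sy * yl) * xl + (sx * yl - sy * xl) * yl by ring.
  by rewrite h2 mul0r add0r.
have e2 : sy * (xl ^+ 2 + yl ^+ 2) = - (sx * yl - sy * xl) * xl.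
  have -> : sy * (xl ^+ 2 + yl ^+ 2) = (sx * xl + sy * yl) * yl - (sx * yl - sy * xl) * xl by ring.
  by rewrite h2 mul0r add0r mulNr.
have sg2 : sg^-1 = sg by case: sgE => ->; rewrite ?invr1// invrN1.
rewrite invfM sg2 mul1r.
have -> : f' * (r' * (- (sx * xt + sy * yt) + U' * sx + W' * sy)) *
    ((xl ^+ 2 + yl ^+ 2) * (sg * (sx * yl - sy * xl)^-1)) =
  f' * (r' * sg) * ((U' - xt) * (sx * (xl ^+ 2 + yl ^+ 2)) + (W' - yt) * (sy * (xl ^+ 2 + yl ^+ 2))) *
    (sx * yl - sy * xl)^-1 by ring.
rewrite e1 e2; by field.
Qed.

Lemma crv_flux (f : R * R -> R) t : 0 <= t ->
  crv T s X Y (flux_density s f r U W) (cst 1) t =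
  curvef T X Y (fun z => - sg * fluxm r U W X Y z) t f.
Proof.
move=> t0; apply/funext => l; rewrite /crv /curvef; case: ifPn => // tl.
have tl0 : 0 <= t < T l by rewrite t0.
have h1 := su_time su tl0; have h2 := su_tan su tl0; have h3 := orient tl0.
exact: flux_algebra h1 h2 h3.
Qed.

Lemma continuous_fluxm z : pdom T z -> {for z, continuous (fluxm r U W X Y)}.
Proof.
move=> pz; have cX := su_X su pz; have cY := su_Y su pz.
have [h1 h2] : Om (z.1, (X z, Y z)) /\ s (z.1, (X z, Y z)) = 0.
  by move: pz; rewrite [z]surjective_pairing => /(su_on su).
have cq : {for z, continuous (fun z => (z.1, (X z, Y z)))}.
  apply: continuous_at_pair; first exact: continuous_at_fst.
  by apply: continuous_at_pair; exact: c1at_continuous.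
have h0 : 0 <= s (z.1, (X z, Y z)) by rewrite h2.
apply: cvgM; first exact: (continuous_comp cq (c1at_continuous (gr h1 h0))).
apply: cvgB; apply: cvgM.
- by apply: cvgB; [exact: c1at_d1|exact: (continuous_comp cq (c1at_continuous (gU h1 h0)))].
- exact: c1at_d2.
- by apply: cvgB; [exact: c1at_d1|exact: (continuous_comp cq (c1at_continuous (gW h1 h0)))].
- exact: c1at_d2.
Qed.

Lemma supp_out (f : R * R -> R) p : ~ supp f p -> f p = 0.
Proof. by move=> nf; apply/eqP; apply: contrapT => /negP h; apply: nf; exact: subset_closure. Qed.

Lemma supp_d1 (f : R * R -> R) p : ~ supp f p -> d1 f p = 0 /\ d2 f p = 0.
Proof.
Transparent d1 d2.
move=> nf; have h : \forall q \near p, f q = 0.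
  have : nbhs p (~` supp f) by apply: open_nbhs_nbhs; split => //; exact/closed_openC/closed_closure.
  by apply: filterS => q /supp_out.
have e w : 'D_w f p = 0.
  rewrite -(derive_cst (0 : R) p w); apply: near_eq_derive.
  by apply: filterS h => q ->.
by rewrite /d1 /d2 !e.
Opaque d1 d2.
Qed.

(** The limit of [cutoff_balance]. The bounds of [cutoff_int_cvg] and [coarea] are uniform in t from
    some n on, so the limit may be taken under the time integral. *)
Lemma side_balance (t1 t2 : R) (f : R * R -> R) : 0 < t1 -> t1 < t2 -> Cc1 f ->
  (forall t p, t1 <= t <= t2 -> supp f p -> Om (t, p)) ->
  let G t := \int[leb2 R]_p sidef s (r \* U) t (d1 f) p + \int[leb2 R]_p sidef s (r \* W) t (d2 f) p -
    \int[leb R]_l curvef T X Y (fun z => sg * fluxm r U W X Y z) t f l in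
  (leb R).-integrable `[t1, t2] (EFin \o G) /\
  \int[leb2 R]_p sidef s r t2 f p - \int[leb2 R]_p sidef s r t1 f p =
  \int[leb R]_(t in `[t1, t2]) G t.
Proof.
move=> t10 t12 Cf fOm G; have cK : compact (supp f) := Cf.2.
have f0 := @supp_out f.
have cf p : c1at f p by exact: C1_c1at Cf.1 I.
have ccf : continuous f by move=> p; exact: c1at_continuous.
have cd1 : continuous (d1 f) by move=> p; exact: c1at_d1.
have cd2 : continuous (d2 f) by move=> p; exact: c1at_d2.
have cr q (Oq : Om q) (sq : 0 <= s q) := c1at_continuous (gr Oq sq).
have crU q (Oq : Om q) (sq : 0 <= s q) := c1at_continuous (grU Oq sq).
have crW q (Oq : Om q) (sq : 0 <= s q) := c1at_continuous (grW Oq sq).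
have L := @cutoff_int_cvg _ _ _ _ _ _ su t1 t2 (supp f) cK fOm.
have [_ _ Lr] := L _ _ cr ccf f0.
have [C1 hC1 L1] := L _ _ crU cd1 (fun p h => (supp_d1 h).1).
have [C2 hC2 L2] := L _ _ crW cd2 (fun p h => (supp_d1 h).2).
pose A1 n t := \int[leb2 R]_p (d1 f p * (step (n%:R * s (t, p)) * (r \* U) (t, p))).
pose A2 n t := \int[leb2 R]_p (d2 f p * (step (n%:R * s (t, p)) * (r \* W) (t, p))).
pose Z n t := \int[leb2 R]_p Zf s (flux_density s f r U W) (cst 1) n t p.
have t1t2 := ltW t12.
have [|t p ht nf|t p ht fp sp|C [N [hC hL]]] := @coarea _ T Om s X Y t1 t2 (flux_density s f r U W) (supp f) su (ltW t10) cK.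
- exact: fOm.
- by rewrite /flux_density /= f0// mul0r.
- have Oq := fOm _ _ ht fp; have sq : 0 <= s (t, p) by rewrite sp.
  apply: near_c1at4 (su_S su Oq) (gr Oq sq) (gU Oq sq) (gW Oq sq) _ => q cs' cr' cU' cW'.
  apply: cvgM; first by apply: continuous_comp; [exact: continuous_at_snd|exact: ccf].
  apply: cvgM; first exact: c1at_continuous.
  apply: cvgD; first apply: cvgD.
  + exact: c1at_dt.
  + by apply: cvgM; [exact: c1at_continuous|exact: c1at_dx].
  + by apply: cvgM; [exact: c1at_continuous|exact: c1at_dy].
have [|||iG lim] := @Rintegral_segment_cvg _ (fun n t => A1 n t + A2 n t + Z n t) G t1 t2 (C1 + C2 + C) N t1t2.
- move=> n t; apply: cvgD; first apply: cvgD.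
  + exact: (cutoff_int_continuous su (ltW t10) t1t2 cK fOm crU cd1 (fun p h => (supp_d1 h).1)).
  + exact: (cutoff_int_continuous su (ltW t10) t1t2 cK fOm crW cd2 (fun p h => (supp_d1 h).2)).
  + exact: (Zf_int_continuous su t12 Cf fOm gr gU gW).
- move=> n t Nn ht; rewrite (le_trans (ler_normD _ _))// lerD ?(hC n t Nn ht).2//.
  by rewrite (le_trans (ler_normD _ _))// lerD ?(hC1 n t ht).2 ?(hC2 n t ht).2.
- move=> t ht; have t0 : 0 <= t by apply: le_trans (ltW t10) _; case/andP: ht.
  have -> : G t = \int[leb2 R]_p sidef s (r \* U) t (d1 f) p + \int[leb2 R]_p sidef s (r \* W) t (d2 f) p +
      \int[leb R]_l crv T s X Y (flux_density s f r U W) (cst 1) t l.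
    rewrite /G crv_flux//; congr (_ + _).
    have -> : curvef T X Y (fun z => - sg * fluxm r U W X Y z) t f =
        (fun l => (-1) * curvef T X Y (fun z => sg * fluxm r U W X Y z) t f l).
      apply/funext => l; rewrite /curvef; case: ifP => _; last by rewrite mulr0.
      by rewrite mulN1r mulNr mulrN.
    rewrite RintegralZl ?mulN1r//.
    have := (hL t ht).1; rewrite crv_flux// => /bcs1_integrable h.
    have := integrableN h; apply: eq_integrable => // l _; rewrite /curvef /=.
    by case: ifP => _; rewrite ?oppr0// mulNr mulrN opprK.
  by apply: cvgD; [apply: cvgD; [exact: L1|exact: L2]|exact: (hL t ht).2].
have e n : \int[leb2 R]_p (f p * (step (n%:R * s (t2, p)) * r (t2, p))) -
    \int[leb2 R]_p (f p * (step (n%:R * s (t1, p)) * r (t1, p))) =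
    \int[leb R]_(t in `[t1, t2]) (A1 n t + A2 n t + Z n t).
  rewrite (cutoff_balance su t10 t12 Cf fOm gr gU gW grU grW pde n).
  apply: eq_Rintegral => t; rewrite inE/= in_itv/= => ht; congr (_ + _).
  rewrite -int2_add; [|exact: (hC1 n t ht).1|exact: (hC2 n t ht).1].
  apply: eq_Rintegral => p _ /=.
  by move: (step _) (r _) (d1 f p) (d2 f p) (U _) (W _) => x1 x2 x3 x4 x5 x6; ring.
have i1 : t1 <= t1 <= t2 by rewrite lexx.
have i2 : t1 <= t2 <= t2 by rewrite lexx andbT.
have lim' : \int[leb R]_(t in `[t1, t2]) (A1 n t + A2 n t + Z n t) @[n --> \oo] -->
    \int[leb2 R]_p sidef s r t2 f p - \int[leb2 R]_p sidef s r t1 f p.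
  by under eq_fun do rewrite -e; exact: cvgB (Lr t2 i2) (Lr t1 i1).
by split => //; exact: (cvg_unique _ lim' lim).
Qed.

End side_balance.

Lemma clampr_integrable {R : realType} (G : R -> R) (t1 t2 : R) :
  continuous (fun t => G (clampr t1 t2 t)) -> (leb R).-integrable `[t1, t2] (EFin \o G).
Proof.
move=> cG; have := @segment_integrable _ (fun t => G (clampr t1 t2 t)) t1 t2 (fun t _ => cG t).
apply: eq_integrable => [|t]; first exact: measurable_itv.
by rewrite inE/= in_itv/= => ht; rewrite clampr_id.
Qed.

(** The second alternative is for the labels with T l <= t1: there F is 0 on [t1, t2], but need not
    be differentiable at t1, since [is_derive] also looks at earlier times. *)
Lemma int_FTC_swap {R : realType} (E F : R -> R -> R) (t1 t2 L : R) : t1 < t2 ->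
  continuous (fun z : R * R => E (clampr t1 t2 z.1) z.2) ->
  (forall t l, t1 <= t <= t2 -> E t l != 0 -> `|l| <= L) ->
  (forall l, (forall t, t1 <= t <= t2 -> is_derive t 1 (F ^~ l) (E t l)) \/
     (F t1 l = F t2 l /\ forall t, t1 <= t <= t2 -> E t l = 0)) ->
  bcs1 (F t1) -> bcs1 (F t2) ->
  \int[leb R]_l F t2 l - \int[leb R]_l F t1 l =
  \int[leb R]_(t in `[t1, t2]) \int[leb R]_l E t l.
Proof.
move=> t12 cE EL EF b1 b2; have t12' := ltW t12.
have swp := @int_swap _ (fun z => E (clampr t1 t2 z.1) z.2) t1 t2 L cE.
rewrite -(RintegralB measurableT (bcs1_integrable b2) (bcs1_integrable b1)).
transitivity (\int[leb R]_l \int[leb R]_(t in `[t1, t2]) E (clampr t1 t2 t) l); last first.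
  rewrite /= in swp; rewrite swp.
    apply: eq_Rintegral => t; rewrite inE/= in_itv/= => ht.
    by rewrite (clampr_id ht).
  by move=> t l h; apply: EL h; exact: clampr_in.
apply: eq_Rintegral => l _.
have e t : t \in `[t1, t2]%classic -> E (clampr t1 t2 t) l = E t l.
  by rewrite inE/= in_itv/= => ht; rewrite (clampr_id ht).
have cE' t : {for t, continuous (fun t => E (clampr t1 t2 t) l)}.
  apply: (@continuous_comp _ _ _ (fun t => (t, l)) (fun z => E (clampr t1 t2 z.1) z.2)); last exact: cE.
  by apply: continuous_at_pair; [exact: cvg_id|exact: cvg_cst].
have [dE|[FF E0]] := EF l.
  have dE' t : t1 <= t <= t2 -> is_derive t 1 (F ^~ l) (E (clampr t1 t2 t) l).
    by move=> ht; rewrite (clampr_id ht); exact: dE.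
  exact: (esym (@Rintegral_FTC2 R _ (F ^~ l) t1 t2 t12' dE' (fun t _ => cE' t))).
rewrite FF subrr; apply: esym; transitivity (\int[leb R]_(t in `[t1, t2]) (0 : R)).
  by apply: eq_Rintegral => t th; rewrite e//; apply: E0; move: th; rewrite inE/= in_itv.
by rewrite Rintegral_cst_segment ?mul0r.
Qed.

(** * The balance law along the curve *)

Section curve_balance.
Context {R : realType}.
Variables (T : R -> R) (Om : set (R * (R * R))) (s : R * (R * R) -> R) (X Y : R * R -> R).
Hypothesis su : surf T Om s X Y.
Variables (t1 t2 : R) (f m : R * R -> R).
Hypotheses (t10 : 0 < t1) (t12 : t1 < t2) (Cf : Cc1 f).
Hypothesis fOm : forall t p, t1 <= t <= t2 -> supp f p -> Om (t, p).
Hypothesis cm : forall z, pdom T z -> c1at m z.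

Let cf p : c1at f p. Proof. exact: C1_c1at Cf.1 I. Qed.
Let ccf : continuous f. Proof. by move=> p; exact: c1at_continuous. Qed.
Let cd1 : continuous (d1 f). Proof. by move=> p; exact: c1at_d1. Qed.
Let cd2 : continuous (d2 f). Proof. by move=> p; exact: c1at_d2. Qed.

Let mX z := m z * d1 X z.
Let mY z := m z * d1 Y z.

Let cmX z : pdom T z -> {for z, continuous mX}.
Proof.
by move=> pz; apply: cvgM; [exact: c1at_continuous (cm pz)|exact: c1at_d1 (su_X su pz)].
Qed.

Let cmY z : pdom T z -> {for z, continuous mY}.
Proof.
by move=> pz; apply: cvgM; [exact: c1at_continuous (cm pz)|exact: c1at_d1 (su_Y su pz)].
Qed.

Let cdm z : pdom T z -> {for z, continuous (d1 m)}.
Proof. by move=> pz; exact: c1at_d1 (cm pz). Qed.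

Let E t l := curvef T X Y mX t (d1 f) l + curvef T X Y mY t (d2 f) l + curvef T X Y (d1 m) t f l.

Let E_cont : continuous (fun z : R * R => E (clampr t1 t2 z.1) z.2).
Proof.
have C := @curve_continuous _ _ _ _ _ _ su t1 t2 (supp f) (ltW t10) (ltW t12) Cf.2 fOm.
move=> z; apply: cvgD; first apply: cvgD.
- exact: (C _ _ cmX cd1 (fun p h => (supp_d1 h).1)).
- exact: (C _ _ cmY cd2 (fun p h => (supp_d1 h).2)).
- exact: (C _ _ cdm ccf (@supp_out _ f)).
Qed.

Let curvef0 t l h phi : t1 <= t <= t2 -> (forall p, ~ supp f p -> phi p = 0) ->
  ~ (t < T l /\ supp f (X (t, l), Y (t, l))) -> curvef T X Y h t phi l = 0.
Proof.
move=> ht phi0 nK; rewrite /curvef; case: ifP => // tl.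
by rewrite phi0 ?mul0r// => Kp; apply: nK.
Qed.

Let E0 t l : t1 <= t <= t2 -> ~ (t < T l /\ supp f (X (t, l), Y (t, l))) -> E t l = 0.
Proof.
move=> ht nK; rewrite /E !curvef0// ?addr0// => p h; [exact: supp_out|exact: (supp_d1 h).2|exact: (supp_d1 h).1].
Qed.

Let ring_split (f' a x' m' y' b dm : R) :
  f' * dm + m' * (x' * a + y' * b) = a * (m' * x') + b * (m' * y') + f' * dm.
Proof. by ring. Qed.

(** While t < T l this is the chain rule. At t >= T l > t1, [curve_away] makes the function vanish
    on both sides of t, so its derivative is 0 there, and so is E. *)
Let E_derive t l : t1 <= t <= t2 -> t1 < T l -> is_derive t 1 (fun t => curvef T X Y m t f l) (E t l).
Proof.
move=> ht tl1; have t0 : 0 < t by apply: lt_le_trans t10 _; case/andP: ht.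
have [tl|tl] := ltP t (T l).
  have pz : pdom T (t, l) by rewrite /pdom/= tl ltW.
  have hn : \forall t' \near t, f (X (t', l), Y (t', l)) * m (t', l) = curvef T X Y m t' f l.
    near=> t'; rewrite /curvef ifT//; near: t'; exact: lt_nbhsl.
  apply: (near_eq_is_derive hn).
  have dX : is_derive t 1 (fun t => X (t, l)) (d1 X (t, l)) by apply: is_derive_d1; exact: c1at_diff (su_X su pz).
  have dY : is_derive t 1 (fun t => Y (t, l)) (d1 Y (t, l)) by apply: is_derive_d1; exact: c1at_diff (su_Y su pz).
  have dm : is_derive t 1 (fun t => m (t, l)) (d1 m (t, l)) by apply: is_derive_d1; exact: c1at_diff (cm pz).
  have df := is_derive_comp2 (c1at_diff (cf (X (t, l), Y (t, l)))) dX dY.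
  apply: is_derive_eq (is_deriveM df dm) _.
  rewrite /E /curvef tl; exact: ring_split.
have ht1 : t1 < t by exact: lt_le_trans tl.
have hz := @curve_away _ _ _ _ _ _ su t1 t2 (supp f) (ltW t10) Cf.2 fOm (t, l) ht tl.
have ct : {for t, continuous (fun t => (t, l))}.
  by apply: continuous_at_pair; [exact: cvg_id|exact: cvg_cst].
have hn : \forall t' \near t, cst 0 t' = curvef T X Y m t' f l.
  have hz' : \forall t' \near t, t1 <= t' <= t2 -> t' < T l -> ~ supp f (X (t', l), Y (t', l)) := ct _ hz.
  have ht' : \forall t' \near t, t1 < t' by exact: lt_nbhsr.
  apply: filterS2 hz' ht' => t' h1 h2 /=; rewrite /curvef; case: ifP => // tl'.
  have t't2 : t1 <= t' <= t2.
    by rewrite (ltW h2)/=; apply: ltW; apply: (lt_le_trans tl'); apply: (le_trans tl); case/andP: ht.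
  by rewrite supp_out ?mul0r//; exact: h1.
apply: (near_eq_is_derive hn).
rewrite E0//; first exact: is_derive_cst.
by move=> [h _]; move: h; rewrite ltNge tl.
Unshelve. all: by end_near. Qed.

Lemma curve_balance :
  let G t := \int[leb R]_l curvef T X Y (fun z => m z * d1 X z) t (d1 f) l +
    \int[leb R]_l curvef T X Y (fun z => m z * d1 Y z) t (d2 f) l +
    \int[leb R]_l curvef T X Y (d1 m) t f l in
  (leb R).-integrable `[t1, t2] (EFin \o G) /\
  \int[leb R]_l curvef T X Y m t2 f l - \int[leb R]_l curvef T X Y m t1 f l =
  \int[leb R]_(t in `[t1, t2]) G t.
Proof.
move=> G; have [L L0 hL] := curve_lbound su (ltW t10) Cf.2 fOm.
have i1 : t1 <= t1 <= t2 by rewrite lexx ltW.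
have i2 : t1 <= t2 <= t2 by rewrite lexx ltW.
have bc h phi t : (forall z, pdom T z -> {for z, continuous h}) -> continuous phi ->
    (forall p, ~ supp f p -> phi p = 0) -> t1 <= t <= t2 -> bcs1 (curvef T X Y h t phi).
  move=> ch cphi phi0 ht; have cphi' q : supp f q -> {for q, continuous phi} by move=> _; exact: cphi.
  have [B B0 hB] := compact_bound Cf.2 cphi'.
  apply: (@curve_bcs1 _ _ _ _ _ _ su t1 t2 (supp f) (ltW t10) Cf.2 fOm t phi h B ht ch) => //.
    exact: continuous_measurable_plane.
  by move=> p; have [/hB//|/phi0->] := pselect (supp f p); rewrite normr0.
have bX t := bc _ _ t cmX cd1 (fun p h => (supp_d1 h).1).
have bY t := bc _ _ t cmY cd2 (fun p h => (supp_d1 h).2).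
have bd t := bc _ _ t cdm ccf (@supp_out _ f).
have bm t := bc _ _ t (fun z pz => c1at_continuous (cm pz)) ccf (@supp_out _ f).
have GE t : t1 <= t <= t2 -> G t = \int[leb R]_l E t l.
  by move=> ht; rewrite /G /E !int1_add//; [exact: bX|exact: bY|apply: bcs1_add; [exact: bX|exact: bY]|exact: bd].
have iG : (leb R).-integrable `[t1, t2] (EFin \o G).
  have C := @curve_int_continuous _ _ _ _ _ _ su t1 t2 (supp f) (ltW t10) (ltW t12) Cf.2 fOm.
  have cG : continuous (fun t => G (clampr t1 t2 t)).
    move=> t; apply: cvgD; first apply: cvgD.
    - exact: (C _ _ cmX cd1 (fun p h => (supp_d1 h).1)).
    - exact: (C _ _ cmY cd2 (fun p h => (supp_d1 h).2)).
    - exact: (C _ _ cdm ccf (@supp_out _ f)).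
  exact: clampr_integrable.
split; first exact: iG.
have -> : \int[leb R]_(t in `[t1, t2]) G t = \int[leb R]_(t in `[t1, t2]) \int[leb R]_l E t l.
  by apply: eq_Rintegral => t; rewrite inE/= in_itv/= => ht; exact: GE.
apply: (@int_FTC_swap _ E (fun t l => curvef T X Y m t f l) t1 t2 L t12 E_cont).
- move=> t l ht h; apply: contrapT => nL; case/eqP: h; apply: E0 => // -[tl Kl]; apply: nL.
  exact: hL ht tl Kl.
- move=> l; have [tl|tl] := ltP t1 (T l); first by left => t ht; exact: E_derive.
  have tN t : t1 <= t -> (t < T l) = false by move=> tt; apply/negbTE; rewrite -leNgt (le_trans tl).
  right; split; first by rewrite /curvef !tN// ltW.
  by move=> t ht; apply: E0 => // -[h _]; move: h; rewrite tN//; case/andP: ht.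
- exact: bm.
- exact: bm.
Qed.

End curve_balance.

(** * Geometry of the shock *)

Section derivative_lemmas.
Context {R : realType}.

Lemma is_derive_right_ge0 (f : R -> R) (x d : R) :
  is_derive x 1 f d -> f x = 0 -> (\forall h \near 0^'+, 0 <= f (x + h)) -> 0 <= d.
Proof.
move=> [df <-] fx0 f0.
have h1 : h^-1 *: (f (h *: 1 + x) - f x) @[h --> 0^'+] --> 'D_1 f x.
  apply: cvg_trans df.
  apply: cvg_app => A; rewrite /dnbhs /at_right /within /nbhs/=.
  by apply: filterS => h hA h0; apply: hA; rewrite gt_eqF.
apply: (ler_cvg_to (cvg_cst 0) h1).
have hp : \forall h \near (0 : R)^'+, 0 < h by exact: nbhs_right_gt.
apply: filterS2 hp f0 => h h0; rewrite /GRing.scale/= mulr1 fx0 subr0 addrC => fh.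
by rewrite mulr_ge0// invr_ge0 ltW.
Qed.

Lemma is_derive_affine (c k s : R) : is_derive s 1 (fun s => c + k * s) k.
Proof.
have := is_deriveD (is_derive_cst c s 1) (is_deriveZ k (is_derive_id s 1)).
by rewrite /GRing.scale/= mulr1 add0r.
Qed.

Lemma is_derive_transport (f : R * R -> R) (z w x y : R -> R) (s z' w' x' y' : R) :
  differentiable f (x s, y s) -> is_derive s 1 z z' -> is_derive s 1 w w' ->
  is_derive s 1 x x' -> is_derive s 1 y y' ->
  is_derive s 1 (fun s => z s + w s * f (x s, y s))
    (z' + (w s * (x' * d1 f (x s, y s) + y' * d2 f (x s, y s)) + f (x s, y s) * w')).
Proof.
by move=> df dz dw dx dy; exact: (is_deriveD dz (is_deriveM dw (is_derive_comp2 df dx dy))).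
Qed.

Lemma flow_d (f g : R * R -> R) (t : R) p : differentiable f p -> differentiable g p ->
  flow_jac f g t p = (1 + t * d1 f p) * (1 + t * d2 g p) - t * d2 f p * (t * d1 g p).
Proof.
move=> df dg; have dt' (h k : R * R -> R) : differentiable h p -> differentiable k p ->
    differentiable (fun q => k q + t * h q) p.
  by move=> dh dk; apply: differentiableD => //; exact: differentiableM.
have dfst := @differentiable_fst R R R p; have dsnd := @differentiable_snd R R R p.
case: p df dg dt' dfst dsnd => x y df dg dt' dfst dsnd; rewrite /flow_jac /flow /=.
have [_ <-] := is_derive_d1 (dt' f fst df dfst); have [_ <-] := is_derive_d2 (dt' f fst df dfst).
have [_ <-] := is_derive_d1 (dt' g snd dg dsnd); have [_ <-] := is_derive_d2 (dt' g snd dg dsnd).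
have [_ ->] := is_derive_transport df (is_derive_id x 1) (is_derive_cst t x 1) (is_derive_id x 1) (is_derive_cst y x 1).
have [_ ->] := is_derive_transport df (is_derive_cst x y 1) (is_derive_cst t y 1) (is_derive_cst x y 1) (is_derive_id y 1).
have [_ ->] := is_derive_transport dg (is_derive_cst y x 1) (is_derive_cst t x 1) (is_derive_id x 1) (is_derive_cst y x 1).
have [_ ->] := is_derive_transport dg (is_derive_id y 1) (is_derive_cst t y 1) (is_derive_cst x y 1) (is_derive_id y 1).
by move: (d1 f _) (d2 f _) (d1 g _) (d2 g _) => f1 f2 g1 g2; rewrite /cst; ring.
Qed.

(** Differentiating the characteristic equations, the differential of the flow sends (a_t, b_t) to
    (x_t - U, y_t - W) and (a_l, b_l) to (x_l, y_l). Determinants multiply, and the Jacobian J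
    cancels the one that divides the density. *)
Lemma flux_jacobian (t U W ua ub va vb at_ bt al bl r J xt xl yt yl : R) :
  xt = at_ + (t * (at_ * ua + bt * ub) + U * 1) -> yt = bt + (t * (at_ * va + bt * vb) + W * 1) ->
  xl = al + (t * (al * ua + bl * ub) + U * 0) -> yl = bl + (t * (al * va + bl * vb) + W * 0) ->
  J = (1 + t * ua) * (1 + t * vb) - t * ub * (t * va) -> J != 0 ->
  r / J * ((xt - U) * yl - (yt - W) * xl) = r * (at_ * bl - bt * al).
Proof. by move=> -> -> -> -> -> J0; field. Qed.

(** By the identity of Lagrange, (p y - r x) (sx y - sy x) = (p sx + r sy) (x^2 + y^2) - (sx x + sy
    y) (p x + r y), whose last term vanishes by tangency. *)
Lemma flux_sign (sg sx sy x y p r : R) : sx * x + sy * y = 0 -> 0 < sx * y - sy * x ->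
  0 <= sg * (p * sx + r * sy) -> 0 <= sg * (p * y - r * x).
Proof.
move=> e N0 h; rewrite -(pmulr_lge0 _ N0).
have -> : sg * (p * y - r * x) * (sx * y - sy * x) =
  sg * (p * sx + r * sy) * (x ^+ 2 + y ^+ 2) - sg * (sx * x + sy * y) * (p * x + r * y) by ring.
by rewrite e mulr0 mul0r subr0 mulr_ge0// addr_ge0// sqr_ge0.
Qed.

(** Neither term is negative, and p2 < p1 excludes that both vanish. *)
Lemma flux_difference_gt0 (r1 r2 p1 p2 : R) : 0 < r1 -> 0 < r2 -> 0 <= p1 -> p2 <= 0 -> p2 < p1 ->
  0 < r1 * p1 - r2 * p2.
Proof.
move=> r10 r20 p10 p20 p21; have [p1z|p1p] := eqVneq p1 0.
  by rewrite p1z mulr0 sub0r oppr_gt0 pmulr_rlt0// -p1z.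
have h : 0 < r1 * p1 by rewrite mulr_gt0// lt0r p1p.
by rewrite (lt_le_trans h)// lerDl oppr_ge0 mulr_ge0_le0// ltW.
Qed.

Lemma derive_dtxy (f : R * (R * R) -> R) q (w : R * (R * R)) : differentiable f q ->
  'D_w f q = w.1 * dt f q + w.2.1 * dx f q + w.2.2 * dy f q.
Proof.
Transparent dt dx dy.
move=> df; case: w => z [x y]; rewrite /=.
have -> : (z, (x, y)) = z *: ((1, (0, 0)) : R * (R * R))
   + x *: ((0, (1, 0)) : R * (R * R)) + y *: ((0, (0, 1)) : R * (R * R)).
  by congr pair; [|congr pair]; rewrite /= /GRing.scale/= !(mulr0, mulr1) ?addr0 ?add0r.
by rewrite deriveE// !linearD !linearZ /dt /dx /dy !deriveE.
Opaque dt dx dy.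
Qed.

Lemma c1at_mul (V : normedModType R) (f g : V -> R) q : c1at f q -> c1at g q -> c1at (f \* g) q.
Proof.
move=> cf cg; apply: (near_c1at4 cf cg cf cg) => {cf cg}q cf cg _ _.
have df := c1at_diff cf; have dg := c1at_diff cg; split; first exact: differentiableM.
have := near_c1at4 cf cg cf cg (fun q h1 h2 _ _ => conj h1 h2) => n w.
apply: (@continuous_at_near_eq _ _ (fun z => f z * 'D_w g z + g z * 'D_w f z)).
  apply: filterS n => z [h1 h2].
  have [hd1 hd2] := (c1at_diff h1, c1at_diff h2).
  by rewrite deriveM//; apply: diff_derivable.
apply: cvgD; apply: cvgM; [exact: c1at_continuous|exact: c1at_derive|exact: c1at_continuous|exact: c1at_derive].
Qed.

End derivative_lemmas.

(** * Orientation, densities and fluxes at the shock *)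

Section geometry.
Context {R : realType}.
Variables (A B : R -> R) (G : R * R -> R) (rho u v : bool -> R * R -> R).
Variables (T : R -> R) (V : R -> set (R * R)) (Om : set (R * (R * R))).
Variables (S : R * (R * R) -> R) (xs ys ut vt : R * R -> R).
Variables (a b : bool -> R * R -> R) (rhoS uS vS : bool -> R * (R * R) -> R).
Hypothesis data : compressive_data A B G rho u v.
Hypothesis time : local_time A B G u v T V.
Hypothesis surface : shock_surface A B G u v T V Om S xs ys ut vt a b.
Hypothesis sides : side_solutions G rho u v T V Om S rhoS uS vS.

Let cS q : Om q -> c1at S q. Proof. exact: C1_c1at (ss_S surface). Qed.
Let cX z : pdom T z -> c1at xs z. Proof. exact: C1_c1at (ss_xs surface). Qed.
Let cY z : pdom T z -> c1at ys z. Proof. exact: C1_c1at (ss_ys surface). Qed.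

Let on t l : 0 <= t < T l -> Om (t, (xs (t, l), ys (t, l))) /\ S (t, (xs (t, l), ys (t, l))) = 0.
Proof. by move=> tl; apply/(ss_param surface); exists l. Qed.

Let dX1 t l : 0 <= t < T l -> is_derive t 1 (fun t => xs (t, l)) (d1 xs (t, l)).
Proof. by move=> tl; apply: is_derive_d1; apply: c1at_diff; exact: cX. Qed.
Let dY1 t l : 0 <= t < T l -> is_derive t 1 (fun t => ys (t, l)) (d1 ys (t, l)).
Proof. by move=> tl; apply: is_derive_d1; apply: c1at_diff; exact: cY. Qed.
Let dX2 t l : 0 <= t < T l -> is_derive l 1 (fun l => xs (t, l)) (d2 xs (t, l)).
Proof. by move=> tl; apply: is_derive_d2; apply: c1at_diff; exact: cX. Qed.
Let dY2 t l : 0 <= t < T l -> is_derive l 1 (fun l => ys (t, l)) (d2 ys (t, l)).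
Proof. by move=> tl; apply: is_derive_d2; apply: c1at_diff; exact: cY. Qed.

Let tan t l : 0 <= t < T l -> let q := (t, (xs (t, l), ys (t, l))) in
  dx S q * d2 xs (t, l) + dy S q * d2 ys (t, l) = 0.
Proof.
move=> tl q; have [Oq _] := on tl.
have [_ e1] := is_derive_comp3 (c1at_diff (cS Oq)) (is_derive_cst t l 1) (dX2 tl) (dY2 tl).
have h0 : \forall l' \near l, cst 0 l' = S (t, (xs (t, l'), ys (t, l'))).
  case/andP: tl => t0 /(lt_T_lsc time); apply: filterS => l' tl' /=.
  by have [|_ ->] := @on t l'; rewrite ?t0.
have [_ e2] := near_eq_is_derive h0 (is_derive_cst (0 : R) l 1).
by move: e1; rewrite e2 mul0r add0r ![d2 _ _ * _]mulrC => <-.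
Qed.

Let tim t l : 0 <= t < T l -> let q := (t, (xs (t, l), ys (t, l))) in
  dt S q + dx S q * d1 xs (t, l) + dy S q * d1 ys (t, l) = 0.
Proof.
move=> tl q; have [Oq Sq] := on tl.
have dS := is_derive_comp3 (c1at_diff (cS Oq)) (is_derive_id t 1) (dX1 tl) (dY1 tl).
suff : 1 * dt S q + d1 xs (t, l) * dx S q + d1 ys (t, l) * dy S q = 0.
  by rewrite mul1r ![d1 _ _ * _]mulrC.
apply: (is_derive_right0 dS Sq).
case/andP: tl => t0 tT; have h0 : (0 : R) < T l - t by rewrite subr_gt0.
near=> h; have [|_ ->//] := @on (t + h) l.
apply/andP; split; first by rewrite addr_ge0//; apply: ltW; near: h; exact: nbhs_right_gt.
by rewrite -ltrBrDl; near: h; exact: nbhs_right_lt.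
Unshelve. all: by end_near. Qed.

Lemma shock_surf : surf T Om S xs ys.
Proof.
constructor.
- exact: ss_domain surface.
- exact: cS.
- exact: lt_T_lsc time.
- exact: cX.
- exact: cY.
- exact: on.
- by move=> t p Op Sp; apply/(ss_param surface).
- exact: ss_inj surface.
- move=> z /(ss_immersion surface); rewrite xpair_eqE negb_and => /orP[]; by [left|right].
- exact: tan.
(* Regularity of S only says that its space-time gradient is nonzero. If S_x = S_y = 0, the identity
   [tim] forces S_t = 0 as well. *)
- move=> q Oq Sq; apply: contrapT => /not_orP[/negP/negPn/eqP h1 /negP/negPn/eqP h2].
  have [w] := ss_regular surface Oq Sq.
  rewrite derive_dtxy ?h1 ?h2; last exact: c1at_diff (cS Oq).
  have [|l tl qE] := (ss_param surface q.1 q.2).1; first by rewrite -surjective_pairing.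
  have := tim tl; rewrite -qE -surjective_pairing /= h1 h2 !mul0r !addr0 => ->.
  by rewrite !mulr0 !addr0 eqxx.
- exact: tim.
Qed.

(** The gradient and the tangent are orthogonal and nonzero, so their cross product cannot vanish,
    and along each l it keeps its sign by continuity in t. At t = 0 it is the derivative of S along
    the right normal (B_l, - A_l), on which [cd_right] makes S positive. *)
Lemma shock_orient t l : 0 <= t < T l -> let q := (t, (xs (t, l), ys (t, l))) in
  0 < dx S q * d2 ys (t, l) - dy S q * d2 xs (t, l).
Proof.
have neq0 s l' : 0 <= s < T l' -> dx S (s, (xs (s, l'), ys (s, l'))) * d2 ys (s, l') -
    dy S (s, (xs (s, l'), ys (s, l'))) * d2 xs (s, l') != 0.
  move=> tl; set q := (s, _); have [Oq Sq] := on tl.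
  have e : dx S q * d2 xs (s, l') + dy S q * d2 ys (s, l') = 0 := tan tl.
  have h1 : dx S q != 0 \/ dy S q != 0 := su_reg shock_surf Oq Sq; have h2 := @su_imm _ _ _ _ _ _ shock_surf (s, l') tl.
  apply: contraPN h1 => /eqP; move: e h2.
  move: (dx S q) (dy S q) (d2 xs _) (d2 ys _) => c d x y e1 h e2.
  have n0 : x ^+ 2 + y ^+ 2 != 0 by rewrite paddr_eq0 ?sqr_ge0// !expf_eq0/= negb_and; case: h => ->; rewrite ?orbT.
  have c0 : c * (x ^+ 2 + y ^+ 2) = 0.
    have -> : c * (x ^+ 2 + y ^+ 2) = (c * x + d * y) * x + (c * y - d * x) * y by ring.
    by rewrite e1 e2 !mul0r addr0.
  have d0 : d * (x ^+ 2 + y ^+ 2) = 0.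
    have -> : d * (x ^+ 2 + y ^+ 2) = (c * x + d * y) * y - (c * y - d * x) * x by ring.
    by rewrite e1 e2 !mul0r subr0.
  move/eqP: c0; rewrite mulf_eq0 (negPf n0) orbF => /eqP ->.
  by move/eqP: d0; rewrite mulf_eq0 (negPf n0) orbF => /eqP -> []; rewrite eqxx.
move=> tl; have /andP[t0 tT] := tl.
pose N s := let q := (s, (xs (s, l), ys (s, l))) in dx S q * d2 ys (s, l) - dy S q * d2 xs (s, l).
have cN s : 0 <= s < T l -> {for s, continuous N}.
  move=> sl; have [Oq _] := on sl.
  have cs (h : R * R -> R) : {for (s, l), continuous h} -> {for s, continuous (fun s => h (s, l))}.
    move=> ch; apply: (@continuous_comp _ _ _ (fun s => (s, l)) h); last exact: ch.
    by apply: continuous_at_pair; [exact: cvg_id|exact: cvg_cst].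
  have cq : {for s, continuous (fun s => (s, (xs (s, l), ys (s, l))))}.
    apply: continuous_at_pair; first exact: cvg_id.
    by apply: continuous_at_pair; apply: cs; apply: c1at_continuous; [exact: cX|exact: cY].
  apply: cvgB; apply: cvgM.
  - exact: (continuous_comp cq (c1at_dx (cS Oq))).
  - by apply: cs; exact: (c1at_d2 (@cY (s, l) sl)).
  - exact: (continuous_comp cq (c1at_dy (cS Oq))).
  - by apply: cs; exact: (c1at_d2 (@cX (s, l) sl)).
have l0 : (0 : R) <= 0 < T l by rewrite lexx (le_lt_trans t0).
have N0 : 0 < N 0.
  rewrite lt_neqAle eq_sym neq0//=.
  have [Oq Sq] := on l0; have [eX eY] := ss_issued surface l.
  have e1 : d2 xs (0, l) = derive1 A l.
    have eA : (fun l => xs (0, l)) = A by apply/funext => l'; have [-> _] := ss_issued surface l'.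
    by have [_ <-] := dX2 l0; rewrite derive1E eA.
  have e2 : d2 ys (0, l) = derive1 B l.
    have eB : (fun l => ys (0, l)) = B by apply/funext => l'; have [_ ->] := ss_issued surface l'.
    by have [_ <-] := dY2 l0; rewrite derive1E eB.
  pose x (s : R) : R := A l + derive1 B l * s; pose y (s : R) : R := B l + - derive1 A l * s.
  have dxs : is_derive (0 : R) 1 x (derive1 B l) by exact: is_derive_affine.
  have dys : is_derive (0 : R) 1 y (- derive1 A l) by exact: is_derive_affine.
  have q0 : (xs (0, l), ys (0, l)) = (x 0, y 0) by rewrite eX eY /x /y !mulr0 !addr0.
  rewrite /N q0 in Oq Sq *.
  have dS := @is_derive_comp3 R S (cst 0) x y 0 0 _ _ (c1at_diff (cS Oq)) (is_derive_cst (0 : R) (0 : R) 1) dxs dys.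
  suff : 0 <= 0 * dt S (0, (x 0, y 0)) + derive1 B l * dx S (0, (x 0, y 0)) + - derive1 A l * dy S (0, (x 0, y 0)).
    rewrite e1 e2; move: (dt S _) (dx S _) (dy S _) (derive1 A l) (derive1 B l) => c1 c2 c3 c4 c5.
    by have -> : 0 * c1 + c5 * c2 + - c4 * c3 = c2 * c5 - c3 * c4 by ring.
  apply: (is_derive_right_ge0 dS Sq).
  have [W oW OmW] := ss_domain surface.
  have nW : \forall s \near (0 : R), W (0, (x s, y s)).
    have cxy : {for 0, continuous (fun s => ((0 : R), (x s, y s)))}.
      apply: continuous_at_pair; first exact: cvg_cst.
      by apply: continuous_at_pair; apply: differentiable_continuous; apply/derivable1_diffP; [case: dxs|case: dys].
    apply: cxy; apply: open_nbhs_nbhs; split => //.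
    by move: Oq; rewrite OmW => -[].
  have nW' : \forall s \near (0 : R)^'+, W (0, (x s, y s)) by apply: cvg_at_right_filter nW; exact: cvg_id.
  apply: filterS2 nW' (cd_right data l) => s Ws /=; rewrite add0r [s * derive1 B l]mulrC [s * derive1 A l]mulrC -mulNr => Gs.
  have Os : Om (0, (x s, y s)) by rewrite OmW; split => //=.
  have [_ /(_ true) [_ /(_ Gs)]] := ss_initial_surface surface Os.
  exact: ltW.
suff : 0 < N t by [].
rewrite lt_neqAle eq_sym neq0//= leNgt; apply/negP => Nt.
have [||s] := @IVT R N 0 t 0 t0.
- apply: continuous_in_subspaceT => s; rewrite inE/= in_itv/= => /andP[s0 st].
  by apply: cN; rewrite s0 (le_lt_trans st).
- by rewrite ge_min le_max (ltW N0) (ltW Nt) orbT.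
rewrite in_itv/= => /andP[s0 st] Ns.
have sl : 0 <= s < T l by rewrite s0 (le_lt_trans st).
by have := neq0 _ _ sl; rewrite /= -/(N s) Ns eqxx.
Qed.

(** For t > 0 the Jacobian of the flow is nonzero and the characteristic equations of the feet hold
    at times on both sides of t, so they can be differentiated; [flux_jacobian] then applies. *)
Lemma side_flow j t l : 0 < t < T l -> let q := (t, (xs (t, l), ys (t, l))) in
  let p := (a j (t, l), b j (t, l)) in
  [/\ uS j q = u j p, vS j q = v j p &
   rhoS j q * ((d1 xs (t, l) - uS j q) * d2 ys (t, l) - (d1 ys (t, l) - vS j q) * d2 xs (t, l)) =
   rho j p * (d1 (a j) (t, l) * d2 (b j) (t, l) - d1 (b j) (t, l) * d2 (a j) (t, l))].
Proof.
move=> /[dup] tl0 /andP[t0 tT] q p; have tl : 0 <= t < T l by rewrite ltW.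
have [Oq Sq] := on tl; have [clp Vp fp] := ss_feet surface j tl.
have cq : cside j (S q) by rewrite /cside (_ : S q = 0)//; case: (j).
have [uE vE rE] := so_formulas sides Oq cq tT Vp clp fp.
split => //; rewrite -/q -/p in uE vE rE *; rewrite uE vE rE.
have J0 : flow_jac (u j) (v j) t p != 0 := lt_nondegenerate time tl0 Vp clp.
have cu : c1at (u j) p := C1_c1at (cd_u data j) clp.
have cv : c1at (v j) p := C1_c1at (cd_v data j) clp.
have ca : c1at (a j) (t, l) by exact: (C1_c1at (ss_a surface j) (tl : pdom T (t, l))).
have cb : c1at (b j) (t, l) by exact: (C1_c1at (ss_b surface j) (tl : pdom T (t, l))).
have near_tl : \forall z \near (t, l), 0 <= z.1 < T z.2.
  have n1 := pdom_near (lt_T_lsc time) tT.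
  have n2 : \forall z \near (t, l), 0 < z.1.
    have := @continuous_at_fst _ _ (t, l); rewrite /prop_for /continuous_at => /cvgr_gt; exact.
  by apply: filterS2 n1 n2 => z h1 h2; rewrite ltW.
have ct : {for t, continuous (fun t => (t, l))}.
  by apply: continuous_at_pair; [exact: cvg_id|exact: cvg_cst].
have cl : {for l, continuous (fun l => (t, l))}.
  by apply: continuous_at_pair; [exact: cvg_cst|exact: cvg_id].
have nt : \forall s \near t, 0 <= s < T l := ct _ near_tl.
have nl : \forall s \near l, 0 <= t < T s := cl _ near_tl.
have a1 : is_derive t 1 (fun s => a j (s, l)) (d1 (a j) (t, l)) := is_derive_d1 (c1at_diff ca).
have b1 : is_derive t 1 (fun s => b j (s, l)) (d1 (b j) (t, l)) := is_derive_d1 (c1at_diff cb).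
have a2 : is_derive l 1 (fun s => a j (t, s)) (d2 (a j) (t, l)) := is_derive_d2 (c1at_diff ca).
have b2 : is_derive l 1 (fun s => b j (t, s)) (d2 (b j) (t, l)) := is_derive_d2 (c1at_diff cb).
have du : differentiable (u j) (a j (t, l), b j (t, l)) := c1at_diff cu.
have dv : differentiable (v j) (a j (t, l), b j (t, l)) := c1at_diff cv.
have feet s l' : 0 <= s < T l' -> a j (s, l') + s * u j (a j (s, l'), b j (s, l')) = xs (s, l') /\
    b j (s, l') + s * v j (a j (s, l'), b j (s, l')) = ys (s, l').
  by move=> h; have [_ _ [-> ->]] := ss_feet surface j h.
apply: (@flux_jacobian _ t _ _ (d1 (u j) p) (d2 (u j) p) (d1 (v j) p) (d2 (v j) p)) J0; last exact: flow_d.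
- have [_ <-] := dX1 tl; have [_ <-] := is_derive_transport du a1 (is_derive_id t 1) a1 b1.
  by apply/esym/near_eq_derive; apply: filterS nt => s h; have [] := feet _ _ h.
- have [_ <-] := dY1 tl; have [_ <-] := is_derive_transport dv b1 (is_derive_id t 1) a1 b1.
  by apply/esym/near_eq_derive; apply: filterS nt => s h; have [] := feet _ _ h.
- have [_ <-] := dX2 tl; have [_ <-] := is_derive_transport du a2 (is_derive_cst t l 1) a2 b2.
  by apply/esym/near_eq_derive; apply: filterS nl => s h; have [] := feet _ _ h.
- have [_ <-] := dY2 tl; have [_ <-] := is_derive_transport dv b2 (is_derive_cst t l 1) a2 b2.
  by apply/esym/near_eq_derive; apply: filterS nl => s h; have [] := feet _ _ h.
Qed.

Let Om_ge0 t p : Om (t, p) -> 0 <= t.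
Proof. by have [W _ ->] := ss_domain surface; case. Qed.

(** The Jacobian of the flow at a fixed foot is 1 at time 0 and has no zero before T l, so it stays
    positive up to time t. *)
Lemma rhoS_gt0 j t p : Om (t, p) -> cside j (S (t, p)) -> 0 < rhoS j (t, p).
Proof.
move=> Op Sp; have [l [p0 [tT Vp clp pE]]] := so_characteristics sides Op Sp.
have [_ _ ->] := so_formulas sides Op Sp tT Vp clp pE.
have t0 := Om_ge0 Op; rewrite divr_gt0 ?(cd_rho_gt0 data)//.
have du : differentiable (u j) p0 := c1at_diff (C1_c1at (cd_u data j) clp).
have dv : differentiable (v j) p0 := c1at_diff (C1_c1at (cd_v data j) clp).
pose J s := flow_jac (u j) (v j) s p0.
have JE : J = fun s => (1 + s * d1 (u j) p0) * (1 + s * d2 (v j) p0) - s * d2 (u j) p0 * (s * d1 (v j) p0).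
  by apply/funext => s; exact: flow_d.
have J0 : J 0 = 1 by rewrite JE !mul0r !addr0 mulr1 subr0.
have cJ : continuous J.
  move=> s; rewrite JE; have ck (k : R) : {for s, continuous (fun s : R => s * k)}.
    by apply: cvgM; [exact: cvg_id|exact: cvg_cst].
  by apply: cvgB; apply: cvgM; [apply: cvgD; [exact: cvg_cst|exact: ck]..|exact: ck|exact: ck].
rewrite ltNge; apply/negP => Jt.
have [||s] := @IVT R J 0 t 0 t0.
- by apply: continuous_subspaceT.
- by rewrite ge_min le_max J0 Jt ler01 orbT.
rewrite in_itv/= => /andP[s0 st] Js.
have sN0 : s != 0 by apply/eqP => e; move: Js; rewrite e J0 => /eqP; rewrite oner_eq0.
have sl : 0 < s < T l by rewrite lt0r sN0 s0 (le_lt_trans st tT).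
by have := lt_nondegenerate time sl Vp clp; rewrite -/(J s) Js eqxx.
Qed.

(** The right derivative at t = 0 of x^s = a + t u (a, b) and y^s = b + t v (a, b): the terms with
    the derivatives of u and v carry the factor t. *)
Let feet_rate j l : 0 < T l ->
  d1 (a j) (0, l) = d1 xs (0, l) - u j (A l, B l) /\ d1 (b j) (0, l) = d1 ys (0, l) - v j (A l, B l) /\
  (a j (0, l), b j (0, l)) = (A l, B l).
Proof.
move=> T0; have tl : (0 : R) <= 0 < T l by rewrite lexx.
have [clp Vp fp] := ss_feet surface j tl.
have ab : (a j (0, l), b j (0, l)) = (A l, B l).
  have [<- <-] := ss_issued surface l; rewrite fp /flow /= !mul0r !addr0//.
have [eA eB] : a j (0, l) = A l /\ b j (0, l) = B l by case: ab.
have ca : c1at (a j) (0, l) by exact: (C1_c1at (ss_a surface j) (tl : pdom T (0, l))).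
have cb : c1at (b j) (0, l) by exact: (C1_c1at (ss_b surface j) (tl : pdom T (0, l))).
have a1 : is_derive (0 : R) 1 (fun s => a j (s, l)) (d1 (a j) (0, l)) := is_derive_d1 (c1at_diff ca).
have b1 : is_derive (0 : R) 1 (fun s => b j (s, l)) (d1 (b j) (0, l)) := is_derive_d1 (c1at_diff cb).
have du : differentiable (u j) (a j (0, l), b j (0, l)) := c1at_diff (C1_c1at (cd_u data j) clp).
have dv : differentiable (v j) (a j (0, l), b j (0, l)) := c1at_diff (C1_c1at (cd_v data j) clp).
have near0 (P : R -> Prop) : (forall s, 0 <= s < T l -> P s) -> \forall h \near (0 : R)^'+, P (0 + h).
  move=> hP; near=> h; apply: hP; rewrite add0r; apply/andP; split.
    by apply: ltW; near: h; exact: nbhs_right_gt.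
  by near: h; exact: nbhs_right_lt.
have feet s : 0 <= s < T l -> a j (s, l) + s * u j (a j (s, l), b j (s, l)) - xs (s, l) = 0 /\
    b j (s, l) + s * v j (a j (s, l), b j (s, l)) - ys (s, l) = 0.
  by move=> h; have [_ _ [-> ->]] := ss_feet surface j h; rewrite !subrr.
have da := is_deriveB (is_derive_transport du a1 (is_derive_id (0 : R) 1) a1 b1) (dX1 tl).
have db := is_deriveB (is_derive_transport dv b1 (is_derive_id (0 : R) 1) a1 b1) (dY1 tl).
have := is_derive_right0 da (feet 0 tl).1 (near0 _ (fun s h => (feet s h).1)).
have := is_derive_right0 db (feet 0 tl).2 (near0 _ (fun s h => (feet s h).2)).
rewrite !mul0r !add0r !mulr1 ab => /eqP; rewrite subr_eq0 => /eqP <- /eqP; rewrite subr_eq0 => /eqP <-.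
by rewrite !addrK.
Unshelve. all: by end_near. Qed.

(* At t = 0 the feet leave the shock into their own sides, which gives the sign of each flux;
   their difference is the compression hypothesis. *)
Lemma initial_flux_gt0 l : 0 < T l ->
  0 < fluxm (rhoS true) (uS true) (vS true) xs ys (0, l) -
      fluxm (rhoS false) (uS false) (vS false) xs ys (0, l).
Proof.
move=> T0; have tl : (0 : R) <= 0 < T l by rewrite lexx.
have [Oq Sq] := on tl; have N0 := shock_orient tl; have e := tan tl.
have [eX eY] := ss_issued surface l; rewrite eX eY in Oq Sq N0 e.
have XA : d2 xs (0, l) = derive1 A l.
  have eA : (fun l => xs (0, l)) = A by apply/funext => l'; have [-> _] := ss_issued surface l'.
  by have [_ <-] := dX2 tl; rewrite derive1E eA.
have YB : d2 ys (0, l) = derive1 B l.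
  have eB : (fun l => ys (0, l)) = B by apply/funext => l'; have [_ ->] := ss_issued surface l'.
  by have [_ <-] := dY2 tl; rewrite derive1E eB.
have cs0 j : cside j (S (0, (A l, B l))) by rewrite /cside Sq; case: j.
have ini j := so_initial sides Oq (cs0 j).
(* S at time 0 is followed along the moving feet. They stay in the closure of region j, where G,
   hence S (0, .), has the weak sign of j, and S is 0 at the start. *)
have sgn j (sg : R) : (forall p, cside j p -> 0 <= sg * p) ->
    0 <= sg * ((d1 xs (0, l) - u j (A l, B l)) * dx S (0, (A l, B l)) +
               (d1 ys (0, l) - v j (A l, B l)) * dy S (0, (A l, B l))).
  move=> sgP; have [ea [eb ab]] := feet_rate j T0; rewrite -ea -eb.
  have ca : c1at (a j) (0, l) by exact: (C1_c1at (ss_a surface j) (tl : pdom T (0, l))).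
  have cb : c1at (b j) (0, l) by exact: (C1_c1at (ss_b surface j) (tl : pdom T (0, l))).
  have a1 : is_derive (0 : R) 1 (fun s => a j (s, l)) (d1 (a j) (0, l)) := is_derive_d1 (c1at_diff ca).
  have b1 : is_derive (0 : R) 1 (fun s => b j (s, l)) (d1 (b j) (0, l)) := is_derive_d1 (c1at_diff cb).
  have dS0 : differentiable S (cst 0 (0 : R), (a j (0, l), b j (0, l))).
    by rewrite ab; exact: c1at_diff (cS Oq).
  have dS := is_deriveZ sg (is_derive_comp3 dS0 (is_derive_cst (0 : R) (0 : R) 1) a1 b1).
  have {dS}dS : is_derive (0 : R) 1 (fun s => sg * S (0, (a j (s, l), b j (s, l))))
      (sg * (d1 (a j) (0, l) * dx S (0, (A l, B l)) + d1 (b j) (0, l) * dy S (0, (A l, B l)))).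
    apply: is_derive_eq dS _; rewrite /GRing.scale/= ab.
    by congr (_ * _); rewrite mul0r add0r.
  have S00 : sg * S (0, (a j (0, l), b j (0, l))) = 0 by rewrite ab Sq mulr0.
  apply: (is_derive_right_ge0 dS S00).
  have [W oW OmW] := ss_domain surface.
  have nW : \forall s \near (0 : R), W (0, (a j (s, l), b j (s, l))).
    have cab : {for 0, continuous (fun s => ((0 : R), (a j (s, l), b j (s, l))))}.
      apply: continuous_at_pair; first exact: cvg_cst.
      by apply: continuous_at_pair; apply: differentiable_continuous; apply/derivable1_diffP; [case: a1|case: b1].
    apply: cab; apply: open_nbhs_nbhs; split => //.
    by rewrite ab; move: Oq; rewrite OmW => -[].
  have nW' : \forall s \near (0 : R)^'+, W (0, (a j (s, l), b j (s, l))) by apply: cvg_at_right_filter nW; exact: cvg_id.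
  have nT : \forall s \near (0 : R)^'+, 0 < s < T l.
    near=> s; apply/andP; split; near: s; [exact: nbhs_right_gt|exact: nbhs_right_lt].
  apply: filterS2 nW' nT => s Ws /andP[s0 sT]; rewrite add0r.
  have sl : 0 <= s < T l by rewrite ltW.
  have Os : Om (0, (a j (s, l), b j (s, l))) by rewrite OmW; split => //=.
  have [clp _ _] := ss_feet surface j sl.
  have cG : continuous G by move=> p; apply: c1at_continuous; exact: C1_c1at (cd_G data) I.
  apply: sgP; have [_ Sj] := ss_initial_surface surface Os.
  have clG (D : set R) : closed D -> region G j `<=` G @^-1` D -> D (G (a j (s, l), b j (s, l))).
    move=> cD jD; have cGD : closed (G @^-1` D) by exact: closed_comp (fun p _ => cG p) cD.
    by apply: cGD; apply: closureS jD _ clp.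
  case: (j) Sj clG => Sj clG.
    rewrite /cside leNgt; apply/negP => /(Sj false) /=; apply/negP; rewrite -leNgt.
    by apply: (clG [set z | 0 <= z]); [exact: closed_ge|move=> p /ltW].
  rewrite /cside leNgt; apply/negP => /(Sj true) /=; apply/negP; rewrite -leNgt.
  by apply: (clG [set z | z <= 0]); [exact: closed_le|move=> p /ltW].
have s1 : 0 <= 1 * ((d1 xs (0, l) - u true (A l, B l)) * d2 ys (0, l) - (d1 ys (0, l) - v true (A l, B l)) * d2 xs (0, l)).
  by apply: flux_sign e N0 _; apply: sgn => z /= h; rewrite mul1r.
have s2 : 0 <= -1 * ((d1 xs (0, l) - u false (A l, B l)) * d2 ys (0, l) - (d1 ys (0, l) - v false (A l, B l)) * d2 xs (0, l)).
  by apply: flux_sign e N0 _; apply: sgn => z /= h; rewrite mulN1r oppr_ge0.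
rewrite mul1r in s1; rewrite mulN1r oppr_ge0 in s2.
rewrite /fluxm /= eX eY.
have [-> -> ->] := ini true; have [-> -> ->] := ini false.
have clp j : closure (region G j) (A l, B l).
  by have [_ [_ <-]] := feet_rate j T0; have [] := ss_feet surface j tl.
have rp := cd_rho_gt0 data (clp true); have rm := cd_rho_gt0 data (clp false).
apply: (flux_difference_gt0 rp rm s1 s2).
have c1 := cd_compressive_minus data l; have c2 := cd_compressive_plus data l.
rewrite XA YB; move: c1 c2; move: (derive1 A l) (derive1 B l) (d1 xs _) (d1 ys _) => c d e1 e2.
move: (u false _) (v false _) (u true _) (v true _) => w1 w2 w3 w4 h1 h2.
(* The term with the shock velocity is common to both sides, so only A_l v - B_l u is compared. *)
have -> : (e1 - w1) * d - (e2 - w2) * c = (e1 * d - e2 * c) + (c * w2 - d * w1) by ring.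
have -> : (e1 - w3) * d - (e2 - w4) * c = (e1 * d - e2 * c) + (c * w4 - d * w3) by ring.
by rewrite ltrD2l (lt_trans h1).
Unshelve. all: by end_near. Qed.

End geometry.

(** * Test functions and the total balance *)

Section bumps.
Context {R : realType}.

Lemma c1at_comp1 (V : normedModType R) (h h' : R -> R) (g : V -> R) (q : V) :
  (forall x : R, is_derive x 1 h (h' x)) -> continuous h' -> c1at g q -> c1at (h \o g) q.
Proof.
move=> dh ch' cg; apply: (near_c1at4 cg cg cg cg) => {cg}q cg _ _ _.
have dh' x : differentiable h x by apply/derivable1_diffP; have [] := dh x.
have dg := c1at_diff cg; split; first exact: differentiable_comp.
have e w z : differentiable g z -> 'D_w (h \o g) z = 'D_w g z * h' (g z).
  move=> dz; rewrite deriveE; last exact: differentiable_comp.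
  by rewrite diff_comp//= diff1E// derive1E; have [_ ->] := dh (g z); rewrite deriveE.
move=> w; apply: (@continuous_at_near_eq _ _ (fun z => 'D_w g z * h' (g z))).
  by apply: (near_c1at4 cg cg cg cg) => z cz _ _ _; rewrite e//; exact: c1at_diff.
apply: cvgM; first exact: c1at_derive.
by apply: (@continuous_comp _ _ _ g h'); [exact: c1at_continuous|exact: ch'].
Qed.

Lemma c1atW (V : normedModType R) (f : V -> R) (q : V) :
  (forall z, differentiable f z /\ forall w, {for z, continuous ('D_w f)}) -> c1at f q.
Proof. by move=> h; exact: nearW. Qed.

Lemma c1at_fst (q : R * R) : c1at (fst : R * R -> R) q.
Proof.
apply: c1atW => z; split; first exact: differentiable_fst.
move=> w; have -> : 'D_w (fst : R * R -> R) = cst w.1; last exact: cvg_cst.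
apply/funext => y; rewrite deriveE; last exact: differentiable_fst.
by rewrite (@diff_lin R (R * R)%type R fst)// => x; exact: continuous_at_fst.
Qed.

Lemma c1at_snd (q : R * R) : c1at (snd : R * R -> R) q.
Proof.
apply: c1atW => z; split; first exact: differentiable_snd.
move=> w; have -> : 'D_w (snd : R * R -> R) = cst w.2; last exact: cvg_cst.
apply/funext => y; rewrite deriveE; last exact: differentiable_snd.
by rewrite (@diff_lin R (R * R)%type R snd)// => x; exact: continuous_at_snd.
Qed.

(** For d > 0, a C^1 function that is positive exactly on |x - c| < d. *)
Definition bump1 (c d x : R) : R := psq (x - (c - d)) * psq (c + d - x).

Lemma bump1_ge0 (c d x : R) : 0 <= bump1 c d x.
Proof. by rewrite mulr_ge0// psq_ge0. Qed.

Lemma psq_gt0 (x : R) : 0 < x -> 0 < psq x.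
Proof. by move=> x0; rewrite /psq (max_idPr (ltW x0)) exprn_gt0. Qed.

Lemma psq_le0 (x : R) : x <= 0 -> psq x = 0.
Proof. by move=> x0; rewrite /psq (max_idPl x0) expr0n. Qed.

Lemma bump1_out (c d x : R) : ~~ (`|x - c| < d) -> bump1 c d x = 0.
Proof.
rewrite -leNgt => h; rewrite /bump1.
have [h1|h1] := leP (x - (c - d)) 0; first by rewrite psq_le0// mul0r.
rewrite [X in _ * X]psq_le0 ?mulr0//; move: h; rewrite ler_normr => /orP[]; lra.
Qed.

Lemma bump1_center (c d : R) : 0 < d -> 0 < bump1 c d c.
Proof. by move=> d0; rewrite mulr_gt0// psq_gt0//; lra. Qed.

Lemma is_derive_bump1 (c d x : R) : is_derive x 1 (bump1 c d)
  (psq (x - (c - d)) * (- (2 * Num.max 0 (c + d - x))) + psq (c + d - x) * (2 * Num.max 0 (x - (c - d)))).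
Proof.
have h1 : is_derive x 1 (fun x => psq (x - (c - d))) (2 * Num.max 0 (x - (c - d))).
  have g : is_derive x 1 (fun x => x - (c - d)) 1.
    have := is_deriveB (is_derive_id x 1) (is_derive_cst (c - d) x 1).
    by rewrite subr0.
  have := @is_derive1_comp R psq (fun x => x - (c - d)) x _ _ (is_derive_psq (x - (c - d))) g.
  by rewrite mulr1.
have h2 : is_derive x 1 (fun x => psq (c + d - x)) (- (2 * Num.max 0 (c + d - x))).
  have g : is_derive x 1 (fun x => c + d - x) (-1).
    have := is_deriveB (is_derive_cst (c + d) x 1) (is_derive_id x 1).
    by rewrite sub0r.
  have := @is_derive1_comp R psq (fun x => c + d - x) x _ _ (is_derive_psq (c + d - x)) g.
  by rewrite mulrN1.
exact: is_deriveM h1 h2.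
Qed.

Definition bump (p0 : R * R) (d : R) (p : R * R) : R := bump1 p0.1 d p.1 * bump1 p0.2 d p.2.

Lemma bump_Cc1 p0 d : 0 < d -> Cc1 (bump p0 d) /\
  (forall p, supp (bump p0 d) p -> `|p.1 - p0.1| <= d /\ `|p.2 - p0.2| <= d).
Proof.
move=> dgt0; pose D : set (R * R) := `[p0.1 - d, p0.1 + d]%classic `*` `[p0.2 - d, p0.2 + d]%classic.
have cD : compact D by apply: compact_setX; exact: segment_compact.
have clD : closed D by exact: compact_closed.
have sD : supp (bump p0 d) `<=` D.
  have : [set p | bump p0 d p != 0] `<=` D.
    move=> p /= h; have [h1|h1] := boolP (`|p.1 - p0.1| < d); last by move: h; rewrite /bump bump1_out// mul0r eqxx.
    have [h2|h2] := boolP (`|p.2 - p0.2| < d); last by move: h; rewrite /bump [X in _ * X]bump1_out// mulr0 eqxx.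
    by move: h1 h2; rewrite !ltr_norml => h1 h2; split; rewrite /= in_itv/=; lra.
  by move/closureS => /subset_trans; apply; exact: clD.
split; last first.
  by move=> p /sD[/=]; rewrite !in_itv/= !ler_norml => h1 h2; split; lra.
split; last by apply: subclosed_compact cD sD; exact: closed_closure.
exists setT; first by split => //; exact: openT.
have ch (c : R) : continuous (fun x => psq (x - (c - d)) * (- (2 * Num.max 0 (c + d - x))) + psq (c + d - x) * (2 * Num.max 0 (x - (c - d)))).
  have cp (k : R -> R) : continuous k -> continuous (fun x => psq (k x)).
    by move=> ck x; apply: (@continuous_comp _ _ _ k psq); [exact: ck|exact: continuous_psq].
  have cm (k : R -> R) : continuous k -> continuous (fun x => 2 * Num.max 0 (k x)).
    move=> ck x; apply: cvgMr; apply: (@continuous_max _ _ (cst 0) k); [exact: cvg_cst|exact: ck].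
  have c1 : continuous (fun x : R => x - (c - d)) by move=> x; apply: cvgB; [exact: cvg_id|exact: cvg_cst].
  have c2 : continuous (fun x : R => c + d - x) by move=> x; apply: cvgB; [exact: cvg_cst|exact: cvg_id].
  move=> x; apply: cvgD; apply: cvgM; [exact: (cp _ c1 x)|exact: cvgN (cm _ c2 x)|exact: (cp _ c2 x)|exact: (cm _ c1 x)].
move=> p _; suff cb : c1at (bump p0 d) p by split; [exact: c1at_diff|move=> w; exact: c1at_derive].
apply: (@c1at_mul _ _ (fun p : R * R => bump1 p0.1 d p.1) (fun p : R * R => bump1 p0.2 d p.2)).
- exact: (c1at_comp1 (is_derive_bump1 p0.1 d) (ch p0.1) (c1at_fst p)).
- exact: (c1at_comp1 (is_derive_bump1 p0.2 d) (ch p0.2) (c1at_snd p)).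
Qed.

Lemma bump_ge0 p0 d p : 0 <= bump p0 d p.
Proof. by rewrite mulr_ge0// bump1_ge0. Qed.

Lemma bump_gt0 p0 d : 0 < d -> 0 < bump p0 d p0.
Proof. by move=> d0; rewrite mulr_gt0// bump1_center. Qed.

Lemma int_ge0_eq0 (g : R -> R) (x0 : R) : bcs1 g -> (forall x, 0 <= g x) ->
  {for x0, continuous g} -> \int[leb R]_x g x = 0 -> g x0 = 0.
Proof.
move=> bg g0 cg I0; apply/eqP; rewrite eq_le g0 andbT leNgt; apply/negP => gx0.
have [r /= r0 rg] : exists2 r : R, 0 < r & forall x, `|x - x0| <= r -> g x0 / 2 <= g x.
  have /cvgr_ge/(_ (g x0 / 2)) : g x @[x --> x0] --> g x0 by exact: cg.
  rewrite half_ltr// => /(_ isT)/nbhs_ballP[r /= r0 rP].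
  exists (r / 2) => [|x hx]; first by rewrite divr_gt0.
  by apply: rP; rewrite /ball/= distrC (le_lt_trans hx)// half_ltr.
suff : g x0 / 2 * ((x0 + r) - (x0 - r)) <= \int[leb R]_x g x.
  rewrite I0 leNgt => /negP; apply; rewrite mulr_gt0// ?divr_gt0//; lra.
rewrite -Rintegral_cst_segment; last by lra.
rewrite Rintegral_mkcond; apply: le_Rintegral => //.
- have := @bcs1_integrable _ ((fun=> g x0 / 2) \_ `[x0 - r, x0 + r]).
  apply; split.
    by apply: (measurable_restrictT _ _).1 => //; exact: measurable_cst.
  exists (g x0 / 2 + (`|x0| + r)); first by rewrite addr_ge0 ?divr_ge0// ?addr_ge0// ltW.
  move=> x; rewrite patchE; case: ifPn => [|_]; last by split=> //; rewrite normr0 addr_ge0 ?divr_ge0// ?addr_ge0// ltW.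
  rewrite inE/= in_itv/= => hx; split.
    by rewrite ger0_norm ?divr_ge0// lerDl addr_ge0// ltW.
  rewrite ltNge => /negP h; exfalso; apply: h.
  have -> : x = x0 + (x - x0) by rewrite addrC subrK.
  rewrite (le_trans (ler_normD _ _))// -[leLHS]add0r lerD ?divr_ge0// lerD2l.
  by rewrite ler_norml; lra.
- exact: bcs1_integrable.
- move=> x _; rewrite patchE; case: ifPn => // ; rewrite inE/= in_itv/= => hx.
  by apply: rg; rewrite ler_norml; lra.
Qed.

(** The weak form holds on every time interval, so no test function in time is needed: a positive
    value at t0 would give a positive integral over a short segment starting at t0. *)
Lemma segment_ints_eq0 (g : R -> R) (t1 t2 t0 : R) : t1 < t0 < t2 ->
  continuous (fun t => g (clampr t1 t2 t)) ->
  (forall a b, t1 <= a -> a < b -> b <= t2 -> \int[leb R]_(t in `[a, b]) g t = 0) -> g t0 = 0.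
Proof.
wlog : g / 0 <= g t0.
  move=> h ht cg I0; have [g0|g0] := leP 0 (g t0); first exact: h.
  apply/eqP; rewrite -oppr_eq0; apply/eqP; apply: (h (fun t => - g t)) => //.
  - by rewrite oppr_ge0 ltW.
  - by move=> t; apply: cvgN; exact: cg.
  - move=> a b ta ab bt.
    have ig : (leb R).-integrable `[a, b] (EFin \o g).
      apply: integrableS (clampr_integrable cg) => //.
      by apply: subset_itv; rewrite bnd_simp.
    have -> : \int[leb R]_(t in `[a, b]) - g t = \int[leb R]_(t in `[a, b]) (-1 * g t).
      by apply: eq_Rintegral => t _; rewrite mulN1r.
    by rewrite RintegralZl// I0// mulr0.
move=> g0 ht cg I0; apply/eqP; rewrite eq_le g0 andbT leNgt; apply/negP => gt0.
have ht' : t1 <= t0 <= t2 by case/andP: ht => /ltW-> /ltW->.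
have [r r0 rg] : exists2 r : R, 0 < r & forall x, `|x - t0| <= r -> g t0 / 2 <= g (clampr t1 t2 x).
  have := cg t0; rewrite /continuous_at (clampr_id ht') => /cvgr_ge/(_ (g t0 / 2)).
  rewrite half_ltr// => /(_ isT)/nbhs_ballP[r /= r0 rP].
  exists (r / 2) => [|x hx]; first by rewrite divr_gt0.
  by apply: rP; rewrite /ball/= distrC (le_lt_trans hx)// half_ltr.
pose b := Num.min (t0 + r) t2; have tb : t0 < b by rewrite /b lt_min; case/andP: ht => _ ->; rewrite ltrDl r0.
have bt2 : b <= t2 by rewrite /b ge_min lexx orbT.
have br : b <= t0 + r by rewrite /b ge_min lexx.
have t1t0 : t1 <= t0 by case/andP: ht'.
have := I0 t0 b t1t0 tb bt2 => I0'.
suff : g t0 / 2 * (b - t0) <= 0 by rewrite leNgt => /negP; apply; rewrite mulr_gt0 ?divr_gt0// subr_gt0.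
rewrite -I0' -Rintegral_cst_segment; last exact: ltW.
apply: le_Rintegral => //.
- by apply: segment_integrable => y _; exact: cvg_cst.
- apply: integrableS (clampr_integrable cg) => //.
  by apply: subset_itv; rewrite bnd_simp.
- move=> x; rewrite /= in_itv/= => /andP[x1 x2].
  rewrite -(@clampr_id _ t1 t2 x); last by rewrite (le_trans t1t0 x1) (le_trans x2).
  by apply: rg; rewrite ler_norml; lra.
Qed.

End bumps.

Lemma Rintegral_segment_split {R : realType} (a b c h e : R -> R) (t1 t2 : R) :
  (leb R).-integrable `[t1, t2] (EFin \o a) -> (leb R).-integrable `[t1, t2] (EFin \o b) ->
  (leb R).-integrable `[t1, t2] (EFin \o c) -> (leb R).-integrable `[t1, t2] (EFin \o h) ->
  (leb R).-integrable `[t1, t2] (EFin \o e) ->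
  (forall t, t1 <= t <= t2 -> a t + b t + c t = h t + e t) ->
  \int[leb R]_(t in `[t1, t2]) a t + \int[leb R]_(t in `[t1, t2]) b t +
  \int[leb R]_(t in `[t1, t2]) c t =
  \int[leb R]_(t in `[t1, t2]) h t + \int[leb R]_(t in `[t1, t2]) e t.
Proof.
move=> ia ib ic ih ie E; have m12 : measurable (`[t1, t2]%classic : set (measurableTypeR R)) by [].
have iab : (leb R).-integrable `[t1, t2] (EFin \o (fun t => a t + b t)).
  by have := integrableD m12 ia ib; apply: eq_integrable.
rewrite -RintegralD// -RintegralD// -RintegralD//; apply: eq_Rintegral => t.
by rewrite inE/= in_itv/= => /E.
Qed.

(* The integral of phi against the measure described by [shock_decomposition], see [Lam_indic]. *)
Definition Lam {R : realType} (T : R -> R) (S : R * (R * R) -> R) (X Y : R * R -> R)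
    (F : bool -> R * (R * R) -> R) (m : R * R -> R) (t : R) (phi : R * R -> R) : R :=
  \int[leb2 R]_p sidef (fun q => - S q) (F false) t phi p +
  \int[leb2 R]_p sidef S (F true) t phi p + \int[leb R]_l curvef T X Y m t phi l.

(** * The total balance: both sides and the curve *)

Section two_sides.
Context {R : realType}.
Variables (T : R -> R) (Om : set (R * (R * R))) (S : R * (R * R) -> R) (X Y : R * R -> R).
Hypothesis su : surf T Om S X Y.
Hypothesis orient : forall t l, 0 <= t < T l -> let q := (t, (X (t, l), Y (t, l))) in
  0 < dx S q * d2 Y (t, l) - dy S q * d2 X (t, l).

Let su' : surf T Om (fun q => - S q) X Y. Proof. exact: surf_opp. Qed.

Let orient' t l : 0 <= t < T l -> let q := (t, (X (t, l), Y (t, l))) in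
  0 < -1 * (dx (fun q => - S q) q * d2 Y (t, l) - dy (fun q => - S q) q * d2 X (t, l)).
Proof.
Transparent dx dy.
move=> tl; cbv zeta; set q := (t, _); have [Oq _] := su_on su tl.
have -> : dx (fun q => - S q) q = - dx S q by apply: derive_opp; exact: c1at_diff (su_S su Oq).
have -> : dy (fun q => - S q) q = - dy S q by apply: derive_opp; exact: c1at_diff (su_S su Oq).
Opaque dx dy.
have h : 0 < dx S q * d2 Y (t, l) - dy S q * d2 X (t, l) := orient tl.
by move: h; move: (dx S q) (dy S q) (d2 X _) (d2 Y _) => c d x y; rewrite mulN1r !mulNr -opprD opprK.
Qed.

(** The tube lemma. It makes a test function that is admissible at one time admissible for all
    nearby times. *)
Lemma Om_tube (K : set (R * R)) (t0 : R) : compact K -> K `<=` slice Om t0 ->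
  exists2 r : R, 0 < r & forall t p, 0 <= t -> `|t - t0| <= r -> K p -> Om (t, p).
Proof.
move=> cK KO; have [W oW OmW] := su_Om su.
have cN := (@compact_near_coveringP _ K).1 cK.
have : \forall t \near t0, K `<=` [set p | W (t, p)].
  apply: (cN _ (nbhs t0) (fun t p => W (t, p)) _) => p /KO Op.
  have : nbhs (t0, p) W by apply: open_nbhs_nbhs; split => //; move: Op; rewrite /slice/= OmW => -[].
  move=> [[D E] /= [nD nE] DE]; exists (E, D) => //= -[p' t'] [/= h1 h2]; exact: (DE (t', p')).
move=> /nbhs_ballP[r /= r0 rP]; exists (r / 2); first by rewrite divr_gt0.
move=> t p tt h Kp; rewrite OmW; split => //; apply: rP Kp.
by rewrite /ball/= distrC (le_lt_trans h)// half_ltr.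
Qed.

Section continuity.
Variables (F : bool -> R * (R * R) -> R) (m : R * R -> R).
Hypothesis gF : forall j q, Om q -> cside j (S q) -> {for q, continuous (F j)}.
Hypothesis gm : forall z, pdom T z -> {for z, continuous m}.

Let gFp q : Om q -> 0 <= S q -> {for q, continuous (F true)}.
Proof. exact: (gF (j := true)). Qed.
Let gFm q : Om q -> 0 <= - S q -> {for q, continuous (F false)}.
Proof. by rewrite oppr_ge0; exact: (gF (j := false)). Qed.

Lemma Lam_continuous (t1 t2 : R) (K : set (R * R)) (phi : R * R -> R) : 0 <= t1 -> t1 <= t2 ->
  compact K -> (forall t p, t1 <= t <= t2 -> K p -> Om (t, p)) ->
  continuous phi -> (forall p, ~ K p -> phi p = 0) ->
  continuous (fun t => Lam T S X Y F m (clampr t1 t2 t) phi).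
Proof.
move=> t10 t12 cK KO cphi phi0 t; apply: cvgD; first apply: cvgD.
- exact: (side_continuous su' t10 t12 cK KO gFm cphi phi0).
- exact: (side_continuous su t10 t12 cK KO gFp cphi phi0).
- exact: (curve_int_continuous su t10 t12 cK KO gm cphi phi0).
Qed.

Lemma Lam_cvg (t0 : R) (phi : R * R -> R) : 0 < t0 -> Cc phi -> supp phi `<=` slice Om t0 ->
  Lam T S X Y F m t phi @[t --> t0] --> Lam T S X Y F m t0 phi.
Proof.
move=> t00 [cphi cK] KO; have [r r0 rP] := Om_tube cK KO.
pose d := Num.min r (t0 / 2).
have d0 : 0 < d by rewrite lt_min r0 divr_gt0.
have dr : d <= r by rewrite ge_min lexx.
have dt0 : d <= t0 / 2 by rewrite ge_min lexx orbT.
have t10 : 0 <= t0 - d by lra.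
have t12 : t0 - d <= t0 + d by lra.
have KO' t p : t0 - d <= t <= t0 + d -> supp phi p -> Om (t, p).
  by move=> ht; apply: rP; [lra|rewrite ler_norml; lra].
have := @Lam_continuous _ _ _ _ t10 t12 cK KO' cphi (@supp_out _ phi) t0.
rewrite /continuous_at clampr_id; last by lra.
apply: cvg_trans; apply: near_eq_cvg; near=> t; rewrite clampr_id//.
have : `|t0 - t| < d by near: t; exact: cvgr_dist_lt.
by rewrite ltr_norml; lra.
Unshelve. all: by end_near. Qed.

Lemma Lam_cvg0 (phi : R * R -> R) : Cc phi -> supp phi `<=` slice Om 0 ->
  Lam T S X Y F m t phi @[t --> 0^'+] --> Lam T S X Y F m 0 phi.
Proof.
move=> [cphi cK] KO; have [r r0 rP] := Om_tube cK KO.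
have KO' t p : 0 <= t <= r -> supp phi p -> Om (t, p).
  by move=> ht; apply: rP; [lra|rewrite subr0 ler_norml; lra].
have := @Lam_continuous 0 r _ _ (lexx 0) (ltW r0) cK KO' cphi (@supp_out _ phi) 0.
rewrite /continuous_at clampr_id ?lexx ?ltW// => /(cvg_at_right_filter) h.
apply: cvg_trans h; apply: near_eq_cvg; near=> t; rewrite clampr_id//.
apply/andP; split; [apply: ltW; near: t; exact: nbhs_right_gt|near: t; exact: nbhs_right_le].
Unshelve. all: by end_near. Qed.

End continuity.

Lemma curvef_D (m1 m2 : R * R -> R) t phi l :
  curvef T X Y (fun z => m1 z + m2 z) t phi l = curvef T X Y m1 t phi l + curvef T X Y m2 t phi l.
Proof. by rewrite /curvef; case: ifP => _; rewrite ?addr0// mulrDr. Qed.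

Section balance.
Variables (r U W : bool -> R * (R * R) -> R) (m : R * R -> R).
Hypothesis gr : forall j q, Om q -> cside j (S q) -> c1at (r j) q.
Hypothesis gU : forall j q, Om q -> cside j (S q) -> c1at (U j) q.
Hypothesis gW : forall j q, Om q -> cside j (S q) -> c1at (W j) q.
Hypothesis pde : forall j q, Om q -> 0 < q.1 -> side j (S q) ->
  dt (r j) q + dx (r j \* U j) q + dy (r j \* W j) q = 0.
Hypothesis cm : forall z, pdom T z -> c1at m z.

Definition flux z : R := fluxm (r true) (U true) (W true) X Y z - fluxm (r false) (U false) (W false) X Y z.

Let s (j : bool) := if j then S else (fun q => - S q).
Let sg (j : bool) : R := if j then 1 else -1.

Let suj j : surf T Om (s j) X Y. Proof. by case: j. Qed.

Let csj j q : 0 <= s j q -> cside j (S q).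
Proof. by case: j; rewrite /s /cside ?oppr_ge0. Qed.

Let orj j t l : 0 <= t < T l -> let q := (t, (X (t, l), Y (t, l))) in
  0 < sg j * (dx (s j) q * d2 Y (t, l) - dy (s j) q * d2 X (t, l)).
Proof. by case: j => h; [rewrite /sg /s mul1r; exact: orient|exact: orient']. Qed.

Let fluxj j := fluxm (r j) (U j) (W j) X Y.

Let cflux j z : pdom T z -> {for z, continuous (fluxj j)}.
Proof.
exact: (continuous_fluxm (suj j) (fun q Oq h => gr Oq (csj h)) (fun q Oq h => gU Oq (csj h))
  (fun q Oq h => gW Oq (csj h))).
Qed.

Lemma continuous_flux z : pdom T z -> {for z, continuous flux}.
Proof. by move=> pz; have h1 := @cflux true z pz; have h2 := @cflux false z pz; exact: cvgB h1 h2. Qed.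

(** H is the right-hand side of the weak equation when the singular part moves with the curve, and E
    is the defect in the equation m_t = flux. The flows through the two sides enter with opposite
    signs because S is replaced by - S on the minus side. *)
Lemma Lam_balance (t1 t2 : R) (f : R * R -> R) : 0 < t1 -> t1 < t2 -> Cc1 f ->
  (forall t p, t1 <= t <= t2 -> supp f p -> Om (t, p)) ->
  let H t := Lam T S X Y (fun j => r j \* U j) (fun z => m z * d1 X z) t (d1 f) +
    Lam T S X Y (fun j => r j \* W j) (fun z => m z * d1 Y z) t (d2 f) in
  let E t := \int[leb R]_l curvef T X Y (fun z => d1 m z - flux z) t f l in
  [/\ (leb R).-integrable `[t1, t2] (EFin \o H), (leb R).-integrable `[t1, t2] (EFin \o E) &
   Lam T S X Y r m t2 f - Lam T S X Y r m t1 f =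
     \int[leb R]_(t in `[t1, t2]) H t + \int[leb R]_(t in `[t1, t2]) E t].
Proof.
move=> t10 t12 Cf fOm H E.
have cf p : c1at f p by exact: C1_c1at Cf.1 I.
have ccf : continuous f by move=> p; exact: c1at_continuous.
have cd1 : continuous (d1 f) by move=> p; exact: c1at_d1.
have cd2 : continuous (d2 f) by move=> p; exact: c1at_d2.
have c1f p : ~ supp f p -> d1 f p = 0 by move=> /supp_d1[].
have c2f p : ~ supp f p -> d2 f p = 0 by move=> /supp_d1[].
have t10' := ltW t10; have t12' := ltW t12.
have grU j q : Om q -> cside j (S q) -> c1at (r j \* U j) q.
  by move=> h1 h2; apply: c1at_mul; [exact: gr|exact: gU].
have grW j q : Om q -> cside j (S q) -> c1at (r j \* W j) q.
  by move=> h1 h2; apply: c1at_mul; [exact: gr|exact: gW].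
have cmX z : pdom T z -> {for z, continuous (fun z => m z * d1 X z)}.
  by move=> pz; apply: cvgM; [exact: c1at_continuous (cm pz)|exact: c1at_d1 (su_X su pz)].
have cmY z : pdom T z -> {for z, continuous (fun z => m z * d1 Y z)}.
  by move=> pz; apply: cvgM; [exact: c1at_continuous (cm pz)|exact: c1at_d1 (su_Y su pz)].
have ce z : pdom T z -> {for z, continuous (fun z => d1 m z - flux z)}.
  by move=> pz; apply: cvgB; [exact: c1at_d1 (cm pz)|exact: continuous_flux].
have [Gp_int Gp] := side_balance (suj true) (or_introl erefl : sg true = 1 \/ sg true = -1) (@orj true)
  (fun q Oq h => gr Oq (csj h)) (fun q Oq h => gU Oq (csj h)) (fun q Oq h => gW Oq (csj h))
  (fun q Oq h => grU _ _ Oq (csj h)) (fun q Oq h => grW _ _ Oq (csj h)) (@pde true) t10 t12 Cf fOm.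
have pde' q : Om q -> 0 < q.1 -> 0 < s false q ->
  dt (r false) q + dx (r false \* U false) q + dy (r false \* W false) q = 0.
  by move=> h1 h2 h3; apply: (@pde false) => //; move: h3; rewrite /s oppr_gt0.
have [Gm_int Gm] := side_balance (suj false) (or_intror erefl : sg false = 1 \/ sg false = -1) (@orj false)
  (fun q Oq h => gr Oq (csj h)) (fun q Oq h => gU Oq (csj h)) (fun q Oq h => gW Oq (csj h))
  (fun q Oq h => grU _ _ Oq (csj h)) (fun q Oq h => grW _ _ Oq (csj h)) pde' t10 t12 Cf fOm.
have [Gc_int Gc] := curve_balance su t10 t12 Cf fOm cm.
have iH : (leb R).-integrable `[t1, t2] (EFin \o H).
  apply: clampr_integrable => t; apply: cvgD.
    apply: (@Lam_continuous _ _ _ _ t1 t2 (supp f)) => //; last exact: Cf.2.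
    by move=> j q h1 h2; exact: c1at_continuous (grU _ _ h1 h2).
  apply: (@Lam_continuous _ _ _ _ t1 t2 (supp f)) => //; last exact: Cf.2.
  by move=> j q h1 h2; exact: c1at_continuous (grW _ _ h1 h2).
have iE : (leb R).-integrable `[t1, t2] (EFin \o E).
  by apply: clampr_integrable; exact: (curve_int_continuous su t10' t12' Cf.2 fOm ce ccf (@supp_out _ f)).
split => //.
transitivity ((\int[leb2 R]_p sidef (s false) (r false) t2 f p - \int[leb2 R]_p sidef (s false) (r false) t1 f p) +
  (\int[leb2 R]_p sidef (s true) (r true) t2 f p - \int[leb2 R]_p sidef (s true) (r true) t1 f p) +
  (\int[leb R]_l curvef T X Y m t2 f l - \int[leb R]_l curvef T X Y m t1 f l)).
  rewrite /Lam; move: (\int[leb2 R]_p _) (\int[leb2 R]_p _) (\int[leb R]_l _) => x1 x2 x3.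
  by move: (\int[leb2 R]_p _) (\int[leb2 R]_p _) (\int[leb R]_l _) => x4 x5 x6; ring.
rewrite Gp Gm Gc; apply: (Rintegral_segment_split Gm_int Gp_int Gc_int iH iE) => t ht.
have bc h : (forall z, pdom T z -> {for z, continuous h}) -> bcs1 (curvef T X Y h t f).
  move=> ch; have cf' q : supp f q -> {for q, continuous f} by move=> _; exact: ccf.
  have [B B0 hB] := compact_bound Cf.2 cf'.
  apply: (curve_bcs1 su t10' Cf.2 fOm ht ch (continuous_measurable_plane ccf) (B := B) _ (@supp_out _ f)).
  by move=> p; have [/hB//|/supp_out->] := pselect (supp f p); rewrite normr0.
have csg j z : pdom T z -> {for z, continuous (fun z => sg j * fluxj j z)}.
  by move=> pz; have h := @cflux j z pz; exact: cvgM (cvg_cst _) h.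
have cnf j z : pdom T z -> {for z, continuous (fun z => - (sg j * fluxj j z))}.
  by move=> pz; have h := @csg j z pz; exact: cvgN h.
have intN (h : R -> R) : bcs1 h -> \int[leb R]_l (- h l) = - \int[leb R]_l h l.
  move=> bh; rewrite -mulN1r -RintegralZl//; last exact: bcs1_integrable.
  by apply: eq_Rintegral => l _; rewrite mulN1r.
have cN j l : curvef T X Y (fun z => - (sg j * fluxj j z)) t f l = - curvef T X Y (fun z => sg j * fluxj j z) t f l.
  by rewrite /curvef; case: ifP => _; rewrite ?oppr0// mulrN.
have Ee : E t = \int[leb R]_l curvef T X Y (d1 m) t f l -
    \int[leb R]_l curvef T X Y (fun z => sg true * fluxj true z) t f l -
    \int[leb R]_l curvef T X Y (fun z => sg false * fluxj false z) t f l.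
  rewrite -(intN _ (bc _ (csg true))) -(intN _ (bc _ (csg false))).
  under [X in _ + X + _]eq_Rintegral do rewrite -cN.
  under [X in _ + X]eq_Rintegral do rewrite -cN.
  have b1 := bc _ (fun z pz => c1at_d1 (cm pz)); have b2 := bc _ (cnf true); have b3 := bc _ (cnf false).
  rewrite -(int1_add b1 b2) -(int1_add (bcs1_add b1 b2) b3).
  apply: eq_Rintegral => l _; rewrite -!curvef_D /curvef; case: ifP => // _; congr (_ * _).
  rewrite /flux /fluxj /sg; move: (d1 m _) (fluxm _ _ _ _ _ _) (fluxm _ _ _ _ _ _) => x1 x2 x3; ring.
rewrite Ee /H /Lam /fluxj.
move: (\int[leb R]_l curvef T X Y (d1 m) t f l) (\int[leb R]_l _) (\int[leb R]_l _) (\int[leb R]_l _) (\int[leb R]_l _) => x1 x2 x3 x4 x5.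
move: (\int[leb2 R]_p _) (\int[leb2 R]_p _) (\int[leb2 R]_p _) (\int[leb2 R]_p _) => x6 x7 x8 x9; ring.
Qed.
End balance.
End two_sides.

(** * The fundamental lemma of the calculus of variations on the shock *)

Section fundamental_lemma.
Context {R : realType}.
Variables (T : R -> R) (Om : set (R * (R * R))) (S : R * (R * R) -> R) (X Y : R * R -> R).
Hypothesis su : surf T Om S X Y.

Let slice_self t0 (K : set (R * R)) : K `<=` slice Om t0 ->
  forall t p, t0 <= t <= t0 -> K p -> Om (t, p).
Proof. by move=> KO t p ht /KO; rewrite (_ : t = t0)//; apply/eqP; rewrite eq_le andbC. Qed.

Lemma curvef_slice_bcs1 (e f : R * R -> R) t0 : 0 <= t0 ->
  (forall z, pdom T z -> {for z, continuous e}) -> Cc1 f -> supp f `<=` slice Om t0 ->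
  bcs1 (curvef T X Y e t0 f).
Proof.
move=> t00 ce Cf fO; have ht : t0 <= t0 <= t0 by rewrite lexx.
have cf : continuous f by move=> p; apply: c1at_continuous; exact: C1_c1at Cf.1 I.
have cf' q : supp f q -> {for q, continuous f} by move=> _; exact: cf.
have [B B0 hB] := compact_bound Cf.2 cf'.
have bB p : `|f p| <= B by have [/hB//|/supp_out->] := pselect (supp f p); rewrite normr0.
exact: (curve_bcs1 su t00 Cf.2 (slice_self fO) ht ce (continuous_measurable_plane cf) bB (@supp_out _ _)).
Qed.

(** Test functions live in the plane, not on the parameter line, so a bump at a shock point might
    also meet the curve at remote labels. By [surf_inverse] a small bump meets it only at labels
    near l0, where e keeps its sign. *)
Lemma curve_test_eq0 (e : R * R -> R) t0 : 0 <= t0 ->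
  (forall z, pdom T z -> {for z, continuous e}) ->
  (forall f, Cc1 f -> supp f `<=` slice Om t0 -> \int[leb R]_l curvef T X Y e t0 f l = 0) ->
  forall l0, t0 < T l0 -> e (t0, l0) = 0.
Proof.
move=> t00; wlog suff : e / forall l0, t0 < T l0 ->
    (forall z, pdom T z -> {for z, continuous e}) ->
    (forall f, Cc1 f -> supp f `<=` slice Om t0 -> \int[leb R]_l curvef T X Y e t0 f l = 0) ->
    ~ 0 < e (t0, l0).
  move=> h ce ie l0 tl; apply/eqP; rewrite eq_le !leNgt; apply/andP; split.
    by apply/negP; exact: (h e).
  apply/negP; rewrite -oppr_gt0; apply: (h (fun z => - e z)) => //.
    by move=> z pz; have c := ce z pz; exact: cvgN c.
  move=> f Cf fO; have b := curvef_slice_bcs1 t00 ce Cf fO.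
  rewrite (_ : curvef T X Y (fun z => - e z) t0 f = (fun l => -1 * curvef T X Y e t0 f l)).
    by rewrite RintegralZl//; [rewrite ie// mulr0|exact: bcs1_integrable].
  by apply/funext => l; rewrite /curvef; case: ifP => _; rewrite ?mulr0// mulN1r mulrN.
move=> l0 tl ce ie e0; have tl0 : 0 <= t0 < T l0 by rewrite t00.
have [Op Sp] := su_on su tl0.
have [eta eta0 he] : exists2 eta : R, 0 < eta & forall l, `|l - l0| < eta -> 0 < e (t0, l).
  have cel : {for l0, continuous (fun l => e (t0, l))}.
    apply: (@continuous_comp _ _ _ (fun l => (t0, l)) e); last exact: ce.
    by apply: continuous_at_pair; [exact: cvg_cst|exact: cvg_id].
  have /nbhs_ballP[eta /= eta0 hP] : \forall l \near l0, 0 < e (t0, l) by exact: cvgr_gt cel _ e0.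
  by exists eta => // l hl; apply: hP; rewrite /ball/= distrC.
have [d d0 hd] := surf_inverse su tl0 eta0.
have [W oW OmW] := su_Om su.
have [d' d'0 hd'] : exists2 d' : R, 0 < d' & forall p, `|p.1 - X (t0, l0)| <= d' -> `|p.2 - Y (t0, l0)| <= d' -> Om (t0, p).
  have : nbhs (t0, (X (t0, l0), Y (t0, l0))) W.
    by apply: open_nbhs_nbhs; split => //; move: Op; rewrite OmW => -[].
  move=> /near3P[d' d'0 h]; exists d' => // -[x y] /= h1 h2; rewrite OmW; split => //.
  by apply: h => //; rewrite subrr normr0 ltW.
pose D := Num.min d d'; have D0 : 0 < D by rewrite lt_min d0.
have Dd : D <= d by rewrite ge_min lexx.
have Dd' : D <= d' by rewrite ge_min lexx orbT.
pose p0 := (X (t0, l0), Y (t0, l0)); have [Cb sb] := bump_Cc1 p0 D0.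
have sO : supp (bump p0 D) `<=` slice Om t0.
  by move=> p /sb[h1 h2]; apply: hd'; [exact: le_trans Dd'|exact: le_trans Dd'].
have cb : continuous (bump p0 D) by move=> p; apply: c1at_continuous; exact: C1_c1at Cb.1 I.
have bc := curvef_slice_bcs1 t00 ce Cb sO.
have cc := curve_continuous su t00 (lexx t0) Cb.2 (slice_self sO) ce cb (@supp_out _ _).
have ck : {for l0, continuous (curvef T X Y e t0 (bump p0 D))}.
  have -> : curvef T X Y e t0 (bump p0 D) = (fun l => curvef T X Y e (clampr t0 t0 t0) (bump p0 D) l).
    by rewrite clampr_id// lexx.
  apply: (@continuous_comp _ _ _ (fun l => (t0, l)) (fun z => curvef T X Y e (clampr t0 t0 z.1) (bump p0 D) z.2)); last exact: cc.
  by apply: continuous_at_pair; [exact: cvg_cst|exact: cvg_id].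
have k0 l : 0 <= curvef T X Y e t0 (bump p0 D) l.
  rewrite /curvef; case: ifP => // tl'.
  have [->|bn] := eqVneq (bump p0 D (X (t0, l), Y (t0, l))) 0; first by rewrite mul0r.
  rewrite mulr_ge0 ?bump_ge0// ltW//; apply: he.
  have [h1 h2] := sb _ (@subset_closure _ [set p | bump p0 D p != 0] _ bn).
  apply: (hd t0 l); [by rewrite t00|by rewrite subrr normr0 ltW|exact: le_trans h1 Dd|exact: le_trans h2 Dd].
have := int_ge0_eq0 bc k0 ck (ie _ Cb sO); rewrite /curvef tl => /eqP.
by rewrite mulf_eq0 (gt_eqF e0) orbF (gt_eqF (bump_gt0 p0 D0)).
Qed.

(** For f supported in the slice at t0, the integral along the curve is continuous in t and has
    integral 0 over each small interval near t0; hence it vanishes at t0 itself, and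
    [curve_test_eq0] applies there. *)
Lemma spacetime_test_eq0 (e : R * R -> R) :
  (forall z, pdom T z -> {for z, continuous e}) ->
  (forall f t1 t2, 0 < t1 -> t1 < t2 -> Cc1 f ->
     (forall t p, t1 <= t <= t2 -> supp f p -> Om (t, p)) ->
     \int[leb R]_(t in `[t1, t2]) \int[leb R]_l curvef T X Y e t f l = 0) ->
  forall t l, 0 < t < T l -> e (t, l) = 0.
Proof.
move=> ce ie t0 l0 /andP[t00 tl]; apply: (curve_test_eq0 (ltW t00) ce) tl => f Cf fO.
have [r r0 hr] := Om_tube su Cf.2 fO.
pose d := Num.min r (t0 / 2).
have d0 : 0 < d by rewrite lt_min r0 divr_gt0.
have dr : d <= r by rewrite ge_min lexx.
have dt0 : d <= t0 / 2 by rewrite ge_min lexx orbT.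
have t10 : 0 < t0 - d by lra.
have KO' t p : t0 - d <= t <= t0 + d -> supp f p -> Om (t, p).
  by move=> ht; apply: hr; [lra|rewrite ler_norml; lra].
have cf : continuous f by move=> p; apply: c1at_continuous; exact: C1_c1at Cf.1 I.
have t12 : t0 - d <= t0 + d by lra.
apply: (@segment_ints_eq0 _ (fun t => \int[leb R]_l curvef T X Y e t f l) (t0 - d) (t0 + d)).
- by apply/andP; split; lra.
- exact: (curve_int_continuous su (ltW t10) t12 Cf.2 KO' ce cf (@supp_out _ f)).
- move=> a b ta ab bt; apply: ie => //; first exact: lt_le_trans ta.
  by move=> t p /andP[h1 h2]; apply: KO'; rewrite (le_trans ta h1) (le_trans h2 bt).
Qed.

End fundamental_lemma.

(** * Measures as bounded functionals *)

Section bounded_functions.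
Context {R : realType}.
Implicit Types (K E : set (mplane R)) (phi : mplane R -> R).

Definition bmeas K phi (M : R) : Prop :=
  [/\ measurable_fun setT phi, forall p, `|phi p| <= M & forall p, ~ K p -> phi p = 0].

Lemma bmeas_ge0 K phi M : bmeas K phi M -> 0 <= M.
Proof. by move=> [_ h _]; exact: le_trans (h (0, 0)). Qed.

Lemma bmeas_indic K E : measurable E -> E `<=` K -> bmeas K (\1_E) 1.
Proof.
move=> mE EK; split; first exact: measurable_indic.
  by move=> p; rewrite indicE; case: (_ \in _); rewrite ?normr1 ?normr0.
by move=> p nK; rewrite indicE memNset// => /EK.
Qed.

Lemma bmeas_add K E phi M c : measurable E -> E `<=` K -> bmeas K phi M ->
  bmeas K (fun p => phi p + c * \1_E p) (M + `|c|).
Proof.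
move=> mE EK [mphi phiM phi0]; split.
- apply: measurable_funD => //; apply: measurable_funM; first exact: measurable_cst.
  exact: measurable_indic.
- move=> p; rewrite (le_trans (ler_normD _ _))// lerD// normrM indicE.
  by case: (_ \in _); rewrite ?normr1 ?normr0 ?mulr1 ?mulr0.
- by move=> p nK; rewrite phi0// indicE memNset ?mulr0 ?addr0// => /EK.
Qed.

(** Instead of linearity, only additivity against multiples of indicators is asked: the halving
    argument below uses no more. *)
Definition bounded_functional K (L : (mplane R -> R) -> R) : Prop :=
  (forall phi M c E, bmeas K phi M -> measurable E -> E `<=` K ->
     L (fun p => phi p + c * \1_E p) = L phi + c * L (\1_E)) /\
  exists2 C : R, 0 <= C & forall phi M, bmeas K phi M -> `|L phi| <= C * M.

(* Subtracting (M/2) 1_{phi >= M/2} from 0 <= phi <= M halves the bound without changing the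
   difference of the two functionals. *)
Lemma bounded_functional_eq K L1 L2 : measurable K ->
  bounded_functional K L1 -> bounded_functional K L2 ->
  (forall E, measurable E -> E `<=` K -> L1 (\1_E) = L2 (\1_E)) ->
  forall phi M, bmeas K phi M -> L1 phi = L2 phi.
Proof.
move=> mK [add1 [C1 C10 b1]] [add2 [C2 C20 b2]] L12.
pose D phi := L1 phi - L2 phi; pose C := C1 + C2.
have C0 : 0 <= C by exact: addr_ge0.
have Dadd phi M c E : bmeas K phi M -> measurable E -> E `<=` K ->
    D (fun p => phi p + c * \1_E p) = D phi.
  move=> bphi mE EK; rewrite /D (add1 _ _ _ _ bphi mE EK) (add2 _ _ _ _ bphi mE EK) L12//.
  by rewrite opprD addrACA subrr addr0.
have Db phi M : bmeas K phi M -> `|D phi| <= C * M.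
  by move=> b; rewrite (le_trans (ler_normB _ _))// mulrDl lerD ?(b1 _ _ b) ?(b2 _ _ b).
have halve n : forall phi M, bmeas K phi M -> (forall p, 0 <= phi p) -> `|D phi| <= C * (M / 2 ^+ n).
  elim: n => [|n IH] phi M b phi0; first by rewrite expr0 divr1; exact: Db.
  have M0 := bmeas_ge0 b; have [mphi phiM phiK] := b.
  pose E := K `&` [set p | M / 2 <= phi p].
  have mE : measurable E.
    have := mphi measurableT _ (measurable_itv `[M / 2, +oo[); rewrite setTI => h.
    apply: measurableI => //; congr measurable: h; apply/seteqP; split => p /=; rewrite in_itv/= andbT//.
  have EK : E `<=` K by move=> p [].
  have h p : 0 <= phi p + - (M / 2) * \1_E p <= M / 2.
    have pM := le_trans (ler_norm _) (phiM p).
    rewrite indicE; have [pE|pE] := pselect (E p).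
      by rewrite mem_set// mulr1; case: pE => _ /=; lra.
    rewrite memNset// mulr0 addr0 phi0/=; have [Kp|/phiK->] := pselect (K p); last by rewrite divr_ge0.
    by rewrite leNgt; apply/negP => /ltW hp; apply: pE.
  have b' : bmeas K (fun p => phi p + - (M / 2) * \1_E p) (M / 2).
    have [m' _ z'] := bmeas_add (- (M / 2)) mE EK b; split => // p.
    by have /andP[h1 h2] := h p; rewrite ger0_norm.
  rewrite -(Dadd _ _ (- (M / 2)) _ b mE EK) (le_trans (IH _ _ b' _))//.
    by move=> p; case/andP: (h p).
  by rewrite exprS invfM [M * (_ * _)]mulrA.
move=> phi M b; apply/eqP; rewrite -subr_eq0 -/(D phi) -normr_le0.
have M0 := bmeas_ge0 b; have [mphi phiM phiK] := b.
(* Adding M on K makes phi nonnegative, as [halve] requires, without changing the difference D. *)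
rewrite -(Dadd _ _ M _ b mK (@subset_refl _ K)).
have b' := bmeas_add M mK (@subset_refl _ K) b.
have lim : C * ((M + `|M|) / 2 ^+ n) @[n --> \oo] --> C * ((M + `|M|) * 0).
  apply: cvgMr; apply: cvgMr; under eq_fun do rewrite -exprVn.
  by apply: cvg_expr; rewrite ger0_norm ?invr_ge0// invf_lt1// ltr1n.
rewrite mulr0 mulr0 in lim; apply: (ler_cvg_to (cvg_cst _) lim); apply: nearW => n.
apply: halve b' _ => p; rewrite indicE; have [Kp|Kp] := pselect (K p).
  by rewrite mem_set// mulr1 -lerBlDr sub0r; have := phiM p; rewrite ler_norml => /andP[].
by rewrite memNset// mulr0 addr0 phiK.
Qed.

Section measure_functional.
Variable mu : {measure set (mplane R) -> \bar R}.

Lemma bmeas_integrable K phi M : measurable K -> (mu K < +oo)%E -> bmeas K phi M ->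
  mu.-integrable setT (EFin \o phi).
Proof.
move=> mK muK [mphi phiM phiK].
have -> : EFin \o phi = (EFin \o phi) \_ K.
  by apply/funext => p; rewrite patchE; case: ifPn => // /negP h; rewrite /= phiK// => Kp; apply: h; rewrite inE.
apply/(integrable_mkcond _ mK).1; apply: measurable_bounded_integrable => //.
  exact: measurable_funTS.
exists M; split; first exact: num_real.
by move=> x Mx p _ /=; rewrite (le_trans (phiM p))// ltW.
Qed.

Lemma bounded_functional_integral K : measurable K -> (mu K < +oo)%E ->
  bounded_functional K (fun phi => \int[mu]_p phi p).
Proof.
move=> mK muK; split.
  move=> phi M c E b mE EK; have bE := bmeas_indic mE EK.
  have iE := bmeas_integrable mK muK bE; have iphi := bmeas_integrable mK muK b.
  rewrite RintegralD//; last by have := integrableZl measurableT c iE; apply: eq_integrable => // p _; rewrite /= EFinM.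
  by rewrite RintegralZl.
exists (fine (mu K)); first exact: fine_ge0.
move=> phi M b; have iphi := bmeas_integrable mK muK b; have [mphi phiM phiK] := b.
apply: (le_trans (le_normr_Rintegral measurableT iphi)).
have -> : fine (mu K) * M = \int[mu]_p (M * \1_K p).
  rewrite RintegralZl//; last exact: bmeas_integrable (bmeas_indic mK (@subset_refl _ K)).
  by rewrite /Rintegral integral_indic// setIT mulrC.
apply: le_Rintegral => //.
- exact: integrable_norm iphi.
- have := integrableZl measurableT M (bmeas_integrable mK muK (bmeas_indic mK (@subset_refl _ K))).
  by apply: eq_integrable => // p _; rewrite /= EFinM.
- move=> p _; rewrite indicE; have [Kp|Kp] := pselect (K p); first by rewrite mem_set// mulr1.
  by rewrite phiK// memNset// mulr0 normr0.
Qed.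

End measure_functional.

(** * Measures with a density and image measures *)

Section measure_construction.
Context d (T : measurableType d) (mu : {measure set T -> \bar R}).

Section density.
Variable f : T -> R.
Hypotheses (mf : measurable_fun setT f) (f0 : forall x, 0 <= f x).

Let nu (A : set T) := (\int[mu]_(x in A) (f x)%:E)%E.

Let nu0 : nu set0 = 0%E. Proof. exact: integral_set0. Qed.

Let nu_ge0 (A : set T) : (0 <= nu A)%E.
Proof. by apply: integral_ge0 => x _; rewrite lee_fin. Qed.

Let nu_sigma : semi_sigma_additive nu.
Proof.
move=> F mF tF mUF; rewrite /nu ge0_integral_bigcup//.
- apply: is_cvg_ereal_nneg_natsum_cond => n _ _; exact: nu_ge0.
- by apply: measurable_funTS; exact/measurable_EFinP.
- by move=> x _; rewrite lee_fin.
Qed.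

Lemma density_measure : exists nu : {measure set T -> \bar R},
  forall A : set T, nu A = (\int[mu]_(x in A) (f x)%:E)%E.
Proof.
pose m := HB.pack_for {measure set T -> \bar R} nu (isMeasure.Build _ _ _ nu nu0 nu_ge0 nu_sigma).
by exists m.
Qed.
End density.

Lemma pushforward_measure_ex d' (T' : measurableType d') (phi : T -> T') :
  measurable_fun setT phi -> exists nu : {measure set T' -> \bar R},
  forall A : set T', nu A = mu (phi @^-1` A).
Proof.
move=> mphi; pose nu (A : set T') := mu (phi @^-1` A).
have m0 : nu set0 = 0%E by rewrite /nu preimage_set0 measure0.
have mge0 (A : set T') : (0 <= nu A)%E by exact: measure_ge0.
have ms : semi_sigma_additive nu.
  move=> F mF tF mUF; rewrite /nu preimage_bigcup; apply: measure_semi_sigma_additive.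
  - by move=> n; rewrite -[X in measurable X]setTI; exact: mphi.
  - apply/trivIsetP => /= i j _ _ ij; rewrite -preimage_setI.
    by move/trivIsetP : tF => /(_ _ _ _ _ ij) ->//; rewrite preimage_set0.
  - by rewrite -preimage_bigcup -[X in measurable X]setTI; exact: mphi.
pose m := HB.pack_for {measure set T' -> \bar R} nu (isMeasure.Build _ _ _ nu m0 mge0 ms).
by exists m.
Qed.

End measure_construction.
End bounded_functions.

(** * The functional of a measure with a shock decomposition *)

Section lam_functional.
Context {R : realType}.
Variables (T : R -> R) (Om : set (R * (R * R))) (S : R * (R * R) -> R) (X Y : R * R -> R).
Hypothesis su : surf T Om S X Y.
Variables (F : bool -> R * (R * R) -> R) (m : R * R -> R).
Hypothesis gF : forall j q, Om q -> cside j (S q) -> {for q, continuous (F j)}.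
Hypothesis gm : forall z, pdom T z -> {for z, continuous m}.
Variables (t : R) (K : set (R * R)).
Hypotheses (t0 : 0 <= t) (cK : compact K) (KO : K `<=` slice Om t).

Let su' : surf T Om (fun q => - S q) X Y. Proof. exact: surf_opp. Qed.
Let mK : measurable (K : set (mplane R)). Proof. exact: compact_measurable_plane. Qed.

Let tt : t <= t <= t. Proof. by rewrite lexx. Qed.

Let KO' t' p : t <= t' <= t -> K p -> Om (t', p).
Proof. by move=> /andP[h1 h2] /KO; rewrite (_ : t' = t)//; apply/eqP; rewrite eq_le h1 h2. Qed.

Let gFp q : Om q -> 0 <= S q -> {for q, continuous (F true)}.
Proof. exact: (gF (j := true)). Qed.
Let gFm q : Om q -> 0 <= - S q -> {for q, continuous (F false)}.
Proof. by rewrite oppr_ge0; exact: (gF (j := false)). Qed.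

Lemma sidef_lin (s F' : R * (R * R) -> R) (phi psi : R * R -> R) (c : R) p :
  sidef s F' t (fun p => phi p + c * psi p) p = sidef s F' t phi p + c * sidef s F' t psi p.
Proof. by rewrite /sidef; case: ifP => _; rewrite ?mulr0 ?addr0// mulrDl mulrA. Qed.

Lemma curvef_lin (phi psi : R * R -> R) (c : R) l :
  curvef T X Y m t (fun p => phi p + c * psi p) l =
  curvef T X Y m t phi l + c * curvef T X Y m t psi l.
Proof. by rewrite /curvef; case: ifP => _; rewrite ?mulr0 ?addr0// mulrDl mulrA. Qed.

Let side_functional (s F' : R * (R * R) -> R) : surf T Om s X Y ->
  (forall q, Om q -> 0 <= s q -> {for q, continuous F'}) ->
  bounded_functional K (fun phi => \int[leb2 R]_p sidef s F' t phi p).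
Proof.
move=> sus gF'; have bs phi M : bmeas K phi M -> bcs2 (sidef s F' t phi).
  by move=> [mphi phiM phi0]; exact: (side_bcs2 sus cK KO' gF' tt mphi phiM phi0).
split.
  move=> phi M c E b mE EK.
  have i1 := bcs2_integrable (bs _ _ b); have i2 := bcs2_integrable (bs _ _ (bmeas_indic mE EK)).
  have i3 : (leb2 R).-integrable setT (EFin \o (fun p => c * sidef s F' t \1_E p)).
    by have := integrableZl measurableT c i2; apply: eq_integrable => // p _; rewrite /= EFinM.
  rewrite -(RintegralZl c measurableT i2) -(RintegralD measurableT i1 i3).
  by apply: eq_Rintegral => p _; rewrite sidef_lin.
have [M0 M00 hM0] := side_bound sus cK KO' gF'.
exists (M0 * fine (leb2 R K)); first by rewrite mulr_ge0// fine_ge0.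
move=> phi M b; have [mphi phiM phi0] := b; have M_ge0 := bmeas_ge0 b.
rewrite mulrAC; apply: int2_bound => //; first exact: bs b.
  move=> p; rewrite /sidef; case: ifPn => [sp|_]; last by rewrite normr0 mulr_ge0.
  have [Kp|Kp] := pselect (K p); last by rewrite phi0// mul0r normr0 mulr_ge0.
  by rewrite normrM mulrC ler_pM//; apply: hM0 => //; exact: ltW.
by move=> p nK; rewrite /sidef phi0// mul0r if_same.
Qed.

Let bcurve phi M : bmeas K phi M -> bcs1 (curvef T X Y m t phi).
Proof.
by move=> [mphi phiM phi0]; exact: (curve_bcs1 su t0 cK KO' tt gm mphi phiM phi0).
Qed.

Let curve_functional : bounded_functional K (fun phi => \int[leb R]_l curvef T X Y m t phi l).
Proof.
split.
  move=> phi M c E b mE EK.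
  have i1 := bcs1_integrable (bcurve b); have i2 := bcs1_integrable (bcurve (bmeas_indic mE EK)).
  have i3 : (leb R).-integrable setT (EFin \o (fun l => c * curvef T X Y m t \1_E l)).
    by have := integrableZl measurableT c i2; apply: eq_integrable => // p _; rewrite /= EFinM.
  rewrite -(RintegralZl c measurableT i2) -(RintegralD measurableT i1 i3).
  by apply: eq_Rintegral => l _; rewrite curvef_lin.
have [L L0 hL] := curve_lbound su t0 cK KO'; have [N N0 hN] := curve_bound su t0 cK KO' gm.
(* Over K the labels stay in [- L, L] and the singular density is at most N in absolute value. *)
exists (N * (L - - L)); first by rewrite mulr_ge0// opprK addr_ge0.
move=> phi M b; have [mphi phiM phi0] := b; have M_ge0 := bmeas_ge0 b.
have LL : - L <= L by rewrite (le_trans _ L0)// oppr_le0.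
have i1 := bcs1_integrable (bcurve b).
apply: (le_trans (le_normr_Rintegral measurableT i1)).
rewrite mulrAC -Rintegral_cst_segment// [leRHS]Rintegral_mkcond; apply: le_Rintegral => //.
- exact: integrable_norm i1.
- have i4 : (leb R).-integrable `[- L, L] (EFin \o cst (N * M)).
    by apply: segment_integrable => y _; exact: cvg_cst.
  have := (@integrable_mkcond _ _ _ (leb R) `[- L, L]%classic _ (measurable_itv _)).1 i4.
  apply: eq_integrable => // l _.
  by rewrite /= !patchE; case: ifP.
- move=> l _; rewrite patchE /curvef; case: ifPn => [tl|_]; last first.
    by rewrite normr0; case: ifP => // _; rewrite mulr_ge0.
  have [Kp|Kp] := pselect (K (X (t, l), Y (t, l))); last first.
    by rewrite phi0// mul0r normr0; case: ifP => // _; rewrite mulr_ge0.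
  rewrite mem_set; last by rewrite /= in_itv/= -ler_norml; exact: hL tt tl Kp.
  by rewrite normrM mulrC ler_pM//; exact: hN tt tl Kp.
Qed.

Lemma Lam_functional : bounded_functional K (fun phi => Lam T S X Y F m t phi).
Proof.
have [a1 [C1 C10 b1]] := side_functional su' gFm; have [a2 [C2 C20 b2]] := side_functional su gFp.
have [a3 [C3 C30 b3]] := curve_functional; split.
  move=> phi M c E b mE EK; rewrite /Lam (a1 _ _ _ _ b mE EK) (a2 _ _ _ _ b mE EK) (a3 _ _ _ _ b mE EK).
  by move: (\int[leb2 R]_p _) (\int[leb2 R]_p _) (\int[leb2 R]_p _) (\int[leb2 R]_p _) (\int[leb R]_l _) (\int[leb R]_l _) => x1 x2 x3 x4 x5 x6; ring.
exists (C1 + C2 + C3); first by rewrite !addr_ge0.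
move=> phi M b; rewrite !mulrDl (le_trans (ler_normD _ _))// lerD ?(b3 _ _ b)//.
by rewrite (le_trans (ler_normD _ _))// lerD ?(b1 _ _ b) ?(b2 _ _ b).
Qed.

Lemma Lam_indic (E : set (mplane R)) : E `<=` K ->
  Lam T S X Y F m t (\1_E) =
  \int[leb2 R]_(p in E `&` [set p | side false (S (t, p))]) F false (t, p) +
  \int[leb2 R]_(p in E `&` [set p | side true (S (t, p))]) F true (t, p) +
  \int[leb R]_(l in [set l | t < T l /\ E (X (t, l), Y (t, l))]) m (t, l).
Proof.
move=> EK; rewrite /Lam; congr (_ + _ + _); rewrite [RHS]Rintegral_mkcond; apply: eq_Rintegral => p _.
- rewrite /sidef patchE oppr_gt0 indicE; case: (boolP (p \in E)) => pE; last first.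
    by rewrite mul0r if_same memNset// => -[pE' _]; case/negP: pE; rewrite inE.
  rewrite mul1r; case: ifPn => Sp; first by rewrite mem_set//; split => //; rewrite -inE.
  by rewrite memNset// => -[_ /=]; apply/negP.
- rewrite /sidef patchE indicE; case: (boolP (p \in E)) => pE; last first.
    by rewrite mul0r if_same memNset// => -[pE' _]; case/negP: pE; rewrite inE.
  rewrite mul1r; case: ifPn => Sp; first by rewrite mem_set//; split => //; rewrite -inE.
  by rewrite memNset// => -[_ /=]; apply/negP.
- rewrite /curvef patchE indicE; case: ifPn => tl; last by rewrite memNset// => -[h _]; rewrite h in tl.
  case: (boolP ((X (t, p), Y (t, p)) \in E)) => pE.
    by rewrite mul1r mem_set//; split => //; rewrite -inE.
  by rewrite mul0r memNset// => -[_ h]; case/negP: pE; rewrite inE.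
Qed.

Lemma sint_Lam (mu : @signed_measure R) : (spos mu K < +oo)%E -> (sneg mu K < +oo)%E ->
  (forall E : set (mplane R), measurable E -> E `<=` K -> smeas mu E = (Lam T S X Y F m t (\1_E))%:E) ->
  forall phi M, bmeas K phi M -> sint mu phi = Lam T S X Y F m t phi.
Proof.
move=> fp fn dec; apply: (bounded_functional_eq mK _ Lam_functional).
  have [a1 [C1 C10 b1]] := bounded_functional_integral mK fp.
  have [a2 [C2 C20 b2]] := bounded_functional_integral mK fn; split.
    move=> phi M c E b mE EK; rewrite /sint (a1 _ _ _ _ b mE EK) (a2 _ _ _ _ b mE EK).
    by move: (\int[_]_p _) (\int[_]_p _) (\int[_]_p _) (\int[_]_p _) => x1 x2 x3 x4; ring.
  exists (C1 + C2); first exact: addr_ge0.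
  by move=> phi M b; rewrite mulrDl (le_trans (ler_normB _ _))// lerD ?(b1 _ _ b) ?(b2 _ _ b).
move=> E mE EK; have := dec E mE EK; rewrite /smeas /sint /Rintegral !integral_indic// !setIT.
have pE : (spos mu E < +oo)%E by apply: le_lt_trans fp; apply: le_measure; rewrite ?inE.
have nE : (sneg mu E < +oo)%E by apply: le_lt_trans fn; apply: le_measure; rewrite ?inE.
have pf : spos mu E \is a fin_num by rewrite ge0_fin_numE.
have nf : sneg mu E \is a fin_num by rewrite ge0_fin_numE.
by rewrite -(fineK pf) -(fineK nf) -EFinB => -[<-].
Qed.

End lam_functional.

(** * Radon-Nikodym derivatives on and off the shock *)

Section radon_nikodym.
Context {R : realType}.
Variables (T : R -> R) (Om : set (R * (R * R))) (S : R * (R * R) -> R) (X Y : R * R -> R).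
Hypothesis su : surf T Om S X Y.
Variables (r w : bool -> R * (R * R) -> R) (m om : R * R -> R).
Hypothesis gr : forall j q, Om q -> cside j (S q) -> {for q, continuous (r j)}.
Hypothesis gw : forall j q, Om q -> cside j (S q) -> {for q, continuous (w j)}.
Hypothesis gm : forall z, pdom T z -> {for z, continuous m}.
Hypothesis gom : forall z, pdom T z -> {for z, continuous om}.
Variables (t : R) (K : set (R * R)).
Hypotheses (t0 : 0 <= t) (cK : compact K) (KO : K `<=` slice Om t).
Variable P : {measure set (mplane R) -> \bar R}.
Hypothesis PK : (P K < +oo)%E.
Hypothesis decP : forall E : set (mplane R), measurable E -> E `<=` K ->
  P E = (Lam T S X Y r m t (\1_E))%:E.
Variable wd : R * R -> R.
Hypothesis mwd : measurable_fun (K : set (mplane R)) (wd : mplane R -> R).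
Hypothesis wd_om : forall l, 0 <= t < T l -> wd (X (t, l), Y (t, l)) = om (t, l).

Let su' : surf T Om (fun q => - S q) X Y. Proof. exact: surf_opp. Qed.
Let mK : measurable (K : set (mplane R)). Proof. exact: compact_measurable_plane. Qed.
Let tt : t <= t <= t. Proof. by rewrite lexx. Qed.
Let KO' t' p : t <= t' <= t -> K p -> Om (t', p).
Proof. by move=> /andP[h1 h2] /KO; rewrite (_ : t' = t)//; apply/eqP; rewrite eq_le h1 h2. Qed.

Let gwp q : Om q -> 0 <= S q -> {for q, continuous (w true)}.
Proof. exact: (gw (j := true)). Qed.
Let gwm q : Om q -> 0 <= - S q -> {for q, continuous (w false)}.
Proof. by rewrite oppr_ge0; exact: (gw (j := false)). Qed.

(* A Radon-Nikodym derivative [wd] is only known up to a null set; off the curve it is replaced by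
   the classical velocity. *)
Definition canonical_velocity (p : R * R) : R :=
  if p \in K then (if S (t, p) < 0 then w false (t, p) else if 0 < S (t, p) then w true (t, p) else wd p)
  else 0.

Let wc := canonical_velocity.

Let sideP : measurable (K `&` [set p | 0 < S (t, p)] : set (mplane R)) /\
  measurable_fun (K `&` [set p | 0 < S (t, p)] : set (mplane R)) (fun p => w true (t, p)).
Proof. exact: (side_measurable su cK KO' gwp tt). Qed.

Let sideM : measurable (K `&` [set p | 0 < - S (t, p)] : set (mplane R)) /\
  measurable_fun (K `&` [set p | 0 < - S (t, p)] : set (mplane R)) (fun p => w false (t, p)).
Proof. exact: (side_measurable su' cK KO' gwm tt). Qed.

(** The part of K off the curve; what remains, Z, lies on the curve, where wc and wd coincide by
    definition. *)
Let D : set (mplane R) := K `&` [set p | 0 < S (t, p)] `|` K `&` [set p | 0 < - S (t, p)].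
Let Z : set (mplane R) := K `\` D.

Let mD : measurable D. Proof. by apply: measurableU; [exact: sideP.1|exact: sideM.1]. Qed.
Let mZ : measurable Z. Proof. exact: measurableD. Qed.

Let ZP p : K p -> ~ D p -> S (t, p) = 0.
Proof.
move=> Kp nD; apply/eqP; rewrite eq_le !leNgt; apply/andP; split; apply/negP => h; apply: nD.
  by left.
by right; split => //=; rewrite oppr_gt0.
Qed.

Let wcE : wc = fun p => ((fun p => w true (t, p)) \_ (K `&` [set p | 0 < S (t, p)])) p +
  ((fun p => w false (t, p)) \_ (K `&` [set p | 0 < - S (t, p)])) p + (wd \_ Z) p.
Proof.
apply/funext => p; rewrite /wc /canonical_velocity !patchE.
case: (boolP (p \in K)) => pK; last first.
  have nK : ~ K p by move=> h; case/negP: pK; rewrite inE.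
  by rewrite !memNset ?addr0// => -[h].
have Kp : K p by rewrite -inE.
have nZ : D p -> (p \in Z) = false by move=> h; apply: memNset => -[].
have [Sp|Sp|Sp] := ltgtP (S (t, p)) 0.
- rewrite memNset; last by move=> [_ /=]; rewrite ltNge (ltW Sp).
  have h : (K `&` [set p | 0 < - S (t, p)]) p by split => //=; rewrite oppr_gt0.
  by rewrite (mem_set h) nZ ?add0r ?addr0//; right.
- have h : (K `&` [set p | 0 < S (t, p)]) p by [].
  rewrite (mem_set h) memNset; last by move=> [_ /=]; rewrite oppr_gt0 ltNge (ltW Sp).
  by rewrite nZ ?addr0//; left.
- have n1 : ~ (K `&` [set p | 0 < S (t, p)]) p by move=> [_ /=]; rewrite Sp ltxx.
  have n2 : ~ (K `&` [set p | 0 < - S (t, p)]) p by move=> [_ /=]; rewrite Sp oppr0 ltxx.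
  rewrite (memNset n1) (memNset n2) !add0r mem_set//; by split => // -[].
Qed.

(** Boundedness is what wc gains over wd: off the curve it is a classical field, and on the curve it
    is [om], which [curve_bound] controls. *)
Lemma canonical_velocity_bmeas : exists M, bmeas K wc M.
Proof.
have [M1 M10 h1] := side_bound su cK KO' gwp; have [M2 M20 h2] := side_bound su' cK KO' gwm.
have [M3 M30 h3] := curve_bound su t0 cK KO' gom.
exists (M1 + M2 + M3); split.
- rewrite wcE; apply: measurable_funD; first apply: measurable_funD.
  + by apply: (measurable_restrictT _ sideP.1).1; exact: sideP.2.
  + by apply: (measurable_restrictT _ sideM.1).1; exact: sideM.2.
  + apply: (measurable_restrictT _ mZ).1; apply: measurable_funS mwd => //; exact: subDsetl.
- move=> p; rewrite /wc /canonical_velocity; case: ifPn => [|_]; last by rewrite normr0 !addr_ge0.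
  rewrite inE => Kp; have [Sp|Sp|Sp] := ltgtP (S (t, p)) 0.
  + have h : `|w false (t, p)| <= M2 by apply: h2 => //; rewrite oppr_ge0 ltW.
    by rewrite (le_trans h)// -addrA [M2 + _]addrC addrA lerDr addr_ge0.
  + have h : `|w true (t, p)| <= M1 by apply: h1 => //; exact: ltW.
    by rewrite (le_trans h)// -addrA lerDl addr_ge0.
  + have [l tl pE] := su_par su (KO Kp) Sp.
    have h : `|wd p| <= M3 by rewrite pE wd_om//; apply: h3 => //; [case/andP: tl|rewrite -pE].
    by rewrite (le_trans h)// lerDr addr_ge0.
- by move=> p nK; rewrite /wc /canonical_velocity memNset.
Qed.

Lemma Lam_canonical (F : bool -> R * (R * R) -> R) (k : R * R -> R) (phi : R * R -> R) :
  (forall p, ~ K p -> phi p = 0) ->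
  Lam T S X Y F k t (fun p => phi p * wc p) =
  Lam T S X Y (fun j => F j \* w j) (fun z => k z * om z) t phi.
Proof.
move=> phi0; rewrite /Lam; congr (_ + _ + _); apply: eq_Rintegral => p _.
- rewrite /sidef; case: ifPn => // Sp; have [Kp|Kp] := pselect (K p); last by rewrite phi0// !mul0r.
  by rewrite /wc /canonical_velocity mem_set// -oppr_gt0 Sp /= mulrAC mulrA.
- rewrite /sidef; case: ifPn => // Sp; have [Kp|Kp] := pselect (K p); last by rewrite phi0// !mul0r.
  by rewrite /wc /canonical_velocity mem_set// ltNge (ltW Sp)/= Sp /= mulrAC mulrA.
- rewrite /curvef; case: ifPn => // tl; have tl0 : 0 <= t < T p by rewrite t0.
  have [Kp|Kp] := pselect (K (X (t, p), Y (t, p))); last by rewrite phi0// !mul0r.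
  have [_ Sq] := su_on su tl0.
  by rewrite /wc /canonical_velocity mem_set// Sq ltxx wd_om// mulrAC mulrA.
Qed.

Variable mi : R * R -> R.
Hypothesis gmi : forall z, pdom T z -> {for z, continuous mi}.
Hypothesis iwd : P.-integrable K (EFin \o wd).
Hypothesis dwd : forall E : set (mplane R), measurable E -> E `<=` K ->
  (Lam T S X Y (fun j => r j \* w j) mi t (\1_E))%:E = (\int[P]_(p in E) (wd p)%:E)%E.

Lemma integral_Lam phi M : bmeas K phi M -> \int[P]_p phi p = Lam T S X Y r m t phi.
Proof.
apply: (bounded_functional_eq mK (bounded_functional_integral mK PK) (Lam_functional su gr gm t0 cK KO)).
move=> E mE EK; rewrite /Rintegral integral_indic// setIT.
by have /(congr1 fine) := decP mE EK.
Qed.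

Lemma int_canonical_velocity (E : set (mplane R)) : measurable E -> E `<=` K ->
  (\int[P]_(p in E) (wc p)%:E)%E = (Lam T S X Y (fun j => r j \* w j) (fun z => m z * om z) t (\1_E))%:E.
Proof.
move=> mE EK; have [M bwc] := canonical_velocity_bmeas.
have e : (fun p => (wc p)%:E) \_ E = EFin \o (fun p => \1_E p * wc p).
  apply/funext => p; rewrite patchE /= indicE; case: (boolP (p \in E)) => _; rewrite ?mul1r ?mul0r//.
have bE : bmeas K (fun p => \1_E p * wc p) M.
  have [mwc wcM wc0] := bwc; split.
  - by apply: measurable_funM => //; exact: measurable_indic.
  - move=> p; rewrite normrM indicE; case: (_ \in _); rewrite ?normr1 ?mul1r// normr0 mul0r.
    exact: bmeas_ge0 bwc.
  - by move=> p nK; rewrite wc0// mulr0.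
rewrite integral_mkcond e -Lam_canonical; last by move=> p nK; rewrite indicE memNset// => /EK.
rewrite -(integral_Lam bE) /Rintegral fineK//.
exact: integrable_fin_num (bmeas_integrable mK PK bE).
Qed.

(** On subsets of D the terms along the curve vanish, so both decompositions reduce to the same
    densities: wd and wc have equal integrals over each measurable part of D. *)
Let ae_wc : ae_eq P D (EFin \o wd) (EFin \o wc).
Proof.
have DK : D `<=` K by move=> p [[]|[]].
have [M bwc] := canonical_velocity_bmeas.
apply: integral_ae_eq => //.
- by apply: integrableS iwd.
- by apply/measurable_EFinP; apply: measurable_funTS; case: bwc.
move=> E ED mE; have EK := subset_trans ED DK.
rewrite -(dwd mE EK) (int_canonical_velocity mE EK) /Lam; congr (_ + _)%:E.
apply: eq_Rintegral => l _; rewrite /curvef; case: ifP => // tl.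
have tl0 : 0 <= t < T l by rewrite t0.
have [_ Sq] := su_on su tl0.
by rewrite indicE memNset ?mul0r// => /ED[[_ /=]|[_ /=]]; rewrite Sq ?oppr0 ltxx.
Qed.

Let Nn : set (mplane R) := K `&` [set p | wd p - wc p != 0].

Let mN : measurable Nn.
Proof.
have [M [mwc _ _]] := canonical_velocity_bmeas.
have mf : measurable_fun (K : set (mplane R)) (fun p => wd p - wc p).
  by apply: measurable_funB => //; exact: measurable_funTS.
have := mf mK _ (measurableC (measurable_set1 (0 : R))); congr measurable.
by apply/seteqP; split => p [Kp /=] /eqP; split.
Qed.

Let PN : P Nn = 0%E.
Proof.
have nP := (@negligibleP _ _ _ P Nn mN).1; apply: nP; apply: negligibleS ae_wc => p [Kp /= ne] /= h.
have [Dp|Dp] := pselect (D p).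
  by have [e] := h Dp; move: ne; rewrite e subrr eqxx.
move: ne; rewrite /wc /canonical_velocity mem_set// (ZP Kp Dp) ltxx subrr eqxx//.
Qed.

(** On indicators both sides are integrals against P, of wd on the left and of wc on the right, and
    these agree P-almost everywhere. Since the parts off the curve are the same, this compares mi
    with m om on the shock. *)
Lemma Lam_momentum phi M : bmeas K phi M ->
  Lam T S X Y (fun j => r j \* w j) mi t phi =
  Lam T S X Y (fun j => r j \* w j) (fun z => m z * om z) t phi.
Proof.
have grw j q : Om q -> cside j (S q) -> {for q, continuous (r j \* w j)}.
  by move=> h1 h2; apply: cvgM; [exact: gr|exact: gw].
have gmo z : pdom T z -> {for z, continuous (fun z => m z * om z)}.
  by move=> pz; apply: cvgM; [exact: gm|exact: gom].
apply: (bounded_functional_eq mK (Lam_functional su grw gmi t0 cK KO) (Lam_functional su grw gmo t0 cK KO)).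
move=> E mE EK; apply: EFin_inj; rewrite (dwd mE EK) -(int_canonical_velocity mE EK).
have [N [mwc _ _]] := canonical_velocity_bmeas.
apply: ae_eq_integral => //.
- by apply/measurable_EFinP; exact: measurable_funS mwd.
- by apply/measurable_EFinP; exact: measurable_funTS.
- exists Nn; split; [exact: mN|exact: PN|] => p /= h; split; first by apply: EK; apply: contrapT => nE; apply: h.
  by apply/eqP => /subr0_eq e; apply: h => _; rewrite e.
Qed.

(** The set where wd and wc differ is P-null, hence null for both parts of mu, so wd may be replaced
    by the bounded wc under mu too. *)
Lemma sint_velocity (F : bool -> R * (R * R) -> R) (k : R * R -> R) (mu : @signed_measure R) :
  (forall j q, Om q -> cside j (S q) -> {for q, continuous (F j)}) ->
  (forall z, pdom T z -> {for z, continuous k}) ->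
  (spos mu K < +oo)%E -> (sneg mu K < +oo)%E ->
  (forall E : set (mplane R), measurable E -> E `<=` K -> P E = 0%E -> spos mu E = 0%E /\ sneg mu E = 0%E) ->
  (forall E : set (mplane R), measurable E -> E `<=` K -> smeas mu E = (Lam T S X Y F k t (\1_E))%:E) ->
  forall phi M, bmeas K phi M ->
  sint mu (fun p => phi p * wd p) = Lam T S X Y (fun j => F j \* w j) (fun z => k z * om z) t phi.
Proof.
move=> gF gk fp fn ac dec phi M b; have [mphi phiM phi0] := b.
have [N bwc] := canonical_velocity_bmeas; have [mwc wcN wc0] := bwc.
have NK : Nn `<=` K by move=> p [].
have [p0 n0] := ac _ mN NK PN.
have e (nu : {measure set (mplane R) -> \bar R}) : nu Nn = 0%E ->
    \int[nu]_p (phi p * wd p) = \int[nu]_p (phi p * wc p).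
  move=> nuN; rewrite /Rintegral; congr fine; apply: ae_eq_integral => //.
  - apply/measurable_EFinP; have -> : (fun p => phi p * wd p) = (fun p => phi p * (wd \_ K) p).
      apply/funext => p; rewrite patchE; case: ifPn => // /negP h; rewrite phi0 ?mul0r// => Kp.
      by apply: h; rewrite inE.
    by apply: measurable_funM => //; exact: (measurable_restrictT _ mK).1.
  - by apply/measurable_EFinP; exact: measurable_funM.
  - exists Nn; split => // p /= h; have Kp : K p.
      by apply: contrapT => nK; apply: h => _; rewrite phi0// !mul0r.
    by split => //; apply/eqP => /subr0_eq ee; apply: h => _; rewrite ee.
have bw : bmeas K (fun p => phi p * wc p) (M * N).
  split; first exact: measurable_funM.
    by move=> p; rewrite normrM ler_pM.
  by move=> p nK; rewrite phi0// mul0r.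
rewrite /sint !e// -/(sint mu (fun p => phi p * wc p)) (sint_Lam su gF gk t0 cK KO fp fn dec bw).
exact: Lam_canonical.
Qed.

End radon_nikodym.

(** * From the weak form to the formulas *)

Section primitives.
Context {R : realType}.

(** The identity between the flux and the rate of absorption is available for t > 0 only; the left
    end point does not affect the integral. *)
Lemma Rintegral_eq_oc (f g : R -> R) (a b : R) : a <= b ->
  (forall y, a <= y <= b -> {for y, continuous f}) ->
  (forall y, a < y <= b -> g y = f y) ->
  \int[leb R]_(y in `[a, b]) g y = \int[leb R]_(y in `[a, b]) f y.
Proof.
move=> ab cf gf; have fi : (leb R).-integrable `]a, b] (EFin \o f).
  by apply: integrableS (segment_integrable cf) => //; apply: subset_itv; rewrite bnd_simp.
have gf' y : y \in `]a, b]%classic -> g y = f y by rewrite inE/= in_itv/=; exact: gf.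
have gi : (leb R).-integrable `]a, b] (EFin \o g).
  by apply: eq_integrable fi => // y hy; rewrite /= gf'.
by rewrite -(Rintegral_itv_obnd_cbnd gi) -(Rintegral_itv_obnd_cbnd fi); exact: eq_Rintegral.
Qed.

Variables (M M' k e : R -> R) (T : R).
Hypothesis dM : forall t, 0 <= t < T -> is_derive t 1 M (M' t).
Hypothesis cM' : forall t, 0 <= t < T -> {for t, continuous M'}.
Hypothesis ce : forall t, 0 <= t < T -> {for t, continuous e}.
Hypothesis ke : forall t, 0 < t < T -> k t = e t.

Let within t y : 0 < t < T -> 0 <= y <= t -> 0 <= y < T.
Proof. by move=> /andP[_ tT] /andP[-> yt]; exact: le_lt_trans tT. Qed.

Let FTC a b : 0 <= a -> a <= b -> b < T -> \int[leb R]_(y in `[a, b]) M' y = M b - M a.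
Proof.
move=> a0 ab bT; have h y : a <= y <= b -> 0 <= y < T.
  by move=> /andP[ay yb]; rewrite (le_trans a0 ay) (le_lt_trans yb).
by apply: Rintegral_FTC2 => // y /h; [exact: dM|exact: cM'].
Qed.

Lemma primitive_eq : M 0 = 0 -> (forall t, 0 < t < T -> M' t = e t) ->
  forall t, 0 < t < T -> M t = \int[leb R]_(y in `[0, t]) k y.
Proof.
move=> M0 Me t ht; have t0 : 0 <= t by case/andP: ht => /ltW.
rewrite (@Rintegral_eq_oc M' k 0 t t0).
- by rewrite FTC ?M0 ?subr0//; case/andP: ht.
- by move=> y hy; apply: cM'; exact: within hy.
- move=> y /andP[y0 yt]; have hy : 0 < y < T by rewrite y0 (le_lt_trans yt)//; case/andP: ht.
  by rewrite ke// Me.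
Qed.

(** Over each segment inside ]0, T[ the continuous functions M' and e have the same integral, so
    they agree there. Nothing is assumed about M at 0, and its value has to be recovered. *)
Lemma derivative_primitive : (forall t, 0 < t < T -> M t = \int[leb R]_(y in `[0, t]) k y) ->
  (forall t, 0 < t < T -> M' t = e t) /\ (0 < T -> M 0 = 0).
Proof.
move=> Mk.
have Me t : 0 < t < T -> M t = \int[leb R]_(y in `[0, t]) e y.
  move=> ht; have t0 : 0 <= t by case/andP: ht => /ltW.
  rewrite Mk//; apply: Rintegral_eq_oc => //.
    by move=> y hy; apply: ce; exact: within hy.
  by move=> y /andP[y0 yt]; apply: ke; rewrite y0 (le_lt_trans yt)//; case/andP: ht.
have M'e t : 0 < t < T -> M' t = e t.
  move=> /andP[t0 tT]; pose t1 := t / 2; pose t2 := (t + T) / 2.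
  have t12 : t1 < t < t2 by rewrite /t1 /t2; apply/andP; split; lra.
  have t10 : 0 < t1 by rewrite divr_gt0.
  have t2T : t2 < T by rewrite /t2; lra.
  have t1t2 : t1 <= t2 by case/andP: t12 => h1 h2; exact: ltW (lt_trans h1 h2).
  have cl y : 0 <= clampr t1 t2 y < T.
    by have /andP[h1 h2] := clampr_in y t1t2; rewrite (le_trans (ltW t10))//= (le_lt_trans h2).
  apply/eqP; rewrite -subr_eq0; apply/eqP.
  apply: (@segment_ints_eq0 _ (fun y => M' y - e y) t1 t2 t t12).
    move=> y; have cy := @continuous_clampr _ t1 t2 y.
    by apply: cvgB; [exact: (continuous_comp cy (cM' (cl y)))|exact: (continuous_comp cy (ce (cl y)))].
  move=> a b ta ab bt.
  have hy y : 0 <= y <= b -> 0 <= y < T by move=> /andP[-> yb]/=; rewrite (le_lt_trans yb)// (le_lt_trans bt).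
  have a0 : 0 < a by exact: lt_le_trans ta.
  have ha y : a <= y <= b -> 0 <= y < T by move=> /andP[ay yb]; apply: hy; rewrite yb (le_trans (ltW a0)).
  have ie : (leb R).-integrable `[0, b] (EFin \o e).
    by apply: segment_integrable => y /hy; exact: ce.
  have i1 : (leb R).-integrable `[a, b] (EFin \o M') by apply: segment_integrable => y /ha; exact: cM'.
  have i2 : (leb R).-integrable `[a, b] (EFin \o e) by apply: segment_integrable => y /ha; exact: ce.
  rewrite RintegralB// (FTC (ltW a0) (ltW ab) (le_lt_trans bt t2T)).
  rewrite !Me; first last.
  - by rewrite (lt_trans a0)//= (le_lt_trans bt).
  - by rewrite a0 (lt_trans ab)// (le_lt_trans bt).
  apply/eqP; rewrite subr_eq0; apply/eqP.
  have i3 : (leb R).-integrable `]a, b] (EFin \o e).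
    by apply: integrableS i2 => //; apply: subset_itv; rewrite bnd_simp.
  rewrite (@Rintegral_itvB _ e (BLeft 0) (BRight b) a ie) ?bnd_simp ?(ltW a0) ?(ltW ab)//.
  by rewrite Rintegral_itv_obnd_cbnd.
(* At any such t the integral of M' over [0, t] is M t - M 0 by the fundamental theorem, and M t
   because M' = e on ]0, t]. *)
split => // T0; pose t := T / 2; have ht : 0 < t < T by rewrite /t; apply/andP; split; lra.
have t0 : 0 <= t by case/andP: ht => /ltW.
have := @FTC 0 t (lexx 0) t0; case/andP: (ht) => _ tT /(_ tT).
rewrite (_ : \int[leb R]_(y in `[0, t]) M' y = M t).
  by move=> /eqP; rewrite eq_sym subr_eq -subr_eq0 opprD addNKr oppr_eq0 => /eqP.
rewrite Me//; apply: Rintegral_eq_oc => //.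
  by move=> y hy; apply: ce; exact: within hy.
by move=> y /andP[y0 yt]; apply: M'e; rewrite y0 (le_lt_trans yt)//; case/andP: ht.
Qed.

End primitives.

Lemma continuous_bmeas {R : realType} (K : set (R * R)) (phi : R * R -> R) : compact K ->
  continuous phi -> (forall p, ~ K p -> phi p = 0) -> exists M, bmeas K phi M.
Proof.
move=> cK cphi phi0; have cphi' q : K q -> {for q, continuous phi} by move=> _; exact: cphi.
have [B B0 hB] := compact_bound cK cphi'.
exists B; split => //; first exact: continuous_measurable_plane.
by move=> p; have [/hB//|/phi0->] := pselect (K p); rewrite normr0.
Qed.

Lemma Cc1_Cc {R : realType} (f : R * R -> R) : Cc1 f -> Cc f.
Proof.
by move=> Cf; split; [move=> p; apply: c1at_continuous; exact: C1_c1at Cf.1 I|exact: Cf.2].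
Qed.

Lemma Cc1_bmeas {R : realType} (f : R * R -> R) : Cc1 f -> exists M, [/\ bmeas (supp f) f M, bmeas (supp f) (d1 f) M & bmeas (supp f) (d2 f) M].
Proof.
move=> Cf; have cf p : c1at f p by exact: C1_c1at Cf.1 Logic.I.
have [M0 [h1 h2 h3]] := continuous_bmeas Cf.2 (fun p => c1at_continuous (cf p)) (@supp_out _ f).
have [M1 [k1 k2 k3]] := continuous_bmeas Cf.2 (fun p => c1at_d1 (cf p)) (fun p h => (supp_d1 h).1).
have [M2 [l1 l2 l3]] := continuous_bmeas Cf.2 (fun p => c1at_d2 (cf p)) (fun p h => (supp_d1 h).2).
have M0p := le_trans (normr_ge0 _) (h2 (0, 0)); have M1p := le_trans (normr_ge0 _) (k2 (0, 0)).
have M2p := le_trans (normr_ge0 _) (l2 (0, 0)).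
exists (M0 + M1 + M2); split; split => // p.
- by rewrite (le_trans (h2 p))// -addrA lerDl addr_ge0.
- by rewrite (le_trans (k2 p))// [M0 + _]addrC -addrA lerDl addr_ge0.
- by rewrite (le_trans (l2 p))// lerDr addr_ge0.
Qed.

Lemma Cc_bmeas {R : realType} (f : R * R -> R) : Cc f -> exists M, bmeas (supp f) f M.
Proof. by move=> [cf cK]; exact: continuous_bmeas cK cf (@supp_out _ f). Qed.

Section shock.
Context {R : realType}.
Variables (A B : R -> R) (G : R * R -> R) (rho u v : bool -> R * R -> R).
Variables (T : R -> R) (V : R -> set (R * R)) (Om : set (R * (R * R))).
Variables (S : R * (R * R) -> R) (xs ys ut vt : R * R -> R).
Variables (a b : bool -> R * R -> R) (rhoS uS vS : bool -> R * (R * R) -> R).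
Hypothesis data : compressive_data A B G rho u v.
Hypothesis time : local_time A B G u v T V.
Hypothesis surface : shock_surface A B G u v T V Om S xs ys ut vt a b.
Hypothesis sides : side_solutions G rho u v T V Om S rhoS uS vS.

Let su : surf T Om S xs ys. Proof. exact: shock_surf time surface. Qed.

Lemma rhoS_c1at j q : Om q -> cside j (S q) -> c1at (rhoS j) q.
Proof. by move=> h1 h2; have [h _ _] := so_C1 sides j; exact: C1_c1at h _. Qed.
Lemma uS_c1at j q : Om q -> cside j (S q) -> c1at (uS j) q.
Proof. by move=> h1 h2; have [_ h _] := so_C1 sides j; exact: C1_c1at h _. Qed.
Lemma vS_c1at j q : Om q -> cside j (S q) -> c1at (vS j) q.
Proof. by move=> h1 h2; have [_ _ h] := so_C1 sides j; exact: C1_c1at h _. Qed.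
Lemma rho_uS_c1at j q : Om q -> cside j (S q) -> c1at (rhoS j \* uS j) q.
Proof. by move=> h1 h2; apply: c1at_mul; [exact: rhoS_c1at|exact: uS_c1at]. Qed.
Lemma rho_vS_c1at j q : Om q -> cside j (S q) -> c1at (rhoS j \* vS j) q.
Proof. by move=> h1 h2; apply: c1at_mul; [exact: rhoS_c1at|exact: vS_c1at]. Qed.

Lemma continuous_d1_xs z : pdom T z -> {for z, continuous (d1 xs)}.
Proof. by move=> pz; exact: c1at_d1 (su_X su pz). Qed.
Lemma continuous_d1_ys z : pdom T z -> {for z, continuous (d1 ys)}.
Proof. by move=> pz; exact: c1at_d1 (su_Y su pz). Qed.

Lemma pde_mass j q : Om q -> 0 < q.1 -> side j (S q) ->
  dt (rhoS j) q + dx (rhoS j \* uS j) q + dy (rhoS j \* vS j) q = 0.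
Proof. by move=> h1 h2 h3; have [] := so_system sides h1 h2 h3. Qed.
Lemma pde_u j q : Om q -> 0 < q.1 -> side j (S q) ->
  dt (rhoS j \* uS j) q + dx (rhoS j \* uS j \* uS j) q + dy (rhoS j \* uS j \* vS j) q = 0.
Proof. by move=> h1 h2 h3; have [] := so_system sides h1 h2 h3. Qed.
Lemma pde_v j q : Om q -> 0 < q.1 -> side j (S q) ->
  dt (rhoS j \* vS j) q + dx (rhoS j \* vS j \* uS j) q + dy (rhoS j \* vS j \* vS j) q = 0.
Proof.
move=> h1 h2 h3; have [_ _] := so_system sides h1 h2 h3.
have -> : rhoS j \* uS j \* vS j = rhoS j \* vS j \* uS j by apply/funext => z /=; rewrite mulrAC.
by [].
Qed.

Definition absorbed_rate (w : bool -> R * R -> R) (l tau : R) : R :=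
  let k j := w j (a j (tau, l), b j (tau, l)) *
    (d1 (a j) (tau, l) * d2 (b j) (tau, l) - d1 (b j) (tau, l) * d2 (a j) (tau, l)) in
  k true - k false.

(** The factor k is 1, u or v, and u and v are constant along characteristics: the same k multiplies
    the density at the shock and at the foot, so [side_flow] for the mass yields all three
    fluxes. *)
Lemma flux_absorbed_rate (r : bool -> R * (R * R) -> R) (w : bool -> R * R -> R) (k : bool -> R -> R -> R) :
  (forall j t l, 0 < t < T l -> r j (t, (xs (t, l), ys (t, l))) = rhoS j (t, (xs (t, l), ys (t, l))) * k j t l /\
     w j (a j (t, l), b j (t, l)) = rho j (a j (t, l), b j (t, l)) * k j t l) ->
  forall t l, 0 < t < T l -> flux xs ys r uS vS (t, l) = absorbed_rate w l t.
Proof.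
move=> rk t l tl; have h j : fluxm (r j) (uS j) (vS j) xs ys (t, l) =
    w j (a j (t, l), b j (t, l)) *
    (d1 (a j) (t, l) * d2 (b j) (t, l) - d1 (b j) (t, l) * d2 (a j) (t, l)).
  have [_ _ e] := side_flow data time surface sides j tl.
  have [e1 e2] := rk j t l tl.
  by rewrite /fluxm /= e1 e2 mulrAC e mulrAC.
by rewrite /flux !h.
Qed.

Lemma flux_mass t l : 0 < t < T l -> flux xs ys rhoS uS vS (t, l) = absorbed_rate rho l t.
Proof. by apply: (@flux_absorbed_rate _ _ (fun _ _ _ => 1)) => j t' l' _; rewrite !mulr1. Qed.

Lemma flux_u t l : 0 < t < T l ->
  flux xs ys (fun j => rhoS j \* uS j) uS vS (t, l) = absorbed_rate (fun j => rho j \* u j) l t.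
Proof.
apply: (@flux_absorbed_rate _ _ (fun j t l => u j (a j (t, l), b j (t, l)))) => j t' l' tl.
by have [/= -> _ _] := side_flow data time surface sides j tl.
Qed.

Lemma flux_v t l : 0 < t < T l ->
  flux xs ys (fun j => rhoS j \* vS j) uS vS (t, l) = absorbed_rate (fun j => rho j \* v j) l t.
Proof.
apply: (@flux_absorbed_rate _ _ (fun j t l => v j (a j (t, l), b j (t, l)))) => j t' l' tl.
by have [/= _ -> _] := side_flow data time surface sides j tl.
Qed.

Section ode.
Variables (r : bool -> R * (R * R) -> R) (w : bool -> R * R -> R) (m : R * R -> R).
Hypothesis gr : forall j q, Om q -> cside j (S q) -> c1at (r j) q.
Hypothesis cm : forall z, pdom T z -> c1at m z.
Hypothesis fk : forall t l, 0 < t < T l -> flux xs ys r uS vS (t, l) = absorbed_rate w l t.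

Let cs (h : R * R -> R) l : (forall z, pdom T z -> {for z, continuous h}) ->
  forall t, 0 <= t < T l -> {for t, continuous (fun t => h (t, l))}.
Proof.
move=> ch t tl; apply: (@continuous_comp _ _ _ (fun t => (t, l)) h); last exact: ch.
by apply: continuous_at_pair; [exact: cvg_id|exact: cvg_cst].
Qed.

Let dm l t : 0 <= t < T l -> is_derive t 1 (fun t => m (t, l)) (d1 m (t, l)).
Proof. by move=> tl; apply: is_derive_d1; exact: c1at_diff (@cm (t, l) tl). Qed.

Let cdm z : pdom T z -> {for z, continuous (d1 m)}.
Proof. by move=> pz; exact: c1at_d1 (cm pz). Qed.

Let cfl z : pdom T z -> {for z, continuous (flux xs ys r uS vS)}.
Proof. exact: (continuous_flux su gr uS_c1at vS_c1at). Qed.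

Lemma absorbed_of_ode : (forall t l, 0 < t < T l -> d1 m (t, l) = flux xs ys r uS vS (t, l)) ->
  (forall l, 0 < T l -> m (0, l) = 0) ->
  forall t l, 0 < t < T l -> m (t, l) = absorbed w a b t l.
Proof.
move=> ode m0 t l tl; have T0 : 0 < T l by case/andP: tl; exact: lt_trans.
exact: (@primitive_eq _ _ _ (absorbed_rate w l) (fun t => flux xs ys r uS vS (t, l)) (T l) (@dm l) (cs cdm)
  (fun t h => esym (fk h)) (m0 l T0) (fun t h => ode t l h) t tl).
Qed.

Lemma ode_of_absorbed : (forall t l, 0 < t < T l -> m (t, l) = absorbed w a b t l) ->
  (forall t l, 0 < t < T l -> d1 m (t, l) = flux xs ys r uS vS (t, l)) /\
  (forall l, 0 < T l -> m (0, l) = 0).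
Proof.
move=> ma; have h l := @derivative_primitive _ (fun t => m (t, l)) (fun t => d1 m (t, l)) (absorbed_rate w l)
  (fun t => flux xs ys r uS vS (t, l)) (T l) (@dm l) (cs cdm) (cs cfl) (fun t h => esym (fk h)) (fun t h => ma t l h).
by split => [t l tl|l]; [exact: (h l).1|exact: (h l).2].
Qed.

End ode.

Lemma Lam_eq_curve (r : bool -> R * (R * R) -> R) (m1 m2 : R * R -> R) t phi :
  (forall l, t < T l -> m1 (t, l) = m2 (t, l)) -> Lam T S xs ys r m1 t phi = Lam T S xs ys r m2 t phi.
Proof.
move=> e; rewrite /Lam; congr (_ + _); apply: eq_Rintegral => l _.
by rewrite /curvef; case: ifP => // tl; rewrite e.
Qed.

Lemma Lam_curve_eq (r : bool -> R * (R * R) -> R) (m1 m2 : R * R -> R) t : 0 <= t ->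
  (forall z, pdom T z -> {for z, continuous m1}) -> (forall z, pdom T z -> {for z, continuous m2}) ->
  (forall f, Cc1 f -> supp f `<=` slice Om t -> Lam T S xs ys r m1 t f = Lam T S xs ys r m2 t f) ->
  forall l, t < T l -> m1 (t, l) = m2 (t, l).
Proof.
move=> t0 c1 c2 e l tl; apply/eqP; rewrite -subr_eq0; apply/eqP.
have ce z : pdom T z -> {for z, continuous (fun z => m1 z - m2 z)}.
  by move=> pz; have h1 := c1 z pz; have h2 := c2 z pz; exact: cvgB h1 h2.
apply: (curve_test_eq0 su t0 ce _ tl) => f Cf fO.
have b1 := curvef_slice_bcs1 su t0 ce Cf fO; have b2 := curvef_slice_bcs1 su t0 c2 Cf fO.
have := e f Cf fO; rewrite /Lam => /addrI.
have -> : \int[leb R]_l curvef T xs ys m1 t f l =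
    \int[leb R]_l curvef T xs ys (fun z => m1 z - m2 z) t f l + \int[leb R]_l curvef T xs ys m2 t f l.
  by rewrite -int1_add//; apply: eq_Rintegral => l' _; rewrite -curvef_D; congr curvef; apply/funext => z; rewrite subrK.
by move=> /eqP; rewrite -subr_eq0 addrK => /eqP.
Qed.

Section initial.
Variables (r : bool -> R * (R * R) -> R) (w : bool -> R * R -> R) (r0 : R * R -> R) (m : R * R -> R).
Hypothesis gr : forall j q, Om q -> cside j (S q) -> {for q, continuous (r j)}.
Hypothesis rw : forall j p, Om (0, p) -> cside j (S (0, p)) -> r j (0, p) = w j p.
Hypothesis r0E : r0 = piecewise G w.

(** At t = 0 the sides of S are those of G, so the two integrands differ only on the initial curve,
    which is a null set by [surf_null]. *)
Lemma Lam_initial f : Cc f -> supp f `<=` slice Om 0 ->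
  Lam T S xs ys r m 0 f = \int[leb2 R]_p (f p * r0 p) + \int[leb R]_l curvef T xs ys m 0 f l.
Proof.
move=> [cf cK] fO; rewrite /Lam; congr (_ + _).
have [M [mf fM f0]] := continuous_bmeas cK cf (@supp_out _ f).
have tt : ((0 : R) <= 0) && ((0 : R) <= 0) by apply/andP.
have KO' t' p : (0 : R) <= t' <= 0 -> supp f p -> Om (t', p).
  by move=> /andP[h1 h2] /fO; rewrite (_ : t' = 0)//; apply/eqP; rewrite eq_le h1 h2.
have gm q : Om q -> 0 <= - S q -> {for q, continuous (r false)} by rewrite oppr_ge0; exact: (gr (j := false)).
have gp q : Om q -> 0 <= S q -> {for q, continuous (r true)} by exact: (gr (j := true)).
have bm := side_bcs2 (surf_opp su) cK KO' gm tt mf fM f0.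
have bp := side_bcs2 su cK KO' gp tt mf fM f0.
have bD := bcs2_add bm bp.
have t00 : (0 : R) <= 0 by [].
pose D0 : set (R * R) := [set p | supp f p /\ S (0, p) = 0].
have cS0 p : supp f p -> {for p, continuous (fun p => S (0, p))}.
  by move=> /fO Op; apply: slice_section; exact: c1at_continuous (su_S su Op).
have cD0 : compact D0 by apply: compact_zeros => //; exact: closed_closure.
have mD0 := compact_measurable_plane cD0.
(* [piecewise] takes the plus value on G = 0. The term g is this contribution, carried by a null
   set; it is kept to see that f r0 is Borel. *)
pose g := (fun p => f p * r true (0, p)) \_ D0.
have mg : measurable_fun setT (g : mplane R -> R).
  apply: (measurable_restrictT _ mD0).1; apply: within_continuous_measurable_plane => //.
  apply: continuous_in_subspaceT => p /set_mem[fp Sp].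
  apply: cvgM; first exact: cf.
  by apply: slice_section; apply: (gr (j := true)); [exact: fO|rewrite /cside Sp].
have E p : f p * r0 p = sidef (fun q => - S q) (r false) 0 f p + sidef S (r true) 0 f p + g p.
  rewrite /g patchE /sidef; have [fp|fp] := pselect (supp f p); last first.
    by rewrite supp_out// !mul0r !if_same !addr0.
  have Op := fO _ fp; have [S0 Sj] := ss_initial_surface surface Op.
  rewrite r0E /piecewise oppr_gt0; have [Sp|Sp|Sp] := ltgtP (S (0, p)) 0.
  - have Gp : G p < 0 := (Sj false).1 Sp.
    rewrite Gp memNset; last by move=> [_ /= e]; rewrite e ltxx in Sp.
    by rewrite !addr0 rw//; exact: ltW.
  - have Gp : 0 < G p := (Sj true).1 Sp.
    rewrite ltNge (ltW Gp)/= memNset; last by move=> [_ /= e]; rewrite e ltxx in Sp.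
    by rewrite add0r addr0 rw//; exact: ltW.
  - rewrite (S0.1 Sp) ltxx mem_set// !add0r rw//.
    by rewrite /cside Sp.
rewrite -int2_add// /Rintegral; congr fine; apply: ae_eq_integral => //.
- by apply/measurable_EFinP; exact: bD.1.
- apply/measurable_EFinP; rewrite (_ : (fun p => f p * r0 p) = (fun p => sidef (fun q => - S q) (r false) 0 f p + sidef S (r true) 0 f p + g p)).
    by apply: measurable_funD => //; exact: bD.1.
  by apply/funext => p; exact: E.
- apply: negligibleS (surf_null su t00 cK fO) => p /= h.
  have fp : supp f p by apply: contrapT => nf; apply: h => _; rewrite E /sidef /g patchE supp_out// !mul0r !if_same !addr0.
  split => //; apply: contrapT => nS; apply: h => _.
  by rewrite E /g patchE memNset ?addr0// => -[].
Qed.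

End initial.
End shock.

Lemma ae_itv {R : realType} (Q : R -> Prop) (a b : R) : a < b -> {ae leb R, forall t, Q t} ->
  exists t, a <= t <= b /\ Q t.
Proof.
move=> ab aeQ; apply: contrapT => nQ.
have : (leb R).-negligible `[a, b]%classic.
  apply: negligibleS aeQ => t /=; rewrite in_itv/= => ht Qt; apply: nQ; by exists t.
move/(negligibleP (leb R) (measurable_itv `[a, b])).
have e : leb R `[a, b]%classic = (b - a)%:E by rewrite lebesgue_measure_itv/= lte_fin ab -EFinD.
by move=> e'; move: e; rewrite e' => -[] /esym/eqP; rewrite subr_eq0 gt_eqF.
Qed.

Lemma ae_impl {R : realType} (P Q : R -> Prop) : (forall x, P x -> Q x) ->
  {ae leb R, forall x, P x} -> {ae leb R, forall x, Q x}.
Proof. by move=> PQ; apply: negligibleS => x nQ Px; apply: nQ; exact: PQ. Qed.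

Lemma ae_impl2 {R : realType} (P1 P2 Q : R -> Prop) : (forall x, P1 x -> P2 x -> Q x) ->
  {ae leb R, forall x, P1 x} -> {ae leb R, forall x, P2 x} -> {ae leb R, forall x, Q x}.
Proof.
move=> PQ h1 h2; apply: negligibleS (negligibleU h1 h2) => x nQ.
have [p1|p1] := pselect (P1 x); last by left.
by right => p2; apply: nQ; exact: PQ.
Qed.

Lemma piecewiseM {R : realType} (G : R * R -> R) (w1 w2 : bool -> R * R -> R) :
  (fun p => piecewise G w1 p * piecewise G w2 p) = piecewise G (fun j => w1 j \* w2 j).
Proof. by apply/funext => p; rewrite /piecewise; case: ifP. Qed.

(** * Necessity of the formulas *)

Section forward.
Context {R : realType}.
Variables (A B : R -> R) (G : R * R -> R) (rho u v : bool -> R * R -> R).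
Variables (T : R -> R) (V : R -> set (R * R)) (Om : set (R * (R * R))).
Variables (S : R * (R * R) -> R) (xs ys ut vt : R * R -> R).
Variables (a b : bool -> R * R -> R) (rhoS uS vS : bool -> R * (R * R) -> R).
Hypothesis data : compressive_data A B G rho u v.
Hypothesis time : local_time A B G u v T V.
Hypothesis surface : shock_surface A B G u v T V Om S xs ys ut vt a b.
Hypothesis sides : side_solutions G rho u v T V Om S rhoS uS vS.

Let su : surf T Om S xs ys. Proof. exact: shock_surf time surface. Qed.
Let orient := shock_orient data time surface.
Let cr' := rhoS_c1at sides. Let cu' := uS_c1at sides. Let cv' := vS_c1at sides.
Let cru' := rho_uS_c1at sides. Let crv' := rho_vS_c1at sides.
Let d1x z : pdom T z -> {for z, continuous (d1 xs)}. Proof. exact: (continuous_d1_xs time surface). Qed.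
Let d1y z : pdom T z -> {for z, continuous (d1 ys)}. Proof. exact: (continuous_d1_ys time surface). Qed.

Section weak.
Variables (r : bool -> R * (R * R) -> R) (m : R * R -> R).
Hypothesis gr : forall j q, Om q -> cside j (S q) -> c1at (r j) q.
Hypothesis cm : forall z, pdom T z -> c1at m z.
Hypothesis pde : forall j q, Om q -> 0 < q.1 -> side j (S q) ->
  dt (r j) q + dx (r j \* uS j) q + dy (r j \* vS j) q = 0.

Definition weak_integrand (f : R * R -> R) t : R :=
  Lam T S xs ys (fun j => r j \* uS j) (fun z => m z * d1 xs z) t (d1 f) +
  Lam T S xs ys (fun j => r j \* vS j) (fun z => m z * d1 ys z) t (d2 f).

(** The integrand Fi of a solution is identified with [weak_integrand] for almost every t only,
    because velocities and absolute continuity are given for almost every t. The integrals agree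
    nonetheless, and [Lam_balance] leaves the defect tested against every f. *)
Lemma weak_ode :
  (forall f t1 t2, Cc1 f -> 0 < t1 -> t1 < t2 ->
    (forall t, t1 <= t <= t2 -> supp f `<=` slice Om t) -> exists Fi : R -> R,
    [/\ (leb R).-integrable `[t1, t2] (EFin \o Fi),
        {ae leb R, forall t, t1 <= t <= t2 -> Fi t = weak_integrand f t} &
        Lam T S xs ys r m t2 f - Lam T S xs ys r m t1 f = \int[leb R]_(t in `[t1, t2]) Fi t]) ->
  forall t l, 0 < t < T l -> d1 m (t, l) = flux xs ys r uS vS (t, l).
Proof.
move=> weak t l tl; apply/eqP; rewrite -subr_eq0; apply/eqP.
have ce z : pdom T z -> {for z, continuous (fun z => d1 m z - flux xs ys r uS vS z)}.
  by move=> pz; have h1 := c1at_d1 (cm pz); have h2 := continuous_flux su gr cu' cv' pz; exact: cvgB h1 h2.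
apply: (spacetime_test_eq0 su ce _ tl) => f t1 t2 t10 t12 Cf fOm.
have [Fi [iF aeF e]] := weak f t1 t2 Cf t10 t12 (fun t ht p fp => fOm t p ht fp).
have [iH iE bal] := Lam_balance su orient gr cu' cv' pde cm t10 t12 Cf fOm.
have eF : \int[leb R]_(t in `[t1, t2]) Fi t = \int[leb R]_(t in `[t1, t2]) weak_integrand f t.
  rewrite /Rintegral; congr fine; apply: ae_eq_integral => //.
  - by case/integrableP: iF.
  - by case/integrableP: iH.
  - apply: (negligibleS _ aeF) => t' /= h h'; apply: h; rewrite /= in_itv/= => ht.
    by rewrite h'.
move: bal; rewrite e eF => /eqP; rewrite -subr_eq0 opprD addNKr oppr_eq0 => /eqP; exact.
Qed.

Lemma ode_weak : (forall t l, 0 < t < T l -> d1 m (t, l) = flux xs ys r uS vS (t, l)) ->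
  forall f t1 t2, Cc1 f -> 0 < t1 -> t1 < t2 ->
    (forall t, t1 <= t <= t2 -> supp f `<=` slice Om t) ->
    (leb R).-integrable `[t1, t2] (EFin \o weak_integrand f) /\
    Lam T S xs ys r m t2 f - Lam T S xs ys r m t1 f = \int[leb R]_(t in `[t1, t2]) weak_integrand f t.
Proof.
move=> ode f t1 t2 Cf t10 t12 fOm.
have [iH iE bal] := Lam_balance su orient gr cu' cv' pde cm t10 t12 Cf (fun t p ht fp => fOm t ht p fp).
split => //; rewrite bal -[RHS]addr0; congr (_ + _).
transitivity (\int[leb R]_(t in `[t1, t2]) (0 : R)); last by rewrite Rintegral_cst_segment ?mul0r// ltW.
apply: eq_Rintegral => t; rewrite inE/= in_itv/= => /andP[h1 h2].
rewrite (_ : curvef _ _ _ _ _ _ = fun=> 0).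
  by rewrite /Rintegral integral0.
apply/funext => l; rewrite /curvef; case: ifP => // tl.
by rewrite ode ?subrr ?mulr0// tl (lt_le_trans t10).
Qed.

End weak.

(** The limit as t tends to 0+ is computed twice, from the initial condition and from the continuity
    of [Lam]; the difference is the singular part at t = 0. *)
Lemma initial_curve_eq0 (r : bool -> R * (R * R) -> R) (w : bool -> R * R -> R) (r0 : R * R -> R)
    (m : R * R -> R) (L : R -> (R * R -> R) -> R) :
  (forall j q, Om q -> cside j (S q) -> {for q, continuous (r j)}) ->
  (forall j p, Om (0, p) -> cside j (S (0, p)) -> r j (0, p) = w j p) ->
  r0 = piecewise G w -> (forall z, pdom T z -> {for z, continuous m}) ->
  (forall f t, 0 < t -> Cc f -> supp f `<=` slice Om t -> L t f = Lam T S xs ys r m t f) ->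
  (forall f, Cc f -> supp f `<=` slice Om 0 -> L t f @[t --> 0^'+] --> \int[leb2 R]_p (f p * r0 p)) ->
  forall l, 0 < T l -> m (0, l) = 0.
Proof.
move=> gr rw r0E cm LE Lc l T0; apply: (curve_test_eq0 su (lexx 0) cm _ T0) => f Cf fO.
have Cf' := Cc1_Cc Cf; have c1 := Lam_cvg0 su gr cm Cf' fO; have c2 := Lc f Cf' fO.
have [d d0 hd] := Om_tube su Cf.2 fO.
have c3 : L t f @[t --> 0^'+] --> Lam T S xs ys r m 0 f.
  apply: cvg_trans c1; apply: near_eq_cvg; near=> t.
  have t0 : 0 < t by near: t; exact: nbhs_right_gt.
  have td : t <= d by near: t; exact: nbhs_right_le.
  apply/esym/LE => // p fp; apply: (hd t p _ _ fp); first exact: ltW.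
  by rewrite subr0 gtr0_norm.
have : Lam T S xs ys r m 0 f = \int[leb2 R]_p (f p * r0 p) by exact: (cvg_unique _ c3 c2).
rewrite (Lam_initial time surface m gr rw r0E Cf' fO).
by move=> /eqP; rewrite -subr_eq0 addrAC subrr add0r => /eqP.
Unshelve. all: by end_near. Qed.

Variables (Pt It Jt : R * R -> R).
Hypotheses (C1P : C1 (pdom T) Pt) (C1I : C1 (pdom T) It) (C1J : C1 (pdom T) Jt).

Let cP z : pdom T z -> c1at Pt z. Proof. exact: C1_c1at C1P. Qed.
Let cI z : pdom T z -> c1at It z. Proof. exact: C1_c1at C1I. Qed.
Let cJ z : pdom T z -> c1at Jt z. Proof. exact: C1_c1at C1J. Qed.
Let kr j q Oq Sq := c1at_continuous (@cr' j q Oq Sq).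
Let ku j q Oq Sq := c1at_continuous (@cu' j q Oq Sq).
Let kv j q Oq Sq := c1at_continuous (@cv' j q Oq Sq).
Let kru j q Oq Sq := c1at_continuous (@cru' j q Oq Sq).
Let krv j q Oq Sq := c1at_continuous (@crv' j q Oq Sq).
Let kP z pz := c1at_continuous (@cP z pz).
Let kI z pz := c1at_continuous (@cI z pz).
Let kJ z pz := c1at_continuous (@cJ z pz).

Section solution.
Variables (P : R -> {measure set (mplane R) -> \bar R}) (I J : R -> @signed_measure R).
Variables (dI dJ : R -> R * R -> R).
Hypothesis gs : generalized_solution Om (piecewise G rho) (piecewise G u) (piecewise G v) P I J dI dJ.
Hypothesis sf : single_shock_form T Om S xs ys ut vt rhoS uS vS Pt It Jt P I J dI dJ.

Let L := Lam T S xs ys.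

Section slice.
Variables (t : R) (K : set (R * R)).
Hypotheses (t0 : 0 < t) (cK : compact K) (KO : K `<=` slice Om t).

Lemma decP E : measurable (E : set (mplane R)) -> E `<=` K -> P t E = (L rhoS Pt t (\1_E))%:E.
Proof. by move=> mE EK; rewrite /L (Lam_indic _ _ _ _ _ _ _ EK); exact: (sf_P sf t0 cK KO mE EK). Qed.
Lemma decI E : measurable (E : set (mplane R)) -> E `<=` K ->
  smeas (I t) E = (L (fun j => rhoS j \* uS j) It t (\1_E))%:E.
Proof. by move=> mE EK; rewrite /L (Lam_indic _ _ _ _ _ _ _ EK); exact: (sf_I sf t0 cK KO mE EK). Qed.
Lemma decJ E : measurable (E : set (mplane R)) -> E `<=` K ->
  smeas (J t) E = (L (fun j => rhoS j \* vS j) Jt t (\1_E))%:E.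
Proof. by move=> mE EK; rewrite /L (Lam_indic _ _ _ _ _ _ _ EK); exact: (sf_J sf t0 cK KO mE EK). Qed.

Let finP : (P t K < +oo)%E. Proof. by have [h _ _] := gs_radon gs t0; exact: h. Qed.
Let finI : (spos (I t) K < +oo)%E /\ (sneg (I t) K < +oo)%E.
Proof. by have [_ [h1 h2 _] _] := gs_radon gs t0; split; [exact: h1|exact: h2]. Qed.
Let finJ : (spos (J t) K < +oo)%E /\ (sneg (J t) K < +oo)%E.
Proof. by have [_ _ [h1 h2 _]] := gs_radon gs t0; split; [exact: h1|exact: h2]. Qed.

Lemma intP phi M : bmeas K phi M -> \int[P t]_p phi p = L rhoS Pt t phi.
Proof. exact: (integral_Lam su kr kP (ltW t0) cK KO finP decP). Qed.
Lemma intI phi M : bmeas K phi M -> sint (I t) phi = L (fun j => rhoS j \* uS j) It t phi.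
Proof. exact: (sint_Lam su kru kI (ltW t0) cK KO finI.1 finI.2 decI). Qed.
Lemma intJ phi M : bmeas K phi M -> sint (J t) phi = L (fun j => rhoS j \* vS j) Jt t phi.
Proof. exact: (sint_Lam su krv kJ (ltW t0) cK KO finJ.1 finJ.2 decJ). Qed.

Hypothesis acI : abs_continuous_on (slice Om t) (I t) (P t).
Hypothesis acJ : abs_continuous_on (slice Om t) (J t) (P t).
Hypothesis rnI : RN_derivative_on (slice Om t) (I t) (P t) (dI t).
Hypothesis rnJ : RN_derivative_on (slice Om t) (J t) (P t) (dJ t).

Let meas_of (wd : R * R -> R) : (P t).-integrable K (EFin \o wd) ->
  measurable_fun (K : set (mplane R)) (wd : mplane R -> R).
Proof. by move=> /integrableP[/measurable_EFinP]. Qed.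

Let dI_curve l : 0 <= t < T l -> dI t (xs (t, l), ys (t, l)) = d1 xs (t, l).
Proof.
move=> /andP[_ tl]; have tl0 : 0 < t < T l by rewrite t0.
have pz : pdom T (t, l) by rewrite /pdom/= ltW.
by have [-> _] := sf_velocity sf tl0; have [-> _] := ss_integral_curves surface pz.
Qed.
Let dJ_curve l : 0 <= t < T l -> dJ t (xs (t, l), ys (t, l)) = d1 ys (t, l).
Proof.
move=> /andP[_ tl]; have tl0 : 0 < t < T l by rewrite t0.
have pz : pdom T (t, l) by rewrite /pdom/= ltW.
by have [_ ->] := sf_velocity sf tl0; have [_ ->] := ss_integral_curves surface pz.
Qed.

Let iI := (rnI cK KO).1. Let iJ := (rnJ cK KO).1.
Let dwI E (mE : measurable (E : set (mplane R))) (EK : E `<=` K) :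
  (L (fun j => rhoS j \* uS j) It t (\1_E))%:E = (\int[P t]_(p in E) (dI t p)%:E)%E.
Proof. by rewrite -decI//; exact: ((rnI cK KO).2 E mE EK). Qed.
Let dwJ E (mE : measurable (E : set (mplane R))) (EK : E `<=` K) :
  (L (fun j => rhoS j \* vS j) Jt t (\1_E))%:E = (\int[P t]_(p in E) (dJ t p)%:E)%E.
Proof. by rewrite -decJ//; exact: ((rnJ cK KO).2 E mE EK). Qed.

Lemma momentumI phi M : bmeas K phi M -> L (fun j => rhoS j \* uS j) It t phi =
  L (fun j => rhoS j \* uS j) (fun z => Pt z * d1 xs z) t phi.
Proof. exact: (Lam_momentum su kr ku kP d1x (ltW t0) cK KO finP decP (meas_of iI) dI_curve kI iI dwI). Qed.
Lemma momentumJ phi M : bmeas K phi M -> L (fun j => rhoS j \* vS j) Jt t phi =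
  L (fun j => rhoS j \* vS j) (fun z => Pt z * d1 ys z) t phi.
Proof. exact: (Lam_momentum su kr kv kP d1y (ltW t0) cK KO finP decP (meas_of iJ) dJ_curve kJ iJ dwJ). Qed.

Let acI' E : measurable (E : set (mplane R)) -> E `<=` K -> P t E = 0%E -> spos (I t) E = 0%E /\ sneg (I t) E = 0%E.
Proof. by move=> mE EK; apply: acI => //; exact: subset_trans KO. Qed.
Let acJ' E : measurable (E : set (mplane R)) -> E `<=` K -> P t E = 0%E -> spos (J t) E = 0%E /\ sneg (J t) E = 0%E.
Proof. by move=> mE EK; apply: acJ => //; exact: subset_trans KO. Qed.

Lemma velocities phi M : bmeas K phi M ->
  [/\ sint (I t) (fun p => phi p * dI t p) = L (fun j => rhoS j \* uS j \* uS j) (fun z => It z * d1 xs z) t phi,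
      sint (I t) (fun p => phi p * dJ t p) = L (fun j => rhoS j \* uS j \* vS j) (fun z => It z * d1 ys z) t phi,
      sint (J t) (fun p => phi p * dI t p) = L (fun j => rhoS j \* vS j \* uS j) (fun z => Jt z * d1 xs z) t phi &
      sint (J t) (fun p => phi p * dJ t p) = L (fun j => rhoS j \* vS j \* vS j) (fun z => Jt z * d1 ys z) t phi].
Proof.
move=> bphi.
have SI := sint_velocity su kr ku kP d1x (ltW t0) cK KO finP decP (meas_of iI) dI_curve iI dwI.
have SJ := sint_velocity su kr kv kP d1y (ltW t0) cK KO finP decP (meas_of iJ) dJ_curve iJ dwJ.
split.
- exact: (SI _ _ _ kru kI finI.1 finI.2 acI' decI _ _ bphi).
- exact: (SJ _ _ _ kru kI finI.1 finI.2 acI' decI _ _ bphi).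
- exact: (SI _ _ _ krv kJ finJ.1 finJ.2 acJ' decJ _ _ bphi).
- exact: (SJ _ _ _ krv kJ finJ.1 finJ.2 acJ' decJ _ _ bphi).
Qed.

End slice.

Let good := {ae leb R, forall t, 0 < t ->
  [/\ abs_continuous_on (slice Om t) (I t) (P t), abs_continuous_on (slice Om t) (J t) (P t),
   RN_derivative_on (slice Om t) (I t) (P t) (dI t) & RN_derivative_on (slice Om t) (J t) (P t) (dJ t)]}.

Let aegood : good.
Proof.
apply: ae_impl2 (gs_abs_continuous gs) (gs_velocity gs) => t h1 h2 t0.
by have [a1 a2] := h1 t0; have [b1 b2] := h2 t0.
Qed.

(** If e (t, l) <> 0, then e (s, l) <> 0 for all s in an interval around t, and this interval
    contains times from the set of full measure. *)
Let all_times (e : R * R -> R) : (forall z, pdom T z -> {for z, continuous e}) ->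
  {ae leb R, forall t, 0 < t -> forall l, t < T l -> e (t, l) = 0} ->
  forall t l, 0 < t < T l -> e (t, l) = 0.
Proof.
move=> ce ae t l /andP[t0 tl]; apply/eqP; apply: contrapT => /negP ne.
have ct : {for t, continuous (fun t => e (t, l))}.
  apply: (@continuous_comp _ _ _ (fun t => (t, l)) e); last by apply: ce; rewrite /pdom/= ltW.
  by apply: continuous_at_pair; [exact: cvg_id|exact: cvg_cst].
have n1 : \forall s \near t, 0 < `|e (s, l)|
  by move: ct; rewrite /prop_for /continuous_at => /cvgr_norm_gt/(_ 0); rewrite normr_gt0; exact.
have n2 : \forall s \near t, 0 < s by exact: lt_nbhsr.
have n3 : \forall s \near t, s < T l by exact: lt_nbhsl.
have [r /= r0 rP] := (nbhs_ballP _ _).1 (filterI n1 (filterI n2 n3)).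
have tr : t - r / 2 < t + r / 2 by lra.
have [s [hs Qs]] := ae_itv tr ae.
have [h1 [h2 h3]] : 0 < `|e (s, l)| /\ 0 < s /\ s < T l.
  by apply: rP; rewrite /ball/= ltr_norml; lra.
by rewrite (Qs h2 l h3) normr0 ltxx in h1.
Qed.

(** The Radon-Nikodym derivative of I is [ut] = x^s_t on the shock, so the singular part of I is
    x^s_t times that of P, at almost every time by [momentumI] and then at all times. *)
Let ItE t l : 0 < t < T l -> It (t, l) = Pt (t, l) * d1 xs (t, l).
Proof.
move=> tl; apply/eqP; rewrite -subr_eq0; apply/eqP; move: t l tl.
have k2 z : pdom T z -> {for z, continuous (fun z => Pt z * d1 xs z)}.
  by move=> pz; apply: cvgM; [exact: kP|exact: d1x].
apply: (all_times (e := fun z => It z - Pt z * d1 xs z)).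
  by move=> z pz; have h1 := kI pz; have h2 := k2 z pz; exact: cvgB h1 h2.
apply: ae_impl aegood => t h t0 l tl; have [a1 a2 b1 b2] := h t0.
apply/eqP; rewrite subr_eq0; apply/eqP.
apply: (Lam_curve_eq time surface (ltW t0) kI k2 _ tl (r := fun j => rhoS j \* uS j)) => f Cf fO.
have [M [bf _ _]] := Cc1_bmeas Cf.
exact: (momentumI t0 Cf.2 fO b1 bf).
Qed.

Let JtE t l : 0 < t < T l -> Jt (t, l) = Pt (t, l) * d1 ys (t, l).
Proof.
move=> tl; apply/eqP; rewrite -subr_eq0; apply/eqP; move: t l tl.
have k2 z : pdom T z -> {for z, continuous (fun z => Pt z * d1 ys z)}.
  by move=> pz; apply: cvgM; [exact: kP|exact: d1y].
apply: (all_times (e := fun z => Jt z - Pt z * d1 ys z)).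
  by move=> z pz; have h1 := kJ pz; have h2 := k2 z pz; exact: cvgB h1 h2.
apply: ae_impl aegood => t h t0 l tl; have [a1 a2 b1 b2] := h t0.
apply/eqP; rewrite subr_eq0; apply/eqP.
apply: (Lam_curve_eq time surface (ltW t0) kJ k2 _ tl (r := fun j => rhoS j \* vS j)) => f Cf fO.
have [M [bf _ _]] := Cc1_bmeas Cf.
exact: (momentumJ t0 Cf.2 fO b2 bf).
Qed.

Let ends (t1 t2 : R) : t1 < t2 -> (t1 <= t1 <= t2) /\ (t1 <= t2 <= t2).
Proof. by move=> /ltW t12; rewrite !lexx t12. Qed.

Let ode_mass t l : 0 < t < T l -> d1 Pt (t, l) = flux xs ys rhoS uS vS (t, l).
Proof.
move: t l; apply: (weak_ode cr' cP (pde_mass sides)) => f t1 t2 Cf t10 t12 fOm.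
have [iF e] := gs_mass gs Cf t10 t12 fOm; have [M [bf b1 b2]] := Cc1_bmeas Cf.
have [h1 h2] := ends t12; have t20 := lt_trans t10 t12.
eexists; split; first exact: iF.
  apply: aeW => t ht; have t0 : 0 < t by case/andP: ht => h _; exact: lt_le_trans h.
  rewrite (intI t0 Cf.2 (fOm t ht) b1) (intJ t0 Cf.2 (fOm t ht) b2) /weak_integrand /L.
  by congr (_ + _); apply: Lam_eq_curve => l' tl'; [apply: ItE|apply: JtE]; rewrite t0.
by rewrite -e (intP t20 Cf.2 (fOm _ h2) bf) (intP t10 Cf.2 (fOm _ h1) bf).
Qed.

Let ode_u t l : 0 < t < T l -> d1 It (t, l) = flux xs ys (fun j => rhoS j \* uS j) uS vS (t, l).
Proof.
move: t l; apply: (weak_ode cru' cI (pde_u sides)) => f t1 t2 Cf t10 t12 fOm.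
have [iF e] := gs_momentum_x gs Cf t10 t12 fOm; have [M [bf b1 b2]] := Cc1_bmeas Cf.
have [h1 h2] := ends t12; have t20 := lt_trans t10 t12.
eexists; split; first exact: iF.
  apply: ae_impl aegood => t h ht; have t0 : 0 < t by case/andP: ht => h' _; exact: lt_le_trans h'.
  have [a1 a2 c1 c2] := h t0.
  have [-> _ _ _] := velocities t0 Cf.2 (fOm t ht) a1 a2 c1 c2 b1.
  by have [_ -> _ _] := velocities t0 Cf.2 (fOm t ht) a1 a2 c1 c2 b2.
by rewrite -e (intI t20 Cf.2 (fOm _ h2) bf) (intI t10 Cf.2 (fOm _ h1) bf).
Qed.

Let ode_v t l : 0 < t < T l -> d1 Jt (t, l) = flux xs ys (fun j => rhoS j \* vS j) uS vS (t, l).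
Proof.
move: t l; apply: (weak_ode crv' cJ (pde_v sides)) => f t1 t2 Cf t10 t12 fOm.
have [iF e] := gs_momentum_y gs Cf t10 t12 fOm; have [M [bf b1 b2]] := Cc1_bmeas Cf.
have [h1 h2] := ends t12; have t20 := lt_trans t10 t12.
eexists; split; first exact: iF.
  apply: ae_impl aegood => t h ht; have t0 : 0 < t by case/andP: ht => h' _; exact: lt_le_trans h'.
  have [a1 a2 c1 c2] := h t0.
  have [_ _ -> _] := velocities t0 Cf.2 (fOm t ht) a1 a2 c1 c2 b1.
  by have [_ _ _ ->] := velocities t0 Cf.2 (fOm t ht) a1 a2 c1 c2 b2.
by rewrite -e (intJ t20 Cf.2 (fOm _ h2) bf) (intJ t10 Cf.2 (fOm _ h1) bf).
Qed.

Let ini_mass l : 0 < T l -> Pt (0, l) = 0.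
Proof.
apply: (initial_curve_eq0 kr _ erefl kP (w := rho) (L := fun t f => \int[P t]_p f p)).
- by move=> j p h1 h2; have [] := so_initial sides h1 h2.
- by move=> f t t0 Cf fO; have [M bf] := Cc_bmeas Cf; exact: (intP t0 Cf.2 fO bf).
- by move=> f Cf fO; have [] := gs_initial gs Cf fO.
Qed.

Let ini_u l : 0 < T l -> It (0, l) = 0.
Proof.
apply: (initial_curve_eq0 kru _ (piecewiseM G rho u) kI (L := fun t f => sint (I t) f)).
- by move=> j p h1 h2; have [e1 e2 e3] := so_initial sides h1 h2; rewrite /= e1 e2.
- by move=> f t t0 Cf fO; have [M bf] := Cc_bmeas Cf; exact: (intI t0 Cf.2 fO bf).
- by move=> f Cf fO; have [] := gs_initial gs Cf fO.
Qed.

Let ini_v l : 0 < T l -> Jt (0, l) = 0.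
Proof.
apply: (initial_curve_eq0 krv _ (piecewiseM G rho v) kJ (L := fun t f => sint (J t) f)).
- by move=> j p h1 h2; have [e1 e2 e3] := so_initial sides h1 h2; rewrite /= e1 e3.
- by move=> f t t0 Cf fO; have [M bf] := Cc_bmeas Cf; exact: (intJ t0 Cf.2 fO bf).
- by move=> f Cf fO; have [] := gs_initial gs Cf fO.
Qed.

Lemma solution_formulas : shock_formulas rho u v T ut vt a b Pt It Jt.
Proof.
move=> t l tl; have P0 := sf_mass sf tl; split; first by rewrite gt_eqF.
have Pn : Pt (t, l) != 0 by rewrite gt_eqF.
have pz : pdom T (t, l) by case/andP: tl => h1 h2; rewrite /pdom/= ltW.
have [ex ey] := ss_integral_curves surface pz.
split.
- by rewrite ItE// mulrC mulKf.
- by rewrite JtE// mulrC mulKf.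
- exact: (absorbed_of_ode cP (flux_mass data time surface sides) ode_mass ini_mass tl).
- exact: (absorbed_of_ode cI (flux_u data time surface sides) ode_u ini_u tl).
- exact: (absorbed_of_ode cJ (flux_v data time surface sides) ode_v ini_v tl).
Qed.

End solution.
End forward.

(** * From the formulas to a solution *)

Section shock_field.
Context {R : realType}.
Variables (T : R -> R) (Om : set (R * (R * R))) (S : R * (R * R) -> R) (X Y : R * R -> R).
Hypothesis su : surf T Om S X Y.

Definition curve_label (t : R) (p : R * R) : R :=
  get [set l | 0 <= t < T l /\ p = (X (t, l), Y (t, l))].

Lemma curve_labelP t p : Om (t, p) -> S (t, p) = 0 ->
  0 <= t < T (curve_label t p) /\ p = (X (t, curve_label t p), Y (t, curve_label t p)).
Proof.
move=> Op Sp; have [l tl pE] := su_par su Op Sp.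
by apply: (@getPex _ [set l | 0 <= t < T l /\ p = (X (t, l), Y (t, l))]); exists l.
Qed.

Lemma curve_label_on t l : 0 <= t < T l -> curve_label t (X (t, l), Y (t, l)) = l.
Proof.
move=> tl; have [Oq Sq] := su_on su tl; have [h1 h2] := curve_labelP Oq Sq.
by apply/esym; exact: su_inj su _ _ _ tl h1 h2.
Qed.

(** The velocity of the solution to be constructed: classical on each side, om on the shock. The
    value 0 outside Om makes it a Borel function on the whole plane. *)
Definition shock_field (w : bool -> R * (R * R) -> R) (om : R * R -> R) (t : R) (p : R * R) : R :=
  if `[< Om (t, p) >] then
    if S (t, p) < 0 then w false (t, p)
    else if 0 < S (t, p) then w true (t, p) else om (t, curve_label t p)
  else 0.

Lemma shock_field_on w om t l : 0 <= t < T l ->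
  shock_field w om t (X (t, l), Y (t, l)) = om (t, l).
Proof.
move=> tl; have [Oq Sq] := su_on su tl.
by rewrite /shock_field asboolT// Sq ltxx curve_label_on.
Qed.

Lemma canonical_shock_field w om t (K : set (R * R)) p : K `<=` slice Om t -> K p ->
  canonical_velocity S w t K (shock_field w om t) p = shock_field w om t p.
Proof.
move=> KO Kp; rewrite /canonical_velocity mem_set//.
have Op := KO p Kp; rewrite /shock_field (asboolT Op).
by case: ltgtP.
Qed.

Section fixed_time.
Variables (t : R).
Hypothesis t0 : 0 <= t.

Lemma open_slice : open (slice Om t).
Proof.
have [W oW OmW] := su_Om su; have -> : slice Om t = (fun p => (t, p)) @^-1` W.
  by apply/seteqP; split => p; rewrite /slice/= OmW => // -[].
apply: open_comp => // p _; apply: continuous_at_pair; [exact: cvg_cst|exact: cvg_id].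
Qed.

Let sideD (j : bool) : set (R * R) := [set p | Om (t, p) /\ side j (S (t, p))].

Let oside j : open (sideD j).
Proof.
rewrite openE => p [Op Sp].
have cS : {for p, continuous (fun p => S (t, p))}.
  by apply: slice_section; exact: c1at_continuous (su_S su Op).
have nO : \forall q \near p, Om (t, q) by have := open_slice; rewrite openE; exact.
have nS : \forall q \near p, side j (S (t, q)).
  by case: j Sp => Sp; [exact: cvgr_gt cS _ Sp|exact: cvgr_lt cS _ Sp].
by apply: filterS2 nO nS.
Qed.

Let D0 : set (mplane R) := slice Om t `\` (sideD true `|` sideD false).

Let mside j : measurable (sideD j : set (mplane R)). Proof. exact: open_measurable_plane. Qed.

Let mD0 : measurable D0.
Proof.
by apply: measurableD; [exact: open_measurable_plane open_slice|exact: measurableU].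
Qed.

Let D0P p : D0 p -> Om (t, p) /\ S (t, p) = 0.
Proof.
move=> [Op n]; split => //; apply/eqP; rewrite eq_le !leNgt; apply/andP.
by split; apply/negP => h; apply: n; [left|right].
Qed.

(** By [surf_inverse] the label is continuous along the curve. Continuity within the curve suffices,
    since only measurability is wanted. *)
Lemma curve_label_continuous (om : R * R -> R) : (forall z, pdom T z -> {for z, continuous om}) ->
  {within D0, continuous (fun p => om (t, curve_label t p))}.
Proof.
move=> com; apply/subspace_continuousP => p /D0P[Op Sp].
have [tl pE] := curve_labelP Op Sp; set l0 := curve_label t p in tl pE *.
have c0 : {for l0, continuous (fun l => om (t, l))}.
  apply: (@continuous_comp _ _ _ (fun l => (t, l)) om); last by apply: com; rewrite /pdom/=.
  by apply: continuous_at_pair; [exact: cvg_cst|exact: cvg_id].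
have lc : curve_label t q @[q --> within D0 (nbhs p)] --> l0; last exact: (cvg_comp _ _ lc c0).
apply/cvgrPdist_lt => e e0.
have [d d0 hd] := surf_inverse su tl e0; rewrite /within.
have : \forall q \near p, ball p d q by exact: nbhsx_ballx.
apply: filterS => q /= pq /D0P[Oq Sq]; have [tq qE] := curve_labelP Oq Sq.
have [h1 h2] : `|p.1 - q.1| < d /\ `|p.2 - q.2| < d by [].
have tt : `|t - t| <= d by rewrite subrr normr0 ltW.
rewrite distrC; apply: (hd _ _ tq tt).
  by rewrite distrC; move: h1; rewrite /ball/= {1}pE {1}qE/=; exact: ltW.
by rewrite distrC; move: h2; rewrite /ball/= {1}pE {1}qE/=; exact: ltW.
Qed.

Section field.
Variables (w : bool -> R * (R * R) -> R) (om : R * R -> R).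
Hypothesis gw : forall j q, Om q -> cside j (S q) -> {for q, continuous (w j)}.
Hypothesis gom : forall z, pdom T z -> {for z, continuous om}.

Lemma measurable_shock_field : measurable_fun setT (shock_field w om t : mplane R -> R).
Proof.
have -> : shock_field w om t = fun p => ((fun p => w false (t, p)) \_ (sideD false)) p +
    ((fun p => w true (t, p)) \_ (sideD true)) p + ((fun p => om (t, curve_label t p)) \_ D0) p.
  apply/funext => p; rewrite /shock_field !patchE.
  have [Op|Op] := pselect (Om (t, p)); last first.
    by rewrite asboolF// !memNset ?addr0// => -[].
  have nZ j : sideD j p -> (p \in D0) = false.
    by move=> h; apply: memNset => -[_]; apply; case: j h => h; [left|right].
  have nP j : ~ side j (S (t, p)) -> (p \in sideD j) = false by move=> n; apply: memNset => -[].
  have yP j : side j (S (t, p)) -> (p \in sideD j) = true by move=> h; apply: mem_set.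
  rewrite asboolT//; have [Sp|Sp|Sp] := ltgtP (S (t, p)) 0.
  - rewrite yP// nP; last by rewrite /side; apply/negP; rewrite -leNgt ltW.
    by rewrite (nZ false)// !addr0.
  - rewrite nP; last by rewrite /side; apply/negP; rewrite -leNgt ltW.
    by rewrite yP// (nZ true)// add0r addr0.
  - rewrite nP; last by rewrite /side Sp ltxx.
    rewrite nP; last by rewrite /side Sp ltxx.
    by rewrite !add0r mem_set//; split => // -[[_]|[_]]; rewrite /side Sp ltxx.
have mw j : measurable_fun setT ((fun p => w j (t, p)) \_ (sideD j) : mplane R -> R).
  apply: (measurable_restrictT _ (mside j)).1.
  apply: open_continuous_measurable_plane => // p /set_mem[Op Sp].
  by apply: slice_section; apply: gw => //; case: j Sp; rewrite /side /cside; exact: ltW.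
apply: measurable_funD; first exact: measurable_funD.
apply: (measurable_restrictT _ mD0).1; apply: within_continuous_measurable_plane => //.
exact: curve_label_continuous.
Qed.

End field.

Section measure.
Variables (F : bool -> R * (R * R) -> R) (m : R * R -> R).
Hypothesis gF : forall j q, Om q -> cside j (S q) -> {for q, continuous (F j)}.
Hypothesis gm : forall z, pdom T z -> {for z, continuous m}.
Hypothesis F0 : forall j p, Om (t, p) -> side j (S (t, p)) -> 0 <= F j (t, p).
Hypothesis m0 : forall l, t < T l -> 0 <= m (t, l).

Let D := [set l | t < T l].
Let oD : open D. Proof. by rewrite openE => l tl; exact: (su_T su tl). Qed.
Let mD : measurable D. Proof. exact: open_measurable. Qed.

Let mc (h : R * R -> R) : (forall z, pdom T z -> {for z, continuous h}) ->
  measurable_fun setT ((fun l => h (t, l)) \_ D).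
Proof.
move=> ch; apply: (measurable_restrictT _ mD).1.
apply: open_continuous_measurable_fun => // l /set_mem tl.
apply: (@continuous_comp _ _ _ (fun l => (t, l)) h).
  by apply: continuous_at_pair; [exact: cvg_cst|exact: cvg_id].
by apply: ch; rewrite /pdom/= t0.
Qed.

(** The sum of the measure with density F on the two sides and of the image of m dl under the
    parametrization of the curve. *)
Lemma shock_measure : exists P : {measure set (mplane R) -> \bar R},
  forall (K : set (R * R)) (E : set (mplane R)), compact K -> K `<=` slice Om t -> measurable E ->
  E `<=` K -> P E = (Lam T S X Y F m t (\1_E))%:E.
Proof.
pose g := shock_field F (cst 0) t; pose h := (fun l => m (t, l)) \_ D.
have mg : measurable_fun setT (g : mplane R -> R).
  by apply: measurable_shock_field => // z _; exact: cvg_cst.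
have g0 p : 0 <= g p.
  rewrite /g /shock_field; case: ifPn => // /asboolP Op; case: ifPn => Sp; first exact: (@F0 false).
  by case: ifPn => // Sp'; exact: (@F0 true).
have mh : measurable_fun setT h by exact: mc.
have h0 l : 0 <= h l by rewrite /h patchE; case: ifPn => // /set_mem/m0.
have mX := mc (fun z hz => c1at_continuous (su_X su hz)).
have mY := mc (fun z hz => c1at_continuous (su_Y su hz)).
(* Labels with T l <= t are sent to the origin, but carry no mass, since h vanishes at them. *)
pose phi l : mplane R := (((fun l => X (t, l)) \_ D) l, ((fun l => Y (t, l)) \_ D) l).
have mphi : measurable_fun setT phi by exact: measurable_fun_pair.
have [P1 P1E] := density_measure (leb2 R) mg g0.
have [N NE] := density_measure (leb R) mh h0.
have [P2 P2E] := pushforward_measure_ex N mphi.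
exists (measure_add P1 P2) => K E cK KO mE EK.
have bE := bmeas_indic mE EK; have [mi iM i0] := bE.
have tt : t <= t <= t by rewrite lexx.
have KO' t' p : t <= t' <= t -> K p -> Om (t', p).
  by move=> /andP[h1 h2] /KO; rewrite (_ : t' = t)//; apply/eqP; rewrite eq_le h1 h2.
have gFp q : Om q -> 0 <= S q -> {for q, continuous (F true)} by exact: (gF (j := true)).
have gFm q : Om q -> 0 <= - S q -> {for q, continuous (F false)}.
  by rewrite oppr_ge0; exact: (gF (j := false)).
have bp := side_bcs2 su cK KO' gFp tt mi iM i0.
have bm := side_bcs2 (surf_opp su) cK KO' gFm tt mi iM i0.
have bc := curve_bcs1 su t0 cK KO' tt gm mi iM i0.
have eg : (fun p => (g p)%:E) \_ E = EFin \o (fun p => sidef (fun q => - S q) (F false) t \1_E p + sidef S (F true) t \1_E p).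
  apply/funext => p; rewrite patchE /= /sidef indicE; case: (boolP (p \in E)) => pE; last first.
    by rewrite !mul0r !if_same addr0.
  have Op : Om (t, p) by apply: KO; apply: EK; exact: set_mem.
  rewrite /g /shock_field asboolT// !mul1r oppr_gt0; congr (_%:E).
  by have [Sp|Sp|Sp] := ltgtP (S (t, p)) 0; rewrite ?addr0 ?add0r.
have eh : (fun l => (h l)%:E) \_ (phi @^-1` E) = EFin \o curvef T X Y m t \1_E.
  apply/funext => l; rewrite patchE /= /curvef indicE /h patchE; case: (boolP (t < T l)) => tl; last first.
    have nD : (l \in D) = false by apply: memNset; exact/negP.
    by rewrite nD; case: ifP.
  have Dl : l \in D by exact: mem_set.
  have -> : (l \in phi @^-1` E) = ((X (t, l), Y (t, l)) \in E).
    have phil : phi l = (X (t, l), Y (t, l)) by rewrite /phi !patchE Dl.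
    by apply/idP/idP => /set_mem h'; apply: mem_set; move: h'; rewrite /preimage/= phil.
  by rewrite Dl; case: (_ \in E); rewrite ?mul1r ?mul0r.
have i1 := bcs2_integrable (bcs2_add bm bp); have i2 := bcs1_integrable bc.
transitivity (P1 E + P2 E)%E; first exact: measure_addE.
rewrite P1E P2E NE integral_mkcond eg [X in (_ + X)%E]integral_mkcond eh.
rewrite /Lam -int2_add// EFinD /Rintegral !fineK//; exact: integrable_fin_num.
Qed.

End measure.
End fixed_time.
End shock_field.

Lemma positive_of_derivative {R : realType} (m m' f : R -> R) (T : R) :
  (forall t, 0 <= t < T -> is_derive t 1 m (m' t)) -> (forall t, 0 < t < T -> m' t = f t) ->
  {for 0, continuous f} -> 0 < f 0 -> m 0 = 0 -> (forall t, 0 < t < T -> m t != 0) ->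
  forall t, 0 < t < T -> 0 < m t.
Proof.
move=> dm m'f cf f0 m0 mn t tT; have [t0 tT'] := andP tT.
have dm' s : 0 <= s <= t -> is_derive s 1 m (m' s).
  by move=> /andP[s0 st]; apply: dm; rewrite s0 (le_lt_trans st).
have cm s : 0 <= s <= t -> {for s, continuous m}.
  by move=> /dm'[dms _]; apply: differentiable_continuous; exact/derivable1_diffP.
have [d /= d0 hd] : \forall s \near (0 : R), 0 < f s by exact: cvgr_gt cf _ f0.
pose s := Num.min (d / 2) t.
have s0 : 0 < s by rewrite lt_min t0 divr_gt0.
have st : s <= t by rewrite ge_min lexx orbT.
have sd : s < d by rewrite gt_min half_ltr.
have ms : 0 < m s.
  have [||c] := @MVT R m m' 0 s s0.
  - by move=> x; rewrite in_itv/= => /andP[x0 xs]; apply: dm'; rewrite !ltW// (lt_le_trans xs).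
  - apply: continuous_in_subspaceT => x; rewrite inE/= in_itv/= => /andP[x0 xs].
    by apply: cm; rewrite x0 (le_trans xs).
  rewrite in_itv/= => /andP[c0 cs]; rewrite m0 !subr0 => ->; rewrite mulr_gt0// m'f.
    by apply: hd; rewrite /ball/= sub0r normrN gtr0_norm// (lt_trans cs).
  by rewrite c0 (lt_trans cs)// (le_lt_trans st).
rewrite lt_neqAle eq_sym mn//= leNgt; apply/negP => mt.
have [||x] := @IVT R m s t 0 st.
- apply: continuous_in_subspaceT => x; rewrite inE/= in_itv/= => /andP[x0 xs].
  by apply: cm; rewrite xs (le_trans _ x0)// ltW.
- by rewrite ge_min le_max (ltW ms) (ltW mt) orbT.
rewrite in_itv/= => /andP[sx xt] mx0.
have xT : 0 < x < T by rewrite (lt_le_trans s0 sx) (le_lt_trans xt).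
by have := mn x xT; rewrite mx0 eqxx.
Qed.

(** * Signed measures with a density *)

Section signed_density.
Context {R : realType} (P : {measure set (mplane R) -> \bar R}) (wd : R * R -> R).

(** The Jordan decomposition of wd dP: its two parts live on wd >= 0 and on wd < 0, which provides
    the Hahn set. *)
Definition signed_density (mu : @signed_measure R) : Prop := forall A : set (mplane R),
  spos mu A = (\int[P]_(p in A) (Num.max (wd p) 0)%:E)%E /\
  sneg mu A = (\int[P]_(p in A) (Num.max (- wd p) 0)%:E)%E.

Hypothesis mwd : measurable_fun setT (wd : mplane R -> R).

Let mp : measurable_fun setT (fun p : mplane R => Num.max (wd p) 0).
Proof. by apply: measurable_maxr => //; exact: measurable_cst. Qed.
Let mn : measurable_fun setT (fun p : mplane R => Num.max (- wd p) 0).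
Proof. by apply: measurable_maxr; [exact: measurableT_comp|exact: measurable_cst]. Qed.
Let p0 (f : mplane R -> R) (p : mplane R) : 0 <= Num.max (f p) 0.
Proof. by rewrite le_max lexx orbT. Qed.

Lemma signed_density_ex : exists mu, signed_density mu.
Proof.
have [nu1 h1] := density_measure P mp (p0 _); have [nu2 h2] := density_measure P mn (p0 _).
by exists (SignedMeasure nu1 nu2).
Qed.

Variable mu : @signed_measure R.
Hypothesis hmu : signed_density mu.

Lemma signed_density_null (E : set (mplane R)) : measurable E -> P E = 0%E ->
  spos mu E = 0%E /\ sneg mu E = 0%E.
Proof.
move=> mE PE; have [-> ->] := hmu E.
by split; apply: null_set_integral => //; apply/measurable_EFinP; exact: measurable_funTS.
Qed.

Lemma signed_density_hahn (U : set (R * R)) : exists H : set (mplane R), [/\ measurable H,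
  spos mu (U `\` H) = 0%E & sneg mu (U `&` H) = 0%E].
Proof.
exists [set p | 0 <= wd p]; split.
- have := mwd measurableT (measurable_itv `[0, +oo[); rewrite setTI; congr measurable.
  by apply/seteqP; split => p /=; rewrite in_itv/= andbT.
- have [-> _] := hmu (U `\` [set p | 0 <= wd p]); apply: integral0_eq => p [_ /= /negP].
  by rewrite -ltNge => /ltW h; rewrite (max_r h).
- have [_ ->] := hmu (U `&` [set p | 0 <= wd p]); apply: integral0_eq => p [_ /= h].
  by rewrite max_r// oppr_le0.
Qed.

Lemma signed_density_smeas E : smeas mu E = (\int[P]_(p in E) (wd p)%:E)%E.
Proof.
rewrite /smeas [RHS]integralE; have [-> ->] := hmu E; congr (_ - _)%E; apply: eq_integral => p _.
  by rewrite funeposE EFin_max.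
by rewrite funenegE EFin_max EFinN.
Qed.

Variables (K : set (mplane R)) (M : R).
Hypotheses (mK : measurable K) (PK : (P K < +oo)%E) (wM : forall p, K p -> `|wd p| <= M).

Let fin (f : mplane R -> R) : measurable_fun setT f -> (forall p, K p -> `|f p| <= M) ->
  (\int[P]_(p in K) (f p)%:E < +oo)%E.
Proof.
move=> mf fM; have : P.-integrable K (EFin \o f).
  apply: measurable_bounded_integrable => //; first exact: measurable_funTS.
  by exists M; split; [exact: num_real|move=> x Mx p Kp; exact: le_trans (fM p Kp) (ltW Mx)].
by move=> /integrable_fin_num => /(_ mK); rewrite fin_numE => /andP[_]; rewrite -ltey.
Qed.

Lemma signed_density_lty : (spos mu K < +oo)%E /\ (sneg mu K < +oo)%E.
Proof.
have [-> ->] := hmu K; split; apply: fin => // p /wM wpM; have M0 := le_trans (normr_ge0 _) wpM.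
  by rewrite /Num.max; case: ifP => _; rewrite ?normr0.
by rewrite /Num.max; case: ifP => _; rewrite ?normr0 ?normrN.
Qed.

End signed_density.

(** * Momentum measures as velocity times mass *)

Section shock_momentum.
Context {R : realType}.
Variables (T : R -> R) (Om : set (R * (R * R))) (S : R * (R * R) -> R) (X Y : R * R -> R).
Hypothesis su : surf T Om S X Y.
Variables (r : bool -> R * (R * R) -> R) (m : R * R -> R).
Hypothesis gr : forall j q, Om q -> cside j (S q) -> {for q, continuous (r j)}.
Hypothesis gm : forall z, pdom T z -> {for z, continuous m}.
Variables (t : R) (P : {measure set (mplane R) -> \bar R}).
Hypothesis t0 : 0 <= t.
Hypothesis decP : forall (K : set (R * R)) (E : set (mplane R)), compact K -> K `<=` slice Om t ->
  measurable E -> E `<=` K -> P E = (Lam T S X Y r m t (\1_E))%:E.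

Lemma decomposition_lty (K : set (R * R)) : compact K -> K `<=` slice Om t -> (P K < +oo)%E.
Proof.
by move=> cK KO; rewrite (decP cK KO (compact_measurable_plane cK) (@subset_refl _ K)) ltry.
Qed.

Section field.
Variables (w : bool -> R * (R * R) -> R) (om : R * R -> R).
Hypothesis gw : forall j q, Om q -> cside j (S q) -> {for q, continuous (w j)}.
Hypothesis gom : forall z, pdom T z -> {for z, continuous om}.

Let wd := shock_field T Om S X Y w om t.
Let mwd : measurable_fun setT (wd : mplane R -> R).
Proof. exact: (measurable_shock_field su t0 gw gom). Qed.
Let wd_om l : 0 <= t < T l -> wd (X (t, l), Y (t, l)) = om (t, l).
Proof. exact: (shock_field_on su). Qed.

Section compact.
Variable K : set (R * R).
Hypotheses (cK : compact K) (KO : K `<=` slice Om t).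

Lemma shock_field_bound : exists M : R, forall p, K p -> `|wd p| <= M.
Proof.
have [M [_ hM _]] := canonical_velocity_bmeas su gw gom t0 cK KO (measurable_funTS mwd) wd_om.
by exists M => p Kp; have := hM p; rewrite (@canonical_shock_field R T Om S X Y w om t K p KO Kp).
Qed.

Lemma int_shock_field (E : set (mplane R)) : measurable E -> E `<=` K ->
  (\int[P]_(p in E) (wd p)%:E)%E = (Lam T S X Y (fun j => r j \* w j) (fun z => m z * om z) t (\1_E))%:E.
Proof.
move=> mE EK.
rewrite -(int_canonical_velocity su gr gw gm gom t0 cK KO (decomposition_lty cK KO) (fun E => @decP K E cK KO)
  (measurable_funTS mwd) wd_om mE EK).
by apply: eq_integral => p /set_mem Ep; rewrite canonical_shock_field//; exact: EK.
Qed.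

Lemma shock_field_integrable (nu : {measure set (mplane R) -> \bar R}) : (nu K < +oo)%E ->
  nu.-integrable (K : set (mplane R)) (EFin \o wd).
Proof.
move=> nK; have [M hM] := shock_field_bound; apply: measurable_bounded_integrable => //.
- exact: compact_measurable_plane.
- exact: measurable_funTS.
- by exists M; split; [exact: num_real|move=> x Mx p Kp; exact: le_trans (hM p Kp) (ltW Mx)].
Qed.

Variable mu : @signed_measure R.
Hypothesis hmu : signed_density P wd mu.

Lemma momentum_lty : (spos mu K < +oo)%E /\ (sneg mu K < +oo)%E.
Proof.
have [M hM] := shock_field_bound.
exact: (signed_density_lty mwd hmu (compact_measurable_plane cK) (decomposition_lty cK KO) hM).
Qed.

Lemma momentum_decomposition (mi : R * R -> R) (E : set (mplane R)) :
  (forall l, t < T l -> mi (t, l) = m (t, l) * om (t, l)) -> measurable E -> E `<=` K ->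
  smeas mu E = (Lam T S X Y (fun j => r j \* w j) mi t (\1_E))%:E.
Proof.
move=> hmi mE EK; rewrite (signed_density_smeas hmu) int_shock_field//; congr _%:E.
by apply: Lam_eq_curve => l tl; rewrite hmi.
Qed.

End compact.

Variable mu : @signed_measure R.
Hypothesis hmu : signed_density P wd mu.

Lemma momentum_radon : signed_radon_on (slice Om t) mu.
Proof.
by split; [| |exact: signed_density_hahn hmu _] => K cK KO; have [] := momentum_lty cK KO hmu.
Qed.

Lemma momentum_abs_continuous : abs_continuous_on (slice Om t) mu P.
Proof. by move=> E mE _; exact: (signed_density_null mwd hmu mE). Qed.

Lemma momentum_RN : RN_derivative_on (slice Om t) mu P wd.
Proof.
move=> K cK KO; split; first exact: shock_field_integrable (decomposition_lty cK KO).
by move=> E mE EK; rewrite (signed_density_smeas hmu).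
Qed.

End field.

Lemma momentum_locally_integrable (w1 w2 : bool -> R * (R * R) -> R) (om1 om2 : R * R -> R)
    (mu : @signed_measure R) :
  (forall j q, Om q -> cside j (S q) -> {for q, continuous (w1 j)}) ->
  (forall z, pdom T z -> {for z, continuous om1}) ->
  (forall j q, Om q -> cside j (S q) -> {for q, continuous (w2 j)}) ->
  (forall z, pdom T z -> {for z, continuous om2}) ->
  signed_density P (shock_field T Om S X Y w1 om1 t) mu ->
  locally_integrable_on (slice Om t) mu (shock_field T Om S X Y w2 om2 t).
Proof.
move=> g1 o1 g2 o2 hmu K cK KO; have [h1 h2] := momentum_lty g1 o1 cK KO hmu.
by split; [exact: (shock_field_integrable g2 o2 cK KO h1)|exact: (shock_field_integrable g2 o2 cK KO h2)].
Qed.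

(** Here mu is I or J, with velocity w1, and w2 is the velocity that transports it; the four choices
    give the momentum fluxes in the weak equations. The function mi is the given singular density It
    or Jt, equal to m om1 at time t. *)
Lemma momentum_flux (w1 w2 : bool -> R * (R * R) -> R) (om1 om2 mi : R * R -> R)
    (mu : @signed_measure R) :
  (forall j q, Om q -> cside j (S q) -> {for q, continuous (w1 j)}) ->
  (forall z, pdom T z -> {for z, continuous om1}) ->
  (forall j q, Om q -> cside j (S q) -> {for q, continuous (w2 j)}) ->
  (forall z, pdom T z -> {for z, continuous om2}) ->
  (forall z, pdom T z -> {for z, continuous mi}) ->
  (forall l, t < T l -> mi (t, l) = m (t, l) * om1 (t, l)) ->
  signed_density P (shock_field T Om S X Y w1 om1 t) mu ->
  forall (K : set (R * R)) phi M, compact K -> K `<=` slice Om t -> bmeas K phi M ->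
  sint mu phi = Lam T S X Y (fun j => r j \* w1 j) mi t phi /\
  sint mu (fun p => phi p * shock_field T Om S X Y w2 om2 t p) =
    Lam T S X Y (fun j => r j \* w1 j \* w2 j) (fun z => mi z * om2 z) t phi.
Proof.
move=> g1 o1 g2 o2 gmi hmi hmu K phi M cK KO b; have [h1 h2] := momentum_lty g1 o1 cK KO hmu.
have grw j q : Om q -> cside j (S q) -> {for q, continuous (r j \* w1 j)}.
  by move=> Oq Sq; apply: cvgM; [exact: gr|exact: g1].
have dec E (mE : measurable (E : set (mplane R))) (EK : E `<=` K) := momentum_decomposition g1 o1 cK KO hmu hmi mE EK.
split; first exact: (sint_Lam su grw gmi t0 cK KO h1 h2 dec b).
have PK := decomposition_lty cK KO.
have mwd2 := measurable_shock_field su t0 g2 o2.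
have dwd E (mE : measurable (E : set (mplane R))) (EK : E `<=` K) := esym (int_shock_field g2 o2 cK KO mE EK).
have go2 z : pdom T z -> {for z, continuous (fun z => m z * om2 z)}.
  by move=> pz; apply: cvgM; [exact: gm|exact: o2].
have SV := sint_velocity su gr g2 gm o2 t0 cK KO PK (fun E => @decP K E cK KO) (measurable_funTS mwd2)
  (fun l tl => shock_field_on su w2 om2 tl) (shock_field_integrable g2 o2 cK KO PK) dwd.
exact: (SV _ _ _ grw gmi h1 h2
  (fun E mE EK => signed_density_null (measurable_shock_field su t0 g1 o1) hmu mE) dec _ _ b).
Qed.

End shock_momentum.

(** * Sufficiency of the formulas *)

Section backward.
Context {R : realType}.
Variables (A B : R -> R) (G : R * R -> R) (rho u v : bool -> R * R -> R).
Variables (T : R -> R) (V : R -> set (R * R)) (Om : set (R * (R * R))).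
Variables (S : R * (R * R) -> R) (xs ys ut vt : R * R -> R).
Variables (a b : bool -> R * R -> R) (rhoS uS vS : bool -> R * (R * R) -> R).
Hypothesis data : compressive_data A B G rho u v.
Hypothesis time : local_time A B G u v T V.
Hypothesis surface : shock_surface A B G u v T V Om S xs ys ut vt a b.
Hypothesis sides : side_solutions G rho u v T V Om S rhoS uS vS.
Variables (Pt It Jt : R * R -> R).
Hypotheses (C1P : C1 (pdom T) Pt) (C1I : C1 (pdom T) It) (C1J : C1 (pdom T) Jt).
Hypothesis form : shock_formulas rho u v T ut vt a b Pt It Jt.

Let su : surf T Om S xs ys. Proof. exact: shock_surf time surface. Qed.
Let cr' := rhoS_c1at sides. Let cu' := uS_c1at sides. Let cv' := vS_c1at sides.
Let cru' := rho_uS_c1at sides. Let crv' := rho_vS_c1at sides.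
Let d1x z : pdom T z -> {for z, continuous (d1 xs)}. Proof. exact: (continuous_d1_xs time surface). Qed.
Let d1y z : pdom T z -> {for z, continuous (d1 ys)}. Proof. exact: (continuous_d1_ys time surface). Qed.
Let cP z : pdom T z -> c1at Pt z. Proof. exact: C1_c1at C1P. Qed.
Let cI z : pdom T z -> c1at It z. Proof. exact: C1_c1at C1I. Qed.
Let cJ z : pdom T z -> c1at Jt z. Proof. exact: C1_c1at C1J. Qed.
Let kr j q Oq Sq := c1at_continuous (@cr' j q Oq Sq).
Let ku j q Oq Sq := c1at_continuous (@cu' j q Oq Sq).
Let kv j q Oq Sq := c1at_continuous (@cv' j q Oq Sq).
Let kru j q Oq Sq := c1at_continuous (@cru' j q Oq Sq).
Let krv j q Oq Sq := c1at_continuous (@crv' j q Oq Sq).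
Let kP z pz := c1at_continuous (@cP z pz).
Let kI z pz := c1at_continuous (@cI z pz).
Let kJ z pz := c1at_continuous (@cJ z pz).

Let odeP : (forall t l, 0 < t < T l -> d1 Pt (t, l) = flux xs ys rhoS uS vS (t, l)) /\
  (forall l, 0 < T l -> Pt (0, l) = 0).
Proof.
apply: (ode_of_absorbed time surface sides cr' cP (flux_mass data time surface sides)) => t l tl.
by have [_ []] := form tl.
Qed.

Let odeI : (forall t l, 0 < t < T l -> d1 It (t, l) = flux xs ys (fun j => rhoS j \* uS j) uS vS (t, l)) /\
  (forall l, 0 < T l -> It (0, l) = 0).
Proof.
apply: (ode_of_absorbed time surface sides cru' cI (flux_u data time surface sides)) => t l tl.
by have [_ []] := form tl.
Qed.

Let odeJ : (forall t l, 0 < t < T l -> d1 Jt (t, l) = flux xs ys (fun j => rhoS j \* vS j) uS vS (t, l)) /\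
  (forall l, 0 < T l -> Jt (0, l) = 0).
Proof.
apply: (ode_of_absorbed time surface sides crv' cJ (flux_v data time surface sides)) => t l tl.
by have [_ []] := form tl.
Qed.

Let Pt_gt0 t l : 0 < t < T l -> 0 < Pt (t, l).
Proof.
move=> tl; have T0 : 0 < T l by case/andP: tl => h1 h2; exact: lt_trans h2.
apply: (@positive_of_derivative _ (fun t => Pt (t, l)) (fun t => d1 Pt (t, l))
  (fun t => flux xs ys rhoS uS vS (t, l)) (T l)) tl => //.
- by move=> s sl; apply: is_derive_d1; exact: c1at_diff (@cP (s, l) sl).
- by move=> s; exact: odeP.1.
- apply: (@continuous_comp _ _ _ (fun t => (t, l)) (flux xs ys rhoS uS vS)).
    by apply: continuous_at_pair; [exact: cvg_id|exact: cvg_cst].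
  by apply: (continuous_flux su cr' cu' cv'); rewrite /pdom/= lexx.
- exact: (initial_flux_gt0 data time surface sides T0).
- exact: odeP.2.
- by move=> s /form[].
Qed.

Let ItE t l : 0 < t < T l -> It (t, l) = Pt (t, l) * d1 xs (t, l).
Proof.
move=> tl; have [Pn [eu _ _ _ _]] := form tl.
have pz : pdom T (t, l) by case/andP: tl => h1 h2; rewrite /pdom/= ltW.
by have [-> _] := ss_integral_curves surface pz; rewrite eu mulrC divfK.
Qed.

Let JtE t l : 0 < t < T l -> Jt (t, l) = Pt (t, l) * d1 ys (t, l).
Proof.
move=> tl; have [Pn [_ ev _ _ _]] := form tl.
have pz : pdom T (t, l) by case/andP: tl => h1 h2; rewrite /pdom/= ltW.
by have [_ ->] := ss_integral_curves surface pz; rewrite ev mulrC divfK.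
Qed.

Section functionals.
Variables (r : bool -> R * (R * R) -> R) (m : R * R -> R) (L : R -> (R * R -> R) -> R).
Hypothesis gr : forall j q, Om q -> cside j (S q) -> {for q, continuous (r j)}.
Hypothesis gm : forall z, pdom T z -> {for z, continuous m}.
Hypothesis LE : forall t K phi M, 0 < t -> compact K -> K `<=` slice Om t -> bmeas K phi M ->
  L t phi = Lam T S xs ys r m t phi.

Lemma functional_continuous f t0 : Cc f -> 0 < t0 -> supp f `<=` slice Om t0 ->
  L t f @[t --> t0] --> L t0 f.
Proof.
move=> Cf t00 fO; have [M bf] := Cc_bmeas Cf; have [d d0 hd] := Om_tube su Cf.2 fO.
rewrite (LE t00 Cf.2 fO bf); apply: cvg_trans (Lam_cvg su gr gm t00 Cf fO); apply: near_eq_cvg; near=> t.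
have t_gt0 : 0 < t by near: t; exact: lt_nbhsr.
have td : `|t - t0| <= d by rewrite distrC; near: t; exact: cvgr_dist_le.
by apply/esym/(LE t_gt0 Cf.2 _ bf) => p fp; exact: (hd t p (ltW t_gt0) td).
Unshelve. all: by end_near. Qed.

Lemma functional_initial (w : bool -> R * R -> R) (r0 : R * R -> R) f :
  (forall j p, Om (0, p) -> cside j (S (0, p)) -> r j (0, p) = w j p) -> r0 = piecewise G w ->
  (forall l, 0 < T l -> m (0, l) = 0) -> Cc f -> supp f `<=` slice Om 0 ->
  L t f @[t --> 0^'+] --> \int[leb2 R]_p (f p * r0 p).
Proof.
move=> rw r0E m0 Cf fO; have [M bf] := Cc_bmeas Cf; have [d d0 hd] := Om_tube su Cf.2 fO.
have -> : \int[leb2 R]_p (f p * r0 p) = Lam T S xs ys r m 0 f.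
  rewrite (Lam_initial time surface m gr rw r0E Cf fO) (_ : curvef _ _ _ _ _ _ = fun=> 0).
    by rewrite /Rintegral integral0 addr0.
  by apply/funext => l; rewrite /curvef; case: ifP => // /m0->; rewrite mulr0.
apply: cvg_trans (Lam_cvg0 su gr gm Cf fO); apply: near_eq_cvg; near=> t.
have t_gt0 : 0 < t by near: t; exact: nbhs_right_gt.
have td : t <= d by near: t; exact: nbhs_right_le.
have td' : `|t - 0| <= d by rewrite subr0 gtr0_norm.
by apply/esym/(LE t_gt0 Cf.2 _ bf) => p fp; exact: (hd t p (ltW t_gt0) td').
Unshelve. all: by end_near. Qed.

End functionals.

Let weak_congr (H F : R -> R) t1 t2 (x : R) : (forall t, t1 <= t <= t2 -> F t = H t) ->
  (leb R).-integrable `[t1, t2] (EFin \o H) /\ x = \int[leb R]_(t in `[t1, t2]) H t ->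
  (leb R).-integrable `[t1, t2] (EFin \o F) /\ x = \int[leb R]_(t in `[t1, t2]) F t.
Proof.
move=> FH [iH ->]; split.
  by apply: eq_integrable iH => // t; rewrite inE/= in_itv/= => /FH->.
by apply: eq_Rintegral => t; rewrite inE/= in_itv/= => /FH->.
Qed.

(** On the shock the velocity is written [d1 xs], which equals [ut] on [pdom T] and is known to be
    continuous there. *)
Let dI := shock_field T Om S xs ys uS (d1 xs).
Let dJ := shock_field T Om S xs ys vS (d1 ys).

Section measures.
Variables (P : R -> {measure set (mplane R) -> \bar R}) (I J : R -> @signed_measure R).
Hypothesis hP : forall t, 0 < t -> forall (K : set (R * R)) (E : set (mplane R)), compact K ->
  K `<=` slice Om t -> measurable E -> E `<=` K -> P t E = (Lam T S xs ys rhoS Pt t (\1_E))%:E.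
Hypothesis hI : forall t, 0 < t -> signed_density (P t) (dI t) (I t).
Hypothesis hJ : forall t, 0 < t -> signed_density (P t) (dJ t) (J t).

Let LP := Lam T S xs ys rhoS Pt.
Let LI := Lam T S xs ys (fun j => rhoS j \* uS j) It.
Let LJ := Lam T S xs ys (fun j => rhoS j \* vS j) Jt.

Let It_t t l : 0 < t -> t < T l -> It (t, l) = Pt (t, l) * d1 xs (t, l).
Proof. by move=> t0 tl; apply: ItE; rewrite t0. Qed.
Let Jt_t t l : 0 < t -> t < T l -> Jt (t, l) = Pt (t, l) * d1 ys (t, l).
Proof. by move=> t0 tl; apply: JtE; rewrite t0. Qed.

Let intP t K phi M : 0 < t -> compact K -> K `<=` slice Om t -> bmeas K phi M ->
  \int[P t]_p phi p = LP t phi.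
Proof.
move=> t0 cK KO; exact: (integral_Lam su kr kP (ltW t0) cK KO (decomposition_lty (hP t0) cK KO)
  (fun E => @hP t t0 K E cK KO)).
Qed.

Let fluxI_u t K phi M : 0 < t -> compact K -> K `<=` slice Om t -> bmeas K phi M ->
  sint (I t) phi = LI t phi /\ sint (I t) (fun p => phi p * dI t p) =
    Lam T S xs ys (fun j => rhoS j \* uS j \* uS j) (fun z => It z * d1 xs z) t phi.
Proof.
move=> t0; exact: (momentum_flux su kr kP (ltW t0) (hP t0) ku d1x ku d1x kI (fun l => @It_t t l t0) (hI t0)).
Qed.
Let fluxI_v t K phi M : 0 < t -> compact K -> K `<=` slice Om t -> bmeas K phi M ->
  sint (I t) phi = LI t phi /\ sint (I t) (fun p => phi p * dJ t p) =
    Lam T S xs ys (fun j => rhoS j \* uS j \* vS j) (fun z => It z * d1 ys z) t phi.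
Proof.
move=> t0; exact: (momentum_flux su kr kP (ltW t0) (hP t0) ku d1x kv d1y kI (fun l => @It_t t l t0) (hI t0)).
Qed.
Let fluxJ_u t K phi M : 0 < t -> compact K -> K `<=` slice Om t -> bmeas K phi M ->
  sint (J t) phi = LJ t phi /\ sint (J t) (fun p => phi p * dI t p) =
    Lam T S xs ys (fun j => rhoS j \* vS j \* uS j) (fun z => Jt z * d1 xs z) t phi.
Proof.
move=> t0; exact: (momentum_flux su kr kP (ltW t0) (hP t0) kv d1y ku d1x kJ (fun l => @Jt_t t l t0) (hJ t0)).
Qed.
Let fluxJ_v t K phi M : 0 < t -> compact K -> K `<=` slice Om t -> bmeas K phi M ->
  sint (J t) phi = LJ t phi /\ sint (J t) (fun p => phi p * dJ t p) =
    Lam T S xs ys (fun j => rhoS j \* vS j \* vS j) (fun z => Jt z * d1 ys z) t phi.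
Proof.
move=> t0; exact: (momentum_flux su kr kP (ltW t0) (hP t0) kv d1y kv d1y kJ (fun l => @Jt_t t l t0) (hJ t0)).
Qed.

Let intI t K phi M t0 cK KO b := (@fluxI_u t K phi M t0 cK KO b).1.
Let intJ t K phi M t0 cK KO b := (@fluxJ_u t K phi M t0 cK KO b).1.

Let ends (t1 t2 : R) : t1 < t2 -> (t1 <= t1 <= t2) /\ (t1 <= t2 <= t2).
Proof. by move=> /ltW t12; rewrite !lexx t12. Qed.

Let pos (t1 t2 t : R) : 0 < t1 -> t1 <= t <= t2 -> 0 < t.
Proof. by move=> t10 /andP[h _]; exact: lt_le_trans h. Qed.

Lemma constructed_solution : generalized_solution Om (piecewise G rho) (piecewise G u) (piecewise G v)
  P I J dI dJ.
Proof.
split.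
- move=> t t0; split.
  + by move=> K cK KO; exact: (decomposition_lty (hP t0) cK KO).
  + exact: (momentum_radon su (ltW t0) (hP t0) ku d1x (hI t0)).
  + exact: (momentum_radon su (ltW t0) (hP t0) kv d1y (hJ t0)).
- move=> f t0 Cf t00 fO; split.
  + exact: (functional_continuous kr kP intP Cf t00 fO).
  + exact: (functional_continuous kru kI intI Cf t00 fO).
  + exact: (functional_continuous krv kJ intJ Cf t00 fO).
- apply: aeW => t t0; split.
  + exact: (momentum_abs_continuous su (ltW t0) ku d1x (hI t0)).
  + exact: (momentum_abs_continuous su (ltW t0) kv d1y (hJ t0)).
- apply: aeW => t t0; split.
  + exact: (momentum_RN su (ltW t0) (hP t0) ku d1x (hI t0)).
  + exact: (momentum_RN su (ltW t0) (hP t0) kv d1y (hJ t0)).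
- apply: aeW => t t0; split.
  + exact: (momentum_locally_integrable su (ltW t0) (hP t0) ku d1x ku d1x (hI t0)).
  + exact: (momentum_locally_integrable su (ltW t0) (hP t0) ku d1x kv d1y (hI t0)).
  + exact: (momentum_locally_integrable su (ltW t0) (hP t0) kv d1y ku d1x (hJ t0)).
  + exact: (momentum_locally_integrable su (ltW t0) (hP t0) kv d1y kv d1y (hJ t0)).
- move=> f t1 t2 Cf t10 t12 fOm F; have [h1 h2] := ends t12; have [M [bf b1 b2]] := Cc1_bmeas Cf.
  have W := ode_weak data time surface sides cr' cP (pde_mass sides) odeP.1 Cf t10 t12 fOm.
  rewrite (intP (pos t10 h1) Cf.2 (fOm _ h1) bf) (intP (pos t10 h2) Cf.2 (fOm _ h2) bf).
  apply: weak_congr W => t ht; have t0 := pos t10 ht.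
  rewrite /F (intI t0 Cf.2 (fOm t ht) b1) (intJ t0 Cf.2 (fOm t ht) b2) /weak_integrand.
  by congr (_ + _); apply: Lam_eq_curve => l tl; [exact: It_t|exact: Jt_t].
- move=> f t1 t2 Cf t10 t12 fOm F; have [h1 h2] := ends t12; have [M [bf b1 b2]] := Cc1_bmeas Cf.
  have W := ode_weak data time surface sides cru' cI (pde_u sides) odeI.1 Cf t10 t12 fOm.
  rewrite (intI (pos t10 h1) Cf.2 (fOm _ h1) bf) (intI (pos t10 h2) Cf.2 (fOm _ h2) bf).
  apply: weak_congr W => t ht; have t0 := pos t10 ht.
  by rewrite /F (fluxI_u t0 Cf.2 (fOm t ht) b1).2 (fluxI_v t0 Cf.2 (fOm t ht) b2).2.
- move=> f t1 t2 Cf t10 t12 fOm F; have [h1 h2] := ends t12; have [M [bf b1 b2]] := Cc1_bmeas Cf.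
  have W := ode_weak data time surface sides crv' cJ (pde_v sides) odeJ.1 Cf t10 t12 fOm.
  rewrite (intJ (pos t10 h1) Cf.2 (fOm _ h1) bf) (intJ (pos t10 h2) Cf.2 (fOm _ h2) bf).
  apply: weak_congr W => t ht; have t0 := pos t10 ht.
  by rewrite /F (fluxJ_u t0 Cf.2 (fOm t ht) b1).2 (fluxJ_v t0 Cf.2 (fOm t ht) b2).2.
- move=> f Cf fO; split.
  + apply: (functional_initial kr kP intP (w := rho) _ erefl odeP.2 Cf fO) => j p h1 h2.
    by have [] := so_initial sides h1 h2.
  + apply: (functional_initial kru kI intI _ (piecewiseM G rho u) odeI.2 Cf fO) => j p h1 h2.
    by have [e1 e2 e3] := so_initial sides h1 h2; rewrite /= e1 e2.
  + apply: (functional_initial krv kJ intJ _ (piecewiseM G rho v) odeJ.2 Cf fO) => j p h1 h2.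
    by have [e1 e2 e3] := so_initial sides h1 h2; rewrite /= e1 e3.
Qed.

Lemma constructed_shock_form : single_shock_form T Om S xs ys ut vt rhoS uS vS Pt It Jt P I J dI dJ.
Proof.
split.
- by move=> t K E t0 cK KO mE EK; rewrite (hP t0 cK KO mE EK) (Lam_indic _ _ _ _ _ _ _ EK).
- move=> t K E t0 cK KO mE EK.
  rewrite (momentum_decomposition su kr kP (ltW t0) (hP t0) ku d1x cK KO (hI t0) (fun l => @It_t t l t0) mE EK).
  by rewrite (Lam_indic _ _ _ _ _ _ _ EK).
- move=> t K E t0 cK KO mE EK.
  rewrite (momentum_decomposition su kr kP (ltW t0) (hP t0) kv d1y cK KO (hJ t0) (fun l => @Jt_t t l t0) mE EK).
  by rewrite (Lam_indic _ _ _ _ _ _ _ EK).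
- exact: Pt_gt0.
- move=> t l /andP[t0 tl]; have tl0 : 0 <= t < T l by rewrite ltW.
  have [ex ey] := ss_integral_curves surface (tl0 : pdom T (t, l)).
  by rewrite /dI /dJ !(shock_field_on su)// ex ey.
Qed.

End measures.

Lemma formulas_solution : exists (P : R -> {measure set (mplane R) -> \bar R})
    (I J : R -> @signed_measure R) (dIdP dJdP : R -> R * R -> R),
  generalized_solution Om (piecewise G rho) (piecewise G u) (piecewise G v) P I J dIdP dJdP /\
  single_shock_form T Om S xs ys ut vt rhoS uS vS Pt It Jt P I J dIdP dJdP.
Proof.
have /choice[P hP] : forall t, exists P : {measure set (mplane R) -> \bar R}, 0 < t ->
    forall (K : set (R * R)) (E : set (mplane R)), compact K -> K `<=` slice Om t -> measurable E ->
    E `<=` K -> P E = (Lam T S xs ys rhoS Pt t (\1_E))%:E.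
  (* Only positive times enter the notion of solution; at the others any measure will do. *)
  move=> t; have [t0|t0] := pselect (0 < t); last by exists mzero.
  have [|l tl|P hP] := shock_measure su (ltW t0) kr kP; last by exists P.
    by move=> j p Op Sp; apply/ltW/(rhoS_gt0 data time surface sides Op); case: j Sp => /ltW.
  by apply/ltW/Pt_gt0; rewrite t0.
have density (w : bool -> R * (R * R) -> R) (om : R * R -> R) :
    (forall j q, Om q -> cside j (S q) -> {for q, continuous (w j)}) ->
    (forall z, pdom T z -> {for z, continuous om}) ->
    exists mu : R -> @signed_measure R, forall t, 0 < t -> signed_density (P t) (shock_field T Om S xs ys w om t) (mu t).
  move=> gw gom.
  suff /choice[mu hmu] : forall t, exists mu, 0 < t -> signed_density (P t) (shock_field T Om S xs ys w om t) mu by exists mu.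
  move=> t; have [t0|t0] := pselect (0 < t); last by exists (SignedMeasure (P t) (P t)).
  by have [mu hmu] := signed_density_ex (P t) (measurable_shock_field su (ltW t0) gw gom); exists mu.
have [I hI] := density uS (d1 xs) ku d1x; have [J hJ] := density vS (d1 ys) kv d1y.
exists P, I, J, dI, dJ; split; [exact: (constructed_solution hP hI hJ)|exact: (constructed_shock_form hP hI hJ)].
Qed.

End backward.

Theorem theorem2p1 (R : realType)
  (A B : R -> R) (G : R * R -> R) (rho u v : bool -> R * R -> R)
  (T : R -> R) (V : R -> set (R * R)) (Om : set (R * (R * R)))
  (S : R * (R * R) -> R) (xs ys ut vt : R * R -> R)
  (a b : bool -> R * R -> R) (rhoS uS vS : bool -> R * (R * R) -> R)
  (Pt It Jt : R * R -> R)
  (data : compressive_data A B G rho u v)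
  (time : local_time A B G u v T V)
  (surface : shock_surface A B G u v T V Om S xs ys ut vt a b)
  (sides : side_solutions G rho u v T V Om S rhoS uS vS)
  (C1_Pt : C1 (pdom T) Pt) (C1_It : C1 (pdom T) It) (C1_Jt : C1 (pdom T) Jt) :
  (exists (P : R -> {measure set (mplane R) -> \bar R})
      (I J : R -> @signed_measure R) (dIdP dJdP : R -> R * R -> R),
      generalized_solution Om (piecewise G rho) (piecewise G u) (piecewise G v)
        P I J dIdP dJdP /\
      single_shock_form T Om S xs ys ut vt rhoS uS vS Pt It Jt
        P I J dIdP dJdP)
  <-> shock_formulas rho u v T ut vt a b Pt It Jt.
Proof.
split; last exact: (formulas_solution data time surface sides C1_Pt C1_It C1_Jt).
move=> [P [I [J [dIdP [dJdP [gs sf]]]]]].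
exact: (solution_formulas data time surface sides C1_Pt C1_It C1_Jt gs sf).
Qed.
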